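(* Let $1<p<\infty$ and let $p'$ be the conjugate exponent, $\frac1p+\frac1{p'}=1$. For $t\ge 0$ let $\varphi_t(z)=e^{-t}z+1-e^{-t}$ for $z\in\mathbb{D}$. A closed subspace $M$ of $H^p(\mathbb{D})$ is invariant under the Cesàro operator $\mathcal{C}$ on $H^p(\mathbb{D})$ if and only if its annihilator $M^\perp$ in $H^{p'}(\mathbb{D})$ is invariant under the $C_0$-semigroup of composition operators $\{C_{\varphi_t}\}_{t\ge0}$ on $H^{p'}(\mathbb{D})$, i.e. $C_{\varphi_t}M^\perp\subseteq M^\perp$ for every $t\ge0$.
   Context: $\mathbb{D}$ is the open unit disc in $\mathbb{C}$. For $1\le p<\infty$, the Hardy space $H^p(\mathbb{D})$ consists of the holomorphic functions $f$ on $\mathbb{D}$ with $\|f\|_p=\big(\sup_{0\le r<1}\int_0^{2\pi}|f(re^{i\theta})|^p\frac{d\theta}{2\pi}\big)^{1/p}<\infty$. The Cesàro operator is the bounded operator on $H^p(\mathbb{D})$ ($1<p<\infty$) given, for $f(z)=\sum_{k\ge0} a_k z^k$, by $\mathcal{C}f(z)=\sum_{n=0}^\infty\Big(\frac{1}{n+1}\sum_{k=0}^n a_k\Big)z^n$. For an analytic self-map $\varphi$ of $\mathbb{D}$, $C_\varphi f=f\circ\varphi$. The dual of $H^p(\mathbb{D})$ is identified in the natural way with $H^{p'}(\mathbb{D})$ via the pairing $\langle f,g\rangle=\int_0^{2\pi}f(e^{i\theta})\overline{g(e^{i\theta})}\frac{d\theta}{2\pi}$ (boundary values), and $M^\perp=\{g\in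 H^{p'}(\mathbb{D}):\langle f,g\rangle=0\ \text{for all } f\in M\}$. *)

(* Defs.v *)
From HB Require Import structures.
From mathcomp Require Import all_boot all_order all_algebra.
From mathcomp Require Import complex.
From mathcomp Require Import all_classical all_reals all_analysis.

Set Implicit Arguments.
Unset Strict Implicit.
Unset Printing Implicit Defensive.

Import Order.TTheory GRing.Theory Num.Theory.
Import numFieldTopology.Exports numFieldNormedType.Exports.

Local Open Scope classical_set_scope.
Local Open Scope ring_scope.
Local Open Scope complex_scope.

(* [R[i]] carries two module structures (over [R] and over itself); its regular
   module [R[i]^o] is the one with complex scalars, and it has the topology
   given by the modulus. *)
Notation Cplx R := (R[i]^o).

Section Hardy.
Variable R : realType.
Local Notation C := (Cplx R).
Implicit Types (p r t : R) (z : C) (f g : C -> C) (M : set (C -> C)).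

Definition disc : set C := [set z | `|z| < 1].

(* A function on the disc is represented by its extension by 0, so that [=]
   between representatives is equality of functions on the disc. *)
Definition on_disc f : C -> C := patch (fun=> 0) disc f.

Definition modulus z : R := ComplexField.Normc.normc z.

Definition holomorphic_on_disc f := forall z, disc z -> derivable f z 1.

Definition circle_pt r t : C := r%:C * (cos t +i* sin t).

Definition integral_mean p f r : \bar R :=
  (\int[lebesgue_measure]_(t in `[0%R, (2 * pi)%R])
     (modulus (f (circle_pt r t)) `^ p / (2 * pi))%:E)%E.

Definition hardy_norm p f : \bar R :=
  (ereal_sup [set integral_mean p f r | r in `[0%R, 1%R[] `^ p^-1)%E.

Definition hardy p : set (C -> C) :=
  [set f | [/\ on_disc f = f, holomorphic_on_disc f
             & (hardy_norm p f < +oo)%E]].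

Definition closed_subspace p M : Prop :=
  [/\ M `<=` hardy p,
      submod_closed (mem M)
    & forall f, hardy p f ->
        (forall e : R, 0 < e ->
           exists2 g, M g & (hardy_norm p (f - g)%R < e%:E)%E) ->
        M f].

(* The coefficient [a_k] in [f z = \sum_k a_k z^k]. *)
Definition taylor_coef f (k : nat) : C := derive1n k (f : R[i] -> C) 0 / k`!%:R.

Definition cesaro_op f : C -> C :=
  on_disc (fun z => lim (series (fun n : nat =>
    (n.+1%:R^-1 * \sum_(k < n.+1) taylor_coef f k) * z ^+ n) @ \oo)).

Definition composition_op (phi : C -> C) f : C -> C := on_disc (f \o phi).

Definition phi_semigroup t z : C :=
  (expR (- t))%:C * z + 1 - (expR (- t))%:C.

(* Radial limits; by Fatou's theorem they exist for almost every [t] when [f]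
   is in a Hardy space, so the default value of [lim] does not matter. *)
Definition boundary_value f t : C := lim (f (circle_pt r t) @[r --> 1^'-]).

Definition hardy_pairing f g : C :=
  let h t : C := boundary_value f t * (boundary_value g t)^* / (2 * pi)%:C in
  (\int[lebesgue_measure]_(t in `[0%R, (2 * pi)%R]) complex.Re (h t)) +i*
  (\int[lebesgue_measure]_(t in `[0%R, (2 * pi)%R]) complex.Im (h t)).

Definition annihilator q M : set (C -> C) :=
  [set g | hardy q g /\ forall f, M f -> hardy_pairing f g = 0].

End Hardy.

(* Main.v *)
Require Import Defs.
From HB Require Import structures.
From mathcomp Require Import all_boot all_order all_algebra.
From mathcomp Require Import complex.
From mathcomp Require Import all_classical all_reals all_analysis.
From mathcomp Require Import measurable_realfun exponential_distribution.
From mathcomp Require Import ring lra.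

(* The Cesaro operator C is the resolvent at 0 of a semigroup adjoint to
   e^(-s) C_(phi_s).  Concretely, put W_f(s) = e^(-s) <f, C_(phi_s) g> for f in H^p
   and g in H^p'.  Then (W_(Cf))' = - W_f: by an Abel summation this holds when g
   is a monomial, and it extends to all g by density of the polynomials, because
   |W_f(s)| <= K e^(-s/p) by subordination.  Letting s tend to infinity, <Cf, g> is
   the integral of W_f over the half-line.
   If M is C-invariant and g annihilates M, then the functions v_n = W_(C^n f) satisfy
   v_(n+1)' = - v_n and vanish at 0, so all moments of v_0 vanish; as v_0 decays
   exponentially, v_0 = 0, that is, C_(phi_s) g annihilates f.  Conversely, if the
   annihilator is invariant then W_f = 0 for f in M and g in the annihilator,
   hence <Cf, g> = 0, and Cf is in M by the Hahn-Banach theorem (over a countable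
   dense family) together with the duality of H^p and H^p'.
   That duality, and the boundedness of C, rest on M. Riesz's theorem, proved by
   Calderon's method for exponents at most 2 and by duality for the others; the
   boundary values in the pairing are identified by Fatou's theorem. *)

Set Implicit Arguments.
Unset Strict Implicit.
Unset Printing Implicit Defensive.
Import Order.TTheory GRing.Theory Num.Theory.
Import numFieldTopology.Exports numFieldNormedType.Exports.
Import ComplexField.Normc.
Local Open Scope classical_set_scope.
Local Open Scope ring_scope.
Local Open Scope complex_scope.

(** * Complex numbers and the unit circle *)

(** Hardy functions are integrated only over circles of radius [r < 1], where they are continuous;
    boundary values enter only where the pairing is identified with a limit of circle means. The
    obstacle is that this limit, and the density of polynomials, need the dilates [f (r z)] to
    converge in mean before any boundary function is at hand. Uniform convexity provides it: means
    increase with the radius, and midpoints of dilates have almost the same mean as the dilates. The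
    factor [e^(-s)] in [W] makes the monomials work: the coefficients of [e^(-s) (phi_s)^n] have as
    derivatives [i + 1] times a difference in [i], and [i + 1] cancels the denominator of the Cesaro
    mean. It also yields the decay: composition with [phi_s] on [H^p'] costs [e^(s/p')], and
    [1 - 1/p' = 1/p]. Invariance under C only gives the values at 0 of the [v_n], so that recovering
    [v_0] is a moment problem on the half-line. Exponential decay makes it determinate: the
    vanishing extends to the weights [t^k e^(-l t)], and the functions [(t e^(-t/s))^N], suitably
    scaled, concentrate at [s]. *)

Section ComplexBasics.
Variable R : realType.
Implicit Types (x y z w : R[i]) (r s t e : R).

Lemma normc_ge0 z : 0 <= normc z.
Proof. by case: z => a b; rewrite sqrtr_ge0. Qed.

Lemma normcR r : normc r%:C = `|r|.
Proof. by rewrite /normc /= expr0n addr0 sqrtr_sqr. Qed.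

Lemma ler_normcD z w : normc (z + w) <= normc z + normc w.
Proof. exact: le_normcD. Qed.

Lemma normc_opp z : normc (- z) = normc z.
Proof. by case: z => a b; rewrite /normc /= !sqrrN. Qed.

Lemma normc_dist z w : normc (z - w) = normc (w - z).
Proof. by rewrite -normc_opp opprB. Qed.

Lemma ler_normcB z w : normc (z - w) <= normc z + normc w.
Proof. by rewrite (le_trans (ler_normcD _ _))// normc_opp. Qed.

Lemma ler_dist_normc z w : `|normc z - normc w| <= normc (z - w).
Proof.
rewrite ler_norml; apply/andP; split.
  by rewrite -(opprB (normc w)) lerN2 lerBlDr -{1}(subrK z w) normc_dist ler_normcD.
by rewrite lerBlDr -{1}(subrK w z) ler_normcD.
Qed.

Lemma normc_triangle u z w : normc (z - w) <= normc (z - u) + normc (u - w).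
Proof. by rewrite (_ : z - w = (z - u) + (u - w)) ?ler_normcD//; ring. Qed.

Lemma normcJ z : normc (Num.conj z) = normc z.
Proof. by case: z => a b; rewrite /normc /= sqrrN. Qed.

Lemma normc_Re z : `|complex.Re z| <= normc z.
Proof.
case: z => a b /=; rewrite -sqrtr_sqr ler_wsqrtr// lerDl sqr_ge0 //.
Qed.

Lemma normc_Im z : `|complex.Im z| <= normc z.
Proof.
case: z => a b /=; rewrite -sqrtr_sqr ler_wsqrtr// lerDr sqr_ge0 //.
Qed.

Lemma normc_sq z : normc z ^+ 2 = complex.Re z ^+ 2 + complex.Im z ^+ 2.
Proof. by case: z => a b /=; rewrite sqr_sqrtr// addr_ge0 ?sqr_ge0. Qed.

Lemma normc_ReIm z : normc z <= `|complex.Re z| + `|complex.Im z|.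
Proof.
rewrite -(@ler_pXn2r _ 2)// ?nnegrE ?addr_ge0 ?normc_ge0//.
rewrite normc_sq sqrrD !real_normK ?num_real// lerD2r lerDl.
by rewrite mulrn_wge0// mulr_ge0.
Qed.

Lemma normc_eq0 z : (normc z == 0) = (z == 0).
Proof. by apply/eqP/eqP => [/eq0_normc//|->]; rewrite normc0. Qed.

Lemma normc_gt0 z : (0 < normc z) = (z != 0).
Proof. by rewrite lt_def normc_ge0 normc_eq0 andbT. Qed.

Lemma normcX z n : normc (z ^+ n) = normc z ^+ n.
Proof. by elim: n => [|n IH]; rewrite ?expr0 ?normc1// !exprS normcM IH. Qed.

Lemma ler_normc_sum (I : Type) (r : seq I) (P : pred I) (F : I -> R[i]) :
  normc (\sum_(i <- r | P i) F i) <= \sum_(i <- r | P i) normc (F i).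
Proof.
elim/big_rec2 : _ => [|i y u _ h]; first by rewrite normc0.
by rewrite (le_trans (ler_normcD _ _))// lerD2l.
Qed.

Lemma normc_nat n : normc (n%:R : R[i]) = n%:R.
Proof. by rewrite -(rmorph_nat (real_complex R)) normcR ger0_norm// ler0n. Qed.

Lemma normr_normc z : `|z| = (normc z)%:C.
Proof. by []. Qed.

Lemma mulJ_normc z : z * Num.conj z = (normc z ^+ 2)%:C.
Proof.
rewrite normc_sq; case: z => a b; apply/eqP; rewrite eq_complex /=.
by apply/andP; split; apply/eqP; ring.
Qed.

Lemma complex_ext z w :
  complex.Re z = complex.Re w -> complex.Im z = complex.Im w -> z = w.
Proof. by case: z w => a b [c d] /= -> ->. Qed.

Lemma ReD z w : complex.Re (z + w) = complex.Re z + complex.Re w.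
Proof. by case: z w => a b []. Qed.
Lemma ImD z w : complex.Im (z + w) = complex.Im z + complex.Im w.
Proof. by case: z w => a b []. Qed.
Lemma ReN z : complex.Re (- z) = - complex.Re z.
Proof. by case: z. Qed.
Lemma ImN z : complex.Im (- z) = - complex.Im z.
Proof. by case: z. Qed.
Lemma ReM z w : complex.Re (z * w)
  = complex.Re z * complex.Re w - complex.Im z * complex.Im w.
Proof. by case: z w => a b []. Qed.
Lemma ImM z w : complex.Im (z * w)
  = complex.Re z * complex.Im w + complex.Im z * complex.Re w.
Proof. by case: z w => a b []. Qed.
Lemma ReJ z : complex.Re (Num.conj z) = complex.Re z.
Proof. by case: z. Qed.
Lemma ImJ z : complex.Im (Num.conj z) = - complex.Im z.
Proof. by case: z. Qed.
Definition ReImE := (ReD, ImD, ReN, ImN, ReM, ImM, ReJ, ImJ).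

Definition expi t : R[i] := cos t +i* sin t.

Lemma expi0 : expi 0 = 1.
Proof. by rewrite /expi cos0 sin0. Qed.

Lemma expiD s t : expi (s + t) = expi s * expi t.
Proof.
rewrite /expi cosD sinD; apply: complex_ext => /=; ring.
Qed.

Lemma expiN t : expi (- t) = Num.conj (expi t).
Proof. by rewrite /expi cosN sinN. Qed.

Lemma normc_expi t : normc (expi t) = 1.
Proof. by rewrite /normc /expi cos2Dsin2 sqrtr1. Qed.

Lemma expi_neq0 t : expi t != 0.
Proof. by rewrite -normc_gt0 normc_expi. Qed.

Lemma expiV t : (expi t)^-1 = expi (- t).
Proof.
apply: (mulfI (expi_neq0 t)); rewrite divff ?expi_neq0// -expiD subrr.
by rewrite expi0.
Qed.

Lemma expi_nat t n : expi (t *+ n) = expi t ^+ n.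
Proof.
by elim: n => [|n IH]; rewrite ?mulr0n ?expi0 ?expr0// mulrS exprS expiD IH.
Qed.

Lemma expi2pi : expi (2 * pi) = 1.
Proof. by rewrite /expi mulr_natl cos2pi sin2pi. Qed.

Lemma normc_mul_expi z t : normc (z * expi t) = normc z.
Proof. by rewrite normcM normc_expi mulr1. Qed.

Lemma circle_ptE r t : circle_pt r t = r%:C * expi t.
Proof. by []. Qed.

Lemma normc_circle r t : 0 <= r -> normc (r%:C * expi t) = r.
Proof. by move=> r0; rewrite normc_mul_expi normcR ger0_norm. Qed.

(** Reduces a bound on a complex modulus to a bound on a real part, both for integrals and for the
    functional produced by Hahn-Banach. *)
Lemma exists_rotation z : exists2 u, normc u = 1 & u * z = (normc z)%:C.
Proof.
have [->|z0] := eqVneq z 0; first by exists 1; rewrite ?normc1// mulr0 normc0.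
have nz0 : normc z != 0 by rewrite normc_eq0.
exists ((normc z)^-1%:C * Num.conj z).
  by rewrite normcM normcR normcJ ger0_norm ?invr_ge0 ?normc_ge0// mulVf.
rewrite -mulrA [Num.conj z * z]mulrC mulJ_normc -rmorphM expr2 mulrA.
by rewrite mulVf// mul1r.
Qed.

End ComplexBasics.
Arguments normc : simpl never.

(** * Complex derivatives and continuity *)

Section ComplexDerivative.
Variable R : realType.
Implicit Types (f g : R[i] -> R[i]) (x y z w l : R[i]) (r s t e : R).

(** Without a quotient, with [w = z] allowed and with a real epsilon, the rules for products and
    composites become direct estimates. [cderivP] identifies this with the derivative over complex
    scalars. *)
Definition cderiv f z l := forall e, 0 < e -> exists2 d, 0 < d &
  forall w, normc (w - z) < d ->
    normc (f w - f z - l * (w - z)) <= e * normc (w - z).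

Lemma cplx_gt0 (e : R[i]) : 0 < e -> exists2 r : R, 0 < r & e = r%:C.
Proof.
case: e => a b; rewrite ltcE /= => /andP[/eqP b0 a0].
by exists a => //; rewrite b0.
Qed.

Lemma cderivP f z l :
  is_derive (z : Cplx R) 1 (f : Cplx R -> Cplx R) l <-> cderiv f z l.
Proof.
pose G (h : Cplx R) : Cplx R := h^-1 *: (f (h *: (1 : Cplx R) + z) - f z).
have GE h : G h = (f (h + z) - f z) / h.
  rewrite /G (_ : h *: (1 : Cplx R) = h); first by rewrite /GRing.scale /= mulrC.
  exact: mulr1.
have key : (G h @[h --> (0 : Cplx R)^'] --> (l : Cplx R)) <-> cderiv f z l.
  split.
    move=> /(cvgrPdist_lt G (l : Cplx R)).1 H e e0.
    have e0' : 0 < e%:C :> R[i] by rewrite ltcR.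
    have := H _ e0'; rewrite near_withinE => /nbhs_ballP[d' /= /cplx_gt0[d d0 ->] K].
    exists d => // w wd.
    have [->|wz] := eqVneq w z.
      by rewrite !subrr mulr0 subrr normc0 mulr0.
    have := K (w - z).
    rewrite /ball /= sub0r normrN normr_normc ltcR => /(_ wd).
    rewrite subr_eq0 => /(_ wz).
    rewrite GE subrK normr_normc ltcR => /ltW.
    rewrite -(ler_pM2r (x := normc (w - z))) ?normc_gt0 ?subr_eq0//.
    move=> L; apply: le_trans L.
    rewrite -normcM le_eqVlt normc_dist; apply/orP; left; apply/eqP; congr normc.
    by field; rewrite subr_eq0.
  move=> H; apply/(cvgrPdist_lt G (l : Cplx R)) => e' /cplx_gt0[e e0 ->].
  have e20 : 0 < e / 2 by rewrite divr_gt0.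
  have [d d0 K] := H _ e20.
  rewrite near_withinE; apply/nbhs_ballP; exists d%:C; first by rewrite /= ltcR.
  move=> h /=; rewrite /ball /= sub0r normrN normr_normc ltcR => hd h0.
  have := K (h + z); rewrite addrK => /(_ hd).
  rewrite GE normr_normc ltcR => L.
  have nh : 0 < normc h by rewrite normc_gt0.
  apply: (@le_lt_trans _ _ (e / 2)); last by rewrite ltr_pdivrMr// ltr_pMr// ltr1n.
  rewrite -(ler_pM2r nh); apply: le_trans L.
  rewrite -normcM le_eqVlt normc_dist; apply/orP; left; apply/eqP; congr normc.
  by field.
split.
  case=> df dl; apply/key; rewrite -dl; apply: df.
move/key => H; apply: DeriveDef; first by apply/cvg_ex; exists l.
exact: (cvg_lim _ H).
Qed.

Lemma cderiv_lip f z l : cderiv f z l -> exists2 d, 0 < d &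
  forall w, normc (w - z) < d -> normc (f w - f z) <= (1 + normc l) * normc (w - z).
Proof.
move=> /(_ 1 ltr01)[d d0 H]; exists d => // w /H {}H.
rewrite (_ : f w - f z = (f w - f z - l * (w - z)) + l * (w - z)); last by ring.
by rewrite (le_trans (ler_normcD _ _))// mulrDl lerD// normcM.
Qed.

Lemma cderiv_cst c z : cderiv (fun=> c) z 0.
Proof.
move=> e e0; exists 1 => // w _.
by rewrite subrr mul0r subrr normc0 mulr_ge0 ?normc_ge0// ltW.
Qed.

Lemma cderiv_id z : cderiv id z 1.
Proof.
move=> e e0; exists 1 => // w _.
by rewrite mul1r subrr normc0 mulr_ge0 ?normc_ge0// ltW.
Qed.

Lemma cderivD f g z l m :
  cderiv f z l -> cderiv g z m -> cderiv (fun w => f w + g w) z (l + m).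
Proof.
move=> F G e e0.
have e20 : 0 < e / 2 by rewrite divr_gt0.
have [d1 d10 {}F] := F _ e20; have [d2 d20 {}G] := G _ e20.
exists (Num.min d1 d2) => [|w]; first by rewrite lt_min d10.
rewrite lt_min => /andP[/F {}F /G {}G].
rewrite (_ : _ - _ = (f w - f z - l * (w - z)) + (g w - g z - m * (w - z))); last by ring.
by rewrite (le_trans (ler_normcD _ _))// (splitr e) mulrDl lerD.
Qed.

Lemma cderivM f g z l m : cderiv f z l -> cderiv g z m ->
  cderiv (fun w => f w * g w) z (l * g z + f z * m).
Proof.
move=> F G e e0.
have [d1 d10 Fb] := cderiv_lip F; have [d2 d20 Gb] := cderiv_lip G.
pose K := normc (g z) + normc (f z) + 1.
have K0 : 0 < K by rewrite ltr_wpDl// addr_ge0 ?normc_ge0.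
have e20 : 0 < e / 2 / K by rewrite !divr_gt0.
have [d3 d30 {}F] := F _ e20; have [d4 d40 {}G] := G _ e20.
pose L := (1 + normc l) * (1 + normc m).
have L0 : 0 < L by rewrite mulr_gt0// ltr_pwDl// normc_ge0.
exists (Num.min (Num.min (Num.min d1 d2) (Num.min d3 d4)) (e / 2 / L)).
  by rewrite !lt_min d10 d20 d30 d40 !divr_gt0.
move=> w; rewrite !lt_min => /andP[/andP[/andP[w1 w2] /andP[w3 w4]] w5].
rewrite (_ : _ - _ = (f w - f z - l * (w - z)) * g z
  + f z * (g w - g z - m * (w - z)) + (f w - f z) * (g w - g z)); last by ring.
rewrite (le_trans (ler_normcD _ _))// [X in _ <= X * _](splitr e) [X in _ <= X]mulrDl lerD//.
  rewrite (le_trans (ler_normcD _ _))// !normcM.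
  rewrite (@le_trans _ _ (e / 2 / K * normc (w - z) * (normc (g z) + normc (f z))))//.
    rewrite [X in _ <= X]mulrDr lerD// ?ler_wpM2r ?normc_ge0 ?F//.
    by rewrite mulrC ler_wpM2r ?normc_ge0 ?G.
  rewrite mulrAC ler_wpM2r ?normc_ge0//.
  rewrite mulrAC ler_pdivrMr// ler_wpM2l ?ltW ?divr_gt0// /K.
  by rewrite ltrDl.
rewrite normcM (@le_trans _ _ (L * normc (w - z) * normc (w - z)))//.
  rewrite /L (_ : _ * _ * _ * _ = ((1 + normc l) * normc (w - z)) *
    ((1 + normc m) * normc (w - z))); last by ring.
  by rewrite ler_pM ?normc_ge0 ?Fb ?Gb.
by rewrite ler_wpM2r ?normc_ge0// mulrC -ler_pdivlMr// ltW.
Qed.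

Lemma cderiv_comp f g z l m : cderiv f z l -> cderiv g (f z) m ->
  cderiv (fun w => g (f w)) z (m * l).
Proof.
move=> F G e e0.
have [d1 d10 Fb] := cderiv_lip F.
have l0 : 0 < 1 + normc l by rewrite ltr_pwDl// normc_ge0.
have m0 : 0 < 1 + normc m by rewrite ltr_pwDl// normc_ge0.
have e2 : 0 < e / 2 by rewrite divr_gt0.
have [d2 d20 {}F] := F _ (divr_gt0 e2 m0).
have [d3 d30 {}G] := G _ (divr_gt0 e2 l0).
exists (Num.min (Num.min d1 d2) (d3 / (1 + normc l))).
  by rewrite !lt_min d10 d20 divr_gt0.
move=> w; rewrite !lt_min => /andP[/andP[w1 w2] w3].
rewrite (_ : _ - _ = (g (f w) - g (f z) - m * (f w - f z))
  + m * (f w - f z - l * (w - z))); last by ring.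
rewrite (le_trans (ler_normcD _ _))// [X in _ <= X * _](splitr e) [X in _ <= X]mulrDl lerD//.
  rewrite (le_trans (G (f w) _)) //.
    by rewrite (le_lt_trans (Fb _ w1))// mulrC -ltr_pdivlMr.
  rewrite (@le_trans _ _ (e / 2 / (1 + normc l) * ((1 + normc l) * normc (w - z))))//.
    by rewrite ler_wpM2l ?Fb// ltW// !divr_gt0.
  rewrite le_eqVlt; apply/orP; left; apply/eqP; field; by rewrite lt0r_neq0.
rewrite normcM (@le_trans _ _ ((1 + normc m) * (e / 2 / (1 + normc m) * normc (w - z))))//.
  by rewrite ler_pM ?normc_ge0 ?F// lerDr.
by rewrite le_eqVlt; apply/orP; left; apply/eqP; field; rewrite lt0r_neq0.
Qed.

Lemma cderivV z : z != 0 -> cderiv (fun w => w^-1) z (- z ^- 2).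
Proof.
move=> z0 e e0.
have nz0 : 0 < normc z by rewrite normc_gt0.
exists (Num.min (normc z / 2) (e * normc z ^+ 3 / 2)).
  by rewrite lt_min !divr_gt0// mulr_gt0// exprn_gt0.
move=> w; rewrite lt_min => /andP[w1 w2].
have wn : normc z / 2 < normc w.
  have := ler_dist_normc z w; rewrite normc_dist => h.
  have := le_trans (ler_norm _) h => {}h.
  have := le_lt_trans h w1; lra.
have w0 : w != 0 by rewrite -normc_gt0 (le_lt_trans _ wn)// divr_ge0// normc_ge0.
rewrite (_ : _ - _ = (w - z) ^+ 2 / (z ^+ 2 * w)); last by field; rewrite w0 z0.
rewrite normcM normcX normcV normcM normcX [_ ^+ 2 in X in X <= _]expr2 -mulrA mulrC ler_wpM2r ?normc_ge0//.
rewrite ler_pdivrMr ?mulr_gt0 ?exprn_gt0//; last by rewrite normc_gt0.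
rewrite (le_trans (ltW w2))// (_ : _ / 2 = e * (normc z ^+ 2 * (normc z / 2))).
  by rewrite !ler_wpM2l ?exprn_ge0 ?normc_ge0 ?ltW.
by field.
Qed.

Lemma cderivZ c f z l : cderiv f z l -> cderiv (fun w => c * f w) z (c * l).
Proof.
move=> F; have := cderivM (cderiv_cst c z) F.
by rewrite mul0r add0r.
Qed.

Lemma cderivN f z l : cderiv f z l -> cderiv (fun w => - f w) z (- l).
Proof.
move=> /(cderivZ (- 1)); rewrite mulN1r.
by rewrite (_ : (fun w => -1 * f w) = (fun w => - f w))//; apply/funext => w; rewrite mulN1r.
Qed.

Lemma cderivX f z l n : cderiv f z l ->
  cderiv (fun w => f w ^+ n) z (n%:R * f z ^+ n.-1 * l).
Proof.
move=> F; elim: n => [|n IH].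
  by rewrite !mul0r; exact: cderiv_cst.
have := cderivM F IH; rewrite (_ : (fun w => f w * f w ^+ n) = (fun w => f w ^+ n.+1)).
  rewrite (_ : _ + _ = n.+1%:R * f z ^+ n.+1.-1 * l)//= -natr1.
  case: n {IH} => [|n] /=; first by rewrite expr0; ring.
  by rewrite exprS; ring.
by apply/funext => w; rewrite exprS.
Qed.

Lemma cderiv_local f g z l r : 0 < r -> (forall w, normc (w - z) < r -> f w = g w) ->
  cderiv f z l -> cderiv g z l.
Proof.
move=> r0 fg F e e0; have [d d0 {}F] := F _ e0.
exists (Num.min d r); first by rewrite lt_min d0.
move=> w; rewrite lt_min => /andP[/F {}F /fg <-].
by rewrite -(fg z) ?F// subrr normc0.
Qed.

Lemma eq_cderiv f g z l : f =1 g -> cderiv f z l -> cderiv g z l.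
Proof. by move=> /funext ->. Qed.

Definition ccont_at (u : R -> R[i]) t := forall e, 0 < e ->
  exists2 d, 0 < d & forall s, `|s - t| < d -> normc (u s - u t) < e.

Definition ccont (u : R -> R[i]) := forall t, ccont_at u t.

Lemma cont_epsP (u : R -> R) t : {for t, continuous u} <->
  forall e, 0 < e -> exists2 d, 0 < d & forall s, `|s - t| < d -> `|u s - u t| < e.
Proof.
split => [/cvgrPdist_lt H e /H /nbhs_ballP[d /= d0 K]|H].
  exists d => // s st; rewrite distrC; apply: K.
  by rewrite /ball /= distrC.
apply/cvgrPdist_lt => e /H[d d0 K]; apply/nbhs_ballP; exists d => // s.
by rewrite /ball /= distrC => /K; rewrite distrC.
Qed.

Lemma ccont_atP (u : R -> R[i]) t : ccont_at u t <->
  {for t, continuous (fun s => complex.Re (u s))} /\ {for t, continuous (fun s => complex.Im (u s))}.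
Proof.
split => [H|[/cont_epsP Hr /cont_epsP Hi] e e0].
  split; apply/cont_epsP => e /H[d d0 K]; exists d => // s /K; apply: le_lt_trans.
    by rewrite -ReN -ReD normc_Re.
  by rewrite -ImN -ImD normc_Im.
have e20 : 0 < e / 2 by rewrite divr_gt0.
have [d1 d10 {}Hr] := Hr _ e20; have [d2 d20 {}Hi] := Hi _ e20.
exists (Num.min d1 d2); first by rewrite lt_min d10.
move=> s; rewrite lt_min => /andP[/Hr s1 /Hi s2].
rewrite (le_lt_trans (normc_ReIm _))// (splitr e) ltrD// ?ReD ?ReN ?ImD ?ImN//.
Qed.

Lemma ccontP (u : R -> R[i]) : ccont u <->
  continuous (fun s => complex.Re (u s)) /\ continuous (fun s => complex.Im (u s)).
Proof.
split => [H|[H1 H2] t]; first by split=> t; have [] := (ccont_atP u t).1 (H t).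
by apply/ccont_atP; split; [exact: H1|exact: H2].
Qed.

Lemma ccont_Re u : ccont u -> continuous (fun s => complex.Re (u s)).
Proof. by move=> /ccontP[]. Qed.

Lemma ccont_Im u : ccont u -> continuous (fun s => complex.Im (u s)).
Proof. by move=> /ccontP[]. Qed.

Lemma ccont_norm u : ccont u -> continuous (fun s => normc (u s)).
Proof.
move=> H t; apply/cont_epsP => e /(H t)[d d0 K]; exists d => // s /K.
exact/le_lt_trans/ler_dist_normc.
Qed.

Lemma ccont_cst c : ccont (fun=> c).
Proof. by move=> t e e0; exists 1 => // s _; rewrite subrr normc0. Qed.

Lemma ccont_real (u : R -> R) : continuous u -> ccont (fun t => (u t)%:C).
Proof. by move=> H; apply/ccontP; split => //= t; exact: cst_continuous. Qed.

Lemma ccontD u v : ccont u -> ccont v -> ccont (fun t => u t + v t).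
Proof.
move=> /ccontP[a b] /ccontP[c d]; apply/ccontP; split => t.
  under eq_fun do rewrite ReD.
  by apply: cvgD; [exact: a|exact: c].
under eq_fun do rewrite ImD.
by apply: cvgD; [exact: b|exact: d].
Qed.

Lemma ccontN u : ccont u -> ccont (fun t => - u t).
Proof.
move=> H t e /(H t)[d d0 K]; exists d => // s /K.
by rewrite -opprD normc_opp.
Qed.

Lemma ccontB u v : ccont u -> ccont v -> ccont (fun t => u t - v t).
Proof. by move=> U V; apply: ccontD => //; exact: ccontN. Qed.

Lemma ccontJ u : ccont u -> ccont (fun t => Num.conj (u t)).
Proof.
move=> H t e /(H t)[d d0 K]; exists d => // s /K.
by rewrite -rmorphB normcJ.
Qed.

Lemma ccontM u v : ccont u -> ccont v -> ccont (fun t => u t * v t).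
Proof.
move=> /ccontP[a b] /ccontP[c d]; apply/ccontP; split => t.
  under eq_fun do rewrite ReM.
  by apply: cvgB; apply: cvgM; [exact: a|exact: c|exact: b|exact: d].
under eq_fun do rewrite ImM.
by apply: cvgD; apply: cvgM; [exact: a|exact: d|exact: b|exact: c].
Qed.

Lemma ccontX u n : ccont u -> ccont (fun t => u t ^+ n).
Proof.
move=> U; elim: n => [|n IH].
  rewrite (_ : (fun=> _) = (fun=> 1)); first exact: ccont_cst.
  by apply/funext => t; rewrite expr0.
rewrite (_ : (fun=> _) = (fun t => u t * u t ^+ n)); first exact: ccontM.
by apply/funext => t; rewrite exprS.
Qed.

Lemma ccont_sum (I : Type) (r : seq I) (F : I -> R -> R[i]) :
  (forall i, ccont (F i)) -> ccont (fun t => \sum_(i <- r) F i t).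
Proof.
move=> H; elim: r => [|i r IH].
  rewrite (_ : (fun=> _) = (fun=> 0)); first exact: ccont_cst.
  by apply/funext => t; rewrite big_nil.
rewrite (_ : (fun=> _) = (fun t => F i t + \sum_(j <- r) F j t)); first exact: ccontD.
by apply/funext => t; rewrite big_cons.
Qed.

Lemma ccont_expi : ccont (@expi R).
Proof.
by apply/ccontP; split => /= t; [exact: continuous_cos|exact: continuous_sin].
Qed.

Lemma ccont_comp_real u (v : R -> R) :
  continuous v -> ccont u -> ccont (fun t => u (v t)).
Proof.
move=> V U t e /(U (v t))[d d0 H].
have [d' d'0 K] := (cont_epsP v t).1 (V t) _ d0.
by exists d' => // s /K /H.
Qed.

Lemma ccont_at_deriv f u t l : ccont_at u t -> cderiv f (u t) l ->
  ccont_at (fun s => f (u s)) t.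
Proof.
move=> U /cderiv_lip[d d0 F] e e0.
have l0 : 0 < 1 + normc l by rewrite ltr_pwDl// normc_ge0.
have [d' d'0 {}U] : exists2 d', 0 < d' &
  forall s, `|s - t| < d' -> normc (u s - u t) < Num.min d (e / (1 + normc l)).
  by apply: U; rewrite lt_min d0 divr_gt0.
exists d' => // s /U; rewrite lt_min => /andP[/F s1 s2].
by rewrite (le_lt_trans s1)// mulrC -ltr_pdivlMr.
Qed.

Lemma ccont_deriv f u : ccont u -> (forall t, exists l, cderiv f (u t) l) ->
  ccont (fun s => f (u s)).
Proof. by move=> U H t; have [l /(ccont_at_deriv (U t))] := H t. Qed.

End ComplexDerivative.

(** * Integrals of continuous functions *)

Section RealIntegrals.
Variable R : realType.
Implicit Types (u v : R -> R) (a b c : R).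
Let mu := @lebesgue_measure R.

Definition rint a b u : R := \int[mu]_(t in `[a, b]) u t.

Lemma cont_integrable u a b : continuous u -> mu.-integrable `[a, b] (EFin \o u).
Proof.
move=> H; apply: continuous_compact_integrable; first exact: segment_compact.
exact: continuous_subspaceT.
Qed.

Lemma rintD a b u v : continuous u -> continuous v ->
  rint a b (fun t => u t + v t) = rint a b u + rint a b v.
Proof. by move=> U V; rewrite /rint RintegralD//; exact: cont_integrable. Qed.

Lemma rintB a b u v : continuous u -> continuous v ->
  rint a b (fun t => u t - v t) = rint a b u - rint a b v.
Proof. by move=> U V; rewrite /rint RintegralB//; exact: cont_integrable. Qed.

Lemma rintZ a b k u : continuous u -> rint a b (fun t => k * u t) = k * rint a b u.
Proof. by move=> U; rewrite /rint RintegralZl//; exact: cont_integrable. Qed.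

Lemma rintN a b u : continuous u -> rint a b (fun t => - u t) = - rint a b u.
Proof.
move=> U; rewrite -mulN1r -rintZ//.
by apply: eq_Rintegral => x _; rewrite mulN1r.
Qed.

Lemma eq_rint a b u v : (forall t, a <= t <= b -> u t = v t) -> rint a b u = rint a b v.
Proof. by move=> H; apply: eq_Rintegral => x; rewrite inE /= in_itv /= => /H. Qed.

Lemma rint_cst a b k : a <= b -> rint a b (fun=> k) = k * (b - a).
Proof.
move=> ab; rewrite /rint Rintegral_cst//; congr (_ * _).
have := lebesgue_measure_itv `[a, b] => /= ->.
rewrite lte_fin; case: ltP => //= ba.
have -> : b = a by apply/eqP; rewrite eq_le ab ba.
by rewrite subrr.
Qed.

Lemma le_rint a b u v : continuous u -> continuous v ->
  (forall t, a <= t <= b -> u t <= v t) -> rint a b u <= rint a b v.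
Proof.
move=> U V H; rewrite /rint; apply: le_Rintegral => //; try exact: cont_integrable.
Qed.

Lemma rint_ge0 a b u : (forall t, a <= t <= b -> 0 <= u t) -> 0 <= rint a b u.
Proof.
by move=> H; apply: Rintegral_ge0 => x /=; rewrite in_itv /= => /H.
Qed.

Lemma rint_bound a b k u : a <= b -> continuous u ->
  (forall t, a <= t <= b -> u t <= k) -> rint a b u <= k * (b - a).
Proof.
move=> ab U H; rewrite -rint_cst//; apply: le_rint => //.
by move=> t; exact: cst_continuous.
Qed.

Lemma rint_cat a b c u : continuous u -> a <= b -> b <= c ->
  rint a c u = rint a b u + rint b c u.
Proof.
move=> U ab bc; apply/eqP; rewrite addrC -subr_eq; apply/eqP.
rewrite /rint Rintegral_itvB ?bnd_simp//; last exact: cont_integrable.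
rewrite Rintegral_itv_obnd_cbnd//.
apply: (@integrableS _ _ _ mu `[b, c]) => //; last exact: cont_integrable.
by apply: subset_itvr; rewrite bnd_simp.
Qed.

Lemma rint_FTC2 a b u v : a <= b -> continuous u ->
  (forall t : R, is_derive t 1 (v : R -> R) (u t)) -> rint a b u = v b - v a.
Proof.
rewrite le_eqVlt => /predU1P[->|ab] U H.
  by rewrite subrr /rint set_itv1 Rintegral_set1.
rewrite /rint /Rintegral (continuous_FTC2 (F := v)) //.
- exact: continuous_subspaceT.
- have D t : derivable v t 1 by have [] := H t.
  have C (t : R) : {for t, continuous v} by apply/differentiable_continuous/derivable1_diffP.
  split=> [t _||]; first exact: D.
    by apply: cvg_at_right_filter; exact: C.
  by apply: cvg_at_left_filter; exact: C.
- by move=> t _; rewrite derive1E; have [] := H t.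
Qed.

Lemma rint_FTC1 a b u : continuous u -> a < b ->
  is_derive b 1 (fun x => rint a x u) (u b).
Proof.
move=> U ab.
have b1 : b < b + 1 by rewrite ltrDl.
have [D1 D2] := @continuous_FTC1_closed _ u a b _ b1 (@cont_integrable u a _ U) ab (U b).
rewrite derive1E in D2.
by apply: DeriveDef; [exact: D1|exact: D2].
Qed.

Lemma continuous_normr_comp u : continuous u -> continuous (fun t => `|u t|).
Proof. by move=> U t; apply: cvg_norm; exact: U. Qed.

End RealIntegrals.

Section ComplexIntegrals.
Variable R : realType.
Implicit Types (u v : R -> R[i]) (a b c : R).

Definition cint a b u : R[i] :=
  rint a b (fun t => complex.Re (u t)) +i* rint a b (fun t => complex.Im (u t)).

Lemma cintD a b u v : ccont u -> ccont v ->
  cint a b (fun t => u t + v t) = cint a b u + cint a b v.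
Proof.
move=> U V; rewrite /cint; apply: complex_ext; rewrite ReImE /=.
  rewrite -rintD; try exact: ccont_Re.
  by apply: eq_rint => t _; rewrite ReImE.
rewrite -rintD; try exact: ccont_Im.
by apply: eq_rint => t _; rewrite ReImE.
Qed.

Lemma eq_cint a b u v : (forall t, a <= t <= b -> u t = v t) -> cint a b u = cint a b v.
Proof. by move=> H; congr (_ +i* _); apply: eq_rint => t /H ->. Qed.

Lemma cintZ a b k u : ccont u -> cint a b (fun t => k * u t) = k * cint a b u.
Proof.
move=> U; have Ur := ccont_Re U; have Ui := ccont_Im U.
have Z (r : R) (f : R -> R) : continuous f -> continuous (fun t => r * f t).
  by move=> F t; apply: cvgM; [exact: cvg_cst|exact: F].
rewrite /cint; apply: complex_ext; rewrite ReImE /=.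
  rewrite -!rintZ// -rintB; try exact: Z.
  by apply: eq_rint => t _; rewrite ReImE.
rewrite -!rintZ// -rintD; try exact: Z.
by apply: eq_rint => t _; rewrite ReImE.
Qed.

Lemma cintN a b u : ccont u -> cint a b (fun t => - u t) = - cint a b u.
Proof.
move=> U; rewrite -mulN1r -cintZ//.
by apply: eq_cint => t _; rewrite mulN1r.
Qed.

Lemma cintB a b u v : ccont u -> ccont v ->
  cint a b (fun t => u t - v t) = cint a b u - cint a b v.
Proof.
by move=> U V; rewrite cintD ?cintN//; exact: ccontN.
Qed.

Lemma cint_cst a b k : a <= b -> cint a b (fun=> k) = (b - a)%:C * k.
Proof.
move=> ab; apply: complex_ext; rewrite /cint ReImE /= rint_cst//; ring.
Qed.

Lemma cint_cat a b c u : ccont u -> a <= b -> b <= c ->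
  cint a c u = cint a b u + cint b c u.
Proof.
move=> U ab bc; apply: complex_ext; rewrite /cint ReImE /=; apply: rint_cat => //.
  exact: ccont_Re.
exact: ccont_Im.
Qed.

Lemma cint_sum a b (I : Type) (r : seq I) (F : I -> R -> R[i]) : a <= b ->
  (forall i, ccont (F i)) ->
  cint a b (fun t => \sum_(i <- r) F i t) = \sum_(i <- r) cint a b (F i).
Proof.
move=> ab H; elim: r => [|i r IH].
  rewrite big_nil; transitivity (cint a b (fun=> 0)); last by rewrite cint_cst// mulr0.
  by apply: eq_cint => t _; rewrite big_nil.
rewrite big_cons -IH -cintD//; last exact: ccont_sum.
by apply: eq_cint => t _; rewrite big_cons.
Qed.

(** A rotation turns the integral into a nonnegative real number, hence into the integral of a real
    part, which the modulus dominates pointwise. *)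
Lemma normc_cint a b u : ccont u ->
  normc (cint a b u) <= rint a b (fun t => normc (u t)).
Proof.
move=> U; have [k k1 kE] := exists_rotation (cint a b u).
have -> : normc (cint a b u) = complex.Re (k * cint a b u) by rewrite kE.
rewrite -cintZ//= le_rint//.
- by apply: ccont_Re; apply: ccontM => //; exact: ccont_cst.
- exact: ccont_norm.
move=> t _; rewrite (le_trans (ler_norm _))// (le_trans (normc_Re _))//.
by rewrite normcM k1 mul1r.
Qed.

Lemma cint_bound a b K u : a <= b -> ccont u ->
  (forall t, a <= t <= b -> normc (u t) <= K) -> normc (cint a b u) <= K * (b - a).
Proof.
move=> ab U H; rewrite (le_trans (normc_cint _ _ U))// rint_bound//.
exact: ccont_norm.
Qed.

Lemma cintJ a b u : ccont u -> cint a b (fun t => Num.conj (u t)) = Num.conj (cint a b u).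
Proof.
move=> U; apply: complex_ext; rewrite ReImE /=.
  by apply: eq_rint => t _; rewrite ReImE.
rewrite -rintN; last exact: ccont_Im.
by apply: eq_rint => t _; rewrite ReImE.
Qed.

Lemma cint_FTC2 a b u v : a <= b -> ccont u ->
  (forall t : R, is_derive t 1 (fun t => complex.Re (v t)) (complex.Re (u t))) ->
  (forall t : R, is_derive t 1 (fun t => complex.Im (v t)) (complex.Im (u t))) ->
  cint a b u = v b - v a.
Proof.
move=> ab U Hr Hi; apply: complex_ext; rewrite ReImE /=.
  by rewrite ReN; apply: (rint_FTC2 (v := fun t => complex.Re (v t))) => //; exact: ccont_Re.
by rewrite ImN; apply: (rint_FTC2 (v := fun t => complex.Im (v t))) => //; exact: ccont_Im.
Qed.

End ComplexIntegrals.
Arguments cint : simpl never.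
Arguments rint : simpl never.

(** * Goursat's theorem *)

Section Goursat.
Variable R : realType.
Implicit Types (x y h k e d : R).

Lemma nested_point (a b : nat -> R) : (forall n m, a n <= b m) ->
  exists x, forall n, a n <= x <= b n.
Proof.
move=> H; exists (sup (range a)) => n; apply/andP; split.
  apply: ub_le_sup; last by exists n.
  by exists (b 0) => _ [m _ <-].
by apply: ge_sup => [|_ [m _ <-]//]; exists (a 0), 0.
Qed.

Lemma archi_pow2 (K e : R) : 0 <= K -> 0 < e -> exists n, K / 2 ^+ n < e.
Proof.
move=> K0 e0; exists (Num.bound (K / e)).
rewrite ltr_pdivrMr ?exprn_gt0// mulrC -ltr_pdivrMr//.
rewrite (lt_le_trans (archi_boundP (divr_ge0 K0 (ltW e0))))//.
by rewrite -natrX ler_nat ltnW// ltn_expl.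
Qed.

Lemma four_pigeons (j j1 j2 j3 j4 : R) : j <= j1 + j2 + (j3 + j4) ->
  [\/ j <= 4 * j1, j <= 4 * j2, j <= 4 * j3 | j <= 4 * j4].
Proof.
move=> H; case: (leP j (4 * j1)) => L1; first by constructor 1.
case: (leP j (4 * j2)) => L2; first by constructor 2.
case: (leP j (4 * j3)) => L3; first by constructor 3.
constructor 4; lra.
Qed.

Variables (G : R -> R -> R[i]) (X : R).
Hypothesis Gx : forall y, ccont (G^~ y).
Hypothesis Gy : forall x, ccont (G x).

(** Differentiability relative to the half plane [x <= X]: the function used later is frozen beyond
    [X], hence continuous everywhere but differentiable only from the left at the edge. *)
Definition rect_diff x0 y0 := exists a l, forall e, 0 < e -> exists2 d, 0 < d &
  forall x y, x <= X -> normc ((x - x0) +i* (y - y0)) < d ->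
  normc (G x y - a - l * ((x - x0) +i* (y - y0))) <= e * normc ((x - x0) +i* (y - y0)).

Definition rect_int x y h k : R[i] :=
  cint x (x + h) (fun s => G s y - G s (y + k))
  + 'i%C * cint y (y + k) (fun s => G (x + h) s - G x s).

Lemma rect_int_split x y h k : 0 < h -> 0 < k ->
  rect_int x y h k = rect_int x y (h / 2) (k / 2)
    + rect_int (x + h / 2) y (h / 2) (k / 2)
    + (rect_int x (y + k / 2) (h / 2) (k / 2)
    + rect_int (x + h / 2) (y + k / 2) (h / 2) (k / 2)).
Proof.
move=> h0 k0; rewrite /rect_int.
have E1 (z s : R) : z + s / 2 + s / 2 = z + s by rewrite -addrA -splitr.
rewrite !E1.
have h2 : 0 <= h / 2 by rewrite divr_ge0// ltW.
have k2 : 0 <= k / 2 by rewrite divr_ge0// ltW.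
have hx1 : x <= x + h / 2 by rewrite lerDl.
have hx2 : x + h / 2 <= x + h by rewrite -[leRHS](E1 x) lerDl.
have hy1 : y <= y + k / 2 by rewrite lerDl.
have hy2 : y + k / 2 <= y + k by rewrite -[leRHS](E1 y) lerDl.
have C1 u : ccont u -> cint x (x + h) u = cint x (x + h/2) u + cint (x + h/2) (x + h) u.
  by move=> U; apply: cint_cat.
have C2 u : ccont u -> cint y (y + k) u = cint y (y + k/2) u + cint (y + k/2) (y + k) u.
  by move=> U; apply: cint_cat.
rewrite !cintB// !C1// !C2//; try exact: ccontB; ring.
Qed.

(** Affine functions have integral zero over the boundary: their values on opposite sides differ by
    constants, and the two contributions cancel. In [u] and [v] these constants are subtracted,
    which leaves only the remainder to estimate. *)
Lemma rect_int_bound x y h k a l K : 0 < h -> 0 < k ->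
  (forall s t, x <= s <= x + h -> y <= t <= y + k ->
     normc (G s t - a - l * (s +i* t)) <= K) ->
  normc (rect_int x y h k) <= 2 * K * (h + k).
Proof.
move=> h0 k0 H.
pose u s := G s y - G s (y + k) + l * ('i%C * k%:C).
pose v s := G (x + h) s - G x s - l * h%:C.
have hx : x <= x + h by rewrite lerDl ltW.
have hy : y <= y + k by rewrite lerDl ltW.
have cu : ccont u by apply: ccontD; [exact: ccontB|exact: ccont_cst].
have cv : ccont v by apply: ccontB; [exact: ccontB|exact: ccont_cst].
have E1 : cint x (x + h) u = cint x (x + h) (fun s => G s y - G s (y + k))
   + h%:C * (l * ('i%C * k%:C)).
  rewrite /u (@cintD _ _ _ (fun s => G s y - G s (y + k)) (fun=> l * ('i%C * k%:C))); try exact: ccontB; try exact: ccont_cst.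
  by rewrite cint_cst// (addrC x) addrK.
have E2 : cint y (y + k) v = cint y (y + k) (fun s => G (x + h) s - G x s)
   - k%:C * (l * h%:C).
  rewrite /v (@cintB _ _ _ (fun s => G (x + h) s - G x s) (fun=> l * h%:C)); try exact: ccontB; try exact: ccont_cst.
  by rewrite cint_cst// (addrC y) addrK.
have -> : rect_int x y h k = cint x (x + h) u + 'i%C * cint y (y + k) v.
  rewrite E1 E2 /rect_int; ring.
have i1 : normc ('i%C : R[i]) = 1 by rewrite /normc /= expr0n expr1n add0r sqrtr1.
rewrite (le_trans (ler_normcD _ _))// mulrDr normcM i1 mul1r lerD//.
  have := @cint_bound _ x (x + h) (2 * K) u hx cu; rewrite (addrC x) addrK; apply.
  move=> t; rewrite (addrC h) => tx; rewrite /u.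
  have -> : G t y - G t (y + k) + l * ('i%C * k%:C) =
     (G t y - a - l * (t +i* y)) - (G t (y + k) - a - l * (t +i* (y + k))).
    have -> : t +i* (y + k) = t +i* y + 'i%C * k%:C.
      by apply: complex_ext; rewrite !ReImE /=; ring.
    ring.
  by rewrite (le_trans (ler_normcB _ _))// mulr_natl mulr2n lerD// H// ?lexx ?hy.
have := @cint_bound _ y (y + k) (2 * K) v hy cv; rewrite (addrC y) addrK; apply.
move=> t; rewrite (addrC k) => ty; rewrite /v.
have -> : G (x + h) t - G x t - l * h%:C =
   (G (x + h) t - a - l * ((x + h) +i* t)) - (G x t - a - l * (x +i* t)).
  have -> : (x + h) +i* t = x +i* t + h%:C.
    by apply: complex_ext; rewrite !ReImE /=; ring.
  ring.
by rewrite (le_trans (ler_normcB _ _))// mulr_natl mulr2n lerD// H// ?lexx ?hx.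
Qed.

Hypothesis GD : forall x y, x <= X -> rect_diff x y.

Lemma goursat x y h k : 0 < h -> 0 < k -> x + h <= X -> rect_int x y h k = 0.
Proof.
move=> h0 k0 hX.
pose H n := h / 2 ^+ n; pose K n := k / 2 ^+ n.
have p20 n : 0 < 2 ^+ n :> R by rewrite exprn_gt0.
have H0 n : 0 < H n by rewrite divr_gt0.
have K0 n : 0 < K n by rewrite divr_gt0.
have HS n : H n.+1 = H n / 2 by rewrite /H exprSr invfM mulrA.
have KS n : K n.+1 = K n / 2 by rewrite /K exprSr invfM mulrA.
have step n (p : R * R) : exists q : R * R,
    [/\ p.1 <= q.1, q.1 + H n.+1 <= p.1 + H n, p.2 <= q.2, q.2 + K n.+1 <= p.2 + K n &
    normc (rect_int p.1 p.2 (H n) (K n)) <= 4 * normc (rect_int q.1 q.2 (H n.+1) (K n.+1))].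
  case: p => a b /=.
  have := rect_int_split a b (H0 n) (K0 n); rewrite -HS -KS.
  set J1 := rect_int a b (H n.+1) _; set J2 := rect_int (a + _) b _ _.
  set J3 := rect_int a (b + _) _ _; set J4 := rect_int (a + _) (b + _) _ _ => E.
  have hs : H n = H n.+1 + H n.+1 by rewrite HS -splitr.
  have ks : K n = K n.+1 + K n.+1 by rewrite KS -splitr.
  have h0' := H0 n.+1; have k0' := K0 n.+1.
  have B : normc (rect_int a b (H n) (K n)) <= normc J1 + normc J2 + (normc J3 + normc J4).
    by rewrite E (le_trans (ler_normcD _ _))// lerD// ler_normcD.
  have hs1 : a + H n.+1 <= a + H n by rewrite lerD2l hs lerDl ltW.
  have ks1 : b + K n.+1 <= b + K n by rewrite lerD2l ks lerDl ltW.
  have hs2 : a + H n.+1 + H n.+1 <= a + H n by rewrite -addrA -hs.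
  have ks2 : b + K n.+1 + K n.+1 <= b + K n by rewrite -addrA -ks.
  have aa : a <= a + H n.+1 by rewrite lerDl ltW.
  have bb : b <= b + K n.+1 by rewrite lerDl ltW.
  have [L|L|L|L] := four_pigeons B.
  - by exists (a, b).
  - by exists (a + H n.+1, b).
  - by exists (a, b + K n.+1).
  - by exists (a + H n.+1, b + K n.+1).
have [F FP] := choice (fun np : nat * (R * R) => step np.1 np.2).
pose P := fix P n := if n is m.+1 then F (m, P m) else (x, y).
have Pm1 : {homo (fun n => (P n).1) : a b / (a <= b)%N >-> a <= b}.
  by apply: homo_leq => // [a b c|m]; [exact: le_trans|have [] := FP (m, P m)].
have Pm2 : {homo (fun n => (P n).2) : a b / (a <= b)%N >-> a <= b}.
  by apply: homo_leq => // [a b c|m]; [exact: le_trans|have [] := FP (m, P m)].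
have Pd1 : {homo (fun n => (P n).1 + H n) : a b / (a <= b)%N >-> b <= a}.
  apply: (@homo_leq _ _ (fun a b => b <= a)) => // [a b c|m].
    by move=> ab cb; exact: le_trans cb ab.
  by have [] := FP (m, P m).
have Pd2 : {homo (fun n => (P n).2 + K n) : a b / (a <= b)%N >-> b <= a}.
  apply: (@homo_leq _ _ (fun a b => b <= a)) => // [a b c|m].
    by move=> ab cb; exact: le_trans cb ab.
  by have [] := FP (m, P m).
have [x1 Hx1] : exists x1, forall n, (P n).1 <= x1 <= (P n).1 + H n.
  apply: nested_point => n m.
  rewrite (@le_trans _ _ (P (maxn n m)).1)//; first by apply: Pm1 => //; exact: leq_maxl.
  rewrite (@le_trans _ _ ((P (maxn n m)).1 + H (maxn n m)))// ?lerDl ?(ltW (H0 _))//.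
  by apply: Pd1 => //; exact: leq_maxr.
have [y1 Hy1] : exists y1, forall n, (P n).2 <= y1 <= (P n).2 + K n.
  apply: nested_point => n m.
  rewrite (@le_trans _ _ (P (maxn n m)).2)//; first by apply: Pm2 => //; exact: leq_maxl.
  rewrite (@le_trans _ _ ((P (maxn n m)).2 + K (maxn n m)))// ?lerDl ?(ltW (K0 _))//.
  by apply: Pd2 => //; exact: leq_maxr.
have PJ n : normc (rect_int x y h k) <= 4 ^+ n * normc (rect_int (P n).1 (P n).2 (H n) (K n)).
  elim: n => [|n IH]; first by rewrite expr0 mul1r /H /K !expr0 !divr1.
  rewrite (le_trans IH)// exprSr -mulrA ler_wpM2l ?exprn_ge0//.
  by have [] := FP (n, P n).
have x1X : x1 <= X.
  by have /andP[_ /le_trans-> //] := Hx1 0; rewrite /= /H expr0 divr1.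
have [a [l D]] := GD y1 x1X.
apply/eqP; rewrite -normc_eq0 eq_le normc_ge0 andbT.
apply/ler_addgt0Pl => e e0; rewrite addr0.
have hk0 : 0 < h + k by rewrite addr_gt0.
(* After [n] bisections the half-perimeter is [(h + k) / 2^n] and the accumulated factor [4^n]; with
   this tolerance the bound of [rect_int_bound] becomes exactly [e]. *)
have e'0 : 0 < e / (2 * (h + k) ^+ 2) by rewrite divr_gt0// mulr_gt0// exprn_gt0.
have [d d0 {}D] := D _ e'0.
have [n nd] := archi_pow2 (ltW hk0) d0.
have HKn : H n + K n = (h + k) / 2 ^+ n by rewrite /H /K mulrDl.
have /andP[x1l x1u] := Hx1 n; have /andP[y1l y1u] := Hy1 n.
have L := @rect_int_bound (P n).1 (P n).2 (H n) (K n) (a - l * (x1 +i* y1)) l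
  (e / (2 * (h + k) ^+ 2) * (H n + K n)) (H0 n) (K0 n).
rewrite (le_trans (PJ n))//.
have -> : e = 4 ^+ n * (2 * (e / (2 * (h + k) ^+ 2) * (H n + K n)) * (H n + K n)).
  rewrite HKn (_ : 4 = 2 ^+ 2 :> R) -?exprM; last by rewrite expr2 -natrM.
  rewrite mulnC exprM; field; rewrite lt0r_neq0 ?exprn_gt0//=; exact: lt0r_neq0.
rewrite ler_wpM2l ?exprn_ge0// L// => s t /andP[s1 s2] /andP[t1 t2].
have bd : normc ((s - x1) +i* (t - y1)) <= H n + K n.
  rewrite (le_trans (normc_ReIm _))//= lerD// ler_norml; apply/andP; split; lra.
have sX : s <= X.
  rewrite (le_trans s2)// (le_trans _ hX)//.
  by have := Pd1 0%N n isT; rewrite /= /H expr0 divr1.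
rewrite (_ : _ - _ = G s t - a - l * ((s - x1) +i* (t - y1))).
  rewrite (le_trans (D _ _ sX _))//; first by rewrite (le_lt_trans bd)// HKn.
  by rewrite ler_wpM2l// ltW.
have -> : (s - x1) +i* (t - y1) = (s +i* t) - (x1 +i* y1).
  by apply: complex_ext; rewrite !ReImE.
ring.
Qed.

End Goursat.

(** * The exponential *)

Section ComplexExp.
Variable R : realType.
Implicit Types (x y e : R) (z w : R[i]).

Lemma derive_eps (f : R -> R) x l : is_derive x 1 f l -> forall e, 0 < e ->
  exists2 d, 0 < d & forall h, `|h| < d -> `|f (x + h) - f x - l * h| <= e * `|h|.
Proof.
move=> [df dl] e e0.
pose G (h : R) : R := h^-1 *: (f (h *: (1 : R) + x) - f x).
have : G h @[h --> (0 : R)^'] --> (l : R) by rewrite -dl.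
move/(cvgrPdist_lt G (l : R)).1 => /(_ e e0).
rewrite near_withinE => /nbhs_ballP[d /= d0 K].
exists d => // h hd; have [->|h0] := eqVneq h 0.
  by rewrite addr0 subrr mulr0 subrr normr0 mulr0.
have := K h; rewrite /ball /= sub0r normrN => /(_ hd h0) /ltW L.
have E : f (x + h) - f x - l * h = - (l - G h) * h.
  rewrite /G /GRing.scale /= mulr1 (addrC h x); field; exact: h0.
by rewrite E normrM normrN ler_wpM2r.
Qed.

Lemma eps_derive (f : R -> R) x l : (forall e, 0 < e ->
  exists2 d, 0 < d & forall h, `|h| < d -> `|f (x + h) - f x - l * h| <= e * `|h|) ->
  is_derive x 1 f l.
Proof.
move=> H.
pose G (h : R) : R := h^-1 *: (f (h *: (1 : R) + x) - f x).
suff C : G h @[h --> (0 : R)^'] --> (l : R).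
  by apply: DeriveDef; [apply/cvg_ex; exists l|exact: (cvg_lim _ C)].
apply/(cvgrPdist_lt G (l : R)) => e e0.
have e20 : 0 < e / 2 by rewrite divr_gt0.
have [d d0 K] := H _ e20.
rewrite near_withinE; apply/nbhs_ballP; exists d => // h /=.
rewrite /ball /= sub0r normrN => /K L h0.
apply: (@le_lt_trans _ _ (e / 2)); last by rewrite ltr_pdivrMr// ltr_pMr// ltr1n.
have nh : 0 < `|h| by rewrite normr_gt0.
rewrite -(ler_pM2r nh); apply: le_trans L; rewrite -normrM.
rewrite (_ : (l - G h) * h = - (f (x + h) - f x - l * h)) ?normrN//.
rewrite /G /GRing.scale /= mulr1 (addrC h x); field; exact: h0.
Qed.

Definition cexp z := (expR (complex.Re z))%:C * expi (complex.Im z).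

Lemma cexpD z w : cexp (z + w) = cexp z * cexp w.
Proof. by rewrite /cexp !ReImE expRD expiD rmorphM; ring. Qed.

Lemma normc_cexp z : normc (cexp z) = expR (complex.Re z).
Proof. by rewrite normc_circle ?expR_ge0. Qed.

Lemma cexp0 : cexp 0 = 1.
Proof. by rewrite /cexp /= expR0 expi0 mulr1. Qed.

Lemma cexpN z : cexp (- z) = (cexp z)^-1.
Proof.
have z0 : cexp z != 0 by rewrite -normc_gt0 normc_cexp expR_gt0.
by apply: (mulfI z0); rewrite -cexpD subrr cexp0 divff.
Qed.

Lemma cexp_derive0 : cderiv cexp 0 1.
Proof.
move=> e0' e0'0.
(* The errors of the real and imaginary parts are bounded below by [3 e |w|] and [5 e |w|], together
   less than [10 e |w|]. *)
pose e := Num.min (e0' / 10) 1.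
have e0 : 0 < e by rewrite lt_min divr_gt0//=.
have e1 : e <= 1 by rewrite ge_min lexx orbT.
have ee : 10 * e <= e0'.
  by rewrite mulrC -ler_pdivlMr// ge_min lexx.
clearbody e.
have [d1 d10 H1] := derive_eps (is_derive_expR 0) e0.
have [d2 d20 H2] := derive_eps (is_derive_sin 0) e0.
have [d3 d30 H3] := derive_eps (is_derive_cos 0) e0.
exists (Num.min (Num.min d1 e) (Num.min d2 d3)) => [|w].
  by rewrite !lt_min d10 d20 d30 e0.
rewrite subr0 !lt_min => /andP[/andP[w1 w2] /andP[w3 w4]].
case: w w1 w2 w3 w4 => x y w1 w2 w3 w4.
have xn := normc_Re (x +i* y); have yn := normc_Im (x +i* y).
set n := normc _ in w1 w2 w3 w4 xn yn *; rewrite /= in xn yn.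
have := H1 x (le_lt_trans xn w1); rewrite add0r expR0 mul1r => A1.
have := H2 y (le_lt_trans yn w3); rewrite add0r sin0 cos0 subr0 mul1r => A2.
have := H3 y (le_lt_trans yn w4); rewrite add0r cos0 sin0 oppr0 mul0r subr0 => A3.
rewrite (le_trans (normc_ReIm _))// cexp0 /cexp !ReImE /=.
rewrite !mul0r !subr0 !mul1r !addr0.
have n0 : 0 <= n := normc_ge0 _.
have c1 : `|cos y| <= 1 by rewrite ler_norml cos_geN1 cos_le1.
have x1 : `|x| <= e by rewrite (le_trans xn)// ltW.
have B1 : `|expR x * cos y - 1 - x| <= 3 * (e * n).
  rewrite (_ : _ - x = (expR x - 1 - x) * cos y + (1 + x) * (cos y - 1)); last by ring.
  rewrite (le_trans (ler_normD _ _))// !normrM.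
  have -> : 3 * (e * n) = (e * n) * 1 + 2 * (e * n) by ring.
  apply: lerD; apply: ler_pM => //.
  - by rewrite (le_trans A1)// ler_wpM2l// ltW.
  - rewrite (le_trans (ler_normD _ _))// normr1; lra.
  - by rewrite (le_trans A3)// ler_wpM2l// ltW.
have B2 : `|expR x * sin y + 0 - y| <= 5 * (e * n).
  rewrite (_ : _ - y = (expR x - 1 - x) * sin y + x * sin y + (sin y - y)); last by ring.
  have s1 : `|sin y| <= 2 * n.
    rewrite (_ : sin y = (sin y - y) + y); last by ring.
    rewrite (le_trans (ler_normD _ _))//.
    have : e * `|y| <= 1 * n by rewrite ler_pM// ltW.
    lra.
  have -> : 5 * (e * n) = e * (2 * n) + e * (2 * n) + e * n by ring.
  rewrite (le_trans (ler_normD _ _))// lerD//; last by rewrite (le_trans A2)// ler_wpM2l// ltW.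
  rewrite (le_trans (ler_normD _ _))// !normrM lerD//; apply: ler_pM => //.
  rewrite (le_trans A1)//.
  have : e * `|x| <= e * 1 by rewrite ler_wpM2l ?(ltW e0)// (le_trans x1).
  lra.
have : 10 * e * n <= e0' * n by rewrite ler_wpM2r.
have : 0 <= e * n by rewrite mulr_ge0 ?(ltW e0).
move: B1 B2; rewrite ?addr0; set b1 := `|_|; set b2 := `|_|; lra.
Qed.

Lemma cexp_derive z : cderiv cexp z (cexp z).
Proof.
have H : cderiv (fun w => cexp z * cexp (w - z)) z (cexp z * (1 * (1 + 0))).
  apply: cderivZ; apply: cderiv_comp; last by rewrite subrr; exact: cexp_derive0.
  by apply: cderivD; [exact: cderiv_id|exact: cderiv_cst].
rewrite addr0 !mulr1 in H; apply: eq_cderiv H => w.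
by rewrite -cexpD addrC subrK.
Qed.

End ComplexExp.

(** * Power series *)

Section PowerSeries.
Variable R : realType.
Implicit Types (r q e K : R) (z w : R[i]) (a b : nat -> R[i]) (f g : R[i] -> R[i]).

Lemma geo_small K q e : 0 <= q < 1 -> 0 < e ->
  exists N, forall n, (N <= n)%N -> K * q ^+ n < e.
Proof.
move=> /andP[q0 q1] e0; have : (K * q ^+ n @[n --> \oo] --> K * 0).
  by apply: cvgMr; apply: cvg_expr; rewrite ger0_norm.
rewrite mulr0 => /cvgrPdist_lt /(_ e e0)[N _ H]; exists N => n /H.
by rewrite sub0r normrN; apply: le_lt_trans; rewrite ler_norm.
Qed.

Lemma le_geo_eq0 (x K q : R) : 0 <= q < 1 -> (forall n, `|x| <= K * q ^+ n) -> x = 0.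
Proof.
move=> q01 H; apply/eqP; rewrite -normr_eq0 eq_le normr_ge0 andbT.
apply/ler_addgt0Pl => e e0; rewrite addr0.
by have [N /(_ N (leqnn _)) /ltW] := @geo_small K q e q01 e0; exact: le_trans.
Qed.

(** The intervals of radius [K * q ^+ n] about [u n] meet pairwise, so they have a common point,
    which is the limit and carries the rate with it. *)
Lemma real_cauchy_geo (u : nat -> R) K q :
  (forall n m, (n <= m)%N -> `|u m - u n| <= K * q ^+ n) ->
  exists l, forall n, `|l - u n| <= K * q ^+ n.
Proof.
move=> H; have [n m|l Hl] := @nested_point _ (fun n => u n - K * q ^+ n)
    (fun n => u n + K * q ^+ n).
  have Hn i : 0 <= K * q ^+ i by rewrite (le_trans _ (H i i (leqnn i))).
  have := Hn n; have := Hn m.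
  by case: (leqP n m) => [/H|/ltnW/H]; rewrite ler_norml => /andP[]; lra.
by exists l => n; have := Hl n; rewrite ler_norml => /andP[]; lra.
Qed.

Lemma complex_cauchy_geo (u : nat -> R[i]) K q :
  (forall n m, (n <= m)%N -> normc (u m - u n) <= K * q ^+ n) ->
  exists l, forall n, normc (l - u n) <= 2 * K * q ^+ n.
Proof.
move=> H.
have [n m nm|x Hx] := @real_cauchy_geo (fun n => complex.Re (u n)) K q.
  by rewrite -ReN -ReD (le_trans (normc_Re _))// H.
have [n m nm|y Hy] := @real_cauchy_geo (fun n => complex.Im (u n)) K q.
  by rewrite -ImN -ImD (le_trans (normc_Im _))// H.
exists (x +i* y) => n; rewrite (le_trans (normc_ReIm _))// !ReImE.
by rewrite -mulrA mulr_natl mulr2n lerD.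
Qed.

(** Each of the [k] terms of the geometric sum up to [y ^+ (k - 1)] is at least [y ^+ k]. *)
Lemma natM_geo (y : R) k : 0 <= y < 1 -> k%:R * y ^+ k <= (1 - y)^-1.
Proof.
move=> /andP[y0 y1]; have y1' : 0 < 1 - y by rewrite subr_gt0.
rewrite -(ler_pM2r y1') mulVf ?lt0r_neq0//.
have : k%:R * y ^+ k <= \sum_(i < k) y ^+ i.
  rewrite mulr_natl -[k in _ *+ k]card_ord -sumr_const ler_sum// => i _.
  by rewrite ler_wiXn2l ?(ltW y1)// ltnW.
move/(ler_wpM2r (ltW y1')) => /le_trans; apply.
rewrite mulrC -[1 - y]opprB mulNr -subrX1 opprB lerBlDr lerDl exprn_ge0//.
Qed.

Lemma sqr_geo q : 0 <= q < 1 -> exists C y, [/\ 0 <= C, 0 < y < 1 &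
  forall k, k%:R ^+ 2 * q ^+ k <= C * y ^+ k].
Proof.
(* By the inequality of arithmetic and geometric means for [q, 1, 1], the cube of [y] is at least
   [q]. Two of the three factors absorb [k ^+ 2] through [natM_geo], and the third remains as the
   new ratio. *)
move=> /andP[q0 q1]; pose y := (q + 2) / 3.
have y0 : 0 < y by rewrite divr_gt0// ltr_wpDl.
have y1 : y < 1 by rewrite /y; lra.
have yq : q <= y ^+ 3.
  have : 0 <= (q - 1) ^+ 2 * (q + 8) by rewrite mulr_ge0 ?sqr_ge0// addr_ge0.
  rewrite /y !exprS expr0; lra.
exists ((1 - y)^-1 ^+ 2), y; split; [exact: sqr_ge0|exact/andP|] => k.
have y0' : 0 <= y by exact: ltW.
have E : (k%:R * y ^+ k) ^+ 2 * y ^+ k = k%:R ^+ 2 * (y ^+ 3) ^+ k.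
  by rewrite exprMn -mulrA; congr (_ * _); rewrite -!exprM -exprD -mulnSr mulnC.
apply: (@le_trans _ _ ((k%:R * y ^+ k) ^+ 2 * y ^+ k)).
  rewrite E ler_wpM2l ?sqr_ge0// lerXn2r// nnegrE ?exprn_ge0//.
rewrite ler_wpM2r ?exprn_ge0// lerXn2r ?nnegrE ?invr_ge0 ?subr_ge0 ?(ltW y1)//.
  by rewrite mulr_ge0// exprn_ge0.
by rewrite natM_geo// y0'.
Qed.

Definition psum a n z := \sum_(k < n) a k * z ^+ k.

(* Power series expansion on the unit disc, with explicit geometric control
   of the remainder on each smaller disc. *)
Definition has_ps a f := forall r, 0 <= r < 1 -> exists K q, [/\ 0 <= K, 0 <= q < 1 &
  forall z, normc z <= r -> forall n, normc (f z - psum a n z) <= K * q ^+ n].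

Definition coef_geo a := forall r, 0 <= r < 1 -> exists K q, [/\ 0 <= K, 0 <= q < 1 &
  forall n, normc (a n) * r ^+ n <= K * q ^+ n].

Lemma psumS a n z : psum a n.+1 z = psum a n z + a n * z ^+ n.
Proof. by rewrite /psum big_ord_recr. Qed.

Lemma has_ps_coef a f : has_ps a f -> coef_geo a.
Proof.
move=> H r r01; have /andP[r0 r1] := r01; have [K [q [K0 q01 B]]] := H r r01.
exists (2 * K), q; split; rewrite ?mulr_ge0// => n.
have zr : normc r%:C <= r by rewrite normcR ger0_norm.
have -> : normc (a n) * r ^+ n = normc (psum a n.+1 r%:C - psum a n r%:C).
  by rewrite psumS addrC addKr normcM normcX normcR ger0_norm.
rewrite (le_trans (normc_triangle (f r%:C) _ _))//.
rewrite normc_dist -mulrA mulr_natl mulr2n lerD ?B//.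
rewrite (le_trans (B _ zr _))// ler_wpM2l//.
by have /andP[q0 q1] := q01; rewrite ler_wiXn2l ?(ltW q1).
Qed.

Lemma geo_sum_le q n m : 0 <= q < 1 -> (n <= m)%N ->
  \sum_(n <= k < m) q ^+ k <= (1 - q)^-1 * q ^+ n.
Proof.
move=> /andP[q0 q1] nm; rewrite -{1}(add0n n) big_addn.
under eq_bigr do rewrite addnC exprD.
rewrite -mulr_sumr mulrC ler_wpM2r ?exprn_ge0// big_mkord.
have q1' : 0 < 1 - q by rewrite subr_gt0.
rewrite -(ler_pM2r q1') mulVf ?lt0r_neq0// mulrC -[1 - q]opprB mulNr -subrX1 opprB.
by rewrite lerBlDr lerDl exprn_ge0.
Qed.

Lemma psum_cauchy a r K q n m z : 0 <= q < 1 -> 0 <= K ->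
  (forall n, normc (a n) * r ^+ n <= K * q ^+ n) -> normc z <= r -> (n <= m)%N ->
  normc (psum a m z - psum a n z) <= K / (1 - q) * q ^+ n.
Proof.
move=> q01 K0 H zr nm; rewrite /psum -!(big_mkord xpredT (fun k => a k * z ^+ k)).
rewrite (big_cat_nat (n := n))//= addrAC subrr add0r (le_trans (ler_normc_sum _ _ _))//.
rewrite -mulrA (le_trans _ (ler_wpM2l K0 (geo_sum_le q01 nm)))// mulr_sumr.
apply: ler_sum => k _; rewrite (le_trans _ (H k))// normcM normcX.
rewrite ler_wpM2l ?normc_ge0// lerXn2r ?nnegrE ?normc_ge0//.
by rewrite (le_trans _ zr) ?normc_ge0.
Qed.

Lemma has_ps_exists a : coef_geo a -> exists f, has_ps a f.
Proof.
move=> H.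
have lim r z : 0 <= r < 1 -> normc z <= r -> exists l K q, [/\ 0 <= K, 0 <= q < 1 &
    forall n, normc (l - psum a n z) <= K * q ^+ n].
  move=> r01 zr; have [K [q [K0 q01 B]]] := H r r01.
  have [l Hl] := complex_cauchy_geo (fun n m => @psum_cauchy a r K q n m z q01 K0 B zr).
  exists l, (2 * (K / (1 - q))), q; split => //.
  by rewrite mulr_ge0// divr_ge0// subr_ge0 ltW//; case/andP: q01.
have F z : exists l, normc z < 1 -> exists K q, [/\ 0 <= K, 0 <= q < 1 &
    forall n, normc (l - psum a n z) <= K * q ^+ n].
  have [z1|z1] := ltP (normc z) 1; last by exists 0.
  have z01 : 0 <= normc z < 1 by rewrite normc_ge0.
  by have [l L] := lim _ _ z01 (lexx _); exists l.
have [f {}F] := choice F; exists f => r r01.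
have [K [q [K0 q01 B]]] := H r r01; have /andP[r0 r1] := r01.
exists (2 * (K / (1 - q))), q; split => //.
  by rewrite mulr_ge0// divr_ge0// subr_ge0 ltW//; case/andP: q01.
move=> z zr n; have [l Hl] := complex_cauchy_geo (fun n m => @psum_cauchy a r K q n m z q01 K0 B zr).
have [K' [q' [K'0 q'01 B']]] := F z (le_lt_trans zr r1).
suff -> : f z = l by exact: Hl.
have q''01 : 0 <= Num.max q q' < 1.
  by case/andP: q01 => ? ?; case/andP: q'01 => ? ?; rewrite le_max gt_max; apply/andP; split; [apply/orP; left|apply/andP].
apply/eqP; rewrite -subr_eq0 -normc_eq0; apply/eqP.
apply: (@le_geo_eq0 _ (K' + 2 * (K / (1 - q))) (Num.max q q')) => // m.
rewrite ger0_norm ?normc_ge0// (le_trans (normc_triangle (psum a m z) _ _))//.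
rewrite mulrDl lerD//.
  rewrite (le_trans (B' m))// ler_wpM2l// lerXn2r ?nnegrE ?le_max ?lexx ?orbT//.
    by case/andP: q'01.
  by case/andP: q'01 => ->; rewrite orbT.
rewrite normc_dist (le_trans (Hl m))// ler_wpM2l//.
  by rewrite mulr_ge0// divr_ge0// subr_ge0 ltW//; case/andP: q01.
by rewrite lerXn2r ?nnegrE ?le_max ?lexx//; case/andP: q01 => ->.
Qed.

Lemma has_ps_eq a f g : (forall z, normc z < 1 -> f z = g z) -> has_ps a f -> has_ps a g.
Proof.
move=> fg H r r01; have [K [q [K0 q01 B]]] := H r r01; exists K, q; split => // z zr n.
by rewrite -fg ?B// (le_lt_trans zr)//; case/andP: r01.
Qed.

Definition dcoef a k := k.+1%:R * a k.+1.

Lemma dcoef_geo a : coef_geo a -> coef_geo (dcoef a).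
Proof.
move=> H r /andP[r0 r1]; pose r' := (r + 1) / 2.
have r'0 : 0 < r' by rewrite /r'; lra.
have r'1 : r' < 1 by rewrite /r'; lra.
have rr' : r <= r' by rewrite /r'; lra.
clearbody r'.
have [|K [q [K0 q01 B]]] := H r'; first by rewrite ltW.
have [C [y [C0 y01 L]]] := sqr_geo q01.
have /andP[q0 q1] := q01; have /andP[y0 y1] := y01.
exists (K * C / r'), y; split; rewrite ?divr_ge0 ?mulr_ge0 ?(ltW y0) ?(ltW r'0)// => n.
rewrite /dcoef normcM normc_nat -(ler_pM2r r'0) (_ : K * C / r' * y ^+ n * r' = K * C * y ^+ n); last by field; rewrite lt0r_neq0.
have := B n.+1; have := L n.+1 => {}L {}B.
have n0 : 0 <= n.+1%:R :> R by [].
apply: (@le_trans _ _ (n.+1%:R * (normc (a n.+1) * r' ^+ n.+1))).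
  rewrite -!mulrA ler_wpM2l// exprSr ler_wpM2l ?normc_ge0// ler_wpM2r ?(ltW r'0)//.
  by rewrite lerXn2r// nnegrE// ltW.
rewrite (le_trans (ler_wpM2l n0 B))// mulrCA -mulrA ler_wpM2l//.
apply: (@le_trans _ _ (n.+1%:R ^+ 2 * q ^+ n.+1)).
  rewrite ler_wpM2r ?exprn_ge0// expr2 ler_pMr ?ltr0Sn// ler1n//.
rewrite (le_trans L)// ler_wpM2l// exprS ler_piMl ?exprn_ge0 ?ltW//.
Qed.

(** A second order Taylor estimate for monomials. The factor [s ^+ 2] stands on the left so that the
    exponent [n - 2] never occurs. *)
Lemma expr_taylor (z w : R[i]) (s : R) n : 0 <= s -> normc z <= s -> normc w <= s ->
  normc (w ^+ n - z ^+ n - n%:R * z ^+ n.-1 * (w - z)) * s ^+ 2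
    <= n%:R ^+ 2 * s ^+ n * normc (w - z) ^+ 2.
Proof.
move=> s0 zs ws; elim: n => [|n IH].
  by rewrite !expr0 subrr !mul0r subrr normc0 expr0n !mul0r.
have -> : w ^+ n.+1 - z ^+ n.+1 - n.+1%:R * z ^+ n.+1.-1 * (w - z) =
  w * (w ^+ n - z ^+ n - n%:R * z ^+ n.-1 * (w - z)) + n%:R * z ^+ n.-1 * (w - z) ^+ 2.
  rewrite !exprS -natr1 /=; case: n {IH} => [|n]; first by rewrite !expr0; ring.
  by rewrite /= !exprS; ring.
apply: (@le_trans _ _ ((normc w * normc (w ^+ n - z ^+ n - n%:R * z ^+ n.-1 * (w - z))
   + n%:R * normc z ^+ n.-1 * normc (w - z) ^+ 2) * s ^+ 2)).
  rewrite ler_wpM2r ?sqr_ge0// (le_trans (ler_normcD _ _))// !normcM !normcX normc_nat.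
  by rewrite lerD// ler_wpM2l// ?mulr_ge0 ?exprn_ge0 ?normc_ge0// expr2 normcM expr2.
rewrite mulrDl.
apply: (@le_trans _ _ (s * (n%:R ^+ 2 * s ^+ n * normc (w - z) ^+ 2)
   + n%:R * s ^+ n.+1 * normc (w - z) ^+ 2)).
  apply: lerD.
    by rewrite -mulrA ler_pM ?normc_ge0// mulr_ge0 ?sqr_ge0 ?normc_ge0.
  case: n {IH} => [|n]; first by rewrite !mul0r.
  rewrite /= mulrAC ler_wpM2r ?sqr_ge0// -mulrA ler_wpM2l//.
  rewrite -[in leRHS]addn2 exprD ler_wpM2r ?sqr_ge0// lerXn2r ?nnegrE ?normc_ge0//.
have -> : s * (n%:R ^+ 2 * s ^+ n * normc (w - z) ^+ 2) + n%:R * s ^+ n.+1 * normc (w - z) ^+ 2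
   = (n%:R ^+ 2 + n%:R) * (s ^+ n.+1 * normc (w - z) ^+ 2) by rewrite (exprS s n); ring.
rewrite -mulrA ler_wpM2r ?mulr_ge0 ?exprn_ge0 ?normc_ge0//.
by rewrite -natr1 sqrrD expr1n mulr1 mulr2n; have : 0 <= n%:R :> R by []; lra.
Qed.

Lemma psum_sub a n z w s : psum a n.+1 w - psum a n.+1 z - psum (dcoef a) n z * s =
  \sum_(k < n.+1) a k * (w ^+ k - z ^+ k - k%:R * z ^+ k.-1 * s).
Proof.
have -> : psum (dcoef a) n z = \sum_(k < n.+1) a k * (k%:R * z ^+ k.-1).
  rewrite big_ord_recl mul0r mulr0 add0r; apply: eq_bigr => i _.
  by rewrite lift0 /dcoef /= mulrA; congr (_ * _); rewrite mulrC.
rewrite /psum mulr_suml -!sumrB; apply: eq_bigr => i _; ring.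
Qed.

(** The second order remainders of the partial sums are bounded by [D |w - z|^2] with [D]
    independent of the degree. The bound therefore survives the limit, and a quadratic remainder
    gives the derivative. *)
Lemma has_ps_deriv a f : has_ps a f -> exists2 g, has_ps (dcoef a) g &
  forall z, normc z < 1 -> cderiv f z (g z).
Proof.
move=> F; have A := has_ps_coef F.
have [g G] := has_ps_exists (dcoef_geo A); exists g => // z z1 e e0.
pose s := (normc z + 1) / 2.
have z0 := normc_ge0 z.
have s0 : 0 < s by rewrite /s; lra.
have s1 : s < 1 by rewrite /s; lra.
have zs : normc z < s by rewrite /s; lra.
clearbody s.
have s01 : 0 <= s < 1 by rewrite ltW.
have [K [q [K0 q01 B]]] := A s s01.
have [C [y [C0 y01 L]]] := sqr_geo q01.
have /andP[q0 q1] := q01; have /andP[y0 y1] := y01.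
pose D := K * C / (1 - y) / s ^+ 2.
have D0 : 0 <= D.
  by rewrite /D divr_ge0 ?exprn_ge0 ?(ltW s0)// divr_ge0 ?subr_ge0 ?(ltW y1)// mulr_ge0.
have key w : normc w <= s -> normc (f w - f z - g z * (w - z)) <= D * normc (w - z) ^+ 2.
  move=> ws.
  have part n : normc (psum a n.+1 w - psum a n.+1 z - psum (dcoef a) n z * (w - z))
      <= D * normc (w - z) ^+ 2.
    rewrite psum_sub (le_trans (ler_normc_sum _ _ _))//.
    rewrite -(ler_pM2r (exprn_gt0 2 s0)) mulr_suml.
    have -> : D * normc (w - z) ^+ 2 * s ^+ 2 = K * C / (1 - y) * normc (w - z) ^+ 2.
      by rewrite /D; field; rewrite !lt0r_neq0 ?subr_gt0.
    apply: (@le_trans _ _ (\sum_(k < n.+1) K * C * y ^+ k * normc (w - z) ^+ 2)).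
      apply: ler_sum => k _; rewrite normcM -[leLHS]mulrA.
      apply: (@le_trans _ _ (normc (a k) * (k%:R ^+ 2 * s ^+ k * normc (w - z) ^+ 2))).
        by rewrite ler_wpM2l ?normc_ge0// expr_taylor// ltW.
      rewrite (_ : _ * (_ * _ * _) = k%:R ^+ 2 * (normc (a k) * s ^+ k) * normc (w - z) ^+ 2); last by ring.
      rewrite ler_wpM2r ?sqr_ge0// (le_trans (ler_wpM2l (sqr_ge0 _) (B k)))//.
      by rewrite mulrCA -[leRHS]mulrA ler_wpM2l.
    rewrite -mulr_suml -mulr_sumr ler_wpM2r ?sqr_ge0// ler_wpM2l ?mulr_ge0//.
    rewrite -(big_mkord predT (fun k => y ^+ k)).
    have := @geo_sum_le y 0 n.+1; rewrite expr0 mulr1; apply => //.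
    by rewrite ltW.
  apply/ler_addgt0Pl => d d0.
  have [K1 [q1' [K10 q101 B1]]] := F s s01.
  have [K2 [q2' [K20 q201 B2]]] := G s s01.
  have d4 : 0 < d / 4 by rewrite divr_gt0.
  have [N1 H1] := @geo_small K1 q1' _ q101 d4.
  have [N2 H2] := @geo_small (K2 * normc (w - z)) q2' _ q201 d4.
  pose n := maxn N1 N2.
  have {}H1 : K1 * q1' ^+ n.+1 < d / 4 by apply: H1; rewrite ltnW// ltnS leq_maxl.
  have {}H2 : K2 * normc (w - z) * q2' ^+ n < d / 4 by apply: H2; rewrite leq_maxr.
  have {}B2 := B2 z (ltW zs) n.
  have B3 := B1 z (ltW zs) n.+1.
  have {}B1 := B1 w ws n.+1.
  have P := part n.
  have -> : f w - f z - g z * (w - z) = (f w - psum a n.+1 w) - (f z - psum a n.+1 z)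
     - (g z - psum (dcoef a) n z) * (w - z)
     + (psum a n.+1 w - psum a n.+1 z - psum (dcoef a) n z * (w - z)) by ring.
  have B4 : normc ((g z - psum (dcoef a) n z) * (w - z)) <= d / 4.
    by rewrite normcM (le_trans (ler_wpM2r (normc_ge0 _) B2))// mulrAC ltW.
  have T1 := ler_normcD (f w - psum a n.+1 w - (f z - psum a n.+1 z)
     - (g z - psum (dcoef a) n z) * (w - z)) (psum a n.+1 w - psum a n.+1 z - psum (dcoef a) n z * (w - z)).
  have T2 := ler_normcB (f w - psum a n.+1 w - (f z - psum a n.+1 z)) ((g z - psum (dcoef a) n z) * (w - z)).
  have T3 := ler_normcB (f w - psum a n.+1 w) (f z - psum a n.+1 z).
  rewrite (le_trans T1)// lerD//.
  rewrite (le_trans T2)// (le_trans (lerD T3 B4))//.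
  move: B1 B3 H1 d0; clear; set u := normc _; set v := normc _; set k := K1 * _; lra.
exists (Num.min (s - normc z) (e / (D + 1))) => [|w].
  by rewrite lt_min subr_gt0 zs divr_gt0// ltr_wpDl.
rewrite lt_min => /andP[w1 w2].
have ws : normc w <= s.
  have -> : w = (w - z) + z by ring.
  by rewrite (le_trans (ler_normcD _ _))// -lerBrDr ltW.
rewrite (le_trans (key w ws))// expr2 mulrA ler_wpM2r ?normc_ge0//.
have D1 : D <= D + 1 by rewrite lerDl.
rewrite (le_trans (ler_wpM2r (normc_ge0 _) D1))//.
by rewrite mulrC -ler_pdivlMr ?ltW// ltr_wpDl.
Qed.

End PowerSeries.

(** * Means over the circle *)

Section Averages.
Variable R : realType.
Implicit Types (u v : R -> R[i]) (f g : R -> R) (r K : R) (n : nat).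

Lemma twopi_gt0 : 0 < 2 * pi :> R.
Proof. by rewrite mulr_gt0// pi_gt0. Qed.
Let tp := twopi_gt0.
Let tp0 : 0 <= 2 * pi :> R := ltW twopi_gt0.

Definition avg f : R := (2 * pi)^-1 * rint 0 (2 * pi) f.
Definition cavg u : R[i] := ((2 * pi)^-1)%:C * cint 0 (2 * pi) u.

Lemma avgD f g : continuous f -> continuous g ->
  avg (fun t => f t + g t) = avg f + avg g.
Proof. by move=> F G; rewrite /avg rintD// mulrDr. Qed.

Lemma avgB f g : continuous f -> continuous g ->
  avg (fun t => f t - g t) = avg f - avg g.
Proof. by move=> F G; rewrite /avg rintB// mulrBr. Qed.

Lemma avgZ r f : continuous f -> avg (fun t => r * f t) = r * avg f.
Proof. by move=> F; rewrite /avg rintZ// mulrCA. Qed.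

Lemma avg_cst r : avg (fun=> r) = r.
Proof. by rewrite /avg rint_cst// subr0 mulrCA mulVf ?mulr1// lt0r_neq0. Qed.

Lemma eq_avg f g : (forall t, f t = g t) -> avg f = avg g.
Proof. by move=> fg; congr (_ * _); apply: eq_rint => t _. Qed.

Lemma le_avg f g : continuous f -> continuous g -> (forall t, f t <= g t) -> avg f <= avg g.
Proof.
by move=> F G H; rewrite /avg ler_wpM2l ?invr_ge0// le_rint.
Qed.

Lemma avg_ge0 f : (forall t, 0 <= f t) -> 0 <= avg f.
Proof. by move=> H; rewrite /avg mulr_ge0 ?invr_ge0// rint_ge0. Qed.

Lemma le_avg_cst f K : continuous f -> (forall t, f t <= K) -> avg f <= K.
Proof.
move=> F H; rewrite -[leRHS]avg_cst le_avg// => t; exact: cst_continuous.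
Qed.

Lemma cavgD u v : ccont u -> ccont v -> cavg (fun t => u t + v t) = cavg u + cavg v.
Proof. by move=> U V; rewrite /cavg cintD// mulrDr. Qed.

Lemma cavgB u v : ccont u -> ccont v -> cavg (fun t => u t - v t) = cavg u - cavg v.
Proof. by move=> U V; rewrite /cavg cintB// mulrBr. Qed.

Lemma cavgZ k u : ccont u -> cavg (fun t => k * u t) = k * cavg u.
Proof. by move=> U; rewrite /cavg cintZ// mulrCA. Qed.

Lemma cavgJ u : ccont u -> cavg (fun t => Num.conj (u t)) = Num.conj (cavg u).
Proof.
move=> U; rewrite /cavg cintJ// rmorphM; congr (_ * _).
by apply: complex_ext; rewrite !ReImE /= ?oppr0.
Qed.

Lemma eq_cavg u v : (forall t, u t = v t) -> cavg u = cavg v.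
Proof. by move=> uv; congr (_ * _); apply: eq_cint => t _. Qed.

Lemma cavg_cst k : cavg (fun=> k) = k.
Proof.
rewrite /cavg cint_cst// subr0 mulrA -rmorphM mulVf ?lt0r_neq0//.
by rewrite rmorph1 mul1r.
Qed.

Lemma cavg_sum (I : Type) (s : seq I) (F : I -> R -> R[i]) : (forall i, ccont (F i)) ->
  cavg (fun t => \sum_(i <- s) F i t) = \sum_(i <- s) cavg (F i).
Proof. by move=> H; rewrite /cavg cint_sum// mulr_sumr. Qed.

Lemma Re_cavg u : complex.Re (cavg u) = avg (fun t => complex.Re (u t)).
Proof. by rewrite /cavg ReImE /= mul0r subr0. Qed.

Lemma Im_cavg u : complex.Im (cavg u) = avg (fun t => complex.Im (u t)).
Proof. by rewrite /cavg ReImE /= mul0r addr0. Qed.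

Lemma normc_cavg u : ccont u -> normc (cavg u) <= avg (fun t => normc (u t)).
Proof.
move=> U; rewrite /cavg normcM normcR ger0_norm ?invr_ge0//.
by rewrite ler_wpM2l ?invr_ge0// normc_cint.
Qed.

Lemma cavg_bound u K : ccont u -> (forall t, normc (u t) <= K) -> normc (cavg u) <= K.
Proof.
move=> U H; rewrite (le_trans (normc_cavg U))// le_avg_cst//; exact: ccont_norm.
Qed.

Lemma is_derive_mull (k x : R) : is_derive x 1 (fun t => k * t) k.
Proof.
apply: eps_derive => e e0; exists 1 => // h _.
by rewrite (_ : _ - _ = 0) ?normr0 ?mulr_ge0 ?(ltW e0)//; ring.
Qed.

Lemma is_derive_mulcomp (g : R -> R) (k x l : R) : is_derive (k * x) 1 g l ->
  is_derive x 1 (fun t => g (k * t)) (l * k).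
Proof.
move=> G; exact: (@is_derive1_comp _ g (fun t => k * t) x l k G (is_derive_mull k x)).
Qed.

Lemma is_derive_lmul (g : R -> R) (k x l : R) : is_derive x 1 g l ->
  is_derive x 1 (fun t => k * g t) (k * l).
Proof.
move=> G; exact: (@is_derive1_comp _ (fun t => k * t) g x k l (is_derive_mull k (g x)) G).
Qed.

Lemma cavg_expi n : cavg (fun t => expi t ^+ n) = (n == 0%N)%:R.
Proof.
case: n => [|n]; first by rewrite -[RHS]cavg_cst; apply: eq_cavg => t; rewrite expr0.
pose m : R := n.+1%:R; have m0 : m != 0 by rewrite pnatr_eq0.
pose v (t : R) := (m^-1 * sin (m * t)) +i* (m^-1 * - cos (m * t)).
have -> : cavg (fun t => expi t ^+ n.+1) = ((2 * pi)^-1)%:C * (v (2 * pi) - v 0).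
  congr (_ * _); apply: cint_FTC2 => //; first exact/ccontX/ccont_expi.
    move=> t /=; rewrite (_ : complex.Re _ = m^-1 * (cos (m * t) * m)).
      by apply: is_derive_lmul; apply: is_derive_mulcomp; exact: is_derive_sin.
    by rewrite -expi_nat mulr_natl /= mulrCA mulVf ?mulr1.
  move=> t /=; rewrite (_ : complex.Im _ = m^-1 * (sin (m * t) * m)).
    apply: is_derive_lmul.
    apply: (@is_derive_mulcomp (fun t => - cos t)).
    rewrite -[sin _]opprK; exact: is_deriveN.
  by rewrite -expi_nat mulr_natl /= mulrCA mulVf ?mulr1.
have E (t : R) : m * t = t *+ n.+1 by rewrite mulr_natl.
have H := expi_nat (2 * pi : R) n.+1; rewrite expi2pi expr1n in H.
have [H1 H2] : cos (m * (2 * pi)) = 1 /\ sin (m * (2 * pi)) = 0.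
  by rewrite E; case: H => -> ->.
by rewrite (_ : v (2 * pi) = v 0) ?subrr ?mulr0// /v H1 H2 !mulr0 cos0 sin0 mulr0.
Qed.

Lemma cavg_expiJ n : cavg (fun t => Num.conj (expi t) ^+ n) = (n == 0%N)%:R.
Proof.
transitivity (cavg (fun t => Num.conj (expi t ^+ n))).
  by apply: eq_cavg => t; rewrite rmorphXn.
by rewrite cavgJ; [rewrite cavg_expi rmorph_nat|exact/ccontX/ccont_expi].
Qed.

End Averages.

(** * Fourier coefficients of holomorphic functions *)

Section CircleFourier.
Variable R : realType.
Implicit Types (r x y : R) (z : R[i]) (f : R[i] -> R[i]).

Definition holo f := forall z, normc z < 1 -> exists l, cderiv f z l.

Lemma ccont_circle f r : holo f -> 0 <= r < 1 -> ccont (fun t => f (r%:C * expi t)).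
Proof.
move=> F /andP[r0 r1]; apply: ccont_deriv => [|t].
  by apply: ccontM; [exact: ccont_cst|exact: ccont_expi].
by apply: F; rewrite normc_circle.
Qed.

Lemma cexp_log r t : 0 < r -> cexp (ln r +i* t) = r%:C * expi t.
Proof. by move=> r0; rewrite /cexp /= lnK. Qed.

(* Goursat on a rectangle of the half-plane [Re w < 0] after the substitution
   [z = exp w]; the two horizontal sides cancel by periodicity. *)
Lemma circle_mean_const f (m : R[i]) x1 x2 : holo f -> x1 < 0 -> x2 < 0 ->
  (forall w, cexp (m * (w + (0 +i* (2 * pi)))) = cexp (m * w)) ->
  cavg (fun t => f (cexp (x1 +i* t)) * cexp (m * (x1 +i* t))) =
  cavg (fun t => f (cexp (x2 +i* t)) * cexp (m * (x2 +i* t))).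
Proof.
move=> F.
wlog : x1 x2 / x1 < x2 => [W x10 x20 H|].
  by have [x12|x21|->//] := ltgtP x1 x2; [exact: W|symmetry; exact: W].
move=> x12 x10 x20 mP.
pose X := x2; pose H (w : R[i]) := f (cexp w) * cexp (m * w).
pose G x y := H (Num.min x X +i* y).
have HD w : complex.Re w < 0 -> exists l, cderiv H w l.
  move=> w0; have [l fl] : exists l, cderiv f (cexp w) l.
    by apply: F; rewrite normc_cexp -expR0 ltr_expR.
  eexists; apply: cderivM; first by apply: cderiv_comp fl; exact: cexp_derive.
  apply: cderiv_comp; last exact: cexp_derive.
  exact/cderivZ/cderiv_id.
have X0 x : Num.min x X < 0 by rewrite gt_min x20 orbT.
have Gx y : ccont (G^~ y).
  apply: (@ccont_deriv _ H (fun x => Num.min x X +i* y)) => [|t]; last by apply: HD; exact: X0.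
  apply/ccontP; split => /= t; last exact: cst_continuous.
  by apply: continuous_min; [exact: cvg_id|exact: cst_continuous].
have Gy x : ccont (G x).
  apply: (@ccont_deriv _ H (fun y => Num.min x X +i* y)) => [|t]; last by apply: HD; exact: X0.
  by apply/ccontP; split => /= t; [exact: cst_continuous|exact: cvg_id].
have GD x y : x <= X -> rect_diff G X x y.
  move=> xX; have [|l Hl] := HD (x +i* y); first by rewrite /= (le_lt_trans xX).
  exists (H (x +i* y)), l => e /Hl[d d0 K]; exists d => // s t sX std.
  have E : (s - x) +i* (t - y) = (s +i* t) - (x +i* y) by apply: complex_ext; rewrite !ReImE.
  by rewrite E /G (min_idPl sX) K// -E.
have := @goursat R G X Gx Gy GD x1 0 (x2 - x1) (2 * pi).
rewrite subr_gt0 x12 twopi_gt0 addrC subrK lexx => /(_ isT isT isT).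
rewrite /rect_int.
have -> : cint x1 (x1 + (x2 - x1)) (fun s => G s 0 - G s (0 + 2 * pi)) = 0.
  rewrite addrC subrK (@eq_cint _ _ _ _ (fun=> 0)) ?cint_cst ?mulr0 ?(ltW x12)// => t _.
  rewrite /G /H; set a := Num.min _ _.
  have -> : a +i* (0 + 2 * pi) = a%:C + (0 +i* (2 * pi)) by apply: complex_ext; rewrite !ReImE /= ?addr0 ?add0r.
  rewrite mP cexpD (_ : cexp ((0 +i* (2 * pi))) = 1) ?mulr1 ?subrr//.
  by rewrite /cexp /= expR0 expi2pi mulr1.
have i0 : ('i%C : R[i]) != 0 by rewrite eq_complex /= oner_eq0 andbF.
rewrite !add0r => /eqP; rewrite mulf_eq0 (negPf i0) orFb (addrC x1) subrK.
rewrite (cintB _ _ (Gy _) (Gy _)) subr_eq0 => /eqP E.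
rewrite /cavg; congr (_ * _); symmetry.
have := E; rewrite /G minxx (min_idPl (ltW x12)) => E'; exact: E'.
Qed.

Lemma circle_coef_const f n r1 r2 : holo f -> 0 < r1 < 1 -> 0 < r2 < 1 ->
  cavg (fun t => f (r1%:C * expi t) / (r1%:C * expi t) ^+ n) =
  cavg (fun t => f (r2%:C * expi t) / (r2%:C * expi t) ^+ n).
Proof.
move=> F /andP[r10 r11] /andP[r20 r21].
have l1 : ln r1 < 0 by apply: ln_lt0; rewrite r10.
have l2 : ln r2 < 0 by apply: ln_lt0; rewrite r20.
have := @circle_mean_const f (- n%:R) (ln r1) (ln r2) F l1 l2.
have P (w : R[i]) : cexp (- n%:R * w) = (cexp w ^+ n)^-1.
  rewrite mulNr cexpN; congr (_^-1); elim: n => [|n IH]; first by rewrite mul0r cexp0 expr0.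
  by rewrite -natr1 mulrDl mul1r cexpD IH exprSr.
have Q (w : R[i]) : cexp (- n%:R * (w + (0 +i* (2 * pi)))) = cexp (- n%:R * w).
  by rewrite !P cexpD (_ : cexp ((0 +i* (2 * pi))) = 1) ?mulr1// /cexp /= expR0 expi2pi mulr1.
move=> /(_ Q).
under eq_cavg do rewrite P cexp_log//.
by under [X in _ = X -> _]eq_cavg do rewrite P cexp_log//.
Qed.

Lemma circle_coef_pos_const f n r1 r2 : holo f -> 0 < r1 < 1 -> 0 < r2 < 1 ->
  cavg (fun t => f (r1%:C * expi t) * (r1%:C * expi t) ^+ n) =
  cavg (fun t => f (r2%:C * expi t) * (r2%:C * expi t) ^+ n).
Proof.
move=> F /andP[r10 r11] /andP[r20 r21].
have l1 : ln r1 < 0 by apply: ln_lt0; rewrite r10.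
have l2 : ln r2 < 0 by apply: ln_lt0; rewrite r20.
have := @circle_mean_const f n%:R (ln r1) (ln r2) F l1 l2.
have P (w : R[i]) : cexp (n%:R * w) = cexp w ^+ n.
  elim: n => [|n IH]; first by rewrite mul0r cexp0 expr0.
  by rewrite -natr1 mulrDl mul1r cexpD IH exprSr.
have Q (w : R[i]) : cexp (n%:R * (w + (0 +i* (2 * pi)))) = cexp (n%:R * w).
  by rewrite !P cexpD (_ : cexp ((0 +i* (2 * pi))) = 1) ?mulr1// /cexp /= expR0 expi2pi mulr1.
move=> /(_ Q).
under eq_cavg do rewrite P cexp_log//.
by under [X in _ = X -> _]eq_cavg do rewrite P cexp_log//.
Qed.

(** The mean does not depend on the radius, and for a small radius the integrand is at most a
    constant times the radius. *)
Lemma circle_coef_pos0 f n r : holo f -> 0 < r < 1 -> (0 < n)%N ->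
  cavg (fun t => f (r%:C * expi t) * (r%:C * expi t) ^+ n) = 0.
Proof.
move=> F r01 n0; apply/eqP; rewrite -normc_eq0 eq_le normc_ge0 andbT.
have [|l Fl] := F 0; first by rewrite normc0.
have [d d0 K] := cderiv_lip Fl.
pose B := normc (f 0) + (1 + normc l).
have B0 : 0 < B by rewrite /B addrA ltr_wpDr ?normc_ge0// ltr_wpDl ?normc_ge0.
apply/ler_addgt0Pl => e e0; rewrite addr0.
pose s := Num.min (Num.min (d / 2) (1 / 2)) (e / B).
have s0 : 0 < s by rewrite !lt_min !divr_gt0.
have sd : s < d by rewrite !gt_min ltr_pdivrMr// ltr_pMr// ltr1n.
have h12 : (1 / 2 : R) < 1 by lra.
have s1 : s < 1 by rewrite !gt_min h12 orbT.
have sB : s * B <= e by rewrite -ler_pdivlMr// ge_min lexx orbT.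
clearbody s.
rewrite (@circle_coef_pos_const _ _ r s) ?s0//.
apply: cavg_bound => [|t].
  apply: ccontM; first by apply: ccont_circle => //; rewrite ltW.
  by apply: ccontX; apply: ccontM; [exact: ccont_cst|exact: ccont_expi].
rewrite normcM normcX normc_circle ?(ltW s0)//.
have N : normc (s%:C * expi t - 0) < d by rewrite subr0 normc_circle ?(ltW s0).
apply: le_trans sB; rewrite mulrC; apply: ler_pM; rewrite ?exprn_ge0 ?normc_ge0 ?(ltW s0)//.
  by rewrite -[leRHS]expr1 ler_wiXn2l ?(ltW s0) ?(ltW s1).
rewrite -(subrK (f 0) (f _)) (le_trans (ler_normcD _ _))// /B addrC lerD2l.
rewrite (le_trans (K _ N))// subr0 normc_circle ?(ltW s0)//.
by rewrite ler_piMr ?(ltW s1)// addr_ge0 ?normc_ge0.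
Qed.

(** The radius one half is an arbitrary choice; [fcoefE] transfers the coefficient to every other
    circle. *)
Definition fcoef f n := cavg (fun t => f ((2^-1)%:C * expi t) / ((2^-1)%:C * expi t) ^+ n).

Lemma fcoefE f n r : holo f -> 0 < r < 1 ->
  cavg (fun t => f (r%:C * expi t) * Num.conj (expi t) ^+ n) = (r ^+ n)%:C * fcoef f n.
Proof.
move=> F r01; have /andP[r0 r1] := r01.
rewrite /fcoef (@circle_coef_const _ _ 2^-1 r)//; last first.
  by rewrite invr_gt0 ltr0n invf_lt1 ?ltr1n ?ltr0n.
have rn : (r ^+ n)%:C != 0 :> R[i].
  by rewrite -normc_gt0 normcR normr_gt0 expf_neq0// lt0r_neq0.
have C : ccont (fun t => f (r%:C * expi t) * Num.conj (expi t) ^+ n).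
  apply: ccontM; first by apply: ccont_circle => //; rewrite ltW.
  by apply/ccontX/ccontJ/ccont_expi.
transitivity ((r ^+ n)%:C * ((r ^+ n)%:C^-1 * cavg (fun t => f (r%:C * expi t) * Num.conj (expi t) ^+ n))).
  by rewrite mulrA divff// mul1r.
congr (_ * _); rewrite -cavgZ//; apply: eq_cavg => t.
rewrite exprMn invfM rmorphXn -expiN -expiV exprVn mulrCA; congr (_ * _).
Qed.

Lemma fcoef_neg f n r : holo f -> 0 < r < 1 -> (0 < n)%N ->
  cavg (fun t => f (r%:C * expi t) * expi t ^+ n) = 0.
Proof.
move=> F r01 n0; have /andP[r0 r1] := r01.
have rn : (r ^+ n)%:C != 0 :> R[i].
  by rewrite -normc_gt0 normcR normr_gt0 expf_neq0// lt0r_neq0.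
apply: (mulfI rn); rewrite mulr0 -(circle_coef_pos0 F r01 n0) -cavgZ.
  by apply: eq_cavg => t; rewrite exprMn rmorphXn; ring.
apply: ccontM; first by apply: ccont_circle => //; rewrite ltW.
by apply/ccontX/ccont_expi.
Qed.

(** Cauchy's estimate on a slightly larger circle of radius [s], whence the ratio [r / s]. *)
Lemma fcoef_geo f : holo f -> coef_geo (fcoef f).
Proof.
move=> F r /andP[r0 r1]; pose s := (r + 1) / 2.
have s0 : 0 < s by rewrite /s; lra.
have s1 : s < 1 by rewrite /s; lra.
have rs : r < s by rewrite /s; lra.
clearbody s.
have s01 : 0 < s < 1 by rewrite s0.
have C : ccont (fun t => f (s%:C * expi t)) by apply: ccont_circle => //; rewrite ltW.
exists (avg (fun t => normc (f (s%:C * expi t)))), (r / s); split.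
- by apply: avg_ge0 => t; exact: normc_ge0.
- by rewrite divr_ge0 ?(ltW s0)//= ltr_pdivrMr// mul1r.
move=> n; rewrite expr_div_n mulrA ler_pdivlMr ?exprn_gt0// mulrAC ler_wpM2r ?exprn_ge0//.
have -> : normc (fcoef f n) * s ^+ n = normc ((s ^+ n)%:C * fcoef f n).
  have sn : 0 <= s ^+ n by rewrite exprn_ge0// ltW.
  by rewrite [RHS]normcM normcR ger0_norm// mulrC.
rewrite -fcoefE// (le_trans (normc_cavg _))//.
  by apply: ccontM => //; exact/ccontX/ccontJ/ccont_expi.
rewrite le_eqVlt; apply/orP; left; apply/eqP/eq_avg => t.
by rewrite normcM normcX normcJ normc_expi expr1n mulr1.
Qed.

End CircleFourier.

(** * Powers of a peak function *)

Section Concentration.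
Variable R : realType.
Let mu := @lebesgue_measure R.
Implicit Types (D : set (measurableTypeR R)) (K v : R -> R).

Lemma integrable_realZ D (k : R) v : measurable D -> mu.-integrable D (EFin \o v) ->
  mu.-integrable D (EFin \o (fun t => k * v t)).
Proof.
move=> mD iv; have H := integrableZl mD k iv.
have E := eq_integrable mD _ (EFin \o (fun t => k * v t)) _ H.
by apply: E => t _; rewrite /= EFinM.
Qed.

Lemma integrable_realN D v : measurable D -> mu.-integrable D (EFin \o v) ->
  mu.-integrable D (EFin \o (fun t => - v t)).
Proof.
move=> mD iv; have H := integrableN iv.
have E := eq_integrable mD _ (EFin \o (fun t => - v t)) _ H.
by apply: E => t _; rewrite /= EFinN.
Qed.

(** Laplace's method: if [v t0 > 0], an interval about [t0] on which [K >= q'] contributes at least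
    a constant times [q' ^+ N], while the part away from [t0] contributes at least [- V * q ^+ N]
    with [q < q']. For large [N] the integral cannot vanish. This serves both the circle and the
    half-line. *)
Lemma concentration_gt0 D K v (t0 : R) : measurable D ->
  mu.-integrable D (EFin \o v) ->
  (forall N, mu.-integrable D (EFin \o (fun t => K t ^+ N * v t))) ->
  (forall N, \int[mu]_(t in D) (K t ^+ N * v t) = 0) ->
  (forall t, D t -> 0 <= K t) -> K t0 = 1 ->
  {for t0, continuous K} -> {for t0, continuous v} ->
  (exists2 d, 0 < d & forall t, `|t - t0| < d -> D t) ->
  (forall d, 0 < d -> exists q, [/\ 0 <= q, q < 1 & forall t, D t -> d <= `|t - t0| -> K t <= q]) ->
  0 < v t0 -> False.
Proof.
move=> mD iv iK I0 K0 K1 /cont_epsP cK /cont_epsP cv [d d0 dD] peak v0.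
pose c := v t0 / 2; have c0 : 0 < c by rewrite divr_gt0.
have [d1 d10 H1] := cv _ c0.
pose dl := Num.min d d1; have dl0 : 0 < dl by rewrite lt_min d0.
have [q [q0 q1 Hq]] := peak _ dl0.
pose q' := (1 + q) / 2.
have q'q : q < q' by rewrite /q'; lra.
have q'1 : q' < 1 by rewrite /q'; lra.
have q'0 : 0 < q' by rewrite (le_lt_trans q0).
have q'2 : 0 < 1 - q' by rewrite subr_gt0.
have [d2 d20 H2] := cK _ q'2.
clearbody q'.
pose eta := Num.min dl d2 / 2.
have eta0 : 0 < eta by rewrite divr_gt0// lt_min dl0.
have eta_lt : eta < Num.min dl d2 by rewrite /eta ltr_pdivrMr// ltr_pMr ?ltr1n// lt_min dl0.
have [e1 e2] : eta < dl /\ eta < d2 by move: eta_lt; rewrite lt_min => /andP[].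
pose J := `[t0 - eta, t0 + eta]%classic.
have Jt t : J t -> `|t - t0| <= eta.
  by rewrite /J /= in_itv /= => /andP[a b]; rewrite ler_norml; lra.
have JD : J `<=` D.
  by move=> t /Jt h; apply: dD; rewrite (le_lt_trans h)// (lt_le_trans e1)// ge_min lexx.
have mJ : measurable J by exact: measurable_itv.
have mDJ : measurable (D `\` J) by exact: measurableD.
have iS f (A : set (measurableTypeR R)) : measurable A -> A `<=` D -> mu.-integrable D (EFin \o f) ->
    mu.-integrable A (EFin \o f).
  by move=> mA AD; exact: integrableS.
have DJD : D `\` J `<=` D by exact: subDsetl.
pose V := \int[mu]_(t in D `\` J) `|v t|.
have key N : q' ^+ N * (c * (2 * eta)) <= V * q ^+ N.
  have := I0 N; rewrite -(setDUK JD) Rintegral_setU//; last 2 first.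
  - by rewrite setDUK.
  - by apply/disj_set2P; rewrite setDE setICA setICr setI0.
  have L1 : q' ^+ N * (c * (2 * eta)) <= \int[mu]_(t in J) (K t ^+ N * v t).
    have -> : q' ^+ N * (c * (2 * eta)) = \int[mu]_(t in J) (q' ^+ N * c).
      have := @rint_cst R (t0 - eta) (t0 + eta) (q' ^+ N * c).
      by rewrite /rint -/J => ->; [ring|lra].
    apply: le_Rintegral => //; last 2 first.
    - exact: (iS (fun t => K t ^+ N * v t)).
    - move=> t /Jt tJ.
      have vt : c <= v t.
        have /H1 : `|t - t0| < d1 by rewrite (le_lt_trans tJ)// (lt_le_trans e1)// ge_min lexx orbT.
        by rewrite ltr_norml /c => /andP[a b]; lra.
      have Kt : q' <= K t.
        by have := H2 t (le_lt_trans tJ e2); rewrite K1 ltr_norml => /andP[a b]; lra.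
      by rewrite ler_pM ?exprn_ge0 ?(ltW c0) ?(ltW q'0)// lerXn2r// nnegrE ?(ltW q'0)// (le_trans (ltW q'0)).
    by apply: cont_integrable => t; exact: cst_continuous.
  have L2 : - (V * q ^+ N) <= \int[mu]_(t in D `\` J) (K t ^+ N * v t).
    have iV : mu.-integrable (D `\` J) (EFin \o (fun t => `|v t|)).
      by have := integrable_norm (iS v _ mDJ DJD iv).
    have -> : - (V * q ^+ N) = \int[mu]_(t in D `\` J) ((- q ^+ N) * `|v t|).
      by rewrite RintegralZl// /V; ring.
    apply: le_Rintegral => //; last 2 first.
    - exact: (iS (fun t => K t ^+ N * v t)).
    - move=> t [Dt Jnt]; have [tdl|tdl] := ltP `|t - t0| dl.
        have vt : 0 <= v t.
          have /H1 : `|t - t0| < d1 by rewrite (lt_le_trans tdl)// ge_min lexx orbT.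
          rewrite ltr_norml => /andP[a b]; move: a; rewrite /c; lra.
        rewrite (@le_trans _ _ 0)// ?mulr_ge0 ?exprn_ge0 ?K0//.
        by rewrite mulNr oppr_le0 mulr_ge0 ?exprn_ge0.
      have Kt := Hq _ Dt tdl; have Kt0 := K0 _ Dt.
      rewrite mulNr lerNl -mulrN (@le_trans _ _ (K t ^+ N * `|v t|))//.
        by rewrite ler_wpM2l ?exprn_ge0// -normrN ler_norm.
      by rewrite ler_wpM2r// lerXn2r// nnegrE.
    exact: integrable_realZ.
  by move=> E; have := lerD L1 L2; rewrite E subr_le0.
have q01 : 0 <= q / q' < 1.
  by rewrite divr_ge0 ?(ltW q'0)//= ltr_pdivrMr// mul1r.
have ce0 : 0 < c * (2 * eta) by apply: mulr_gt0 => //; apply: mulr_gt0.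
have [N /(_ N (leqnn _))] := @geo_small R V (q / q') _ q01 ce0.
rewrite expr_div_n mulrA ltr_pdivrMr ?exprn_gt0// mulrC ltNge => /negP; apply.
by have := key N; rewrite [leLHS]mulrC [leRHS]mulrC.
Qed.

Lemma concentration D K v (t0 : R) : measurable D ->
  mu.-integrable D (EFin \o v) ->
  (forall N, mu.-integrable D (EFin \o (fun t => K t ^+ N * v t))) ->
  (forall N, \int[mu]_(t in D) (K t ^+ N * v t) = 0) ->
  (forall t, D t -> 0 <= K t) -> K t0 = 1 ->
  {for t0, continuous K} -> {for t0, continuous v} ->
  (exists2 d, 0 < d & forall t, `|t - t0| < d -> D t) ->
  (forall d, 0 < d -> exists q, [/\ 0 <= q, q < 1 & forall t, D t -> d <= `|t - t0| -> K t <= q]) ->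
  v t0 = 0.
Proof.
move=> mD iv iK I0 K0 K1 cK cv dD peak.
have [v0|v0|//] := ltgtP (v t0) 0; last first.
  by have := concentration_gt0 mD iv iK I0 K0 K1 cK cv dD peak v0.
have E N : (fun t => K t ^+ N * - v t) = (fun t => - (K t ^+ N * v t)).
  by apply/funext => t; rewrite mulrN.
exfalso; apply: (@concentration_gt0 D K (fun t => - v t) t0) => //.
- exact: integrable_realN.
- by move=> N; rewrite E; exact: integrable_realN.
- move=> N; rewrite E.
  under eq_Rintegral do rewrite -mulN1r.
  by rewrite RintegralZl// I0 mulr0.
- by apply: cvgN; exact: cv.
- by rewrite oppr_gt0.
Qed.

End Concentration.

Opaque rint cint avg cavg.

(** * Uniqueness of Fourier coefficients of continuous functions *)

Section FourierUniqueness.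
Variable R : realType.
Implicit Types (r t : R) (z : R[i]) (f g : R[i] -> R[i]) (h : R -> R[i]).

Lemma realcM (a b : R) : (a * b)%:C = a%:C * b%:C.
Proof. by apply: complex_ext; rewrite !ReImE /= ?mulr0 ?mul0r ?subr0 ?addr0. Qed.

(** A trigonometric polynomial of degree one with values in [[0, 1]], equal to 1 only at [t0] modulo
    [2 pi]. Its powers are again trigonometric polynomials, so vanishing Fourier coefficients
    annihilate them. *)
Definition peak t0 t : R := (1 + cos (t - t0)) / 2.

Lemma continuous_peak t0 : continuous (peak t0).
Proof.
move=> t; apply: cvgM; last exact: cvg_cst.
apply: cvgD; first exact: cvg_cst.
apply: (@continuous_comp _ _ _ (fun t => t - t0) cos); last exact: continuous_cos.
by apply: cvgB; [exact: cvg_id|exact: cvg_cst].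
Qed.

Lemma peakE t0 t : (peak t0 t)%:C = 2^-1 + 4^-1 * (Num.conj (expi t0) * expi t)
   + 4^-1 * (expi t0 * Num.conj (expi t)).
Proof.
have -> : 4^-1 = (4^-1 : R)%:C :> R[i] by rewrite fmorphV rmorph_nat.
have -> : 2^-1 = (2^-1 : R)%:C :> R[i] by rewrite fmorphV rmorph_nat.
by rewrite /peak cosB; apply: complex_ext; rewrite !ReImE /=; field.
Qed.

(** Multiplication by the peak shifts frequencies by at most one, so the induction on [N] has to
    carry all frequencies of both signs. *)
Lemma fourier_peak h t0 : ccont h ->
  (forall n, cavg (fun t => h t * expi t ^+ n) = 0) ->
  (forall n, cavg (fun t => h t * Num.conj (expi t) ^+ n) = 0) ->
  forall N, cavg (fun t => (peak t0 t ^+ N)%:C * h t) = 0.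
Proof.
move=> H Hp Hn N.
have cE n : ccont (fun t : R => expi t ^+ n) by exact/ccontX/ccont_expi.
have cJ n : ccont (fun t : R => Num.conj (expi t) ^+ n) by exact/ccontX/ccontJ/ccont_expi.
have cP N' : ccont (fun t => (peak t0 t ^+ N')%:C).
  apply: ccont_real => t; apply: (@continuous_comp _ _ _ (peak t0) (fun x => x ^+ N')).
    exact: continuous_peak.
  exact: exprn_continuous.
have EJ (t : R) : expi t * Num.conj (expi t) = 1.
  by rewrite mulJ_normc normc_expi expr1n.
suff : forall n, cavg (fun t => (peak t0 t ^+ N)%:C * h t * expi t ^+ n) = 0 /\
    cavg (fun t => (peak t0 t ^+ N)%:C * h t * Num.conj (expi t) ^+ n) = 0.
  by move/(_ 0%N) => [<- _]; apply: eq_cavg => t; rewrite expr0 mulr1.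
elim: N => [|N IH] n.
  by split; [rewrite -[RHS](Hp n)|rewrite -[RHS](Hn n)]; apply: eq_cavg => t; rewrite expr0 mul1r.
pose u t := (peak t0 t ^+ N)%:C * h t.
have cu : ccont u by exact: ccontM.
have S k v : ccont v -> cavg (fun t => k * (u t * v t)) = k * cavg (fun t => u t * v t).
  by move=> V; rewrite cavgZ//; exact: ccontM.
have main v v1 v2 : ccont v -> ccont v1 -> ccont v2 ->
   (forall t, expi t * v t = v1 t) -> (forall t, Num.conj (expi t) * v t = v2 t) ->
   cavg (fun t => u t * v t) = 0 -> cavg (fun t => u t * v1 t) = 0 -> cavg (fun t => u t * v2 t) = 0 ->
   cavg (fun t => (peak t0 t ^+ N.+1)%:C * h t * v t) = 0.
  move=> V V1 V2 E1 E2 A0 A1 A2.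
  transitivity (cavg (fun t => 2^-1 * (u t * v t) + 4^-1 * Num.conj (expi t0) * (u t * v1 t)
     + 4^-1 * expi t0 * (u t * v2 t))).
    apply: eq_cavg => t; rewrite exprS realcM peakE -E1 -E2 /u; ring.
  have cK k w : ccont w -> ccont (fun t => k * (u t * w t)).
    by move=> W; apply: ccontM; [exact: ccont_cst|exact: ccontM].
  rewrite (cavgD (ccontD (cK _ _ V) (cK _ _ V1)) (cK _ _ V2)) (cavgD (cK _ _ V) (cK _ _ V1)).
  by rewrite !S// A0 A1 A2 !mulr0 !addr0.
have IH1 k : cavg (fun t => u t * expi t ^+ k) = 0 := (IH k).1.
have IH2 k : cavg (fun t => u t * Num.conj (expi t) ^+ k) = 0 := (IH k).2.
split.
  (* The frequency [n] lowered by one, which at [n = 0] passes from powers of [expi t] to its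
     conjugate. *)
  pose w m t : R[i] := if m is m'.+1 then expi t ^+ m' else Num.conj (expi t).
  have cw m : ccont (w m) by case: m => [|m]; [exact/ccontJ/ccont_expi|exact: cE].
  apply: (main _ (fun t => expi t ^+ n.+1) (w n) (cE _) (cE _) (cw _)).
  - by move=> t; rewrite exprS.
  - move=> t; rewrite /w; case: n => [|m]; first by rewrite expr0 mulr1.
    by rewrite exprS mulrA [_ * expi t]mulrC EJ mul1r.
  - exact: IH1.
  - exact: IH1.
  - rewrite /w; case: n => [|m]; last exact: IH1.
    by rewrite -[RHS](IH2 1%N); apply: eq_cavg => t; rewrite expr1.
pose w m t : R[i] := if m is m'.+1 then Num.conj (expi t) ^+ m' else expi t.
have cw m : ccont (w m) by case: m => [|m]; [exact/ccont_expi|exact: cJ].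
apply: (main _ (w n) (fun t => Num.conj (expi t) ^+ n.+1) (cJ _) (cw _) (cJ _)).
- move=> t; rewrite /w; case: n => [|m]; first by rewrite expr0 mulr1.
  by rewrite exprS mulrA EJ mul1r.
- by move=> t; rewrite exprS.
- exact: IH2.
- rewrite /w; case: n => [|m]; last exact: IH2.
  by rewrite -[RHS](IH1 1%N); apply: eq_cavg => t; rewrite expr1.
- exact: IH2.
Qed.

Lemma avg_eq0 (u : R -> R) : avg u = 0 -> rint 0 (2 * pi) u = 0.
Proof.
Transparent avg.
by move/eqP; rewrite /avg mulf_eq0 invr_eq0 (negPf (lt0r_neq0 (twopi_gt0 R))) => /eqP.
Qed.
Opaque avg.

(** [concentration] asks for a two-sided neighbourhood of [t0] inside the interval, hence the open
    range; the remaining point of the circle is recovered by continuity in [holo_zero]. *)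
Lemma fourier_unique h t0 : 0 < t0 < 2 * pi -> ccont h ->
  (forall n, cavg (fun t => h t * expi t ^+ n) = 0) ->
  (forall n, cavg (fun t => h t * Num.conj (expi t) ^+ n) = 0) -> h t0 = 0.
Proof.
move=> /andP[t00 t02] H Hp Hn.
have P := fourier_peak t0 H Hp Hn.
have main (v : R -> R) : continuous v ->
  (forall N, rint 0 (2 * pi) (fun t => peak t0 t ^+ N * v t) = 0) -> v t0 = 0.
  move=> cv I0.
  have cP N : continuous (fun t => peak t0 t ^+ N * v t).
    move=> t; apply: cvgM; last exact: cv.
    apply: (@continuous_comp _ _ _ (peak t0) (fun x => x ^+ N)).
      exact: continuous_peak.
    exact: exprn_continuous.
  apply: (@concentration R `[0, 2 * pi] (peak t0) v t0).
  - exact: measurable_itv.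
  - exact: cont_integrable.
  - by move=> N; exact: cont_integrable.
  - exact: I0.
  - by move=> t _; rewrite /peak divr_ge0// -lerBlDl sub0r cos_geN1.
  - by rewrite /peak subrr cos0 -mulr2n -(mulr_natl 1) mulr1 divff.
  - exact: continuous_peak.
  - exact: cv.
  - exists (Num.min t0 (2 * pi - t0)); first by rewrite lt_min t00 subr_gt0.
    move=> t; rewrite lt_min => /andP[]; rewrite !ltr_norml => /andP[a1 _] /andP[_ b2].
    rewrite /= in_itv /=; apply/andP; split; lra.
  (* The distance of [t0] to both ends is at least [e], so [|t - t0|] lies between [e] and
     [2 pi - e]; on this range the cosine is at most [cos e]. *)
  move=> d d0; pose e := Num.min (Num.min d t0) (Num.min (2 * pi - t0) pi).
  have e0 : 0 < e by rewrite !lt_min d0 t00 subr_gt0 t02 pi_gt0.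
  have [ed et ef ep] : [/\ e <= d, e <= t0, e <= 2 * pi - t0 & e <= pi].
    by rewrite !ge_min !lexx ?orbT.
  clearbody e; exists ((1 + cos e) / 2); split.
  - by rewrite divr_ge0// -lerBlDl sub0r cos_geN1.
  - have : cos e < cos 0 by rewrite ltr_cos// ?in_itv/= ?lexx ?pi_ge0 ?(ltW e0).
    by rewrite cos0; lra.
  move=> t; rewrite /= in_itv /= => /andP[t1 t2] dt.
  rewrite /peak ler_pM2r ?invr_gt0// lerD2l -cos_norm.
  have [tp|tp] := leP `|t - t0| pi.
    by rewrite leNgt ltr_cos ?in_itv/= ?normr_ge0 ?tp ?(ltW e0)// -leNgt (le_trans ed).
  rewrite -(cosN `|_|) -(cosD2pi (- _)) leNgt.
  have n2 : `|t - t0| <= 2 * pi - e by rewrite ler_norml; apply/andP; split; lra.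
  rewrite ltr_cos ?in_itv/= ?(ltW e0)//; last by apply/andP; split; move: n2 tp; rewrite -mulr_natl; lra.
  by rewrite -leNgt -mulr_natl; move: n2; lra.
apply: complex_ext.
  apply: (main (fun t => complex.Re (h t))); first exact: ccont_Re.
  move=> N; apply: avg_eq0; rewrite -[RHS]/(complex.Re (0 : R[i])) -(P N) Re_cavg.
  by apply: eq_avg => t; rewrite ReM /= mul0r subr0.
apply: (main (fun t => complex.Im (h t))); first exact: ccont_Im.
move=> N; apply: avg_eq0; rewrite -[RHS]/(complex.Im (0 : R[i])) -(P N) Im_cavg.
by apply: eq_avg => t; rewrite ImM /= mul0r addr0.
Qed.

End FourierUniqueness.

(** * Power series of holomorphic functions *)

Section HolomorphicPowerSeries.
Variable R : realType.
Implicit Types (r t : R) (z w : R[i]) (a b : nat -> R[i]) (f g : R[i] -> R[i]).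

Lemma has_ps_holo a f : has_ps a f -> holo f.
Proof. by move=> /has_ps_deriv[g _ H] z /H Hz; exists (g z). Qed.

Lemma holoD f g : holo f -> holo g -> holo (fun z => f z + g z).
Proof.
by move=> F G z z1; have [l ?] := F z z1; have [m ?] := G z z1; exists (l + m); exact: cderivD.
Qed.

Lemma holoM f g : holo f -> holo g -> holo (fun z => f z * g z).
Proof.
move=> F G z z1; have [l ?] := F z z1; have [m ?] := G z z1.
by exists (l * g z + f z * m); exact: cderivM.
Qed.

Lemma holo_cst (c : R[i]) : holo (fun=> c).
Proof. by move=> z _; exists 0; exact: cderiv_cst. Qed.

Lemma holo_id : holo (fun z : R[i] => z).
Proof. by move=> z _; exists 1; exact: cderiv_id. Qed.

Lemma holoZ (c : R[i]) f : holo f -> holo (fun z => c * f z).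
Proof. by move=> F; apply: holoM => //; exact: holo_cst. Qed.

Lemma holoN f : holo f -> holo (fun z => - f z).
Proof. by move=> F z /F[l ?]; exists (- l); exact: cderivN. Qed.

Lemma holoB f g : holo f -> holo g -> holo (fun z => f z - g z).
Proof. by move=> F G; apply: holoD => //; exact: holoN. Qed.

Lemma holo_comp f g : (forall z, normc z < 1 -> normc (f z) < 1) ->
  holo f -> holo g -> holo (fun z => g (f z)).
Proof.
move=> f1 F G z z1; have [l ?] := F z z1; have [m ?] := G _ (f1 z z1).
by exists (m * l); exact: cderiv_comp.
Qed.

Lemma expi_pow_conj (t : R) k n : expi t ^+ k * Num.conj (expi t) ^+ n =
  if (n <= k)%N then expi t ^+ (k - n) else Num.conj (expi t) ^+ (n - k).
Proof.
have EJ : expi t * Num.conj (expi t) = 1 by rewrite mulJ_normc normc_expi expr1n.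
case: leqP => [nk|/ltnW kn].
  by rewrite -{1}(subnK nk) exprD -mulrA -exprMn EJ expr1n mulr1.
by rewrite -{1}(subnK kn) exprD mulrCA -exprMn EJ expr1n mulr1.
Qed.

Lemma cavg_expi_conj k n : cavg (fun t : R => expi t ^+ k * Num.conj (expi t) ^+ n) = (k == n)%:R.
Proof.
case: (leqP n k) => nk.
  transitivity (cavg (fun t : R => expi t ^+ (k - n))).
    by apply: eq_cavg => t; rewrite expi_pow_conj nk.
  by rewrite cavg_expi subn_eq0 [in RHS]eqn_leq nk andbT.
transitivity (cavg (fun t : R => Num.conj (expi t) ^+ (n - k))).
  by apply: eq_cavg => t; rewrite expi_pow_conj leqNgt nk.
by rewrite cavg_expiJ subn_eq0 [in RHS]eqn_leq [(n <= k)%N]leqNgt nk andbF.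
Qed.

Lemma ccont_expin n : ccont (fun t : R => expi t ^+ n).
Proof. exact/ccontX/ccont_expi. Qed.

Lemma ccont_conjn n : ccont (fun t : R => Num.conj (expi t) ^+ n).
Proof. exact/ccontX/ccontJ/ccont_expi. Qed.

Lemma ccontZ (k : R[i]) u : ccont u -> ccont (fun t : R => k * u t).
Proof. by move=> U; apply: ccontM => //; exact: ccont_cst. Qed.

Lemma psum_circle_coef a N n r : (n < N)%N ->
  cavg (fun t => psum a N (r%:C * expi t) * Num.conj (expi t) ^+ n) = (r ^+ n)%:C * a n.
Proof.
move=> nN.
transitivity (cavg (fun t => \sum_(k < N) (a k * (r ^+ k)%:C) * (expi t ^+ k * Num.conj (expi t) ^+ n))).
  apply: eq_cavg => t; rewrite /psum mulr_suml; apply: eq_bigr => k _.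
  by rewrite exprMn rmorphXn; ring.
rewrite cavg_sum => [|i]; last by apply: ccontZ; apply: ccontM; [exact: ccont_expin|exact: ccont_conjn].
under eq_bigr => k _.
  rewrite cavgZ; last by apply: ccontM; [exact: ccont_expin|exact: ccont_conjn].
  rewrite cavg_expi_conj; over.
rewrite (bigD1 (Ordinal nN))//= eqxx mulr1 big1 ?addr0 1?mulrC// => i /negPf.
by rewrite -val_eqE /= => ->; rewrite mulr0.
Qed.

Lemma has_ps_circle_coef a f n r : has_ps a f -> 0 <= r < 1 ->
  cavg (fun t => f (r%:C * expi t) * Num.conj (expi t) ^+ n) = (r ^+ n)%:C * a n.
Proof.
move=> F r01; have /andP[r0 r1] := r01.
have [K [q [K0 q01 B]]] := F r r01.
have Fh := has_ps_holo F.
have cf : ccont (fun t => f (r%:C * expi t)) by exact: ccont_circle.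
have cp N : ccont (fun t => psum a N (r%:C * expi t)).
  apply: ccont_sum => k; apply: ccontZ; apply: ccontX.
  exact/ccontZ/ccont_expi.
apply/eqP; rewrite -subr_eq0 -normc_eq0; apply/eqP.
apply: (@le_geo_eq0 _ _ K q) => // N; rewrite ger0_norm ?normc_ge0//.
have nN : (n < maxn n.+1 N)%N by rewrite leq_max leqnn.
rewrite -(@psum_circle_coef a (maxn n.+1 N))// -cavgB; last 2 first.
- by apply: ccontM => //; exact: ccont_conjn.
- by apply: ccontM => //; exact: ccont_conjn.
apply: cavg_bound => [|t].
  by apply: ccontB; apply: ccontM => //; exact: ccont_conjn.
rewrite -mulrBl normcM normcX normcJ normc_expi expr1n mulr1.
rewrite (le_trans (B _ _ _))// ?normc_circle//.
by rewrite ler_wpM2l// ler_wiXn2l ?leq_maxr//; case/andP: q01 => // _ /ltW.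
Qed.

Lemma has_ps_fcoef a f n : has_ps a f -> fcoef f n = a n.
Proof.
move=> F; have h01 : 0 < (2^-1 : R) < 1 by rewrite invr_gt0 ltr0n invf_lt1 ?ltr1n ?ltr0n.
have h01' : 0 <= (2^-1 : R) < 1 by have /andP[/ltW-> ->] := h01.
have := has_ps_circle_coef n F h01'; rewrite (fcoefE _ (has_ps_holo F) h01) => /mulfI; apply.
by rewrite -normc_gt0 normcR normr_gt0 expf_neq0// invr_neq0// pnatr_eq0.
Qed.

Lemma polar_form z : exists2 t : R, 0 <= t < 2 * pi & z = (normc z)%:C * expi t.
Proof.
have [->|z0] := eqVneq z 0.
  by exists 0; rewrite ?lexx ?twopi_gt0// normc0 mul0r.
have nz : 0 < normc z by rewrite normc_gt0.
pose x := complex.Re z / normc z; pose y := complex.Im z / normc z.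
have xy : x ^+ 2 + y ^+ 2 = 1.
  rewrite /x /y !expr_div_n -mulrDl -normc_sq divff// expf_neq0// lt0r_neq0//.
have x1 : -1 <= x <= 1.
  rewrite -ler_norml /x normrM normfV (gtr0_norm nz) ler_pdivrMr// mul1r normc_Re//.
have zE : z = (normc z)%:C * (x +i* y).
  by apply: complex_ext; rewrite !ReImE /= /x /y; field; rewrite lt0r_neq0.
have y2 : Num.sqrt (1 - x ^+ 2) = `|y|.
  by rewrite -xy addrC addKr sqrtr_sqr.
have a0 : 0 <= acos x by exact: acos_ge0.
have api : acos x <= pi by exact: acos_lepi.
have p0 : 0 < pi :> R by exact: pi_gt0.
have [yp|yn] := leP 0 y.
  exists (acos x); first by rewrite a0 /= (le_lt_trans api)//; lra.
  by rewrite {1}zE /expi acosK// sin_acos// y2 ger0_norm.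
have an0 : 0 < acos x.
  rewrite lt_def a0 andbT; apply: contraTneq yn => h.
  have := y2; rewrite -(acosK x1) h cos0 expr1n subrr sqrtr0 => /esym/eqP.
  by rewrite normr_eq0 -leNgt => /eqP ->.
exists (2 * pi - acos x); first by apply/andP; split; lra.
have -> : 2 * pi - acos x = - acos x + pi *+ 2 by rewrite mulr_natl addrC.
rewrite {1}zE /expi cosD2pi sinD2pi cosN sinN acosK// sin_acos// y2.
by rewrite ltr0_norm// opprK.
Qed.

(** On each circle the Fourier coefficients of negative index vanish by Cauchy and the others by
    hypothesis. Points of argument zero and the centre are limits of points already covered. *)
Lemma holo_zero f : holo f -> (forall n, fcoef f n = 0) -> forall z, normc z < 1 -> f z = 0.
Proof.
move=> F F0.
have F1 r t : 0 < r < 1 -> 0 < t < 2 * pi -> f (r%:C * expi t) = 0.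
  move=> r01 t02; have /andP[r0 r1] := r01.
  apply: (@fourier_unique R (fun t => f (r%:C * expi t)) t t02).
  - by apply: ccont_circle => //; rewrite (ltW r0).
  - case=> [|n]; last exact: fcoef_neg.
    by have := fcoefE 0 F r01; rewrite F0 mulr0 => <-; apply: eq_cavg => s.
  - by move=> n; rewrite fcoefE// F0 mulr0.
move=> z z1.
have C (e : R) : 0 < e -> exists2 w, f w = 0 & normc (f w - f z) <= e.
  move=> e0; have [l Fl] := F z z1; have [d d0 K] := cderiv_lip Fl.
  have [z0|z0] := eqVneq z 0.
    have l1 : 0 < 1 + normc l by rewrite ltr_pwDl ?normc_ge0.
    pose s := Num.min (Num.min (d / 2) (1 / 2)) (e / (1 + normc l)).
    have s0 : 0 < s by rewrite !lt_min !divr_gt0.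
    have sd : s < d by rewrite !gt_min ltr_pdivrMr// ltr_pMr// ltr1n.
    have h12 : (1 / 2 : R) < 1 by lra.
    have s1 : s < 1 by rewrite !gt_min h12 orbT.
    have se : (1 + normc l) * s <= e by rewrite mulrC -ler_pdivlMr// ge_min lexx orbT.
    clearbody s.
    have sn : normc (s%:C * expi pi - z) = s by rewrite z0 subr0 normc_circle// ltW.
    exists (s%:C * expi pi).
      apply: F1; rewrite ?s0//; have := pi_gt0 R; lra.
    by rewrite (le_trans (K _ _))// sn.
  have [t /andP[t0 t2] zE] := polar_form z.
  have nz : 0 < normc z by rewrite normc_gt0.
  have nz01 : 0 < normc z < 1 by rewrite nz.
  have c : ccont (fun t => f ((normc z)%:C * expi t)) by apply: ccont_circle => //; rewrite ltW.
  have [d' d'0 K'] := c t e e0.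
  pose s := Num.min (d' / 2) ((2 * pi - t) / 2).
  have s0 : 0 < s by rewrite lt_min !divr_gt0// subr_gt0.
  have sd : s < d' by rewrite gt_min ltr_pdivrMr// ltr_pMr// ltr1n.
  have st : s <= (2 * pi - t) / 2 by rewrite ge_min lexx orbT.
  clearbody s.
  exists ((normc z)%:C * expi (t + s)).
    by apply: F1 => //; apply/andP; split; lra.
  by rewrite [in X in _ - X]zE ltW// K'// addrC addKr gtr0_norm.
apply/eqP; rewrite -normc_eq0 eq_le normc_ge0 andbT.
apply/ler_addgt0Pl => e /C[w ->]; rewrite sub0r normc_opp addr0//.
Qed.

(** The series with these coefficients converges by Cauchy's estimates; its sum and [f] have the
    same coefficients, so their difference is zero. *)
Theorem holo_has_ps f : holo f -> has_ps (fcoef f) f.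
Proof.
move=> F; have [g G] := has_ps_exists (fcoef_geo F).
have Gh := has_ps_holo G; have G' := G.
apply: has_ps_eq G' => z z1; apply/eqP; rewrite -subr_eq0; apply/eqP.
apply: (@holo_zero (fun z => g z - f z)) => //; first exact: holoB.
move=> n.
have h01 : 0 < (2^-1 : R) < 1 by rewrite invr_gt0 ltr0n invf_lt1 ?ltr1n ?ltr0n.
have hn : (2^-1 ^+ n)%:C != 0 :> R[i].
  by rewrite -normc_gt0 normcR normr_gt0 expf_neq0// invr_neq0// pnatr_eq0.
apply: (mulfI hn); rewrite mulr0 -fcoefE//; last exact: holoB.
have cc h : holo h -> ccont (fun t => h ((2^-1)%:C * expi t) * Num.conj (expi t) ^+ n).
  by move=> H; apply: ccontM; [apply: ccont_circle => //; case/andP: h01 => /ltW->|exact: ccont_conjn].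
transitivity (cavg (fun t => g ((2^-1)%:C * expi t) * Num.conj (expi t) ^+ n
   - f ((2^-1)%:C * expi t) * Num.conj (expi t) ^+ n)).
  by apply: eq_cavg => t; rewrite mulrBl.
rewrite (cavgB (cc _ Gh) (cc _ F)) !fcoefE// (has_ps_fcoef n G).
by rewrite subrr.
Qed.

Lemma has_ps_at0 a f : has_ps a f -> f 0 = a 0%N.
Proof.
move=> F; have z0 : 0 <= (0 : R) < 1 by rewrite lexx ltr01.
have [K [q [K0 q01 B]]] := F 0 z0.
apply/eqP; rewrite -subr_eq0 -normc_eq0; apply/eqP.
apply: (@le_geo_eq0 _ _ K q) => // n; rewrite ger0_norm ?normc_ge0//.
have -> : a 0%N = psum a n.+1 0.
  rewrite /psum big_ord_recl expr0 mulr1 big1 ?addr0// => i _.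
  by rewrite lift0 expr0n mulr0.
rewrite (le_trans (B 0 _ _)) ?normc0//.
by rewrite ler_wpM2l// ler_wiXn2l//; case/andP: q01 => // _ /ltW.
Qed.

Lemma has_ps_derive1n a (f : Cplx R -> Cplx R) k : has_ps a f ->
  has_ps (iter k (@dcoef R) a) (derive1n k f).
Proof.
move=> F; elim: k => [|k IH] //.
have [g G D] := has_ps_deriv IH.
apply: has_ps_eq G => z z1; have /cderivP[_ <-] := D z z1.
by rewrite derive1nS derive1E.
Qed.

Lemma iter_dcoef a k n : iter k (@dcoef R) a n = ((n + k) ^_ k)%:R * a (n + k)%N.
Proof.
elim: k n => [|k IH] n; first by rewrite ffactn0 mul1r addn0.
by rewrite iterS /dcoef IH mulrA -natrM -addSnnS ffactnSr addnK mulnC.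
Qed.

Lemma taylor_coefE a f k : has_ps a f -> taylor_coef f k = a k.
Proof.
move=> F; rewrite /taylor_coef (has_ps_at0 (has_ps_derive1n k F)) iter_dcoef add0n ffactnn.
rewrite mulrC mulKf// -normc_gt0 normc_nat ltr0n fact_gt0//.
Qed.

End HolomorphicPowerSeries.

(** * Poisson integrals and integral means *)

Section ConjugateMorphism.
Variable R : realType.
Implicit Types z w : R[i].

Lemma conjM z w : Num.conj (z * w) = Num.conj z * Num.conj w.
Proof. exact: rmorphM. Qed.

Lemma conjX z n : Num.conj (z ^+ n) = Num.conj z ^+ n.
Proof. exact: rmorphXn. Qed.

Lemma conjK z : Num.conj (Num.conj z) = z.
Proof. by apply: complex_ext; rewrite !ReImE ?opprK. Qed.

End ConjugateMorphism.

Section PowerMeans.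
Variable R : realType.
Implicit Types (p r x y t : R) (u h : R -> R) (w z : R[i]) (f g : R[i] -> R[i]).

Lemma powR_subK p x : 1 < p -> 0 <= x -> x `^ p = x * x `^ (p - 1).
Proof.
move=> p1 x0; have [->|xn0] := eqVneq x 0.
  by rewrite mul0r powR0// gt_eqF// (lt_trans ltr01).
have xp : 0 < x by rewrite lt_def xn0.
by rewrite -{2}(powRr1 x0) -powRD ?xn0 ?implybT// addrC subrK.
Qed.

Lemma bernoulli_powR p x : 1 < p -> 0 <= x -> 1 + p * (x - 1) <= x `^ p.
Proof.
move=> p1 x0; have p0 : 0 < p by rewrite (lt_trans ltr01).
have pn0 : p != 0 by rewrite gt_eqF.
pose q := p / (p - 1).
have q0 : 0 < q by rewrite divr_gt0// subr_gt0.
have p10 : p - 1 != 0 by rewrite gt_eqF// subr_gt0.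
have pq : p^-1 + q^-1 = 1 by rewrite /q; field; rewrite p10.
have := @conjugate_powR R x 1 p q x0 ler01 p0 q0 pq.
rewrite mulr1 powR1 -(ler_pM2l p0) mulrDr mulrCA divff// mulr1 /=.
rewrite (_ : p * (1 / q) = p - 1); last by rewrite /q; field; rewrite p10.
by rewrite mulrBr mulr1; lra.
Qed.

(** Bernoulli's inequality at [x / y], scaled back. As the tangent line of a convex function it
    replaces second derivatives in Jensen's, Minkowski's and the midpoint inequalities. *)
Lemma tangent_powR p x y : 1 < p -> 0 <= x -> 0 <= y ->
  y `^ p + p * y `^ (p - 1) * (x - y) <= x `^ p.
Proof.
move=> p1 x0 y0; have [->|yn0] := eqVneq y 0.
  rewrite !powR0 ?mulr0 ?mul0r ?addr0 ?powR_ge0//.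
    by rewrite gt_eqF// subr_gt0.
  by rewrite gt_eqF// (lt_trans ltr01).
have yp : 0 < y by rewrite lt_def yn0.
have := bernoulli_powR p1 (divr_ge0 x0 y0).
rewrite -(ler_pM2r (powR_gt0 p yp)) -powRM ?divr_ge0// divfK//.
apply: le_trans; rewrite le_eqVlt; apply/orP; left; apply/eqP.
by rewrite (powR_subK p1 y0); field.
Qed.

Lemma powR_lipschitz p B x y : 1 < p -> 0 <= x <= B -> 0 <= y <= B ->
  `|x `^ p - y `^ p| <= p * B `^ (p - 1) * `|x - y|.
Proof.
move=> p1; wlog xy : x y / y <= x.
  by move=> W xB yB; have [/W->//|/ltW/W] := leP y x; rewrite distrC [X in _ <= _ * X]distrC; apply.
move=> /andP[x0 xB] /andP[y0 yB]; have p0 : 0 <= p by rewrite ltW// (lt_trans ltr01).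
rewrite !ger0_norm ?subr_ge0//; last by apply: ge0_ler_powR; rewrite ?nnegrE.
have := tangent_powR p1 y0 x0.
have : x `^ (p - 1) <= B `^ (p - 1).
  by apply: ge0_ler_powR; rewrite ?nnegrE// ?subr_ge0 ?(ltW p1)// (le_trans x0).
move=> /(ler_wpM2l p0)/(ler_wpM2r (_ : 0 <= x - y)); rewrite subr_ge0 => /(_ xy).
by set a := x `^ p; set b := y `^ p; set c := p * x `^ _; set d := p * B `^ _; lra.
Qed.

Lemma continuous_powR_comp p u : 1 < p -> continuous u -> (forall t, 0 <= u t) ->
  continuous (fun t => u t `^ p).
Proof.
move=> p1 U u0 t; apply/cont_epsP => e e0.
pose B := u t + 1; have B1 : 0 < B by rewrite ltr_wpDl.
have K0 : 0 < p * B `^ (p - 1) by rewrite mulr_gt0 ?powR_gt0// (lt_trans ltr01).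
have m0 : 0 < Num.min 1 (e / (p * B `^ (p - 1))) by rewrite lt_min ltr01 divr_gt0.
have [d d0 H] := (cont_epsP u t).1 (U t) _ m0.
exists d => // s /H; rewrite lt_min => /andP[s1 s2].
have sB : 0 <= u s <= B.
  by rewrite u0 /B; move: s1; rewrite ltr_norml => /andP[_]; lra.
have tB : 0 <= u t <= B by rewrite u0 /B lerDl ler01.
by rewrite (le_lt_trans (powR_lipschitz p1 sB tB))// mulrC -ltr_pdivlMr.
Qed.

Lemma continuous_rmul u h : continuous u -> continuous h -> continuous (fun t => u t * h t).
Proof. by move=> U H t; apply: cvgM; [exact: U|exact: H]. Qed.

Lemma continuous_radd u h : continuous u -> continuous h -> continuous (fun t => u t + h t).
Proof. by move=> U H t; apply: cvgD; [exact: U|exact: H]. Qed.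

Lemma continuous_rcst x : continuous (fun _ : R => x).
Proof. by move=> t; exact: cvg_cst. Qed.

(** The tangent inequality at the mean [m], weighted by [W] and averaged; the linear term averages
    to zero. *)
Lemma avg_jensen p (W u : R -> R) : 1 < p -> continuous W -> continuous u ->
  (forall t, 0 <= W t) -> (forall t, 0 <= u t) -> avg W = 1 ->
  avg (fun t => W t * u t) `^ p <= avg (fun t => W t * u t `^ p).
Proof.
move=> p1 cW cu W0 u0 W1.
have cWu : continuous (fun t => W t * u t) by exact: continuous_rmul.
have cup := continuous_powR_comp p1 cu u0.
set m := avg (fun t => W t * u t).
have m0 : 0 <= m by apply: avg_ge0 => t; rewrite mulr_ge0.
pose k := p * m `^ (p - 1).
have -> : m `^ p = avg (fun t => W t * (m `^ p - k * m) + k * (W t * u t)).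
  rewrite avgD; last 2 first.
  - by apply: continuous_rmul => //; exact: continuous_rcst.
  - by apply: continuous_rmul => //; exact: continuous_rcst.
  rewrite avgZ// -/m.
  have -> : avg (fun t => W t * (m `^ p - k * m)) = avg (fun t => (m `^ p - k * m) * W t).
    by apply: eq_avg => t; rewrite mulrC.
  by rewrite avgZ// W1 mulr1 subrK.
apply: le_avg.
- apply: continuous_radd; apply: continuous_rmul => //; exact: continuous_rcst.
- exact: continuous_rmul.
- move=> t; have -> : W t * (m `^ p - k * m) + k * (W t * u t) = W t * (m `^ p + k * (u t - m)) by ring.
  by rewrite ler_wpM2l// tangent_powR.
Qed.

(** The root is never taken: bounds are written with a power on the right, so that convexity applies
    directly. *)
Definition mean p f r := avg (fun t => normc (f (r%:C * expi t)) `^ p).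

Lemma mean_ge0 p f r : 0 <= mean p f r.
Proof. by apply: avg_ge0 => t; exact: powR_ge0. Qed.

Lemma continuous_circle_norm f r : holo f -> 0 <= r < 1 ->
  continuous (fun t => normc (f (r%:C * expi t))).
Proof. by move=> F r01; apply: ccont_norm; exact: ccont_circle. Qed.

Lemma continuous_circle_pow p f r : 1 < p -> holo f -> 0 <= r < 1 ->
  continuous (fun t => normc (f (r%:C * expi t)) `^ p).
Proof.
move=> p1 F r01; apply: continuous_powR_comp => //; first exact: continuous_circle_norm.
by move=> t; exact: normc_ge0.
Qed.

(** The Cauchy kernel of the unit circle; twice its real part minus one, [pkernel], is the Poisson
    kernel. *)
Definition ckernel w t : R[i] := (1 - w * Num.conj (expi t))^-1.
Definition pkernel w t : R := 2 * complex.Re (ckernel w t) - 1.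

Lemma one_sub_lt1 w t : normc w < 1 -> 0 < normc (1 - w * Num.conj (expi t)).
Proof.
move=> w1; rewrite normc_gt0 subr_eq0; apply: contraTneq w1 => /(congr1 (@normc R)).
by rewrite normcM normcJ normc_expi mulr1 normc1 => <-; rewrite ltxx.
Qed.

Lemma pkernelE w t : normc w < 1 ->
  pkernel w t = (1 - normc w ^+ 2) / normc (1 - w * Num.conj (expi t)) ^+ 2.
Proof.
move=> w1; have := one_sub_lt1 t w1.
have -> : normc w ^+ 2 = normc (w * Num.conj (expi t)) ^+ 2.
  by rewrite normcM normcJ normc_expi mulr1.
rewrite /pkernel /ckernel; set v := w * _ => v0.
have n0 : normc (1 - v) ^+ 2 != 0 by rewrite expf_neq0// gt_eqF.
have -> : complex.Re (1 - v)^-1 = complex.Re (1 - v) / normc (1 - v) ^+ 2.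
  have -> : (1 - v)^-1 = Num.conj (1 - v) * ((normc (1 - v) ^+ 2)^-1)%:C.
    have v1 : 1 - v != 0 by rewrite -normc_gt0.
    apply: (mulfI v1); rewrite divff// mulrA mulJ_normc -realcM divff//.
  by rewrite !ReImE /= mulr0 subr0.
apply: (mulIf n0); rewrite divfK// mulrBl mul1r -mulrA divfK//.
by rewrite !normc_sq !ReImE /=; ring.
Qed.

Lemma pkernel_ge0 w t : normc w < 1 -> 0 <= pkernel w t.
Proof.
move=> w1; rewrite pkernelE// divr_ge0// ?sqr_ge0// subr_ge0.
by rewrite expr_le1 ?normc_ge0// ltW.
Qed.

Lemma pkernel_le w t : normc w < 1 -> pkernel w t <= (1 + normc w) / (1 - normc w).
Proof.
move=> w1; rewrite pkernelE//.
have a0 : 0 < 1 - normc w by rewrite subr_gt0.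
have L : 1 - normc w <= normc (1 - w * Num.conj (expi t)).
  have := ler_dist_normc 1 (w * Num.conj (expi t)).
  by rewrite normc1 normcM normcJ normc_expi mulr1; apply: le_trans; exact: ler_norm.
have b0 := lt_le_trans a0 L.
rewrite ler_pdivrMr ?exprn_gt0//.
have -> : 1 - normc w ^+ 2 = (1 + normc w) / (1 - normc w) * (1 - normc w) ^+ 2.
  by field; rewrite gt_eqF.
rewrite ler_wpM2l ?lerXn2r ?nnegrE ?(ltW a0) ?(ltW b0)//.
by rewrite divr_ge0 ?(ltW a0)// addr_ge0 ?normc_ge0.
Qed.

Lemma ccont_ckernel w : normc w < 1 -> ccont (ckernel w).
Proof.
move=> w1; apply: (@ccont_deriv _ (fun z => z^-1) (fun t => 1 - w * Num.conj (expi t))).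
  apply: ccontB; first exact: ccont_cst.
  by apply: ccontZ; exact/ccontJ/ccont_expi.
by move=> t; eexists; apply: cderivV; rewrite -normc_gt0 one_sub_lt1.
Qed.

Lemma continuous_pkernel w : normc w < 1 -> continuous (pkernel w).
Proof.
move=> w1; apply: continuous_radd; last exact: continuous_rcst.
apply: continuous_rmul; first exact: continuous_rcst.
exact/ccont_Re/ccont_ckernel.
Qed.

Lemma ckernel_approx w t n : normc w < 1 ->
  normc (ckernel w t - \sum_(k < n) w ^+ k * Num.conj (expi t) ^+ k)
    <= (1 - normc w)^-1 * normc w ^+ n.
Proof.
move=> w1; have v0 := one_sub_lt1 t w1.
have L : 1 - normc w <= normc (1 - w * Num.conj (expi t)).
  have := ler_dist_normc 1 (w * Num.conj (expi t)).
  by rewrite normc1 normcM normcJ normc_expi mulr1; apply: le_trans; exact: ler_norm.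
have -> : ckernel w t - \sum_(k < n) w ^+ k * Num.conj (expi t) ^+ k
   = ckernel w t * (w * Num.conj (expi t)) ^+ n.
  rewrite /ckernel; under eq_bigr do rewrite -exprMn.
  set v := w * _ in v0 *.
  have v1 : 1 - v != 0 by rewrite -normc_gt0.
  apply: (mulfI v1); rewrite mulrBr mulrA divff// mul1r.
  by rewrite -[X in X * _]opprB mulNr -subrX1; ring.
rewrite normcM normcX /ckernel normcV normcM normcJ normc_expi mulr1.
rewrite ler_wpM2r ?exprn_ge0 ?normc_ge0// lef_pV2// posrE subr_gt0//.
Qed.

(** Expanding the kernel in powers of [w] gives the coefficients. This is the Riesz projection,
    which discards the negative frequencies of [h]. *)
Lemma cauchy_transform (h : R -> R[i]) : ccont h -> exists2 Q,
  has_ps (fun k => cavg (fun t => h t * Num.conj (expi t) ^+ k)) Q &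
  forall w, normc w < 1 -> Q w = cavg (fun t => h t * ckernel w t).
Proof.
move=> H; pose c k := cavg (fun t => h t * Num.conj (expi t) ^+ k).
pose B := avg (fun t => normc (h t)).
have B0 : 0 <= B by apply: avg_ge0 => t; exact: normc_ge0.
have cB k : normc (c k) <= B.
  rewrite (le_trans (normc_cavg _))//; first by apply: ccontM => //; exact: ccont_conjn.
  rewrite le_eqVlt; apply/orP; left; apply/eqP/eq_avg => t.
  by rewrite normcM normcX normcJ normc_expi expr1n mulr1.
have cg : coef_geo c.
  move=> r r01; exists B, r; split => // n.
  by rewrite ler_wpM2r// exprn_ge0//; case/andP: r01.
have [Q QP] := has_ps_exists cg; exists Q => // w w1.
have w01 : 0 <= normc w < 1 by rewrite normc_ge0.
have [K [q [K0 q01 L]]] := QP _ w01.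
apply/eqP; rewrite -subr_eq0 -normc_eq0 eq_le normc_ge0 andbT.
apply/ler_addgt0Pl => e e0; rewrite addr0.
have e20 : 0 < e / 2 by rewrite divr_gt0.
have [N1 H1] := @geo_small R K q _ q01 e20.
have [N2 H2] := @geo_small R (B / (1 - normc w)) (normc w) _ w01 e20.
pose n := maxn N1 N2.
rewrite (le_trans (normc_triangle (psum c n w) _ _))// (splitr e) lerD//.
  by rewrite (le_trans (L _ (lexx _) n))// ltW// H1// leq_maxl.
have -> : psum c n w = cavg (fun t => h t * \sum_(k < n) w ^+ k * Num.conj (expi t) ^+ k).
  transitivity (cavg (fun t => \sum_(k < n) w ^+ k * (h t * Num.conj (expi t) ^+ k))).
    rewrite cavg_sum => [|k]; last by apply: ccontZ; apply: ccontM => //; exact: ccont_conjn.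
    apply: eq_bigr => k _; rewrite cavgZ 1?mulrC//; apply: ccontM => //; exact: ccont_conjn.
  by apply: eq_cavg => t; rewrite mulr_sumr; apply: eq_bigr => k _; rewrite mulrCA.
have cs : ccont (fun t : R => \sum_(k < n) w ^+ k * Num.conj (expi t) ^+ k).
  by apply: ccont_sum => k; apply: ccontZ; exact: ccont_conjn.
rewrite -cavgB; [|exact: ccontM|by apply: ccontM => //; exact: ccont_ckernel].
rewrite (le_trans (normc_cavg _))//.
  by apply: ccontB; apply: ccontM => //; exact: ccont_ckernel.
have -> : e / 2 = e / 2 by [].
rewrite (@le_trans _ _ (B / (1 - normc w) * normc w ^+ n))//; last first.
  by rewrite ltW// H2// leq_maxr.
have -> : B / (1 - normc w) * normc w ^+ n
   = avg (fun t => (normc w ^+ n / (1 - normc w)) * normc (h t)).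
  rewrite avgZ; first by rewrite -/B; ring.
  exact: ccont_norm.
apply: le_avg.
- by apply: ccont_norm; apply: ccontB; apply: ccontM => //; exact: ccont_ckernel.
- by apply: continuous_rmul; [exact: continuous_rcst|exact: ccont_norm].
- move=> t; rewrite -mulrBr normcM mulrC ler_wpM2r ?normc_ge0//.
  by rewrite normc_dist (le_trans (ckernel_approx _ _ w1))// mulrC.
Qed.

Lemma Re_cauchy_transform u z : continuous u -> normc z < 1 ->
  complex.Re (2 * cavg (fun t => (u t)%:C * ckernel z t) - (avg u)%:C)
    = avg (fun t => pkernel z t * u t).
Proof.
move=> H w1; rewrite ReD ReN ReM Re_cavg [complex.Re (avg u)%:C]/=.
have cR : continuous (fun t => complex.Re (ckernel z t)) by exact/ccont_Re/ccont_ckernel.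
have -> : avg (fun t => complex.Re ((u t)%:C * ckernel z t)) = avg (fun t => u t * complex.Re (ckernel z t)).
  by apply: eq_avg => t; rewrite ReM /= mul0r subr0.
rewrite (_ : complex.Re 2 = 2)// (_ : complex.Im 2 = 0) ?mul0r ?subr0; last by rewrite ImD addr0.
have cH : continuous (fun t => u t * complex.Re (ckernel z t)) by exact: continuous_rmul.
rewrite -avgZ// -avgB//; last by apply: continuous_rmul => //; exact: continuous_rcst.
by apply: eq_avg => t; rewrite /pkernel; ring.
Qed.

(** Presents a Poisson integral as the real part of a holomorphic function, so that the mean value
    property and composition with a self-map of the disc need no theory of harmonic functions. *)
Lemma poisson_transform h : continuous h -> exists2 F, holo F &
  (forall w, normc w < 1 -> complex.Re (F w) = avg (fun t => pkernel w t * h t))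
  /\ F 0 = (avg h)%:C.
Proof.
move=> H; have H' := ccont_real H.
have [Q QP QE] := cauchy_transform H'.
have Q0 : Q 0 = (avg h)%:C.
  rewrite (has_ps_at0 QP).
  apply: complex_ext.
    by rewrite Re_cavg; apply: eq_avg => t; rewrite expr0 mulr1.
  rewrite Im_cavg -[RHS]/(0 : R) -[RHS](avg_cst (0 : R)); apply: eq_avg => t.
  by rewrite expr0 mulr1.
exists (fun w => 2 * Q w - (avg h)%:C).
  by apply: holoB; [exact/holoZ/(has_ps_holo QP)|exact: holo_cst].
split; last by rewrite Q0; ring.
by move=> w w1; rewrite QE//; exact: Re_cauchy_transform.
Qed.

Lemma has_ps_unique a f g z : has_ps a f -> has_ps a g -> normc z < 1 -> f z = g z.
Proof.
move=> F G z1; have z01 : 0 <= normc z < 1 by rewrite normc_ge0.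
have [K [q [K0 q01 B]]] := F _ z01; have [L [s [L0 s01 C]]] := G _ z01.
apply/eqP; rewrite -subr_eq0 -normc_eq0 eq_le normc_ge0 andbT.
apply/ler_addgt0Pl => e e0; rewrite addr0.
have e20 : 0 < e / 2 by rewrite divr_gt0.
have [N1 H1] := @geo_small R K q _ q01 e20.
have [N2 H2] := @geo_small R L s _ s01 e20.
pose n := maxn N1 N2.
rewrite (le_trans (normc_triangle (psum a n z) _ _))// (splitr e) lerD//.
  by rewrite (le_trans (B _ (lexx _) n))// ltW// H1// leq_maxl.
by rewrite normc_dist (le_trans (C _ (lexx _) n))// ltW// H2// leq_maxr.
Qed.

Lemma has_ps_dilate a f r : 0 <= r < 1 -> has_ps a f ->
  has_ps (fun k => (r ^+ k)%:C * a k) (fun z => f (r%:C * z)).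
Proof.
move=> /andP[r0 r1] F s s01; have [K [q [K0 q01 B]]] := F _ s01.
exists K, q; split => // z zs n.
have -> : psum (fun k => (r ^+ k)%:C * a k) n z = psum a n (r%:C * z).
  by apply: eq_bigr => k _; rewrite exprMn rmorphXn; ring.
apply: B; rewrite normcM normcR ger0_norm// (le_trans _ zs)// ler_piMl ?normc_ge0 ?(ltW r1)//.
Qed.

Lemma holo_dilate f r : 0 <= r < 1 -> holo f -> holo (fun z => f (r%:C * z)).
Proof. by move=> r01 F; apply: has_ps_holo (has_ps_dilate r01 (holo_has_ps F)). Qed.

Lemma has_ps_cst (c : R[i]) : has_ps (fun k => if k is 0%N then c else 0) (fun=> c).
Proof.
move=> r r01; exists (normc c), 0; split; rewrite ?normc_ge0 ?lexx ?ltr01// => z zr [|n].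
  by rewrite /psum big_ord0 subr0 expr0 mulr1.
rewrite /psum big_ord_recl expr0 mulr1 big1 => [|i _]; last by rewrite lift0 mul0r.
by rewrite addr0 subrr normc0 expr0n mulr0.
Qed.

Lemma pkernelC w t : (pkernel w t)%:C = ckernel w t + Num.conj (ckernel w t) - 1.
Proof.
by apply: complex_ext; rewrite !ReImE /= /pkernel; ring.
Qed.

(** The Cauchy kernel reproduces [f]; its conjugate sees only the constant term, because [f] has no
    negative frequencies; and this constant cancels against the last term of [pkernelC]. *)
Lemma poisson_formula f w r : holo f -> 0 <= r < 1 -> normc w < 1 ->
  f (r%:C * w) = cavg (fun t => (pkernel w t)%:C * f (r%:C * expi t)).
Proof.
move=> F r01 w1; have P := holo_has_ps F; set a := fcoef f in P.
have cf : ccont (fun t => f (r%:C * expi t)) by exact: ccont_circle.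
have cJf := ccontJ cf.
have ck := ccont_ckernel w1.
have E1 : cavg (fun t => f (r%:C * expi t) * ckernel w t) = f (r%:C * w).
  have [Q QP <-//] := cauchy_transform cf.
  apply: (@has_ps_unique _ Q (fun z => f (r%:C * z)) w QP _ w1).
  have := has_ps_dilate r01 P; congr has_ps; apply/funext => k.
  by rewrite -(has_ps_circle_coef k P r01).
have E0 : cavg (fun t => f (r%:C * expi t)) = a 0%N.
  have := has_ps_circle_coef 0 P r01; rewrite expr0 mul1r => <-.
  by apply: eq_cavg => t; rewrite expr0 mulr1.
have E2 : cavg (fun t => f (r%:C * expi t) * Num.conj (ckernel w t)) = a 0%N.
  transitivity (Num.conj (cavg (fun t => Num.conj (f (r%:C * expi t)) * ckernel w t))).
    rewrite -cavgJ; last exact: ccontM.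
    by apply: eq_cavg => t; rewrite conjM conjK.
  have [Q QP <-//] := cauchy_transform cJf.
  rewrite -[RHS]conjK; congr Num.conj.
  apply: (@has_ps_unique _ Q (fun=> Num.conj (a 0%N)) w QP _ w1).
  have := has_ps_cst (Num.conj (a 0%N)); congr has_ps; apply/funext => k.
  transitivity (Num.conj (cavg (fun t => f (r%:C * expi t) * expi t ^+ k))); last first.
    rewrite -cavgJ; last by apply: ccontM => //; exact: ccont_expin.
    by apply: eq_cavg => t; rewrite conjM conjX.
  case: k => [|k].
    by rewrite -E0; congr Num.conj; apply: eq_cavg => t; rewrite expr0 mulr1.
  have [r0|r0] := eqVneq r 0; last first.
    rewrite fcoef_neg ?conjC0//; case/andP: r01 => ? ->; rewrite lt_def r0 andbT//.
  transitivity (Num.conj (f 0 * cavg (fun t : R => expi t ^+ k.+1))).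
    by rewrite cavg_expi mulr0 conjC0.
  rewrite -cavgZ; last exact: ccont_expin.
  by congr Num.conj; apply: eq_cavg => t; rewrite r0 mul0r.
have -> : cavg (fun t => (pkernel w t)%:C * f (r%:C * expi t)) =
  cavg (fun t => f (r%:C * expi t) * ckernel w t + f (r%:C * expi t) * Num.conj (ckernel w t)
     - f (r%:C * expi t)).
  by apply: eq_cavg => t; rewrite pkernelC; ring.
have c1 := ccontM cf ck; have c2 := ccontM cf (ccontJ ck).
by rewrite (cavgB (ccontD c1 c2) cf) (cavgD c1 c2) E1 E2 E0 addrK.
Qed.

Lemma avg_pkernel w : normc w < 1 -> avg (pkernel w) = 1.
Proof.
move=> w1; have z01 : 0 <= (0 : R) < 1 by rewrite lexx ltr01.
have /(congr1 (@complex.Re R)) := poisson_formula (@holo_cst R 1) z01 w1.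
rewrite Re_cavg /= => ->; apply: eq_avg => t; by rewrite mulr1 mul0r subr0.
Qed.

(* Subharmonicity of [|f| ^ p], in the form of a Poisson majorant. *)
Lemma mean_subordinate p f psi r s : 1 < p -> holo f -> holo psi ->
  (forall z, normc z < 1 -> normc (psi z) < 1) -> 0 <= r < 1 -> 0 <= s < 1 ->
  mean p (fun z => f (r%:C * psi z)) s <=
    (1 + normc (psi 0)) / (1 - normc (psi 0)) * mean p f r.
Proof.
move=> p1 F P P1 r01 s01.
have cfp := continuous_circle_pow p1 F r01.
have cfn := continuous_circle_norm F r01.
have [U UH [UE U0]] := poisson_transform cfp.
have r1 : forall z, normc z < 1 -> normc (r%:C * psi z) < 1.
  move=> z /P1 h; case/andP: r01 => r0 r1; rewrite normcM normcR ger0_norm//.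
  by rewrite (le_lt_trans _ h)// ler_piMl ?normc_ge0 ?(ltW r1).
have G : holo (fun z => f (r%:C * psi z)) by apply: holo_comp => //; exact: holoZ.
have UP : holo (fun z => U (psi z)) by exact: holo_comp.
have key z : normc z < 1 -> normc (f (r%:C * psi z)) `^ p <= complex.Re (U (psi z)).
  move=> z1; have w1 := P1 z z1; rewrite UE// (poisson_formula F r01 w1).
  have cpk := continuous_pkernel w1.
  apply: le_trans (avg_jensen p1 cpk cfn _ _ (avg_pkernel w1)); last 2 first.
  - by move=> t; exact: pkernel_ge0.
  - by move=> t; exact: normc_ge0.
  apply: ge0_ler_powR; rewrite ?nnegrE ?normc_ge0//.
  - by rewrite ltW// (lt_trans ltr01).
  - by apply: avg_ge0 => t; rewrite mulr_ge0 ?normc_ge0 ?pkernel_ge0.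
  rewrite (le_trans (normc_cavg _))//.
    by apply: ccontM; [exact: ccont_real|exact: ccont_circle].
  rewrite le_eqVlt; apply/orP; left; apply/eqP/eq_avg => t.
  by rewrite normcM normcR ger0_norm// pkernel_ge0.
have UPs := holo_has_ps UP.
(* The mean value property moves the average over the circle of radius [s] to the centre, where
   Harnack's bound on the Poisson kernel produces the constant. *)
have m0 : complex.Re (U (psi 0)) = avg (fun t => complex.Re (U (psi (s%:C * expi t)))).
  rewrite -Re_cavg; congr complex.Re.
  transitivity (fcoef (fun z => U (psi z)) 0); first exact: (has_ps_at0 UPs).
  have := has_ps_circle_coef 0 UPs s01; rewrite expr0 mul1r => <-.
  by apply: eq_cavg => t; rewrite expr0 mulr1.
have z1 : normc (0 : R[i]) < 1 by rewrite normc0.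
have w1 := P1 0 z1.
apply: (@le_trans _ _ (complex.Re (U (psi 0)))).
  rewrite m0; apply: le_avg.
  - exact: (continuous_circle_pow p1 G).
  - by apply: ccont_Re; exact: (ccont_circle UP).
  - by move=> t; apply: key; rewrite normc_circle//; case/andP: s01.
rewrite UE// /mean -avgZ//; apply: le_avg.
- by apply: continuous_rmul => //; exact: continuous_pkernel.
- by apply: continuous_rmul => //; exact: continuous_rcst.
- by move=> t; rewrite ler_wpM2r ?powR_ge0// pkernel_le.
Qed.

(** Subordination to the identity map, which fixes 0 and so has constant 1. *)
Lemma mean_homo p f r s : 1 < p -> holo f -> 0 <= r -> r <= s -> s < 1 ->
  mean p f r <= mean p f s.
Proof.
move=> p1 F r0; rewrite le_eqVlt => /predU1P[->//|rs] s1.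
have s0 : 0 < s by rewrite (le_lt_trans r0).
have s01 : 0 <= s < 1 by rewrite ltW.
have q01 : 0 <= r / s < 1 by rewrite divr_ge0 ?(ltW s0)//= ltr_pdivrMr// mul1r.
have := @mean_subordinate p f (fun z => z) s (r / s) p1 F (@holo_id R) (fun z zlt1 => zlt1) s01 q01.
rewrite normc0 addr0 subr0 divr1 mul1r; apply: le_trans.
rewrite le_eqVlt; apply/orP; left; apply/eqP/eq_avg => t.
by rewrite mulrA -realcM mulrCA divff ?mulr1// gt_eqF.
Qed.

End PowerMeans.

(** * Uniform convexity *)

Section UniformConvexity.
Variable R : realType.
Implicit Types (p x y e : R) (a b c z w : R[i]).

(** Squaring Bernoulli's inequality at [z] leaves a quadratic gain in [z - 1]: strict convexity in
    quantitative form. *)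
Lemma strict_bernoulli p (z : R) : 1 < p -> 1 <= z ->
  1 + p * (z ^+ 2 - 1) + p * (p - 1) * (z - 1) ^+ 2 <= (z ^+ 2) `^ p.
Proof.
move=> p1 z1; have z0 : 0 <= z by rewrite (le_trans ler01).
have B := bernoulli_powR p1 z0.
have L : 1 <= 1 + p * (z - 1) by rewrite lerDl mulr_ge0 ?subr_ge0// (le_trans ler01)// ltW.
have -> : (z ^+ 2) `^ p = (z `^ p) ^+ 2 by rewrite !expr2 powRM.
apply: (@le_trans _ _ ((1 + p * (z - 1)) ^+ 2)); last first.
  by rewrite lerXn2r ?nnegrE ?powR_ge0// (le_trans ler01).
by rewrite le_eqVlt; apply/orP; left; apply/eqP; ring.
Qed.

Lemma midpoint_gap p e : 1 < p -> 0 < e <= 1 -> exists2 d, 0 < d &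
  forall x, 0 <= x -> x <= 1 - e -> ((1 + x) / 2) `^ p + d <= (1 + x `^ p) / 2.
Proof.
move=> p1 /andP[e0 e1]; have p0 : 0 < p by rewrite (lt_trans ltr01).
pose k := p * (p - 1) * (e / 6) ^+ 2.
have k0 : 0 < k by rewrite !mulr_gt0 ?subr_gt0// exprn_gt0// divr_gt0.
pose h := (2^-1 : R) `^ p; have h0 : 0 < h by rewrite powR_gt0// invr_gt0.
exists (h * k / 2); first by rewrite divr_gt0// mulr_gt0.
move=> x x0 xe; pose m := (1 + x) / 2.
have m0 : 0 < m by rewrite /m; lra.
have m1 : m <= 1 by rewrite /m; lra.
have mh : 2^-1 <= m by rewrite /m; lra.
have T := tangent_powR p1 x0 (ltW m0).
(* [z ^+ 2] is the endpoint 1 divided by the midpoint [m], so [strict_bernoulli] sharpens the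
   tangent inequality at [m] evaluated at 1. The bound [e / 6] follows from [z ^+ 2 - 1 >= e / 2]
   and [z + 1 <= 3]. *)
pose z := Num.sqrt m^-1.
have mi : 0 <= m^-1 by rewrite invr_ge0 ltW.
have zm : z ^+ 2 = m^-1 by rewrite sqr_sqrtr.
have z0 : 0 <= z by exact: sqrtr_ge0.
have z1 : 1 <= z.
  rewrite -(@ler_pXn2r _ 2)// ?nnegrE// zm expr1n invf_ge1//.
have z2 : z <= 2.
  rewrite -(@ler_pXn2r _ 2)// ?nnegrE// zm.
  rewrite (@le_trans _ _ 2)//; last by rewrite expr2; lra.
  by rewrite -[leRHS]invrK lef_pV2// posrE.
have ze : e / 6 <= z - 1.
  have : e / 2 <= z ^+ 2 - 1.
    rewrite zm -(ler_pM2r m0) mulrBl mulVf ?gt_eqF// mul1r.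
    have : e / 2 * m <= e / 2 * 1 by rewrite ler_wpM2l// divr_ge0// ltW.
    rewrite /m; lra.
  rewrite (_ : z ^+ 2 - 1 = (z - 1) * (z + 1)); last by ring.
  have : (z - 1) * (z + 1) <= (z - 1) * 3 by rewrite ler_wpM2l ?subr_ge0//; lra.
  lra.
have S := strict_bernoulli p1 z1.
have kz : k <= p * (p - 1) * (z - 1) ^+ 2.
  rewrite /k ler_wpM2l ?mulr_ge0 ?subr_ge0 ?(ltW p1) ?(ltW p0)//.
  by rewrite lerXn2r ?nnegrE ?divr_ge0 ?(ltW e0) ?subr_ge0.
have mp0 : 0 < m `^ p by exact: powR_gt0.
have U : m `^ p + p * m `^ (p - 1) * (1 - m) + h * k <= 1.
  have E : m `^ p * (z ^+ 2) `^ p = 1.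
    by rewrite zm -powRM ?(ltW m0)// divff ?gt_eqF// powR1.
  rewrite -[leRHS]E (le_trans _ (ler_wpM2l (ltW mp0) S))// zm.
  have -> : m `^ p * (1 + p * (m^-1 - 1) + p * (p - 1) * (z - 1) ^+ 2)
     = m `^ p + p * m `^ (p - 1) * (1 - m) + m `^ p * (p * (p - 1) * (z - 1) ^+ 2).
    by rewrite (powR_subK p1 (ltW m0)); field; rewrite gt_eqF.
  rewrite lerD2l (@le_trans _ _ (m `^ p * k))//.
    rewrite ler_wpM2r ?(ltW k0)// /h; apply: ge0_ler_powR; rewrite ?nnegrE ?(ltW p0) ?(ltW m0)//.
  by rewrite ler_wpM2l// ltW.
move: T U; rewrite -/m.
have -> : p * m `^ (p - 1) * (x - m) = - (p * m `^ (p - 1) * (1 - m)) by rewrite /m; field.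
set u := p * _ * _; set v := h * k; set s := m `^ p; set t := x `^ p; lra.
Qed.

Lemma midpoint_powR p x : 1 < p -> 0 <= x -> ((1 + x) / 2) `^ p <= (1 + x `^ p) / 2.
Proof.
move=> p1 x0; set m := (1 + x) / 2.
have m0 : 0 <= m by rewrite /m; lra.
have T1 := tangent_powR p1 x0 m0.
have T2 := tangent_powR p1 (@ler01 R) m0.
move: T1 T2; rewrite powR1.
have -> : p * m `^ (p - 1) * (x - m) = - (p * m `^ (p - 1) * (1 - m)) by rewrite /m; field.
set u := p * _ * _; set s := m `^ p; set t := x `^ p; lra.
Qed.

Lemma unit_convexity p e : 1 < p -> 0 < e <= 1 -> exists2 d, 0 < d &
  forall c, normc c <= 1 -> e <= normc (1 - c) ->
    normc ((1 + c) / 2) `^ p + d <= (1 + normc c `^ p) / 2.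
Proof.
move=> p1 /andP[e0 e1]; have p0 : 0 < p by rewrite (lt_trans ltr01).
have e201 : 0 < e / 2 <= 1 by rewrite divr_gt0//=; lra.
have [d1 d10 H1] := midpoint_gap p1 e201.
(* Write [m = (1 + x) / 2] with [x = |c|]. If [1 - x <= e / 2], the parallelogram law bounds
   [|(1 + c) / 2|^2] by [m^2 + e^2 / 16 - e^2 / 4], and [m <= 1] turns this into [(m q)^2]. *)
pose q := Num.sqrt (1 - 3 * e ^+ 2 / 16).
have ee : e ^+ 2 <= 1 by rewrite expr_le1// ltW.
have ee0 : 0 < e ^+ 2 by rewrite exprn_gt0.
have q2 : q ^+ 2 = 1 - 3 * e ^+ 2 / 16 by rewrite sqr_sqrtr//; lra.
have q0 : 0 <= q by exact: sqrtr_ge0.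
have q1 : q < 1.
  by rewrite -(@ltr_pXn2r _ 2)// ?nnegrE// q2 expr1n; lra.
have qp1 : q `^ p < 1.
  have -> : 1 = 1 `^ p :> R by rewrite powR1.
  by apply: gt0_ltr_powR; rewrite ?nnegrE.
pose h := (2^-1 : R) `^ p; have h0 : 0 < h by rewrite powR_gt0// invr_gt0.
pose d2 := h * (1 - q `^ p).
have d20 : 0 < d2 by rewrite mulr_gt0// subr_gt0.
exists (Num.min d1 d2); first by rewrite lt_min d10.
move=> c c1 ce; set x := normc c in c1 *.
have x0 : 0 <= x by exact: normc_ge0.
have half z : normc (z / 2) = normc z / 2.
  by rewrite normcM normcV normc_nat.
pose m := (1 + x) / 2.
have nm : normc ((1 + c) / 2) <= m.
  by rewrite half ler_pM2r// (le_trans (ler_normcD _ _))// normc1.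
have m0 : 0 <= m by rewrite /m; lra.
have m1 : m <= 1 by rewrite /m; lra.
have mh : 2^-1 <= m by rewrite /m; lra.
have [xe|xe] := leP x (1 - e / 2).
  apply: le_trans (H1 x x0 xe).
  rewrite -/m lerD//; last by rewrite ge_min lexx.
  by apply: ge0_ler_powR; rewrite ?nnegrE ?normc_ge0 ?(ltW p0).
have nq : normc ((1 + c) / 2) <= m * q.
  suff : normc ((1 + c) / 2) ^+ 2 <= (m * q) ^+ 2.
    by rewrite ler_pXn2r// nnegrE; [exact: normc_ge0|exact: mulr_ge0].
  rewrite half expr_div_n (exprMn _ m q) q2.
  have par : normc (1 + c) ^+ 2 + normc (1 - c) ^+ 2 = 2 * (1 + x ^+ 2).
    by rewrite /x !normc_sq !ReImE /=; ring.
  have ce2 : e ^+ 2 <= normc (1 - c) ^+ 2 by rewrite lerXn2r ?nnegrE ?normc_ge0 ?(ltW e0).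
  have x2 : (1 - x) ^+ 2 <= (e / 2) ^+ 2.
    by rewrite lerXn2r ?nnegrE ?divr_ge0 ?(ltW e0) ?subr_ge0//; lra.
  have mm : m ^+ 2 <= 1 by rewrite expr_le1.
  have mm2 : m ^+ 2 * (3 * e ^+ 2 / 16) <= 3 * e ^+ 2 / 16.
    by rewrite ler_piMl// divr_ge0// mulr_ge0// ltW.
  have m2 : m ^+ 2 = (1 + x ^+ 2) / 2 - (1 - x) ^+ 2 / 4 by rewrite /m; field.
  have x2' : (1 - x) ^+ 2 <= e ^+ 2 / 4.
    by rewrite (le_trans x2)// le_eqVlt; apply/orP; left; apply/eqP; field.
  have -> : normc (1 + c) ^+ 2 / 2 ^+ 2 = normc (1 + c) ^+ 2 / 4 by field.
  rewrite mulrBr mulr1.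
  move: par ce2 mm2 m2 x2'; clear.
  set u := normc (1 + c) ^+ 2; set v := normc (1 - c) ^+ 2; set s := m ^+ 2; set t := (1 - x) ^+ 2.
  set k := e ^+ 2; set l := x ^+ 2; set n := s * _; lra.
have J : m `^ p <= (1 + x `^ p) / 2 by exact: midpoint_powR.
apply: le_trans J; rewrite (@le_trans _ _ (m `^ p * q `^ p + d2))//.
  rewrite lerD//; last by rewrite ge_min lexx orbT.
  rewrite -powRM//; apply: ge0_ler_powR => //; first exact: ltW.
    by rewrite nnegrE normc_ge0.
  by rewrite nnegrE; exact: mulr_ge0.
have hm : h <= m `^ p by apply: ge0_ler_powR; rewrite ?nnegrE ?(ltW p0) ?invr_ge0.
have : h * (1 - q `^ p) <= m `^ p * (1 - q `^ p) by rewrite ler_wpM2r// subr_ge0 ltW.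
by rewrite /d2 [leRHS]mulrBr mulr1; lra.
Qed.

(** Scaled to the larger of [|a|] and [|b|], either [|a - b|] is at most [e], or the midpoint gap
    [d] occurs and pays for [|a - b| <= 2]. The inequality is pointwise, hence can be averaged, and
    it covers all exponents above 1 at once. *)
Lemma uniform_convexity p e : 1 < p -> 0 < e <= 1 -> exists2 C, 0 <= C &
  forall a b, normc (a - b) `^ p <= e `^ p * (normc a `^ p + normc b `^ p)
     + C * ((normc a `^ p + normc b `^ p) / 2 - normc ((a + b) / 2) `^ p).
Proof.
move=> p1 e01; have p0 : 0 < p by rewrite (lt_trans ltr01).
have [d d0 H] := unit_convexity p1 e01; have /andP[e0 e1] := e01.
exists (2 `^ p / d); first by rewrite divr_ge0 ?powR_ge0// ltW.
move=> a b; wlog ba : a b / normc b <= normc a.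
  move=> W; have [/W//|/ltW/W] := leP (normc b) (normc a).
  by rewrite normc_dist (addrC b a) (addrC (normc b `^ p)).
have C0 : 0 <= 2 `^ p / d by rewrite divr_ge0 ?powR_ge0// ltW.
have [a0|a0] := eqVneq a 0.
  move: ba; rewrite a0 normc0 => ba.
  have -> : b = 0 by apply/eqP; rewrite -normc_eq0 eq_le normc_ge0 ba.
  rewrite subrr addr0 mul0r normc0 powR0 ?gt_eqF// addr0 mul0r subrr !mulr0 addr0//.
have na : 0 < normc a by rewrite normc_gt0.
pose c := b / a; have bE : b = a * c by rewrite /c mulrCA divff// mulr1.
have c1 : normc c <= 1 by rewrite /c normcM normcV ler_pdivrMr// mul1r.
clearbody c.
have ap : 0 < normc a `^ p by exact: powR_gt0.
have E1 : normc (a - b) `^ p = normc a `^ p * normc (1 - c) `^ p.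
  by rewrite bE -powRM ?normc_ge0// -normcM mulrBr mulr1.
have E2 : normc b `^ p = normc a `^ p * normc c `^ p.
  by rewrite bE -powRM ?normc_ge0// -normcM.
have E3 : normc ((a + b) / 2) `^ p = normc a `^ p * normc ((1 + c) / 2) `^ p.
  have -> : (a + b) / 2 = a * ((1 + c) / 2) by rewrite bE; ring.
  by rewrite normcM powRM ?normc_ge0.
rewrite E1 E2 E3.
have -> : e `^ p * (normc a `^ p + normc a `^ p * normc c `^ p) +
    2 `^ p / d * ((normc a `^ p + normc a `^ p * normc c `^ p) / 2 - normc a `^ p * normc ((1 + c) / 2) `^ p)
  = normc a `^ p * (e `^ p * (1 + normc c `^ p) +
      2 `^ p / d * ((1 + normc c `^ p) / 2 - normc ((1 + c) / 2) `^ p)) by field; rewrite gt_eqF.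
rewrite ler_pM2l//.
have cp0 : 0 <= normc c `^ p by exact: powR_ge0.
have ep0 : 0 <= e `^ p by exact: powR_ge0.
have half : normc ((1 + c) / 2) <= (1 + normc c) / 2.
  rewrite normcM normcV normc_nat ler_pM2r ?invr_gt0//.
  by rewrite (le_trans (ler_normcD _ _))// normc1.
have gap : 0 <= (1 + normc c `^ p) / 2 - normc ((1 + c) / 2) `^ p.
  rewrite subr_ge0 (le_trans _ (midpoint_powR p1 (normc_ge0 c)))//.
  apply: ge0_ler_powR; rewrite ?nnegrE ?normc_ge0 ?(ltW p0)//.
  by rewrite divr_ge0// addr_ge0 ?normc_ge0.
have [ce|ce] := leP e (normc (1 - c)).
  have L := H c c1 ce.
  have LC : 2 `^ p / d * d <= 2 `^ p / d * ((1 + normc c `^ p) / 2 - normc ((1 + c) / 2) `^ p).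
    by rewrite ler_wpM2l// lerBrDl.
  rewrite divfK ?gt_eqF// in LC.
  apply: le_trans (le_trans LC _); last by rewrite lerDr mulr_ge0 ?addr_ge0.
  apply: ge0_ler_powR; rewrite ?nnegrE ?normc_ge0 ?(ltW p0)//.
  by rewrite (le_trans (ler_normcB _ _))// normc1 -[leRHS]/(1 + 1) lerD2l.
apply: (@le_trans _ _ (e `^ p)).
  by apply: ge0_ler_powR; rewrite ?nnegrE ?normc_ge0 ?(ltW p0) ?(ltW e0)// ltW.
by rewrite mulrDr mulr1 -addrA lerDl addr_ge0// mulr_ge0.
Qed.

End UniformConvexity.

(** * Convergence in mean *)

Opaque normc powR expi.
Section MeanConvergence.
Variable R : realType.
Implicit Types (p q r s x y e A B : R) (u v : R -> R) (a b : nat -> R[i])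
  (z w : R[i]) (f g : R[i] -> R[i]).

Lemma powR_le1 p e : 1 < p -> 0 <= e <= 1 -> e `^ p <= e.
Proof.
move=> p1 /andP[e0 e1]; rewrite (powR_subK p1 e0) -[leRHS]mulr1 ler_wpM2l//.
have E1 : 1 `^ (p - 1) = 1 :> R by rewrite powR1.
by rewrite -[leRHS]E1; apply: ge0_ler_powR; rewrite ?nnegrE ?subr_ge0 ?(ltW p1).
Qed.

Lemma le_powR p x y : 1 < p -> 0 <= x -> x <= y -> x `^ p <= y `^ p.
Proof.
move=> p1 x0 xy; apply: ge0_ler_powR => //; rewrite ?nnegrE//; last exact: le_trans xy.
by rewrite ltW// (lt_trans ltr01).
Qed.

Lemma convex_powR2 p (l x y : R) : 1 < p -> 0 <= l <= 1 -> 0 <= x -> 0 <= y ->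
  (l * x + (1 - l) * y) `^ p <= l * x `^ p + (1 - l) * y `^ p.
Proof.
move=> p1 /andP[l0 l1] x0 y0; set m := l * x + _.
have l1' : 0 <= 1 - l by rewrite subr_ge0.
have m0 : 0 <= m by rewrite addr_ge0// mulr_ge0.
have T1 := ler_wpM2l l0 (tangent_powR p1 x0 m0).
have T2 := ler_wpM2l l1' (tangent_powR p1 y0 m0).
apply: le_trans (lerD T1 T2); rewrite le_eqVlt; apply/orP; left; apply/eqP.
by rewrite /m; ring.
Qed.

(** Convexity of the power with weights [A / (A + B)] and [B / (A + B)]. Positive upper bounds in
    place of norms avoid dividing by a norm that may vanish. *)
Lemma avg_minkowski p A B u v : 1 < p -> 0 < A -> 0 < B -> continuous u -> continuous v ->
  (forall t, 0 <= u t) -> (forall t, 0 <= v t) ->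
  avg (fun t => u t `^ p) <= A `^ p -> avg (fun t => v t `^ p) <= B `^ p ->
  avg (fun t => (u t + v t) `^ p) <= (A + B) `^ p.
Proof.
move=> p1 A0 B0 cu cv u0 v0 HA HB.
have AB : 0 < A + B by rewrite addr_gt0.
pose l := A / (A + B).
have l0 : 0 < l by rewrite divr_gt0.
have l1 : l < 1 by rewrite ltr_pdivrMr// mul1r ltrDl.
have l1E : 1 - l = B / (A + B) by rewrite /l; field; rewrite gt_eqF.
have cup := continuous_powR_comp p1 cu u0.
have cvp := continuous_powR_comp p1 cv v0.
have Ap : 0 < A `^ p by exact: powR_gt0.
have Bp : 0 < B `^ p by exact: powR_gt0.
have ABp : 0 < (A + B) `^ p by exact: powR_gt0.
pose k1 := (A + B) `^ p * (l / A `^ p); pose k2 := (A + B) `^ p * ((1 - l) / B `^ p).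
have l1' : 0 <= 1 - l by rewrite subr_ge0 ltW.
have k10 : 0 <= k1 := mulr_ge0 (ltW ABp) (divr_ge0 (ltW l0) (ltW Ap)).
have k20 : 0 <= k2 := mulr_ge0 (ltW ABp) (divr_ge0 l1' (ltW Bp)).
apply: (@le_trans _ _ (avg (fun t => k1 * u t `^ p + k2 * v t `^ p))).
  apply: le_avg.
  - apply: continuous_powR_comp => //; first exact: continuous_radd.
    by move=> t; rewrite addr_ge0.
  - by apply: continuous_radd; apply: continuous_rmul => //; exact: continuous_rcst.
  - move=> t.
    have E : u t + v t = (A + B) * (l * (u t / A) + (1 - l) * (v t / B)).
      by rewrite l1E /l; field; rewrite !gt_eqF.
    have xa : 0 <= u t / A by rewrite divr_ge0// ltW.
    have xb : 0 <= v t / B by rewrite divr_ge0// ltW.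
    rewrite E powRM ?(ltW AB)//; last exact: addr_ge0 (mulr_ge0 (ltW l0) xa) (mulr_ge0 l1' xb).
    have l01 : 0 <= l <= 1 by rewrite !ltW.
    apply: le_trans (ler_wpM2l (ltW ABp) (convex_powR2 p1 l01 xa xb)) _.
    have Aq (x a : R) : 0 < a -> 0 <= x -> (x / a) `^ p = x `^ p / a `^ p.
      move=> a0 x0; rewrite powRM ?invr_ge0 ?(ltW a0)//; congr (_ * _).
      by rewrite -powR_inv1 ?(ltW a0)// -powRrM mulrC powRrM powR_inv1 ?powR_ge0.
    rewrite !Aq// le_eqVlt; apply/orP; left; apply/eqP; rewrite /k1 /k2; ring.
have c1 : continuous (fun t => k1 * u t `^ p) by apply: continuous_rmul => //; exact: continuous_rcst.
have c2 : continuous (fun t => k2 * v t `^ p) by apply: continuous_rmul => //; exact: continuous_rcst.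
rewrite avgD// !avgZ//.
apply: le_trans (lerD (ler_wpM2l k10 HA) (ler_wpM2l k20 HB)) _.
by rewrite le_eqVlt; apply/orP; left; apply/eqP; rewrite /k1 /k2; field; rewrite !gt_eqF.
Qed.

Lemma avg_hoelder p q A B u v : 1 < p -> 1 < q -> p^-1 + q^-1 = 1 -> 0 < A -> 0 < B ->
  continuous u -> continuous v -> (forall t, 0 <= u t) -> (forall t, 0 <= v t) ->
  avg (fun t => u t `^ p) <= A `^ p -> avg (fun t => v t `^ q) <= B `^ q ->
  avg (fun t => u t * v t) <= A * B.
Proof.
move=> p1 q1 pq A0 B0 cu cv u0 v0 HA HB.
have p0 : 0 < p by rewrite (lt_trans ltr01).
have q0 : 0 < q by rewrite (lt_trans ltr01).
have cup := continuous_powR_comp p1 cu u0.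
have cvq := continuous_powR_comp q1 cv v0.
have Ap : 0 < A `^ p by exact: powR_gt0.
have Bq : 0 < B `^ q by exact: powR_gt0.
have AB0 : 0 < A * B by exact: mulr_gt0.
pose k1 := A * B / (p * A `^ p); pose k2 := A * B / (q * B `^ q).
have k10 : 0 <= k1 := divr_ge0 (ltW AB0) (mulr_ge0 (ltW p0) (ltW Ap)).
have k20 : 0 <= k2 := divr_ge0 (ltW AB0) (mulr_ge0 (ltW q0) (ltW Bq)).
have c1 : continuous (fun t => k1 * u t `^ p) by apply: continuous_rmul => //; exact: continuous_rcst.
have c2 : continuous (fun t => k2 * v t `^ q) by apply: continuous_rmul => //; exact: continuous_rcst.
apply: (@le_trans _ _ (avg (fun t => k1 * u t `^ p + k2 * v t `^ q))).
  apply: le_avg; [exact: continuous_rmul|exact: continuous_radd|] => t.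
  have xa : 0 <= u t / A by rewrite divr_ge0// ltW.
  have xb : 0 <= v t / B by rewrite divr_ge0// ltW.
  have := conjugate_powR xa xb p0 q0 pq.
  have Aq (r x a : R) : 0 < a -> 0 <= x -> (x / a) `^ r = x `^ r / a `^ r.
    move=> a0 x0; rewrite powRM ?invr_ge0 ?(ltW a0)//; congr (_ * _).
    by rewrite -powR_inv1 ?(ltW a0)// -powRrM mulrC powRrM powR_inv1 ?powR_ge0.
  rewrite !Aq// => /(ler_wpM2l (ltW AB0)); rewrite (_ : A * B * (_ * _) = u t * v t); last first.
    by field; rewrite !gt_eqF.
  move/le_trans; apply; rewrite le_eqVlt; apply/orP; left; apply/eqP.
  by rewrite /k1 /k2; field; rewrite !gt_eqF.
rewrite avgD// !avgZ//.
apply: le_trans (lerD (ler_wpM2l k10 HA) (ler_wpM2l k20 HB)) _.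
have -> : k1 * A `^ p + k2 * B `^ q = A * B * (p^-1 + q^-1).
  by rewrite /k1 /k2; field; rewrite !gt_eqF.
by rewrite pq mulr1.
Qed.

Lemma cauchy_formula f w r : holo f -> 0 <= r < 1 -> normc w < 1 ->
  f (r%:C * w) = cavg (fun t => f (r%:C * expi t) * ckernel w t).
Proof.
move=> F r01 w1; have P := holo_has_ps F.
have cf : ccont (fun t => f (r%:C * expi t)) by exact: ccont_circle.
have [Q QP <-//] := cauchy_transform cf; symmetry.
apply: (@has_ps_unique _ _ Q (fun z => f (r%:C * z)) w QP _ w1).
have := has_ps_dilate r01 P; congr has_ps; apply/funext => k.
by rewrite -(has_ps_circle_coef k P r01).
Qed.

(** Cauchy's formula on a larger circle; the difference of two kernels is a multiple of [z - w] with
    denominators bounded below. *)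
Lemma holo_lipschitz f r : holo f -> 0 <= r < 1 -> exists2 L, 0 <= L &
  forall z w, normc z <= r -> normc w <= r -> normc (f z - f w) <= L * normc (z - w).
Proof.
move=> F /andP[r0 r1]; pose s := (1 + r) / 2.
have s0 : 0 < s by rewrite /s; lra.
have s1 : s < 1 by rewrite /s; lra.
have rs : r < s by rewrite /s; lra.
clearbody s; have s01 : 0 <= s < 1 by rewrite ltW.
have cf := ccont_circle F s01.
pose B := avg (fun t => normc (f (s%:C * expi t))).
have B0 : 0 <= B by apply: avg_ge0 => t; exact: normc_ge0.
pose k := 1 - r / s; have k0 : 0 < k by rewrite subr_gt0 ltr_pdivrMr// mul1r.
exists (B / (s * k ^+ 2)).
  by rewrite divr_ge0// mulr_ge0 ?exprn_ge0 ?ltW.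
move=> z w zr wr.
have dil (u : R[i]) : u = s%:C * ((s^-1)%:C * u).
  by rewrite mulrA -realcM divff ?gt_eqF// mul1r.
have n1 (u : R[i]) : normc u <= r -> normc ((s^-1)%:C * u) <= r / s.
  by move=> ur; rewrite normcM normcR ger0_norm ?invr_ge0 ?(ltW s0)// mulrC ler_wpM2r ?invr_ge0 ?(ltW s0).
have lt1 (u : R[i]) : normc u <= r -> normc ((s^-1)%:C * u) < 1.
  by move=> /n1 h; rewrite (le_lt_trans h)// ltr_pdivrMr// mul1r.
have zz := lt1 z zr; have ww := lt1 w wr.
have ck1 := ccont_ckernel zz; have ck2 := ccont_ckernel ww.
have c1 := ccontM cf ck1; have c2 := ccontM cf ck2.
rewrite {1}(dil z) {1}(dil w) !(cauchy_formula F s01)// -cavgB//.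
apply: le_trans (normc_cavg (ccontB c1 c2)) _.
have -> : B / (s * k ^+ 2) * normc (z - w)
   = avg (fun t => (normc (z - w) / (s * k ^+ 2)) * normc (f (s%:C * expi t))).
  by rewrite avgZ; [rewrite /B; ring|exact: ccont_norm].
apply: le_avg.
- by apply: ccont_norm; exact: ccontB.
- by apply: continuous_rmul; [exact: continuous_rcst|exact: ccont_norm].
move=> t; rewrite -mulrBr normcM mulrC ler_wpM2r ?normc_ge0//.
have kn (u : R[i]) : normc u <= r -> k <= normc (1 - (s^-1)%:C * u * Num.conj (expi t)).
  move=> /n1 h; have := ler_dist_normc 1 ((s^-1)%:C * u * Num.conj (expi t)).
  rewrite normc1 normc_dist (normcM _ (Num.conj _)) normcJ normc_expi mulr1.
  rewrite normc_dist => /(le_trans (ler_norm _)); apply: le_trans.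
  by rewrite /k lerD2l lerN2.
have kz := kn z zr; have kw := kn w wr.
rewrite /ckernel.
have E (x y : R[i]) : x != 0 -> y != 0 -> x^-1 - y^-1 = (y - x) / (x * y).
  by move=> x0 y0; field; rewrite x0 y0.
have nz (u : R[i]) : k <= normc u -> u != 0 by move=> h; rewrite -normc_gt0 (lt_le_trans k0).
rewrite E ?nz// normcM normcV normcM.
have -> : normc (1 - (s^-1)%:C * w * Num.conj (expi t) - (1 - (s^-1)%:C * z * Num.conj (expi t)))
   = s^-1 * normc (z - w).
  rewrite (_ : _ - _ = (s^-1)%:C * (z - w) * Num.conj (expi t)); last by ring.
  by rewrite !normcM normcJ normc_expi mulr1 normcR ger0_norm// invr_ge0 ltW.
have nn : k ^+ 2 <= normc (1 - (s^-1)%:C * z * Num.conj (expi t)) * normc (1 - (s^-1)%:C * w * Num.conj (expi t)).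
  by rewrite expr2; exact: ler_pM (ltW k0) (ltW k0) kz kw.
have kk : 0 < k ^+ 2 by exact: exprn_gt0.
have -> : normc (z - w) / (s * k ^+ 2) = s^-1 * normc (z - w) / k ^+ 2.
  by field; rewrite !gt_eqF.
rewrite ler_wpM2l ?mulr_ge0 ?invr_ge0 ?(ltW s0) ?normc_ge0//.
by rewrite lef_pV2// posrE (lt_le_trans kk).
Qed.

Definition bounded_means p f K := forall r, 0 <= r < 1 -> mean p f r <= K.

(** On the fixed disc of radius [r1] the function is Lipschitz, so dilates by factors near 1, and
    their midpoint, are uniformly close to [f]. All moduli stay below [B], so closeness passes to
    p-th powers. *)
Lemma midpoint_mean_lower p f r1 h : 1 < p -> holo f -> 0 <= r1 < 1 -> 0 < h ->
  exists2 d, 0 < d <= 1 / 2 & forall r s, 1 - d < r < 1 -> 1 - d < s < 1 ->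
    mean p f r1 - h <=
    avg (fun t => normc ((f ((r * r1)%:C * expi t) + f ((s * r1)%:C * expi t)) / 2) `^ p).
Proof.
move=> p1 F r101 h0; have p0 : 0 < p by rewrite (lt_trans ltr01).
have [L L0 HL] := holo_lipschitz F r101.
have /andP[r10 r11] := r101.
pose B := normc (f 0) + L.
have B0 : 0 <= B by rewrite addr_ge0 ?normc_ge0.
have fB z : normc z <= r1 -> normc (f z) <= B.
  move=> zr; have z0 : normc (0 : R[i]) <= r1 by rewrite normc0.
  have := HL z 0 zr z0; rewrite subr0 => H.
  rewrite -(subrK (f 0) (f z)) (le_trans (ler_normcD _ _))// addrC lerD2l (le_trans H)//.
  by rewrite ler_piMr// (le_trans zr)// ltW.
pose k := p * B `^ (p - 1) * L.
have k0 : 0 <= k by rewrite !mulr_ge0 ?powR_ge0// ltW.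
pose d := Num.min (1 / 2) (h / (k + 1)).
have k1 : 0 < k + 1 by rewrite ltr_wpDl.
have d0 : 0 < d by rewrite lt_min !divr_gt0.
have d1 : d <= 1 / 2 by rewrite ge_min lexx.
have dk : d * (k + 1) <= h by rewrite -ler_pdivlMr// ge_min lexx orbT.
clearbody d.
have cm := continuous_circle_pow p1 F r101.
exists d; first by rewrite d0.
have n2 x t : 0 <= x < 1 -> normc ((x * r1)%:C * expi t) <= r1.
  by case/andP=> x0 x1; rewrite normc_circle ?mulr_ge0// ler_piMl// ltW.
have dom x : 0 <= x < 1 -> 0 <= x * r1 < 1.
  by case/andP=> x0 x1; rewrite mulr_ge0//= (le_lt_trans _ x1)// ler_piMr// ltW.
move=> r s /andP[rd rl] /andP[sd sl].
have r01 : 0 <= r < 1 by apply/andP; split => //; lra.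
have s01 : 0 <= s < 1 by apply/andP; split => //; lra.
have -> : mean p f r1 - h = avg (fun t => normc (f (r1%:C * expi t)) `^ p - h).
  by rewrite (avgB cm (@continuous_rcst R h)) avg_cst.
apply: le_avg.
- exact: (continuous_radd cm (@continuous_rcst R (- h))).
- apply: continuous_powR_comp => // [|t]; last exact: normc_ge0.
  apply: ccont_norm; apply: ccontM; last exact: ccont_cst.
  by apply: ccontD; apply: ccont_circle => //; exact: dom.
move=> t.
have n1 : normc (r1%:C * expi t) <= r1 by rewrite normc_circle.
have n3 x : 1 - d < x -> 0 <= x < 1 -> normc (f ((x * r1)%:C * expi t) - f (r1%:C * expi t)) <= L * d.
  move=> xd x01; rewrite (le_trans (HL _ _ (n2 x t x01) n1))// ler_wpM2l//.
  have -> : (x * r1)%:C * expi t - r1%:C * expi t = (- ((1 - x) * r1))%:C * expi t.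
    by apply: complex_ext; rewrite !ReImE /=; ring.
  case/andP: x01 => x0 x1.
  rewrite normc_mul_expi normcR normrN ger0_norm; last by rewrite mulr_ge0// subr_ge0 ltW.
  have : (1 - x) * r1 <= (1 - x) * 1 by rewrite ler_wpM2l ?subr_ge0 ?(ltW x1) ?(ltW r11).
  lra.
have n4 : normc ((f ((r * r1)%:C * expi t) + f ((s * r1)%:C * expi t)) / 2 - f (r1%:C * expi t)) <= L * d.
  have -> : (f ((r * r1)%:C * expi t) + f ((s * r1)%:C * expi t)) / 2 - f (r1%:C * expi t)
    = ((f ((r * r1)%:C * expi t) - f (r1%:C * expi t)) + (f ((s * r1)%:C * expi t) - f (r1%:C * expi t))) / 2.
    by field.
  rewrite normcM normcV normc_nat ler_pdivrMr// (le_trans (ler_normcD _ _))//.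
  by rewrite mulr_natr mulr2n lerD// n3.
have nB : normc ((f ((r * r1)%:C * expi t) + f ((s * r1)%:C * expi t)) / 2) <= B.
  rewrite normcM normcV normc_nat ler_pdivrMr// (le_trans (ler_normcD _ _))//.
  by rewrite mulr_natr mulr2n lerD// fB// n2.
have := @powR_lipschitz R p B (normc (f (r1%:C * expi t)))
  (normc ((f ((r * r1)%:C * expi t) + f ((s * r1)%:C * expi t)) / 2)) p1.
rewrite !normc_ge0 fB// nB => /(_ isT isT).
set X := normc (f (r1%:C * expi t)) `^ p; set Y := normc (_ / 2) `^ p => H.
have XY : X - Y <= k * d.
  rewrite (le_trans (ler_norm _))// (le_trans H)// /k -[leRHS]mulrA.
  rewrite ler_wpM2l ?mulr_ge0 ?powR_ge0 ?(ltW p0)//.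
  by rewrite (le_trans (ler_dist_normc _ _))// normc_dist.
have kd : k * d <= h by rewrite (le_trans _ dk)// mulrC ler_wpM2l ?(ltW d0)// lerDl.
by move: XY kd; clear; move: X Y (k * d) => X Y Z; lra.
Qed.

(** The means increase to a supremum [N]. The midpoint of two dilates has mean at least [N - 2 h]:
    on a smaller circle it is close to [f], and its means increase with the radius as well. Uniform
    convexity then forces the two dilates together. *)
Lemma radial_cauchy p f K : 1 < p -> holo f -> bounded_means p f K -> forall e, 0 < e ->
  exists2 r0, 0 <= r0 < 1 & forall r s, r0 < r < 1 -> r0 < s < 1 ->
    avg (fun t => normc (f (r%:C * expi t) - f (s%:C * expi t)) `^ p) <= e.
Proof.
move=> p1 F FK e e0; have p0 : 0 < p by rewrite (lt_trans ltr01).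
pose S := [set mean p f r | r in [set r | 0 <= r < 1]].
have hS : has_sup S.
  split; first by exists (mean p f 0), 0 => //=; rewrite lexx ltr01.
  by exists K => _ [r /= r01 <-]; exact: FK.
pose N := sup S.
have NS r : 0 <= r < 1 -> mean p f r <= N by move=> r01; apply: sup_ubound hS.2 _ _; exists r.
have N0 : 0 <= N by rewrite (le_trans (mean_ge0 p f 0))// NS// lexx ltr01.
pose ep := Num.min 1 (e / (4 * (N + 1))).
have N1 : 0 < 4 * (N + 1) by rewrite mulr_gt0// ltr_wpDl.
have ep0 : 0 < ep by rewrite lt_min ltr01 divr_gt0.
have ep1 : ep <= 1 by rewrite ge_min lexx.
have epe : ep * (4 * (N + 1)) <= e by rewrite -ler_pdivlMr// ge_min lexx orbT.
clearbody ep.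
have ep01 : 0 < ep <= 1 by rewrite ep0.
have [C C0 UC] := uniform_convexity p1 ep01.
pose h := e / (4 * (C + 1)).
have C1 : 0 < 4 * (C + 1) by rewrite mulr_gt0// ltr_wpDl.
have h0 : 0 < h by rewrite divr_gt0.
have hC : h * (4 * (C + 1)) = e by rewrite divfK// gt_eqF.
clearbody h.
have [_ [r1 /= r101 <-] Hr1] := sup_adherent h0 hS.
rewrite -/N in Hr1.
have /andP[r10 r11] := r101.
have [d /andP[d0 d1] low] := midpoint_mean_lower p1 F r101 h0.
exists (1 - d); first by apply/andP; split; lra.
move=> r s /andP[rd rl] /andP[sd sl].
have r01 : 0 <= r < 1 by apply/andP; split => //; lra.
have s01 : 0 <= s < 1 by apply/andP; split => //; lra.
(* An outer radius beyond [r] and [s]: rescaled by it, the midpoint of the two dilates becomes a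
   holomorphic function [g] on the whole disc, to which monotonicity of means applies. *)
pose tau := (1 + Num.max r s) / 2.
have mx1 : Num.max r s < 1 by rewrite gt_max rl sl.
have mxr : r <= Num.max r s by rewrite le_max lexx.
have mxs : s <= Num.max r s by rewrite le_max lexx orbT.
have tl : tau < 1 by rewrite /tau; lra.
have tr : r < tau by rewrite /tau; lra.
have ts : s < tau by rewrite /tau; lra.
clearbody tau; have r0 : 0 <= r by case/andP: r01. have s0 : 0 <= s by case/andP: s01.
have t0 : 0 < tau by rewrite (le_lt_trans r0).
have rt01 : 0 <= r / tau < 1 by rewrite divr_ge0 ?(ltW t0)//= ltr_pdivrMr// mul1r.
have st01 : 0 <= s / tau < 1 by rewrite divr_ge0 ?(ltW t0)//= ltr_pdivrMr// mul1r.
pose g z := 2^-1 * (f ((r / tau)%:C * z) + f ((s / tau)%:C * z)).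
have G : holo g by apply: holoZ; apply: holoD; exact: holo_dilate.
have mg : mean p g (tau * r1) <= mean p g tau.
  by apply: mean_homo => //; rewrite ?mulr_ge0 ?(ltW t0)// ler_piMr ?(ltW t0) ?(ltW r11).
have gE x t : g ((tau * x)%:C * expi t) = (f ((r * x)%:C * expi t) + f ((s * x)%:C * expi t)) / 2.
  rewrite /g mulrC; congr ((f _ + f _) / _); rewrite mulrA -realcM; congr (_%:C * _); field; rewrite gt_eqF//.
have m2 : mean p g tau = avg (fun t => normc ((f (r%:C * expi t) + f (s%:C * expi t)) / 2) `^ p).
  by apply: eq_avg => t; rewrite -[tau]mulr1 gE !mulr1.
have m1 : N - 2 * h <= mean p g (tau * r1).
  have step := low r s (introT andP (conj rd rl)) (introT andP (conj sd sl)).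
  have E : mean p g (tau * r1) = avg (fun t => normc ((f ((r * r1)%:C * expi t) + f ((s * r1)%:C * expi t)) / 2) `^ p).
    by apply: eq_avg => t; rewrite gE.
  by rewrite E; move: step Hr1; clear; move: (avg _) (mean _ _ _) => X Y; lra.
have mid : N - 2 * h <= avg (fun t => normc ((f (r%:C * expi t) + f (s%:C * expi t)) / 2) `^ p).
  by rewrite -m2; exact: le_trans m1 mg.
clear mg gE m2 m1 G g.
have c1 := continuous_circle_pow p1 F r01.
have c2 := continuous_circle_pow p1 F s01.
have cr := ccont_circle F r01; have cs := ccont_circle F s01.
have c3 : continuous (fun t => normc ((f (r%:C * expi t) + f (s%:C * expi t)) / 2) `^ p).
  apply: continuous_powR_comp => // [|t]; last exact: normc_ge0.
  by apply: ccont_norm; apply: ccontM; [exact: ccontD|exact: ccont_cst].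
have c4 : continuous (fun t => normc (f (r%:C * expi t) - f (s%:C * expi t)) `^ p).
  apply: continuous_powR_comp => // [|t]; last exact: normc_ge0.
  by apply: ccont_norm; exact: ccontB.
(* Averaged, the inequality yields at most [2 ep N + 2 C h]; [ep] and [h] were chosen so that each
   term is at most [e / 2]. *)
pose K1 := ep `^ p + C / 2.
have c12 : continuous (fun t => normc (f (r%:C * expi t)) `^ p + normc (f (s%:C * expi t)) `^ p).
  exact: continuous_radd.
apply: (@le_trans _ _ (avg (fun t => K1 * (normc (f (r%:C * expi t)) `^ p + normc (f (s%:C * expi t)) `^ p)
   - C * normc ((f (r%:C * expi t) + f (s%:C * expi t)) / 2) `^ p))).
  apply: le_avg => //.
    move=> t; apply: cvgB; first by apply: cvgM; [exact: cvg_cst|exact: c12].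
    by apply: cvgM; [exact: cvg_cst|exact: c3].
  move=> t; rewrite (le_trans (UC _ _))// le_eqVlt; apply/orP; left; apply/eqP.
  by rewrite /K1; field.
rewrite avgB; [|by apply: continuous_rmul => //; exact: continuous_rcst..].
rewrite !avgZ// avgD//.
have M1 := NS r r01; have M2 := NS s s01; rewrite /mean in M1 M2.
have K10 : 0 <= K1 by rewrite addr_ge0 ?powR_ge0// divr_ge0.
have ea := ler_wpM2l K10 (lerD M1 M2).
have eb := ler_wpM2l C0 mid.
have epp : ep `^ p <= ep by apply: powR_le1 => //; rewrite ltW.
have ec : ep `^ p * (N + N) <= ep * (N + N) by rewrite ler_wpM2r// addr_ge0.
have eN : 0 <= ep * N by rewrite mulr_ge0// ltW.
have hC0 : 0 <= h * C by rewrite mulr_ge0// ltW.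
move: ea eb ec epe hC; rewrite /K1.
have -> : (ep `^ p + C / 2) * (N + N) = ep `^ p * (N + N) + C * N by field.
have -> : C * (N - 2 * h) = C * N - 2 * (h * C) by ring.
have -> : ep * (4 * (N + 1)) = 4 * (ep * N) + 4 * ep by ring.
have -> : h * (4 * (C + 1)) = 4 * (h * C) + 4 * h by ring.
have -> : ep * (N + N) = 2 * (ep * N) by ring.
set X1 := _ * (avg _ + avg _); set X2 := C * avg _; set X3 := C * N; set X4 := h * C in hC0 *.
set X5 := ep * N in eN *; set X6 := _ * (N + N).
move: eN hC0 ep0 h0; clear; lra.
Qed.

End MeanConvergence.

(** * Approximation by dilates and polynomials *)

Section Density.
Variable R : realType.
Implicit Types (p q r s x y e A B K : R) (a b : nat -> R[i])
  (z w : R[i]) (f g : R[i] -> R[i]).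

Lemma bounded_meansD p f g A B : 1 < p -> holo f -> holo g -> 0 < A -> 0 < B ->
  bounded_means p f (A `^ p) -> bounded_means p g (B `^ p) ->
  bounded_means p (fun z => f z + g z) ((A + B) `^ p).
Proof.
move=> p1 F G A0 B0 FA GB r r01.
have cf := continuous_circle_norm F r01; have cg := continuous_circle_norm G r01.
have n0 (h : R[i] -> R[i]) t : 0 <= normc (h (r%:C * expi t)) by exact: normc_ge0.
have M := avg_minkowski p1 A0 B0 cf cg (n0 f) (n0 g) (FA r r01) (GB r r01).
apply: le_trans M; apply: le_avg.
- exact: (continuous_circle_pow p1 (holoD F G) r01).
- apply: (continuous_powR_comp p1 (continuous_radd cf cg)).
  by move=> t; exact: addr_ge0 (n0 f t) (n0 g t).
- by move=> t; exact: le_powR p1 (normc_ge0 _) (ler_normcD _ _).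
Qed.

Lemma bounded_means_le p f K L : K <= L -> bounded_means p f K -> bounded_means p f L.
Proof. by move=> KL H r /H h; exact: le_trans h KL. Qed.

Lemma bounded_meansZ p (c : R[i]) f A : 1 < p -> holo f -> 0 < A -> bounded_means p f (A `^ p) ->
  bounded_means p (fun z => c * f z) ((normc c * A) `^ p).
Proof.
move=> p1 F A0 FA r r01.
have -> : mean p (fun z => c * f z) r = avg (fun t => normc c `^ p * normc (f (r%:C * expi t)) `^ p).
  by apply: eq_avg => t; rewrite normcM powRM ?normc_ge0.
rewrite avgZ; last exact: (continuous_circle_pow p1 F r01).
by rewrite powRM ?normc_ge0 ?(ltW A0)// ler_wpM2l ?powR_ge0//; exact: FA.
Qed.

Lemma eq_bounded_means p f g K : (forall z, normc z < 1 -> f z = g z) ->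
  bounded_means p f K -> bounded_means p g K.
Proof.
move=> fg H r r01; rewrite (_ : mean p g r = mean p f r); first exact: H.
by apply: eq_avg => t; rewrite fg// normc_circle; case/andP: r01.
Qed.

Lemma bounded_means_sup p f B : 1 < p -> holo f -> 0 <= B ->
  (forall z, normc z < 1 -> normc (f z) <= B) -> bounded_means p f (B `^ p).
Proof.
move=> p1 F B0 H r r01; apply: le_avg_cst; first exact: (continuous_circle_pow p1 F r01).
move=> t; apply: (le_powR p1 (normc_ge0 _)); apply: H.
by case/andP: r01 => r0 r1; rewrite normc_circle.
Qed.

Lemma dilate_approx p f K : 1 < p -> holo f -> bounded_means p f K -> forall e, 0 < e ->
  exists2 r0, 0 <= r0 < 1 & forall r, r0 < r < 1 ->
    bounded_means p (fun z => f z - f (r%:C * z)) e.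
Proof.
move=> p1 F FK e e0; have [s0 /andP[s00 s01] H] := radial_cauchy p1 F FK e0.
pose r0 := (1 + s0) / 2.
have r00 : 0 <= r0 by rewrite /r0; lra.
have r01 : r0 < 1 by rewrite /r0; lra.
have r0s : s0 < r0 by rewrite /r0; lra.
have r0r0 : s0 < r0 * r0.
  rewrite -subr_gt0 (_ : _ - _ = ((1 - s0) / 2) ^+ 2); last by rewrite /r0; field.
  by rewrite exprn_gt0// divr_gt0// subr_gt0.
clearbody r0; exists r0; first by rewrite r00.
move=> r /andP[rr0 r1] s /andP[sge slt].
have r_0 : 0 <= r by rewrite (le_trans r00)// ltW.
have r_01 : 0 <= r < 1 by rewrite r_0.
have G : holo (fun z => f z - f (r%:C * z)) by apply: holoB => //; exact: holo_dilate.
(* Enlarging the radius only increases the mean, so it is enough to treat a radius [s'] for which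
   both [s'] and [r * s'] exceed [s0]; the product does because [s0 < r0 * r0]. *)
pose s' := Num.max s ((1 + r0) / 2).
have s'1 : s' < 1 by rewrite gt_max slt /=; lra.
have ss' : s <= s' by rewrite le_max lexx.
have r0s' : r0 < s'.
  by rewrite lt_max; apply/orP; right; lra.
clearbody s'.
apply: (le_trans (mean_homo p1 G sge ss' s'1)).
have s's : s0 < s' < 1 by rewrite s'1 (lt_trans r0s r0s').
have rs'1 : r * s' < 1.
  by rewrite (le_lt_trans _ s'1)// ler_piMl ?(ltW r1)// (le_trans r00)// ltW.
have rs's : s0 < r * s' < 1.
  by rewrite rs'1 (lt_le_trans r0r0)// ler_pM// ltW.
apply: le_trans (H s' (r * s') s's rs's).
rewrite le_eqVlt; apply/orP; left; apply/eqP/eq_avg => t.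
by rewrite mulrA -realcM.
Qed.

Lemma holo_psum a n : holo (psum a n).
Proof.
elim: n => [|n IH].
  rewrite (_ : psum a 0 = fun=> 0); first exact: holo_cst.
  by apply/funext => z; rewrite /psum big_ord0.
rewrite (_ : psum a n.+1 = fun z => psum a n z + a n * z ^+ n).
  apply: holoD => //; apply: holoZ => z _.
  by exists (n%:R * z ^+ n.-1 * 1); exact: (cderivX n (cderiv_id z)).
by apply/funext => z; rewrite psumS.
Qed.

Lemma psum_dilate a n r z : psum (fun k => (r ^+ k)%:C * a k) n z = psum a n (r%:C * z).
Proof. by apply: eq_bigr => k _; rewrite exprMn rmorphXn; ring. Qed.

Lemma poly_approx_sup a f r e : has_ps a f -> 0 <= r < 1 -> 0 < e ->
  exists N, forall n, (N <= n)%N -> forall z, normc z <= 1 ->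
    normc (f (r%:C * z) - psum (fun k => (r ^+ k)%:C * a k) n z) <= e.
Proof.
move=> F r01 e0; have [K [q [K0 q01 B]]] := F r r01.
have [N HN] := @geo_small R K q e q01 e0; exists N => n nN z z1.
have /andP[r0 r1] := r01.
rewrite psum_dilate (le_trans (B _ _ n))//; last exact/ltW/HN.
by rewrite normcM normcR ger0_norm// ler_piMr.
Qed.

(** A dilate close to [f] has a power series converging uniformly on the closed disc, and truncating
    that series gives the polynomial. *)
Lemma poly_approx p f K : 1 < p -> holo f -> bounded_means p f K -> forall e, 0 < e ->
  exists b n, bounded_means p (fun z => f z - psum b n z) (e `^ p).
Proof.
move=> p1 F FK e e0.
have e20 : 0 < e / 2 by rewrite divr_gt0.
have [r0 /andP[r00 r01] H] := dilate_approx p1 F FK (powR_gt0 p e20).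
pose r := (1 + r0) / 2.
have r1 : r0 < r < 1 by rewrite /r; apply/andP; split; lra.
have r_01 : 0 <= r < 1 by case/andP: r1 => h ->; rewrite (le_trans r00)// ltW.
have P := holo_has_ps F.
have [n Hn] := poly_approx_sup P r_01 e20.
pose b k := (r ^+ k)%:C * fcoef f k; exists b, n.
have hd := holo_dilate r_01 F.
have M1 := H r r1.
have M2 : bounded_means p (fun z => f (r%:C * z) - psum b n z) ((e / 2) `^ p).
  apply: bounded_means_sup => //; [exact: holoB (holo_psum _ _)|exact: ltW|].
  by move=> z z1; apply: Hn => //; exact: ltW.
have := bounded_meansD p1 (holoB F hd) (holoB hd (holo_psum b n)) e20 e20 M1 M2.
rewrite -splitr; apply: eq_bounded_means => z z1.
by rewrite addrA subrK.
Qed.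

Lemma conj_sum n (F : 'I_n -> R[i]) :
  Num.conj (\sum_(k < n) F k) = \sum_(k < n) Num.conj (F k).
Proof. exact: (@rmorph_sum _ _ Num.conj). Qed.

Lemma realcX (r : R) k : ((r ^+ k)%:C : R[i]) = r%:C ^+ k.
Proof. exact: rmorphXn. Qed.

Lemma pair_poly a f b n r s : has_ps a f -> 0 <= r < 1 ->
  cavg (fun t => f (r%:C * expi t) * Num.conj (psum b n (s%:C * expi t))) =
  \sum_(k < n) a k * (r ^+ k)%:C * Num.conj (b k * (s ^+ k)%:C).
Proof.
move=> P r01; have F := has_ps_holo P.
have cf := ccont_circle F r01.
transitivity (cavg (fun t => \sum_(k < n) Num.conj (b k * (s ^+ k)%:C) *
    (f (r%:C * expi t) * Num.conj (expi t) ^+ k))).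
  apply: eq_cavg => t; rewrite /psum conj_sum mulr_sumr; apply: eq_bigr => k _.
  by rewrite exprMn !conjM -realcX !conjX; ring.
rewrite cavg_sum => [|k]; last by apply: ccontZ; exact: ccontM cf (ccont_conjn _).
apply: eq_bigr => k _; rewrite cavgZ; last exact: ccontM cf (ccont_conjn _).
by rewrite (has_ps_circle_coef k P r01); ring.
Qed.

End Density.

(** * M. Riesz's theorem and the duality of Hardy spaces *)

Transparent expi.

Section ComplexLog.
Variable R : realType.
Implicit Types (p q r s x y e A B : R) (z w : R[i]) (f g : R[i] -> R[i]).

Lemma Re_expi (t : R) : complex.Re (expi t) = cos t.
Proof. by []. Qed.

Lemma Im_expi (t : R) : complex.Im (expi t) = sin t.
Proof. by []. Qed.

Lemma Re_realM r z : complex.Re (r%:C * z) = r * complex.Re z.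
Proof. by rewrite ReM /= mul0r subr0. Qed.

Lemma Im_realM r z : complex.Im (r%:C * z) = r * complex.Im z.
Proof. by rewrite ImM /= mul0r addr0. Qed.

(* The principal logarithm, used on the right half plane only. *)
Definition clog z : R[i] := ln (normc z) +i* atan (complex.Im z / complex.Re z).

Lemma normc_pos_Re z : 0 < complex.Re z -> 0 < normc z.
Proof. by move=> z0; rewrite (lt_le_trans z0)// (le_trans (ler_norm _) (normc_Re z)). Qed.

Lemma cos_clog z : 0 < complex.Re z -> normc z * cos (complex.Im (clog z)) = complex.Re z.
Proof.
move=> z0; have n0 := normc_pos_Re z0; rewrite [complex.Im (clog z)]/=.
set x := complex.Re z in z0 *; set y := complex.Im z; set th := atan (y / x).
have c0 : 0 < cos th by rewrite cos_gt0_pihalf// atan_gtNpi2 atan_ltpi2.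
have T : sin th = y / x * cos th.
  by have := atanK (y / x); rewrite -/th /tan => <-; rewrite divfK// gt_eqF.
have S := cos2Dsin2 th; have N := normc_sq z; rewrite -/x -/y in N.
have E : (normc z * cos th) ^+ 2 = x ^+ 2.
  apply: (@mulIf _ (1 + (y / x) ^+ 2)).
    by rewrite gt_eqF// ltr_pwDl// sqr_ge0.
  have -> : (normc z * cos th) ^+ 2 * (1 + (y / x) ^+ 2)
     = normc z ^+ 2 * (cos th ^+ 2 + (y / x * cos th) ^+ 2) by ring.
  by rewrite -T S mulr1 N; field; rewrite gt_eqF.
by apply/eqP; rewrite -(@eqrXn2 _ 2) ?(ltW (mulr_gt0 n0 c0)) ?(ltW z0) ?E.
Qed.

Lemma cexp_clog z : 0 < complex.Re z -> cexp (clog z) = z.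
Proof.
move=> z0; have n0 := normc_pos_Re z0; have C := cos_clog z0.
rewrite /clog cexp_log//; apply: complex_ext; rewrite ?Re_realM ?Im_realM ?Re_expi ?Im_expi//.
set x := complex.Re z in z0 *; set y := complex.Im z; set th := atan (y / x).
have c0 : 0 < cos th by rewrite cos_gt0_pihalf// atan_gtNpi2 atan_ltpi2.
have -> : sin th = y / x * cos th.
  by have := atanK (y / x); rewrite -/th /tan => <-; rewrite divfK// gt_eqF.
by rewrite mulrCA C -/x divfK// gt_eqF.
Qed.

Lemma ratio_cont z e : 0 < complex.Re z -> 0 < e -> exists2 d, 0 < d & forall w,
  normc (w - z) < d -> 0 < complex.Re w /\
    `|complex.Im w / complex.Re w - complex.Im z / complex.Re z| < e.
Proof.
move=> z0 e0; set x := complex.Re z in z0 *; set y := complex.Im z.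
have k0 : 0 < (x + `|y|) * (2 / x ^+ 2) by rewrite mulr_gt0 ?ltr_pwDl// divr_gt0// exprn_gt0.
exists (Num.min (x / 2) (e / ((x + `|y|) * (2 / x ^+ 2)))); first by rewrite lt_min !divr_gt0.
move=> w; rewrite lt_min => /andP[w1 w2].
set u := complex.Re w; set v := complex.Im w.
have hu : `|u - x| <= normc (w - z) by rewrite /u /x -ReN -ReD normc_Re.
have hv : `|v - y| <= normc (w - z) by rewrite /v /y -ImN -ImD normc_Im.
have u2 : x / 2 < u.
  by have := le_lt_trans hu w1; rewrite ltr_norml => /andP[+ _]; lra.
have u0 : 0 < u by rewrite (lt_trans _ u2)// divr_gt0.
split=> //.
have -> : v / u - y / x = ((v - y) * x - y * (u - x)) / (u * x).
  by field; rewrite !gt_eqF.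
rewrite normrM normfV (gtr0_norm (mulr_gt0 u0 z0)).
rewrite ltr_pdivrMr ?mulr_gt0//.
have b1 : `|(v - y) * x - y * (u - x)| <= (x + `|y|) * normc (w - z).
  rewrite (le_trans (ler_normB _ _))// !normrM (gtr0_norm z0) mulrDl.
  by rewrite (mulrC x) lerD// ?ler_wpM2r ?ler_wpM2l// ltW.
apply: (le_lt_trans b1).
have : normc (w - z) * ((x + `|y|) * (2 / x ^+ 2)) < e by rewrite -ltr_pdivlMr.
have x2 : 0 < x ^+ 2 / 2 by rewrite divr_gt0// exprn_gt0.
move=> h; have := h; rewrite -(ltr_pM2r x2).
have -> : normc (w - z) * ((x + `|y|) * (2 / x ^+ 2)) * (x ^+ 2 / 2) = (x + `|y|) * normc (w - z).
  by field; rewrite gt_eqF.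
move=> h2; apply: (lt_trans h2); rewrite ltr_pM2l//.
have -> : x ^+ 2 / 2 = x / 2 * x by ring.
by rewrite ltr_pM2r.
Qed.

Lemma clog_cont z e : 0 < complex.Re z -> 0 < e -> exists2 d, 0 < d & forall w,
  normc (w - z) < d -> 0 < complex.Re w /\ normc (clog w - clog z) < e.
Proof.
move=> z0 e0; have n0 := normc_pos_Re z0.
have e20 : 0 < e / 2 by rewrite divr_gt0.
have [d1 d10 H1] := (cont_epsP _ _).1 (continuous_ln n0) _ e20.
have [d2 d20 H2] := (cont_epsP _ _).1 (@continuous_atan R (complex.Im z / complex.Re z)) _ e20.
have [d3 d30 H3] := ratio_cont z0 d20.
exists (Num.min d1 d3); first by rewrite lt_min d10.
move=> w; rewrite lt_min => /andP[w1 w3]; have [w0 h3] := H3 w w3.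
split=> //; rewrite (le_lt_trans (normc_ReIm _))// (splitr e).
rewrite ReD ImD ReN ImN; apply: ltrD; last exact: (H2 _ h3).
by apply: H1; exact: (le_lt_trans (ler_dist_normc w z) w1).
Qed.

(** An inverse function argument: by continuity the increment [k] of the logarithm is small enough
    for the expansion of [cexp] at [clog z], which first bounds [k] by [2 / |z|] times the increment
    of [z] and then gives the derivative. *)
Lemma clog_derive z : 0 < complex.Re z -> cderiv clog z z^-1.
Proof.
move=> z0 e e0; have n0 := normc_pos_Re z0.
have zn : z != 0 by rewrite -normc_gt0.
pose c := normc z; have c0 : 0 < c by [].
pose eta := Num.min (c / 2) (e * c ^+ 2 / 2).
have eta0 : 0 < eta.
  by rewrite lt_min divr_gt0//= divr_gt0// mulr_gt0// exprn_gt0.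
have [d1 d10 H1] := cexp_derive (clog z) eta0.
have [d d0 H] := clog_cont z0 d10.
exists d => // w wd; have [w0 wl] := H w wd.
have := H1 _ wl; rewrite !cexp_clog//.
set k := clog w - clog z; set h := w - z => B.
have kb : normc k <= 2 / c * normc h.
  have b1 : c * normc k <= normc h + c / 2 * normc k.
    rewrite /c -normcM.
    have -> : z * k = h - (h - z * k) by ring.
    rewrite (le_trans (ler_normcB _ _))// lerD2l (le_trans B)//.
    by rewrite ler_wpM2r ?normc_ge0// ge_min lexx.
  have b2 : c / 2 * normc k <= normc h by move: b1; lra.
  have -> : 2 / c * normc h = normc h / (c / 2) by field; rewrite gt_eqF.
  by rewrite ler_pdivlMr ?divr_gt0// mulrC.
have -> : k - z^-1 * h = - (z^-1 * (h - z * k)) by field.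
rewrite normc_opp normcM normcV -/c.
rewrite mulrC ler_pdivrMr// (le_trans B)//.
apply: (@le_trans _ _ (e * c ^+ 2 / 2 * (2 / c * normc h))).
  rewrite (@le_trans _ _ (e * c ^+ 2 / 2 * normc k))//.
    by rewrite ler_wpM2r ?normc_ge0// ge_min lexx orbT.
  by rewrite ler_wpM2l// divr_ge0// mulr_ge0 ?exprn_ge0// ltW.
have -> : e * c ^+ 2 / 2 * (2 / c * normc h) = e * normc h * c by field; rewrite gt_eqF.
exact: lexx.
Qed.

(** For angles near [pi / 2] the multiple [q th] lies between [a > pi / 2] and [pi], where its
    cosine is at most [cos a < 0], and [B] makes the second term at least 1. For angles up to
    [t1 = a / q] the cosine of [th] is bounded below, and [A] compensates [1 + B]. The bound
    [q <= 2] keeps [q th] within [pi]. *)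
Lemma trig_inequality q : 1 < q <= 2 -> exists A B, [/\ 0 < A, 0 <= B & forall th,
  - (pi / 2) < th < pi / 2 -> 1 <= A * cos th `^ q - B * cos (q * th)].
Proof.
move=> /andP[q1 q2]; have q0 : 0 < q by rewrite (lt_trans _ q1).
have P := @pi_gt0 R.
pose a : R := (q * (pi / 2) + pi / 2) / 2.
have a1 : pi / 2 < a by rewrite /a; nra.
have a2 : a < q * (pi / 2) by rewrite /a; nra.
have a3 : q * (pi / 2) <= pi by nra.
have m0 : 0 < - cos a.
  rewrite oppr_gt0 -(@cos_pihalf R) ltr_cos//; rewrite in_itv/=; apply/andP; split; lra.
pose t1 : R := a / q.
have t1q : q * t1 = a by rewrite /t1 mulrC divfK// gt_eqF.
have t12 : t1 < pi / 2 by rewrite /t1 ltr_pdivrMr// mulrC.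
have t10 : 0 < t1 by rewrite divr_gt0//; lra.
have k0 : 0 < cos t1 by rewrite cos_gt0_pihalf// t12 andbT; lra.
pose B : R := (- cos a)^-1; have B0 : 0 < B by rewrite invr_gt0.
pose A : R := (1 + B) / cos t1 `^ q.
have A0 : 0 < A by rewrite divr_gt0 ?powR_gt0// addr_gt0.
exists A, B; split => //; first exact: ltW.
suff H th : 0 <= th < pi / 2 -> 1 <= A * cos th `^ q - B * cos (q * th).
  move=> th /andP[h1 h2]; have [h0|h0] := leP 0 th; first by apply: H; rewrite h0.
  by have := H (- th); rewrite mulrN !cosN; apply; apply/andP; split; lra.
move=> /andP[h1 h2].
have c0 : 0 < cos th by rewrite cos_gt0_pihalf// h2 andbT; lra.
have [h3|h3] := leP th t1.
  have b1 : cos t1 <= cos th.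
    by rewrite leNgt ltr_cos -?leNgt// in_itv/=; apply/andP; split; lra.
  have b2 : 1 + B <= A * cos th `^ q.
    have -> : 1 + B = A * cos t1 `^ q by rewrite /A divfK// gt_eqF// powR_gt0.
    by rewrite ler_pM2l// le_powR// ltW.
  have b3 : B * cos (q * th) <= B * 1 by rewrite ler_pM2l// cos_le1.
  by lra.
have b1 : cos (q * th) <= cos a.
  have h4 : a <= q * th by rewrite -t1q ler_pM2l// ltW.
  have h5 : q * th <= pi by rewrite (le_trans _ a3)// ler_pM2l// ltW.
  by rewrite leNgt ltr_cos -?leNgt// in_itv/=; apply/andP; split; lra.
have b2 : B * - cos a <= B * - cos (q * th) by rewrite ler_pM2l// lerN2.
have b3 : B * - cos a = 1 by rewrite /B mulVf// gt_eqF.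
have b4 : 0 <= A * cos th `^ q by rewrite mulr_ge0 ?powR_ge0// ltW.
by lra.
Qed.

End ComplexLog.
Opaque expi.

(** * Calderon's method for exponents at most 2 *)

Section SmallExponent.
Variable R : realType.
Implicit Types (p q r s x y e A B D E : R) (u : R -> R) (w : R -> R[i]) (z : R[i]) (f g F Q : R[i] -> R[i]).

Lemma circle_mean f r : holo f -> 0 <= r < 1 -> cavg (fun t => f (r%:C * expi t)) = f 0.
Proof.
move=> F r01; have P := holo_has_ps F.
rewrite (has_ps_at0 P) -[RHS]mul1r -(has_ps_circle_coef 0 P r01).
by apply: eq_cavg => t; rewrite expr0 mulr1.
Qed.

(* Calderon's device: [F^q] is holomorphic, and its real part has nonnegative mean. *)
Lemma calderon q : 1 < q <= 2 -> exists2 A, 0 < A & forall F, holo F ->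
  (forall z, normc z < 1 -> 0 < complex.Re (F z)) -> complex.Im (F 0) = 0 ->
  forall r, 0 <= r < 1 -> mean q F r <= A * avg (fun t => complex.Re (F (r%:C * expi t)) `^ q).
Proof.
move=> q12; have [A [B [A0 B0 T]]] := trig_inequality q12; have /andP[q1 _] := q12.
exists A => // F HF F0 F00 r r01.
have z1 t : normc (r%:C * expi t) < 1 by case/andP: r01 => r0 r1; rewrite normc_circle.
pose V z := cexp (q%:C * clog (F z)).
have HV : holo V.
  move=> z /[dup] zl /HF[l Hl]; exists (cexp (q%:C * clog (F z)) * (q%:C * ((F z)^-1 * l))).
  apply: (cderiv_comp _ (cexp_derive _)); apply: cderivZ.
  exact: (cderiv_comp Hl (clog_derive (F0 z zl))).
have ReV z : normc z < 1 ->
    complex.Re (V z) = normc (F z) `^ q * cos (q * complex.Im (clog (F z))).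
  move=> zl; have n0 := normc_pos_Re (F0 z zl).
  rewrite /V /cexp Re_realM Re_expi Re_realM Im_realM [complex.Re (clog _)]/= -ln_powR lnK//.
  by rewrite posrE powR_gt0.
(* [F 0] is a positive real number, so its power [V 0] has nonnegative real part, and by the mean
   value property so has the average of [V] over any circle. The term with factor [B] can therefore
   be dropped. *)
have V0 : 0 <= complex.Re (V 0).
  have z0 : normc (0 : R[i]) < 1 by rewrite normc0.
  by rewrite ReV// [complex.Im (clog _)]/= F00 mul0r atan0 mulr0 cos0 mulr1 powR_ge0.
have cV : continuous (fun t => complex.Re (V (r%:C * expi t))) by exact/ccont_Re/ccont_circle.
have aV : 0 <= avg (fun t => complex.Re (V (r%:C * expi t))).
  by rewrite -Re_cavg (circle_mean HV r01).
have cF : continuous (fun t => complex.Re (F (r%:C * expi t)) `^ q).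
  apply: (continuous_powR_comp q1); first exact/ccont_Re/ccont_circle.
  by move=> t; apply/ltW/F0.
have cN := continuous_circle_pow q1 HF r01.
suff : avg (fun t => normc (F (r%:C * expi t)) `^ q + B * complex.Re (V (r%:C * expi t)))
    <= avg (fun t => A * complex.Re (F (r%:C * expi t)) `^ q).
  rewrite avgD ?avgZ//; last exact: (continuous_rmul (@continuous_rcst _ B) cV).
  by apply: le_trans; rewrite lerDl; exact: mulr_ge0 B0 aV.
apply: le_avg.
- exact: (continuous_radd cN (continuous_rmul (@continuous_rcst _ B) cV)).
- exact: (continuous_rmul (@continuous_rcst _ A) cF).
move=> t; rewrite ReV//; have P := F0 _ (z1 t); have n0 := normc_pos_Re P.
rewrite -(cos_clog P); set th := complex.Im _; set x := normc _ in n0 *.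
have hth : - (pi / 2) < th < pi / 2 by rewrite atan_gtNpi2 atan_ltpi2.
have c0 : 0 <= cos th by apply/ltW/cos_gt0_pihalf.
rewrite (powRM _ (ltW n0) c0).
have := T th hth; rewrite -(ler_pM2l (powR_gt0 q n0)) mulr1 mulrBr; lra.
Qed.

Lemma ckernel0 (t : R) : ckernel 0 t = 1.
Proof. by rewrite /ckernel mul0r subr0 invr1. Qed.

Lemma cavg_real u : cavg (fun t => (u t)%:C) = (avg u)%:C.
Proof.
apply: complex_ext; rewrite ?Re_cavg ?Im_cavg; first exact: eq_avg.
by rewrite -[RHS](avg_cst (0 : R)); apply: eq_avg.
Qed.

(** The real part of [F = 2 Q - avg u] is the Poisson integral of [u], positive and real at the
    centre, so Calderon's inequality applies; Jensen's inequality bounds the means of [Re F] by [u].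
    Finally [Q] is half of [F + F 0]. The lower bound [e] gives strict positivity and does not enter
    the constant. *)
Lemma cauchy_positive q : 1 < q <= 2 -> exists2 A, 0 < A & forall u e E Q,
  continuous u -> 0 < e -> (forall t, e <= u t) -> 0 < E -> avg (fun t => u t `^ q) <= E `^ q ->
  holo Q -> (forall z, normc z < 1 -> Q z = cavg (fun t => (u t)%:C * ckernel z t)) ->
  bounded_means q Q ((A * E) `^ q).
Proof.
move=> q12; have [A0 A00 CAL] := calderon q12; have /andP[q1 _] := q12.
have q0 : 0 < q by rewrite (lt_trans _ q1).
pose A := A0 `^ q^-1; have AP : 0 < A by rewrite powR_gt0.
have AE : A `^ q = A0 by rewrite /A -powRrM mulVf ?gt_eqF// powRr1// ltW.
exists A => // u e E Q cu e0 eu E0 uE HQ QE.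
have u0 t : 0 <= u t by rewrite (le_trans (ltW e0)).
pose F z := 2 * Q z - (avg u)%:C.
have HF : holo F by apply: holoB; [exact: holoZ|exact: holo_cst].
have ReF z : normc z < 1 -> complex.Re (F z) = avg (fun t => pkernel z t * u t).
  by move=> z1; rewrite /F QE// Re_cauchy_transform.
have n00 : normc (0 : R[i]) < 1 by rewrite normc0.
have Q0 : Q 0 = (avg u)%:C.
  by rewrite QE// -cavg_real; apply: eq_cavg => t; rewrite ckernel0 mulr1.
have F0 : F 0 = (avg u)%:C by rewrite /F Q0; ring.
have posF z : normc z < 1 -> 0 < complex.Re (F z).
  move=> z1; rewrite ReF// (lt_le_trans e0)//.
  have -> : e = avg (fun t => e * pkernel z t).
    by rewrite avgZ ?avg_pkernel ?mulr1//; exact: continuous_pkernel.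
  apply: le_avg.
  - exact: (continuous_rmul (@continuous_rcst _ e) (continuous_pkernel z1)).
  - exact: (continuous_rmul (continuous_pkernel z1) cu).
  - by move=> t; rewrite mulrC ler_wpM2l// pkernel_ge0.
have cuq : continuous (fun t => u t `^ q) by exact: continuous_powR_comp.
have [Fh HFh [ReFh Fh0]] := poisson_transform cuq.
have BF : bounded_means q F ((A * E) `^ q).
  move=> r r01; have z1 t : normc (r%:C * expi t) < 1.
    by case/andP: r01 => r0 r1; rewrite normc_circle.
  have F00 : complex.Im (F 0) = 0 by rewrite F0.
  rewrite (le_trans (CAL F HF posF F00 r r01))//.
  have -> : (A * E) `^ q = A0 * E `^ q by rewrite (powRM _ (ltW AP) (ltW E0)) AE.
  apply: (ler_wpM2l (ltW A00)); apply: le_trans uE.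
  have -> : avg (fun t => u t `^ q) = avg (fun t => complex.Re (Fh (r%:C * expi t))).
    by rewrite -Re_cavg (circle_mean HFh r01) Fh0.
  apply: le_avg.
  - apply: (continuous_powR_comp q1); first exact/ccont_Re/ccont_circle.
    by move=> t; apply/ltW/posF.
  - exact/ccont_Re/ccont_circle.
  move=> t; rewrite ReFh// ReF//.
  by apply: avg_jensen => //; [exact: continuous_pkernel|move=> s; exact: pkernel_ge0|exact: avg_pkernel].
have AE0 : 0 < A * E by rewrite mulr_gt0.
have B0 : bounded_means q (fun=> F 0) ((A * E) `^ q).
  have := BF 0; rewrite lexx ltr01 => /(_ isT) h r r01; apply: le_trans h.
  by rewrite le_eqVlt; apply/orP; left; apply/eqP/eq_avg => t; rewrite mul0r.
have BD := bounded_meansD q1 HF (@holo_cst R (F 0)) AE0 AE0 BF B0.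
have := bounded_meansZ (2^-1) q1 (holoD HF (@holo_cst R (F 0))) (addr_gt0 AE0 AE0) BD.
have -> : normc (2^-1 : R[i]) * (A * E + A * E) = A * E.
  by rewrite normcV normc_nat; field.
by apply: eq_bounded_means => z z1; rewrite F0 /F; field.
Qed.

(** Boundedness of the Riesz projection from [L^q] to [H^q], tested on continuous functions only. *)
Definition riesz_bound q := exists2 A, 0 < A & forall w D Q, ccont w -> 0 < D ->
  avg (fun t => normc (w t) `^ q) <= D `^ q ->
  has_ps (fun k => cavg (fun t => w t * Num.conj (expi t) ^+ k)) Q ->
  bounded_means q Q ((A * D) `^ q).

Lemma riesz_small q : 1 < q <= 2 -> riesz_bound q.
Proof.
move=> q12; have [A A0 POS] := cauchy_positive q12; have /andP[q1 _] := q12.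
(* The function is [(u1 - u0) + i (u2 - u0)], with each of these lying between [D] and [2 |w| + D]:
   four projections, each bounded by [3 A D]. *)
exists (12 * A); first by rewrite mulr_gt0.
move=> w D Q cw D0 wD PQ.
have cn := ccont_norm cw.
pose N t := normc (w t) + D.
pose u0 := N; pose u1 t := N t + complex.Re (w t); pose u2 t := N t + complex.Im (w t).
have cN : continuous N by exact: (continuous_radd cn (@continuous_rcst _ D)).
have c1 : continuous u1 by apply: (continuous_radd cN); exact: ccont_Re.
have c2 : continuous u2 by apply: (continuous_radd cN); exact: ccont_Im.
have bd v : continuous v -> (forall t, D <= v t <= 2 * normc (w t) + D) ->
   exists2 Qv, holo Qv & (forall z, normc z < 1 -> Qv z = cavg (fun t => (v t)%:C * ckernel z t))
     /\ bounded_means q Qv ((A * (2 * D + D)) `^ q).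
  move=> cv vb; have [Qv Pv Ev] := cauchy_transform (ccont_real cv).
  have Hv := has_ps_holo Pv; exists Qv => //; split => //.
  have D2 : 0 < 2 * D by rewrite mulr_gt0.
  apply: (POS v D) => //; [by move=> t; case/andP: (vb t)|exact: addr_gt0|].
  have v0 t : 0 <= v t by case/andP: (vb t) => h _; rewrite (le_trans (ltW D0)).
  have c2w : continuous (fun t => 2 * normc (w t)).
    exact: (continuous_rmul (@continuous_rcst _ 2) cn).
  have n2 t : 0 <= 2 * normc (w t) by rewrite mulr_ge0 ?normc_ge0.
  have M := avg_minkowski q1 D2 D0 c2w (@continuous_rcst _ D) n2 (fun=> ltW D0).
  apply: le_trans (M _ _).
  - apply: le_avg; first exact: continuous_powR_comp.
      apply: (continuous_powR_comp q1).
        exact: (continuous_radd c2w (@continuous_rcst _ D)).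
      by move=> t; exact: addr_ge0 (n2 t) (ltW D0).
    by move=> t; apply: (le_powR q1) => //; case/andP: (vb t).
  - have -> : avg (fun t => (2 * normc (w t)) `^ q) = avg (fun t => 2 `^ q * normc (w t) `^ q).
      by apply: eq_avg => t; rewrite powRM// normc_ge0.
    rewrite avgZ; last by apply: (continuous_powR_comp q1 cn) => t; exact: normc_ge0.
    by rewrite powRM ?(ltW D0)// ler_wpM2l// powR_ge0.
  - by rewrite avg_cst.
have rb t : `|complex.Re (w t)| <= normc (w t) by exact: normc_Re.
have ib t : `|complex.Im (w t)| <= normc (w t) by exact: normc_Im.
have n0 t : 0 <= normc (w t) by exact: normc_ge0.
have [|Q0 H0 [E0 B0]] := bd u0 cN.
  by move=> t; rewrite /u0 /N; have := n0 t; move=> h; apply/andP; split; lra.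
have [|Q1 H1 [E1 B1]] := bd u1 c1.
  by move=> t; have := rb t; rewrite ler_norml /u1 /N => /andP[h1 h2]; apply/andP; split; lra.
have [|Q2 H2 [E2 B2]] := bd u2 c2.
  by move=> t; have := ib t; rewrite ler_norml /u2 /N => /andP[h1 h2]; apply/andP; split; lra.
pose K := A * (2 * D + D).
have K0 : 0 < K by rewrite mulr_gt0// addr_gt0// mulr_gt0.
have Bm := bounded_meansZ (-1) q1 H0 K0 B0; rewrite normc_opp normc1 mul1r in Bm.
have Hm := holoZ (-1) H0.
have S1 := bounded_meansD q1 H1 Hm K0 K0 B1 Bm.
have S2 := bounded_meansD q1 H2 Hm K0 K0 B2 Bm.
have KK := addr_gt0 K0 K0.
pose i : R[i] := 0 +i* 1.
have ni : normc i = 1.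
  by apply/eqP; rewrite -(@eqrXn2 _ 2) ?normc_ge0// normc_sq /= expr0n expr1n add0r.
have S3 := bounded_meansZ i q1 (holoD H2 Hm) KK S2; rewrite ni mul1r in S3.
have := bounded_meansD q1 (holoD H1 Hm) (holoZ i (holoD H2 Hm)) KK KK S1 S3.
have -> : K + K + (K + K) = 12 * A * D by rewrite /K; ring.
apply: eq_bounded_means => z z1.
have [Q' PQ' EQ'] := cauchy_transform cw.
rewrite (has_ps_unique PQ PQ' z1) EQ'// E0// E1// E2//.
have ck := ccont_ckernel z1.
have k0 := ccontM (ccont_real cN) ck; have k1 := ccontM (ccont_real c1) ck.
have k2 := ccontM (ccont_real c2) ck.
rewrite -!cavgZ// -!cavgD//; try by apply: ccontZ.
  rewrite -cavgZ; last by apply: ccontD => //; exact: ccontZ.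
  rewrite -cavgD; [|by apply: ccontD => //; exact: ccontZ|by apply/ccontZ/ccontD => //; exact: ccontZ].
  apply: eq_cavg => t; rewrite /u0 /u1 /u2.
  have -> : w t = (complex.Re (w t))%:C + i * (complex.Im (w t))%:C.
    by apply: complex_ext; rewrite !ReImE /=; ring.
  rewrite !ReImE /= !(mul0r, mul1r, mulr0, mulr1, subr0, addr0, add0r).
  have rD (a b : R) : (a + b)%:C = a%:C + b%:C by rewrite rmorphD.
  rewrite !rD; ring.
Qed.

End SmallExponent.

(** * Representation of functionals and Riesz's theorem for all exponents *)

Section Duality.
Variable R : realType.
Implicit Types (p q r s x y e A B D K : R) (u : R -> R) (w h : R -> R[i]) (z : R[i])
  (b c : nat -> R[i]) (f g Q : R[i] -> R[i]).

Lemma conj_exponent p q : 1 < p -> p^-1 + q^-1 = 1 -> 1 < q.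
Proof.
move=> p1 pq; have p0 : 0 < p by rewrite (lt_trans _ p1).
have qE : q^-1 = 1 - p^-1 by rewrite -pq addrAC subrr add0r.
have i1 : p^-1 < 1 by rewrite invf_lt1.
have i0 : 0 < p^-1 by rewrite invr_gt0.
have q0 : 0 < q^-1 by rewrite qE subr_gt0.
have q0' : 0 < q by rewrite -invr_gt0.
by rewrite -(invf_lt1 q0') qE ltrBlDr ltrDl.
Qed.

(* The function [|h|^(p-2) h], extremal for the duality of [L^p] and [L^q]. *)
Definition dual_fun p h (t : R) : R[i] := (normc (h t) `^ (p - 2))%:C * h t.

Lemma normc_dual_fun p h t : 1 < p -> normc (dual_fun p h t) = normc (h t) `^ (p - 1).
Proof.
move=> p1; rewrite normcM normcR ger0_norm ?powR_ge0//.
have [->|h0] := eqVneq (normc (h t)) 0; first by rewrite mulr0 powR0// gt_eqF// subr_gt0.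
rewrite -[X in _ * X](powRr1 (normc_ge0 _)) -powRD ?h0 ?implybT//.
by congr (_ `^ _); ring.
Qed.

Lemma dual_funE p h t : 1 < p -> h t * Num.conj (dual_fun p h t) = (normc (h t) `^ p)%:C.
Proof.
move=> p1; rewrite conjM mulrCA mulJ_normc.
have -> : Num.conj (normc (h t) `^ (p - 2))%:C = (normc (h t) `^ (p - 2))%:C :> R[i].
  by apply: complex_ext; rewrite ?ReJ ?ImJ ?oppr0.
rewrite -realcM; congr (_%:C).
have [->|h0] := eqVneq (normc (h t)) 0.
  by rewrite expr0n mulr0 powR0// gt_eqF// (lt_trans _ p1).
rewrite -powR_mulrn ?normc_ge0// -powRD ?h0 ?implybT//.
by congr (_ `^ _); ring.
Qed.

(** The exponent [p - 2] may be negative, so at a zero of [h] continuity comes from the modulus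
    [|h|^(p-1)]; elsewhere the power is an exponential of a logarithm. *)
Lemma ccont_dual_fun p h : 1 < p -> ccont h -> ccont (dual_fun p h).
Proof.
move=> p1 ch t; have p10 : 0 < p - 1 by rewrite subr_gt0.
have [h0|h0] := eqVneq (h t) 0.
  move=> e e0; have d0 : 0 < e `^ (p - 1)^-1 by rewrite powR_gt0.
  have [d dP H] := ch t _ d0; exists d => // s /H; rewrite h0 subr0 => hs.
  have -> : dual_fun p h t = 0 by rewrite /dual_fun h0 mulr0.
  rewrite subr0 (normc_dual_fun h s p1).
  have -> : e = (e `^ (p - 1)^-1) `^ (p - 1) by rewrite -powRrM mulVf ?powRr1 ?gt_eqF// ltW.
  by apply: (gt0_ltr_powR p10) hs; rewrite nnegrE ?normc_ge0 ?powR_ge0.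
have n0 : 0 < normc (h t) by rewrite normc_gt0.
have cn : {for t, continuous (fun s => normc (h s) `^ (p - 2))}.
  have cl : {for t, continuous (fun s => expR ((p - 2) * ln (normc (h s))))}.
    apply: (@continuous_comp _ _ _ (fun s => (p - 2) * ln (normc (h s)))); last exact: continuous_expR.
    apply: cvgM; first exact: cvg_cst.
    apply: (@continuous_comp _ _ _ (fun s => normc (h s)) (@ln R)); first exact: (ccont_norm ch).
    exact: continuous_ln.
  apply/cont_epsP => e e0; have [d dP H] := (cont_epsP _ _).1 cl e e0.
  have [d' dP' H'] := ch t _ n0.
  exists (Num.min d d'); first by rewrite lt_min dP.
  move=> s; rewrite lt_min => /andP[s1 s2].
  have ns : 0 < normc (h s).
    have := H' s s2; have := ler_dist_normc (h s) (h t); rewrite ler_norml => /andP[h1 _] h2; lra.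
  by have := H s s1; rewrite -!ln_powR !lnK ?posrE ?powR_gt0.
apply/ccont_atP; split.
  rewrite [X in {for t, continuous X}](_ : _ = fun s => normc (h s) `^ (p - 2) * complex.Re (h s)); last first.
    by apply/funext => s; rewrite Re_realM.
  by apply: cvgM => //; exact: (ccont_Re ch).
rewrite [X in {for t, continuous X}](_ : _ = fun s => normc (h s) `^ (p - 2) * complex.Im (h s)); last first.
  by apply/funext => s; rewrite Im_realM.
by apply: cvgM => //; exact: (ccont_Im ch).
Qed.

(** The functional with coefficients [c] is bounded on the polynomials for the [H^q] norm. The
    factor [r ^+ k] lets it be tested on circles inside the disc. *)
Definition dual_bound q c K := forall b n r B, 0 <= r < 1 -> 0 < B ->
  bounded_means q (psum b n) (B `^ q) ->
  normc (\sum_(k < n) c k * (r ^+ k)%:C * Num.conj (b k)) <= K * B.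

Lemma dual_bound_coef q c K k : 1 < q -> 0 < K -> dual_bound q c K -> normc (c k) <= K.
Proof.
move=> q1 K0 H; apply/ler_addgt0Pl => e e0.
pose b j : R[i] := (j == k)%:R.
have pb z : psum b k.+1 z = z ^+ k.
  rewrite psumS /b eqxx mul1r /psum big1 ?add0r// => i _.
  by rewrite (ltn_eqF (ltn_ord i)) mul0r.
have B1 : bounded_means q (psum b k.+1) (1 `^ q).
  apply: (bounded_means_sup q1 (holo_psum b _) ler01) => z z1.
  by rewrite pb normcX exprn_ile1 ?normc_ge0// ltW.
have key r : 0 <= r < 1 -> normc (c k) * r ^+ k <= K.
  move=> r01; have := H b k.+1 r 1 r01 ltr01 B1; rewrite mulr1.
  rewrite big_ord_recr /= big1 ?add0r => [|i _]; last first.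
    by rewrite /b (ltn_eqF (ltn_ord i)) rmorph0 mulr0.
  rewrite /b eqxx rmorph1 mulr1 normcM normcR ger0_norm// exprn_ge0//.
  by case/andP: r01.
(* [key] is wanted at [r = 1], which is excluded; the inequality [(1 - d)^k >= 1 - k d] makes the
   passage to 1 explicit. *)
have k2 (d : R) : 0 < d <= 1 -> normc (c k) * (1 - k%:R * d) <= K.
  move=> /andP[d0 d1]; have r01 : 0 <= 1 - d < 1 by apply/andP; split; lra.
  apply: le_trans (key _ r01); apply: (ler_wpM2l (normc_ge0 _)).
  elim: k {H b pb B1 key} => [|k IH]; first by rewrite mul0r subr0 expr0.
  rewrite exprS; have h0 : 0 <= 1 - d by case/andP: r01.
  apply: (@le_trans _ _ ((1 - d) * (1 - k%:R * d))); last exact: (ler_wpM2l h0 IH).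
  rewrite -natr1; have : 0 <= k%:R * d ^+ 2 by rewrite mulr_ge0// sqr_ge0.
  by lra.
pose m := normc (c k) * k%:R + 1.
have m0 : 0 < m by rewrite ltr_wpDl// mulr_ge0// normc_ge0.
have d0 : 0 < Num.min (e / m) 1 <= 1 by rewrite lt_min divr_gt0//= ltr01 ge_min lexx orbT.
have := k2 _ d0; set d := Num.min _ _ => h.
have dm : m * d <= e by rewrite mulrC -ler_pdivlMr// ge_min lexx.
have : 0 <= d by apply/ltW; case/andP: d0.
rewrite /m in dm; lra.
Qed.

(** Let [J] be the mean of the candidate [h] on a circle and [w] its extremal function, of [L^q]
    norm [J^(1/q)]. Only the Riesz projection of [w] is seen by [h], and its norm is at most
    [A J^(1/q)]. Testing the functional on it gives [J <= 2 A K J^(1/q)], that is, the bound on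
    [J^(1/p)]. *)
Lemma duality p q : 1 < p -> p^-1 + q^-1 = 1 -> riesz_bound q -> exists2 A, 0 < A &
  forall c K, 0 < K -> dual_bound q c K ->
    exists2 h, has_ps c h & bounded_means p h ((A * K) `^ p).
Proof.
move=> p1 pq [A A0 RZ]; have q1 := conj_exponent p1 pq.
have p0 : 0 < p by rewrite (lt_trans _ p1).
have q0 : 0 < q by rewrite (lt_trans _ q1).
exists (2 * A); first by rewrite mulr_gt0.
move=> c K K0 DB.
have cg : coef_geo c.
  move=> r r01; exists K, r; split => //; first exact: ltW.
  move=> n; apply: ler_wpM2r; first by rewrite exprn_ge0//; case/andP: r01.
  exact: (dual_bound_coef n q1 K0 DB).
have [h Ph] := has_ps_exists cg; exists h => //.
have Hh := has_ps_holo Ph.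
suff main r : 0 < r < 1 -> mean p h r <= (2 * A * K) `^ p.
  move=> r /andP[r0 r1]; have [->|rn] := eqVneq r 0.
    by apply: (le_trans (mean_homo (s := 2^-1) p1 Hh _ _ _)) => //; try apply: main; lra.
  by apply: main; rewrite lt_neqAle eq_sym rn r0.
move=> /andP[r0 r1]; have r01 : 0 <= r < 1 by rewrite ltW.
pose hr t := h (r%:C * expi t).
have chr_ : ccont hr by exact: ccont_circle.
pose w := dual_fun p hr; have cw : ccont w by exact: ccont_dual_fun.
pose J := mean p h r; have J0 : 0 <= J by exact: mean_ge0.
rewrite -/J; have [->|Jn] := eqVneq J 0; first exact: powR_ge0.
have JP : 0 < J by rewrite lt_neqAle eq_sym Jn.
have wq : avg (fun t => normc (w t) `^ q) = J.
  apply: eq_avg => t; rewrite normc_dual_fun// -powRrM; congr (_ `^ _).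
  have e1 : (p - 1) / p = q^-1 by rewrite -[q^-1](addKr p^-1) pq; field; rewrite gt_eqF.
  have : (p - 1) = p / q by rewrite -e1 mulrC divfK// gt_eqF.
  by move=> ->; rewrite divfK// gt_eqF.
have Jc : J%:C = cavg (fun t => hr t * Num.conj (w t)).
  rewrite -cavg_real; apply: eq_cavg => t; exact/esym/dual_funE.
clearbody J.
pose D := J `^ q^-1; have DP : 0 < D by rewrite powR_gt0.
have DE : D `^ q = J by rewrite /D -powRrM mulVf ?gt_eqF// powRr1.
have J1 : J = D * J `^ p^-1.
  by rewrite /D -powRD ?Jn ?implybT// addrC pq powRr1.
clearbody D.
have [Q PQ _] := cauchy_transform cw.
have BQ : bounded_means q Q ((A * D) `^ q) by apply: RZ PQ => //; rewrite wq DE.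
have HQ := has_ps_holo PQ.
set wc := (fun k => _) in PQ.
(* The radius is split in two equal factors: one is the dilation in [dual_bound], the other dilates
   [Q] so that its partial sums converge uniformly on the closed disc. *)
have [s s0 ss] : exists2 s, 0 < s & s * s = r.
  by exists (Num.sqrt r); rewrite ?sqrtr_gt0// -expr2 sqr_sqrtr// ltW.
have s1 : s < 1 by move: r1; rewrite -ss; nra.
have s01 : 0 <= s < 1 by rewrite ltW.
pose b k := (s ^+ k)%:C * wc k.
have AD : 0 < A * D by rewrite mulr_gt0.
have BQs : bounded_means q (fun z => Q (s%:C * z)) ((A * D) `^ q).
  move=> x /andP[x0 x1].
  have -> : mean q (fun z => Q (s%:C * z)) x = mean q Q (s * x).
    by apply: eq_avg => t; rewrite mulrA -realcM.
  apply: BQ; apply/andP; split; first exact: mulr_ge0 (ltW s0) x0.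
  exact: (le_lt_trans (ler_piMl x0 (ltW s1)) x1).
have [N HN] := poly_approx_sup PQ s01 AD.
have bnd n : (N <= n)%N -> normc (\sum_(k < n) c k * (s ^+ k)%:C * Num.conj (b k)) <= K * (A * D + A * D).
  move=> Nn; apply: DB => //; first exact: addr_gt0.
  have Hd := holo_dilate s01 HQ; have Hb := holo_psum b n.
  have S : bounded_means q (fun z => psum b n z - Q (s%:C * z)) ((A * D) `^ q).
    apply: (bounded_means_sup q1 (holoB Hb Hd) (ltW AD)) => z z1.
    by rewrite normc_dist; exact: (HN n Nn z (ltW z1)).
  have := bounded_meansD q1 Hd (holoB Hb Hd) AD AD BQs S.
  by apply: eq_bounded_means => z z1; rewrite addrC subrK.
have sumE n : \sum_(k < n) c k * (s ^+ k)%:C * Num.conj (b k)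
    = cavg (fun t => psum c n (r%:C * expi t) * Num.conj (w t)).
  have cc k : ccont (fun t => expi t ^+ k * Num.conj (w t)).
    by apply: ccontM (ccontJ cw); exact: ccont_expin.
  transitivity (cavg (fun t => \sum_(k < n) (c k * (r ^+ k)%:C) * (expi t ^+ k * Num.conj (w t)))).
    rewrite cavg_sum => [|k]; last exact: (ccontZ _ (cc k)).
    apply: eq_bigr => k _; rewrite cavgZ; last exact: cc.
    have -> : cavg (fun t => expi t ^+ k * Num.conj (w t)) = Num.conj (wc k).
      rewrite -cavgJ; last by apply: ccontM cw _; exact: ccont_conjn.
      by apply: eq_cavg => t; rewrite conjM conjX conjK mulrC.
    have -> : Num.conj (b k) = (s ^+ k)%:C * Num.conj (wc k).
      rewrite conjM; congr (_ * _); by apply: complex_ext; rewrite ?ReJ ?ImJ ?oppr0.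
    by rewrite -ss exprMn realcM; ring.
  apply: eq_cavg => t; rewrite /psum mulr_suml; apply: eq_bigr => k _.
  by rewrite exprMn -realcX; ring.
pose W := avg (fun t => normc (w t)).
have W0 : 0 <= W by apply: avg_ge0 => t; exact: normc_ge0.
have JB : J <= K * (A * D + A * D).
  apply/ler_addgt0Pl => e e0.
  have e1 : 0 < e / (W + 1) by rewrite divr_gt0// ltr_wpDl.
  have [N2 H2] := poly_approx_sup Ph r01 e1.
  pose n := maxn N N2.
  have cp : ccont (fun t => psum c n (r%:C * expi t)) by exact: (ccont_circle (holo_psum c n) r01).
  have -> : J = normc (J%:C : R[i]) by rewrite normcR ger0_norm.
  have -> : (J%:C : R[i]) = cavg (fun t => (hr t - psum c n (r%:C * expi t)) * Num.conj (w t))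
      + cavg (fun t => psum c n (r%:C * expi t) * Num.conj (w t)).
    rewrite Jc -cavgD; [|exact: (ccontM (ccontB chr_ cp) (ccontJ cw))|exact: (ccontM cp (ccontJ cw))].
    by apply: eq_cavg => t; rewrite -mulrDl subrK.
  rewrite (le_trans (ler_normcD _ _))//; apply: lerD; last first.
    by rewrite -sumE; apply: bnd; exact: leq_maxl.
  rewrite (le_trans (normc_cavg _))//; first exact: (ccontM (ccontB chr_ cp) (ccontJ cw)).
  apply: (@le_trans _ _ (avg (fun t => e / (W + 1) * normc (w t)))).
    apply: le_avg; first exact/ccont_norm/(ccontM (ccontB chr_ cp) (ccontJ cw)).
      exact: (continuous_rmul (@continuous_rcst _ _) (ccont_norm cw)).
    move=> t; rewrite normcM normcJ; apply: (ler_wpM2r (normc_ge0 _)).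
    rewrite /hr -psum_dilate; apply: H2; first exact: leq_maxr.
    by rewrite normc_expi.
  rewrite avgZ; last exact: (ccont_norm cw).
  rewrite -/W mulrAC ler_pdivrMr ?ltr_wpDl//; apply: (ler_wpM2l (ltW e0)); by rewrite lerDl.
have JB2 : J `^ p^-1 <= 2 * A * K.
  rewrite -(ler_pM2l DP) -J1 (le_trans JB)// le_eqVlt; apply/orP; left; apply/eqP; ring.
have -> : J = (J `^ p^-1) `^ p by rewrite -powRrM mulVf ?gt_eqF// powRr1.
by apply: (le_powR p1) => //; exact: powR_ge0.
Qed.

(** The coefficients of [w] satisfy the dual bound by Hoelder's inequality alone; [duality], which
    uses the projection for [q], converts this into a bound on the projection for [p]. *)
Lemma riesz_dual p q : 1 < p -> p^-1 + q^-1 = 1 -> riesz_bound q -> riesz_bound p.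
Proof.
move=> p1 pq RZ; have q1 := conj_exponent p1 pq.
have [A A0 DL] := duality p1 pq RZ; exists A => // w D Q cw D0 wD PQ.
have [|h Ph Bh] := DL (fun k => cavg (fun t => w t * Num.conj (expi t) ^+ k)) D D0; last first.
  by apply: eq_bounded_means Bh => z; exact: (has_ps_unique Ph PQ).
move=> b n r B r01 B0 Bb.
have cb := ccont_circle (holo_psum b n) r01.
have -> : \sum_(k < n) cavg (fun t => w t * Num.conj (expi t) ^+ k) * (r ^+ k)%:C * Num.conj (b k)
   = cavg (fun t => w t * Num.conj (psum b n (r%:C * expi t))).
  have cc k : ccont (fun t => w t * Num.conj (expi t) ^+ k).
    by apply: ccontM cw _; exact: ccont_conjn.
  transitivity (cavg (fun t => \sum_(k < n) ((r ^+ k)%:C * Num.conj (b k)) * (w t * Num.conj (expi t) ^+ k))).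
    rewrite cavg_sum => [|k]; last exact: (ccontZ _ (cc k)).
    by apply: eq_bigr => k _; rewrite cavgZ; [ring|exact: cc].
  apply: eq_cavg => t; rewrite /psum conj_sum mulr_sumr; apply: eq_bigr => k _.
  rewrite exprMn !conjM -realcX !conjX.
  have -> : Num.conj (r ^+ k)%:C = (r ^+ k)%:C :> R[i] by apply: complex_ext; rewrite ?ReJ ?ImJ ?oppr0.
  by ring.
rewrite (le_trans (normc_cavg (ccontM cw (ccontJ cb))))//.
have -> : avg (fun t => normc (w t * Num.conj (psum b n (r%:C * expi t))))
   = avg (fun t => normc (w t) * normc (psum b n (r%:C * expi t))).
  by apply: eq_avg => t; rewrite normcM normcJ.
apply: (avg_hoelder p1 q1 pq D0 B0 (ccont_norm cw) (ccont_norm cb)) => //; last exact: Bb.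
- by move=> t; exact: normc_ge0.
- by move=> t; exact: normc_ge0.
Qed.

Theorem riesz p : 1 < p -> riesz_bound p.
Proof.
move=> p1; have [p2|p2] := leP p 2; first by apply: riesz_small; rewrite p1.
have p0 : 0 < p by rewrite (lt_trans _ p1).
pose q : R := (1 - p^-1)^-1.
have pq : p^-1 + q^-1 = 1 by rewrite invrK addrC subrK.
apply: (riesz_dual p1 pq); apply: riesz_small; rewrite (conj_exponent p1 pq)/=.
have h : p^-1 <= 2^-1 by rewrite lef_pV2 ?posrE// ltW.
rewrite /q -[leRHS]invrK lef_pV2 ?posrE ?invr_gt0//; lra.
Qed.

End Duality.

(** * The pairing *)

Section Pairing.
Variable R : realType.
Implicit Types (p q r s x y e A B D K : R) (u : R -> R[i]) (z l m : R[i])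
  (a b c : nat -> R[i]) (f g h : R[i] -> R[i]).

Definition left_lim u l := forall e, 0 < e -> exists2 d, 0 <= d < 1 &
  forall r, d < r < 1 -> normc (u r - l) <= e.

Lemma left_lim_unique u l m : left_lim u l -> left_lim u m -> l = m.
Proof.
move=> L M; apply/eqP; rewrite -subr_eq0 -normc_eq0 eq_le normc_ge0 andbT.
apply/ler_addgt0Pl => e e0; rewrite addr0.
have e2 : 0 < e / 2 by rewrite divr_gt0.
have [d /andP[d0 d1] H] := L _ e2; have [d' /andP[d0' d1'] H'] := M _ e2.
pose r := (1 + Num.max d d') / 2.
have [m1 m2] : d <= Num.max d d' /\ d' <= Num.max d d' by rewrite !le_max !lexx orbT.
have m3 : Num.max d d' < 1 by rewrite gt_max d1.
rewrite (le_trans (normc_triangle (u r) _ _))// (splitr e); apply: lerD.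
  by rewrite normc_dist; apply: H; rewrite /r; apply/andP; split; lra.
by apply: H'; rewrite /r; apply/andP; split; lra.
Qed.

Lemma left_cauchy u : (forall e, 0 < e -> exists2 d, 0 <= d < 1 &
    forall r s, d < r < 1 -> d < s < 1 -> normc (u r - u s) <= e) ->
  exists l, left_lim u l.
Proof.
move=> C.
have C' n : exists d, 0 <= d < 1 /\ forall r s, d < r < 1 -> d < s < 1 ->
    normc (u r - u s) <= 1 * (2^-1) ^+ n.
  have [|d d01 H] := C (1 * (2^-1) ^+ n); first by rewrite mul1r exprn_gt0.
  by exists d.
have [d Hd] := choice C'.
pose D := fix D n := if n is k.+1 then Num.max (D k) (d n) else d 0%N.
have D1 n : 0 <= D n < 1.
  elim: n => [|n /andP[i1 i2]]; first exact: (Hd 0%N).1.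
  have [/andP[j1 j2] _] := Hd n.+1.
  by rewrite /= le_max i1 gt_max i2 j2.
have dD n : d n <= D n by case: n => [|n] //=; rewrite le_max lexx orbT.
have Dm n k : (n <= k)%N -> D n <= D k.
  elim: k => [|k IH]; first by rewrite leqn0 => /eqP ->.
  rewrite leq_eqVlt => /orP[/eqP -> //|]; rewrite ltnS => /IH h.
  by rewrite (le_trans h)//= le_max lexx.
pose x n := (1 + D n) / 2.
have xd n k : (n <= k)%N -> d n < x k < 1.
  move=> /Dm h; have h2 := dD n; have /andP[h3 h4] := D1 k.
  by rewrite /x; apply/andP; split; lra.
have cau n k : (n <= k)%N -> normc (u (x k) - u (x n)) <= 1 * (2^-1) ^+ n.
  by move=> nk; apply: (Hd n).2; apply: xd.
have [l Hl] := complex_cauchy_geo cau; exists l => e e0.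
have q01 : 0 <= (2^-1 : R) < 1 by rewrite invr_ge0 ler0n invf_lt1// ltr1n.
have [N HN] := @geo_small R 3 _ e q01 e0.
exists (d N); first exact: (Hd N).1.
move=> r r01; rewrite (le_trans (normc_triangle (u (x N)) _ _))//.
have h1 : normc (u r - u (x N)) <= 1 * (2^-1) ^+ N by apply: (Hd N).2 => //; exact: xd.
have h2 := Hl N; rewrite normc_dist in h2.
by have h3 := HN N (leqnn N); lra.
Qed.

Definition hpair f g r := cavg (fun t => f (r%:C * expi t) * Num.conj (g (r%:C * expi t))).
(** A relation, because existence of the limit needs conjugate exponents, whereas linearity and
    symmetry hold for any holomorphic functions for which limits are given. *)
Definition paired f g l := left_lim (hpair f g) l.

Lemma cavg_hoelder p q A B u (v : R -> R[i]) : 1 < p -> p^-1 + q^-1 = 1 -> 0 < A -> 0 < B ->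
  ccont u -> ccont v -> avg (fun t => normc (u t) `^ p) <= A `^ p ->
  avg (fun t => normc (v t) `^ q) <= B `^ q ->
  normc (cavg (fun t => u t * Num.conj (v t))) <= A * B.
Proof.
move=> p1 pq A0 B0 cu cv uA vB; have q1 := conj_exponent p1 pq.
rewrite (le_trans (normc_cavg (ccontM cu (ccontJ cv))))//.
have -> : avg (fun t => normc (u t * Num.conj (v t))) = avg (fun t => normc (u t) * normc (v t)).
  by apply: eq_avg => t; rewrite normcM normcJ.
apply: (avg_hoelder p1 q1 pq A0 B0 (ccont_norm cu) (ccont_norm cv)) => // t; exact: normc_ge0.
Qed.

Lemma hpair_bound p q A B f g r : 1 < p -> p^-1 + q^-1 = 1 -> 0 < A -> 0 < B ->
  holo f -> holo g -> bounded_means p f (A `^ p) -> bounded_means q g (B `^ q) ->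
  0 <= r < 1 -> normc (hpair f g r) <= A * B.
Proof.
move=> p1 pq A0 B0 F G FA GB r01.
by apply: (cavg_hoelder p1 pq A0 B0) => //; [exact: ccont_circle|exact: ccont_circle|exact: FA|exact: GB].
Qed.

(** Dilates are Cauchy in mean for both exponents, and Hoelder's inequality carries this over to the
    products; no boundary function is involved. *)
Lemma paired_exists p q A B f g : 1 < p -> p^-1 + q^-1 = 1 -> 0 < A -> 0 < B ->
  holo f -> holo g -> bounded_means p f (A `^ p) -> bounded_means q g (B `^ q) ->
  exists l, paired f g l.
Proof.
move=> p1 pq A0 B0 F G FA GB; have q1 := conj_exponent p1 pq.
apply: left_cauchy => e e0.
have e1 : 0 < e / (2 * B) by rewrite divr_gt0// mulr_gt0.
have e2 : 0 < e / (2 * A) by rewrite divr_gt0// mulr_gt0.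
have [d1 /andP[d10 d11] H1] := radial_cauchy p1 F FA (powR_gt0 p e1).
have [d2 /andP[d20 d21] H2] := radial_cauchy q1 G GB (powR_gt0 q e2).
exists (Num.max d1 d2); first by rewrite le_max d10 gt_max d11.
move=> r s; rewrite !gt_max => /andP[/andP[r1 r2] r3] /andP[/andP[s1 s2] s3].
have r01 : 0 <= r < 1 by rewrite r3 ltW// (le_lt_trans d10).
have s01 : 0 <= s < 1 by rewrite s3 ltW// (le_lt_trans d10).
have cfr := ccont_circle F r01; have cfs := ccont_circle F s01.
have cgr := ccont_circle G r01; have cgs := ccont_circle G s01.
have -> : hpair f g r - hpair f g s =
   cavg (fun t => (f (r%:C * expi t) - f (s%:C * expi t)) * Num.conj (g (r%:C * expi t)))
 + cavg (fun t => f (s%:C * expi t) * Num.conj (g (r%:C * expi t) - g (s%:C * expi t))).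
  rewrite /hpair -cavgB; [|exact: ccontM cfr (ccontJ cgr)|exact: ccontM cfs (ccontJ cgs)].
  rewrite -cavgD; [|exact: ccontM (ccontB cfr cfs) (ccontJ cgr)|exact: ccontM cfs (ccontJ (ccontB cgr cgs))].
  by apply: eq_cavg => t; rewrite [in RHS]rmorphB; ring.
rewrite (le_trans (ler_normcD _ _))//.
have -> : e = e / (2 * B) * B + A * (e / (2 * A)) by field; rewrite !gt_eqF.
apply: lerD.
  apply: (cavg_hoelder p1 pq e1 B0) => //; [exact: ccontB|apply: H1; exact/andP|exact: GB].
apply: (cavg_hoelder p1 pq A0 e2) => //; [exact: ccontB|exact: FA|apply: H2; exact/andP].
Qed.

Lemma paired_unique f g l m : paired f g l -> paired f g m -> l = m.
Proof. exact: left_lim_unique. Qed.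

Lemma paired_bound p q A B f g l : 1 < p -> p^-1 + q^-1 = 1 -> 0 < A -> 0 < B ->
  holo f -> holo g -> bounded_means p f (A `^ p) -> bounded_means q g (B `^ q) ->
  paired f g l -> normc l <= A * B.
Proof.
move=> p1 pq A0 B0 F G FA GB L; apply/ler_addgt0Pl => e e0.
have [d /andP[d0 d1] H] := L e e0.
have r1 : d < (1 + d) / 2 < 1 by apply/andP; split; lra.
have r01 : 0 <= (1 + d) / 2 < 1 by apply/andP; split; lra.
have := H _ r1; set r := (1 + d) / 2 in r01 * => h.
have -> : l = - (hpair f g r - l) + hpair f g r by ring.
rewrite (le_trans (ler_normcD _ _))// normc_opp; apply: (lerD h).
exact: (hpair_bound p1 pq A0 B0 F G FA GB r01).
Qed.

Lemma left_limD u (v : R -> R[i]) l m : left_lim u l -> left_lim v m ->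
  left_lim (fun r => u r + v r) (l + m).
Proof.
move=> L M e e0; have e2 : 0 < e / 2 by rewrite divr_gt0.
have [d1 /andP[d10 d11] H1] := L _ e2; have [d2 /andP[d20 d21] H2] := M _ e2.
exists (Num.max d1 d2); first by rewrite le_max d10 gt_max d11.
move=> r; rewrite gt_max => /andP[/andP[r1 r2] r3].
have -> : u r + v r - (l + m) = (u r - l) + (v r - m) by ring.
by rewrite (le_trans (ler_normcD _ _))// (splitr e); apply: lerD; [apply: H1|apply: H2]; apply/andP.
Qed.

Lemma left_limZ u k l : left_lim u l -> left_lim (fun r => k * u r) (k * l).
Proof.
move=> L e e0; have k1 : 0 < normc k + 1 by rewrite ltr_wpDl// normc_ge0.
have [|d d01 H] := L (e / (normc k + 1)); first by rewrite divr_gt0.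
exists d => // r /H h; rewrite -mulrBr normcM.
rewrite (le_trans (ler_wpM2l (normc_ge0 k) h))// mulrCA ler_piMr ?ltW//.
by rewrite ltr_pdivrMr// mul1r ltrDl.
Qed.

Lemma eq_left_lim u (v : R -> R[i]) l : (forall r, 0 <= r < 1 -> u r = v r) ->
  left_lim u l -> left_lim v l.
Proof.
move=> uv L e /L[d d01 H]; exists d => // r /[dup] /andP[r1 r2] /H.
by rewrite uv// r2 andbT ltW// (le_lt_trans _ r1)//; case/andP: d01.
Qed.

Lemma pairedDl f h g l m : holo f -> holo h -> holo g -> paired f g l -> paired h g m ->
  paired (fun z => f z + h z) g (l + m).
Proof.
move=> F H G L M; apply: eq_left_lim (left_limD L M) => r r01.
have cf := ccont_circle F r01; have ch := ccont_circle H r01.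
have cg := ccontJ (ccont_circle G r01).
rewrite /hpair -cavgD; [|exact: ccontM cf cg|exact: ccontM ch cg].
by apply: eq_cavg => t; rewrite mulrDl.
Qed.

Lemma pairedZl k f g l : holo f -> holo g -> paired f g l ->
  paired (fun z => k * f z) g (k * l).
Proof.
move=> F G L; apply: eq_left_lim (left_limZ k L) => r r01.
have cf := ccont_circle F r01; have cg := ccontJ (ccont_circle G r01).
by rewrite /hpair -cavgZ; [apply: eq_cavg => t; rewrite mulrA|exact: ccontM cf cg].
Qed.

Lemma paired_sym f g l : holo f -> holo g -> paired f g l -> paired g f (Num.conj l).
Proof.
move=> F G L e /L[d d01 H]; exists d => // r rd; have := H r rd.
have r01 : 0 <= r < 1.
  by case/andP: rd => r1 r2; case/andP: d01 => d0 _; rewrite r2 andbT ltW// (le_lt_trans d0).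
have cf := ccont_circle F r01; have cg := ccont_circle G r01.
have -> : hpair g f r = Num.conj (hpair f g r).
  rewrite /hpair -cavgJ; last exact: ccontM cf (ccontJ cg).
  by apply: eq_cavg => t; rewrite conjM conjK mulrC.
by rewrite -rmorphB normcJ.
Qed.

Lemma pairedDr f g h l m : holo f -> holo g -> holo h -> paired f g l -> paired f h m ->
  paired f (fun z => g z + h z) (l + m).
Proof.
move=> F G H L M; rewrite -(conjK (l + m)) rmorphD.
apply: paired_sym => //; first exact: holoD.
by apply: pairedDl => //; exact: paired_sym.
Qed.

Lemma pairedZr k f g l : holo f -> holo g -> paired f g l ->
  paired f (fun z => k * g z) (Num.conj k * l).
Proof.
move=> F G L; rewrite -(conjK (Num.conj k * l)) conjM conjK.
by apply: paired_sym => //; [exact: holoZ|apply: pairedZl => //; exact: paired_sym].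
Qed.

Lemma eq_pairedr f g h l : (forall z, normc z < 1 -> g z = h z) -> paired f g l -> paired f h l.
Proof.
move=> gh; apply: eq_left_lim => r /andP[r0 r1]; apply: eq_cavg => t.
by rewrite gh// normc_circle.
Qed.

Lemma one_sub_exprn_le (x : R) n : 0 <= x <= 1 -> 1 - x ^+ n <= n%:R * (1 - x).
Proof.
move=> /andP[x0 x1]; elim: n => [|n IH]; first by rewrite expr0 subrr mul0r.
rewrite exprS -natr1; have : x * (1 - x ^+ n) <= 1 * (1 - x ^+ n).
  by rewrite ler_wpM2r// subr_ge0 exprn_ile1.
lra.
Qed.

Lemma left_lim_exprn n : left_lim (fun r => (r ^+ n)%:C) 1.
Proof.
move=> e e0; have n0 : 0 < n%:R + 1 :> R by rewrite ltr_wpDl.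
pose d := 1 - Num.min 1 (e / (n%:R + 1)).
have m0 : 0 < Num.min 1 (e / (n%:R + 1)) by rewrite lt_min ltr01 divr_gt0.
have m1 : Num.min 1 (e / (n%:R + 1)) <= 1 by rewrite ge_min lexx.
have m2 : Num.min 1 (e / (n%:R + 1)) <= e / (n%:R + 1) by rewrite ge_min lexx orbT.
exists d; first by rewrite /d; apply/andP; split; lra.
move=> r /andP[]; rewrite /d => r1 r2; rewrite normc_dist.
have -> : 1 - (r ^+ n)%:C = (1 - r ^+ n)%:C :> R[i] by rewrite rmorphB.
have r01 : 0 <= r <= 1 by apply/andP; split; lra.
have h := one_sub_exprn_le n r01.
rewrite normcR ger0_norm; last by rewrite subr_ge0 exprn_ile1//; case/andP: r01.
rewrite (le_trans h)//.
have h1 : 1 - r <= e / (n%:R + 1) by lra.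
rewrite (le_trans (ler_wpM2l (ler0n _ n) h1))// mulrCA ler_piMr ?ltW//.
by rewrite ltr_pdivrMr// mul1r ltrDl.
Qed.

Lemma paired_poly a f b n : has_ps a f -> paired f (psum b n) (\sum_(k < n) a k * Num.conj (b k)).
Proof.
move=> P; apply: (@eq_left_lim (fun r => \sum_(k < n) (a k * Num.conj (b k)) * (r ^+ (k + k))%:C)).
  move=> r r01; rewrite /hpair (pair_poly _ _ _ P r01); apply: eq_bigr => k _.
  rewrite conjM exprD realcM.
  have -> : Num.conj (r ^+ k)%:C = (r ^+ k)%:C :> R[i] by apply: complex_ext; rewrite ?ReJ ?ImJ ?oppr0.
  by ring.
elim: n => [|n IH].
  by rewrite big_ord0 => e e0; exists 0; rewrite ?lexx ?ltr01// => r _; rewrite big_ord0 subrr normc0 ltW.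
rewrite big_ord_recr /=.
have := left_limD IH (left_limZ (a n * Num.conj (b n)) (left_lim_exprn (n + n))).
by rewrite mulr1; apply: eq_left_lim => r r01; rewrite big_ord_recr.
Qed.

Definition pairing f g : R[i] := xget 0 [set l | paired f g l].

Lemma pairingE f g l : paired f g l -> pairing f g = l.
Proof.
by move=> L; apply: (@paired_unique f g) => //; exact: (xgetPex 0 (ex_intro _ l L)).
Qed.

End Pairing.

(** * The semigroup and the resolvent identity *)

Section Semigroup.
Variable R : realType.
Implicit Types (p q r s t x y e A B D K : R) (u : R -> R[i]) (z l m : R[i])
  (a b c : nat -> R[i]) (f g h : R[i] -> R[i]).

Lemma rder_mul (v w : R -> R) (x dv dw : R) : is_derive x 1 v dv -> is_derive x 1 w dw ->
  is_derive x 1 (fun t => v t * w t) (v x * dw + w x * dv).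
Proof. by move=> V W; exact: (is_deriveM V W). Qed.

Lemma rder_add (v w : R -> R) (x dv dw : R) : is_derive x 1 v dv -> is_derive x 1 w dw ->
  is_derive x 1 (fun t => v t + w t) (dv + dw).
Proof. by move=> V W; exact: (is_deriveD V W). Qed.

Lemma rder_pow (v : R -> R) (x dv : R) n : is_derive x 1 v dv ->
  is_derive x 1 (fun t => v t ^+ n) (n%:R * v x ^+ n.-1 * dv).
Proof.
move=> V; elim: n => [|n IH].
  by apply: (is_derive_eq (is_derive_cst (1 : R) x 1)); rewrite !mul0r.
have -> : (fun t => v t ^+ n.+1) = (fun t => v t * v t ^+ n) by apply/funext => t; rewrite exprS.
have D := rder_mul V IH; apply: (is_derive_eq D).
rewrite /= -natr1; case: n {IH D} => [|n] /=; first by rewrite expr0; ring.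
by rewrite exprS; ring.
Qed.

Lemma rder_expN (k x : R) : is_derive x 1 (fun t => expR (k * t)) (expR (k * x) * k).
Proof. exact: is_derive_mulcomp (is_derive_expR _). Qed.

Definition phi s z : R[i] := (expR (- s))%:C * z + (1 - expR (- s))%:C.
Definition shift s g z := g (phi s z).

Lemma expRN_01 s : 0 <= s -> 0 < expR (- s) <= 1.
Proof. by move=> s0; rewrite expR_gt0 -[leRHS]expR0 ler_expR oppr_le0. Qed.

Lemma phi_disc s z : 0 <= s -> normc z < 1 -> normc (phi s z) < 1.
Proof.
move=> /expRN_01/andP[a0 a1] z1; rewrite (le_lt_trans (ler_normcD _ _))//.
rewrite normcM !normcR (gtr0_norm a0) ger0_norm ?subr_ge0//.
have : expR (- s) * normc z < expR (- s) * 1 by rewrite ltr_pM2l.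
lra.
Qed.

Lemma holo_phi s : holo (phi s).
Proof. by apply: holoD; [apply: holoZ; exact: holo_id|exact: holo_cst]. Qed.

Lemma holo_shift s g : 0 <= s -> holo g -> holo (shift s g).
Proof. by move=> s0 G; apply: holo_comp => //; [move=> z; exact: phi_disc|exact: holo_phi]. Qed.

(** With [rho] the largest modulus of [phi s] on the circle of radius [y], one has
    [phi s (y z) = rho psi z] for a self-map [psi] of the disc. Subordination then applies, and
    Harnack's constant at [psi 0] is at most [4 e^s]. *)
Lemma bounded_shift p g K s : 1 < p -> holo g -> 0 <= s -> bounded_means p g K ->
  bounded_means p (shift s g) (4 * expR s * K).
Proof.
move=> p1 G s0 GK x /andP[x0 x1].
have [a0 a1] := andP (expRN_01 s0).
have aE : expR s = (expR (- s))^-1 by rewrite expRN invrK.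
rewrite aE; move: a0 a1; rewrite /shift /phi; set a := expR (- s) => a0 a1; clearbody a.
(* [x < y < 1] keeps [x / y] and [rho] below 1, and [y >= 1/2] bounds [(rho + (1 - a)) / (a y)] by
   [4 / a]. *)
pose y := (1 + x) / 2.
have y0 : 2^-1 <= y by rewrite /y; lra.
have yp : 0 < y by lra.
have y1 : y < 1 by rewrite /y; lra.
have xy : x < y by rewrite /y; lra.
clearbody y.
have ay : 0 < a * y by rewrite mulr_gt0.
pose rho := a * y + (1 - a).
have r0 : 0 < rho by rewrite /rho; lra.
have r1 : rho < 1 by rewrite /rho; nra.
have rn : (rho%:C : R[i]) != 0 by rewrite eq_complex /= eqxx andbT gt_eqF.
pose psi z : R[i] := (rho%:C)^-1 * ((a * y)%:C * z + (1 - a)%:C).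
have Hpsi : holo psi by apply/holoZ/holoD; [exact/holoZ/holo_id|exact: holo_cst].
have psi1 z : normc z < 1 -> normc (psi z) < 1.
  move=> z1; rewrite /psi normcM normcV normcR (gtr0_norm r0) mulrC ltr_pdivrMr// mul1r.
  rewrite (le_lt_trans (ler_normcD _ _))// normcM !normcR (gtr0_norm ay) (ger0_norm (_ : 0 <= 1 - a)) ?subr_ge0//.
  by rewrite /rho ltrD2r -[ltRHS]mulr1 ltr_pM2l.
have psi0 : normc (psi 0) = (1 - a) / rho.
  by rewrite /psi mulr0 add0r normcM normcV !normcR (gtr0_norm r0) ger0_norm ?subr_ge0// mulrC.
have xy1 : 0 <= x / y < 1 by rewrite divr_ge0//= ?(ltW yp)// ltr_pdivrMr// mul1r.
have r01 : 0 <= rho < 1 by rewrite ltW.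
have -> : mean p (fun z => g (a%:C * z + (1 - a)%:C)) x = mean p (fun z => g (rho%:C * psi z)) (x / y).
  apply: eq_avg => t; congr (normc (g _) `^ _).
  rewrite /psi mulVKf//; congr (_ + _); rewrite !mulrA -!realcM; congr (_%:C * _).
  by field; rewrite gt_eqF.
rewrite (le_trans (mean_subordinate p1 G Hpsi psi1 r01 xy1))//.
rewrite psi0.
have -> : (1 + (1 - a) / rho) / (1 - (1 - a) / rho) = (rho + (1 - a)) / (a * y).
  by rewrite /rho; field; rewrite !gt_eqF//; lra.
have M0 := mean_ge0 p g rho; have MK := GK rho r01.
apply: (@le_trans _ _ (4 * a^-1 * mean p g rho)); last first.
  by apply: ler_wpM2l MK; rewrite mulr_ge0// invr_ge0 ltW.
apply: (ler_wpM2r M0); rewrite ler_pdivrMr//.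
have -> : 4 * a^-1 * (a * y) = 4 * y by field; rewrite gt_eqF.
by rewrite /rho; nra.
Qed.

(** Takes the root of the factor [4 e^s]. Only the growth [e^(s/p)] matters later, so 4 is kept
    whole. *)
Lemma bounded_shift_pow p g B s : 1 < p -> holo g -> 0 <= s -> 0 < B ->
  bounded_means p g (B `^ p) ->
  bounded_means p (shift s g) ((4 * expR (p^-1 * s) * B) `^ p).
Proof.
move=> p1 G s0 B0 GB; have p0 : 0 < p by rewrite (lt_trans _ p1).
apply: bounded_means_le (bounded_shift p1 G s0 GB).
have E0 := expR_ge0 (p^-1 * s).
rewrite powRM ?(mulr_ge0 _ E0) ?(ltW B0)// powRM//.
apply: ler_wpM2r; first exact: powR_ge0.
have -> : expR (p^-1 * s) `^ p = expR s.
  by rewrite -expRM mulrC mulVKf// gt_eqF.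
apply: ler_wpM2r; first exact: expR_ge0.
have h4 : (1 : R) <= 4 by rewrite ler1n.
by rewrite -[leLHS](powRr1 (le_trans ler01 h4)); apply: (ler_powR h4); exact: ltW.
Qed.

(** Depends only on values in the disc, unlike [hardy], which also imposes extension by zero;
    [hardyP] relates the two. *)
Definition Hp p f := holo f /\ exists2 A, 0 < A & bounded_means p f (A `^ p).

Lemma HpI p f A : 0 < A -> holo f -> bounded_means p f (A `^ p) -> Hp p f.
Proof. by move=> A0 F FA; split => //; exists A. Qed.

Lemma pairingP p q f g : 1 < p -> p^-1 + q^-1 = 1 -> Hp p f -> Hp q g ->
  paired f g (pairing f g).
Proof.
move=> p1 pq [F [A A0 FA]] [G [B B0 GB]].
by have [l L] := paired_exists p1 pq A0 B0 F G FA GB; rewrite (pairingE L).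
Qed.

Lemma Hp_shift p g s : 1 < p -> 0 <= s -> Hp p g -> Hp p (shift s g).
Proof.
move=> p1 s0 [G [B B0 GB]]; split; first exact: holo_shift.
exists (4 * expR (p^-1 * s) * B); last exact: bounded_shift_pow.
by rewrite mulr_gt0// mulr_gt0// expR_gt0.
Qed.

Lemma Hp_add p f g : 1 < p -> Hp p f -> Hp p g -> Hp p (fun z => f z + g z).
Proof.
move=> p1 [F [A A0 FA]] [G [B B0 GB]]; split; first exact: holoD.
by exists (A + B); [exact: addr_gt0|exact: bounded_meansD].
Qed.

Lemma Hp_scale p k f : 1 < p -> Hp p f -> Hp p (fun z => k * f z).
Proof.
move=> p1 [F [A A0 FA]]; split; first exact: holoZ.
exists ((normc k + 1) * A); first by rewrite mulr_gt0// ltr_wpDl// normc_ge0.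
apply: bounded_means_le (bounded_meansZ k p1 F A0 FA).
apply: (le_powR p1); first by rewrite mulr_ge0 ?normc_ge0// ltW.
by apply: ler_wpM2r; [exact: ltW|rewrite lerDl].
Qed.

Lemma Hp_psum p b n : 1 < p -> Hp p (psum b n).
Proof.
move=> p1; split; first exact: holo_psum.
pose B := \sum_(k < n) normc (b k) + 1.
have B0 : 0 < B by rewrite ltr_wpDl// sumr_ge0// => k _; exact: normc_ge0.
exists B => //; apply: (bounded_means_sup p1 (holo_psum b n) (ltW B0)) => z z1.
rewrite /psum (le_trans (ler_normc_sum _ _ _))// /B ler_wpDr//.
apply: ler_sum => k _; rewrite normcM normcX -[leRHS]mulr1.
by apply: ler_wpM2l; [exact: normc_ge0|rewrite exprn_ile1 ?normc_ge0// ltW].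
Qed.

Lemma Hp_eq p f g : (forall z, normc z < 1 -> f z = g z) -> holo g -> Hp p f -> Hp p g.
Proof.
move=> fg G [_ [A A0 FA]]; apply: (HpI A0 G); exact: eq_bounded_means FA.
Qed.

Definition wpair f g s : R[i] := (expR (- s))%:C * pairing f (shift s g).

Lemma wpair_bound p q A B f g s : 1 < p -> p^-1 + q^-1 = 1 -> 0 < A -> 0 < B ->
  holo f -> holo g -> bounded_means p f (A `^ p) -> bounded_means q g (B `^ q) -> 0 <= s ->
  normc (wpair f g s) <= 4 * (A * B) * expR (- p^-1 * s).
Proof.
move=> p1 pq A0 B0 F G FA GB s0; have q1 := conj_exponent p1 pq.
have B1 : 0 < 4 * expR (q^-1 * s) * B by rewrite mulr_gt0// mulr_gt0// expR_gt0.
have GS := bounded_shift_pow q1 G s0 B0 GB.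
have L := pairingP p1 pq (HpI A0 F FA) (Hp_shift q1 s0 (HpI B0 G GB)).
have := paired_bound p1 pq A0 B1 F (holo_shift s0 G) FA GS L.
rewrite /wpair normcM normcR (gtr0_norm (expR_gt0 _)) => h.
apply: (le_trans (ler_wpM2l (ltW (expR_gt0 _)) h)).
have -> : expR (- p^-1 * s) = expR (- s) * expR (q^-1 * s).
  by rewrite -expRD; congr expR; have -> : q^-1 = 1 - p^-1 by [rewrite -pq; ring]; ring.
by rewrite le_eqVlt; apply/orP; left; apply/eqP; ring.
Qed.

(* [beta n i s] is [e^(-s)] times the coefficient of [z^i] in [(phi s z)^n]. *)
Definition beta n i s : R := 'C(n, i)%:R * (expR (- s) ^+ i.+1 * (1 - expR (- s)) ^+ (n - i)).

(** The identity between [(i + 1) C(n, i + 1)] and [(n - i) C(n, i)] turns the derivative into a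
    difference of consecutive terms. Its factor [i + 1] is the one that cancels the denominator of
    the Cesaro mean. *)
Lemma beta_derive n i s : (i <= n)%N ->
  is_derive s 1 (beta n i) (i.+1%:R * (beta n i.+1 s - beta n i s)).
Proof.
move=> ni.
have dE : is_derive s 1 (fun t => expR (- t)) (- expR (- s)).
  have -> : (fun t : R => expR (- t)) = (fun t => expR (-1 * t)) by apply/funext => t; rewrite mulN1r.
  by have := rder_expN (-1) s; rewrite mulN1r mulrN1.
have d1 := rder_pow i.+1 dE.
have dB : is_derive s 1 (fun t => 1 - expR (- t)) (expR (- s)).
  have D := rder_add (is_derive_cst (1 : R) s 1) (is_deriveN dE); apply: (is_derive_eq D).
  by rewrite add0r opprK.
have d2 := rder_pow (n - i) dB.
have D := is_derive_lmul 'C(n, i)%:R (rder_mul d1 d2); apply: (is_derive_eq D).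
rewrite /beta; set a := expR (- s); set d := 1 - a.
have M : i.+1%:R * 'C(n, i.+1)%:R = (n - i)%:R * 'C(n, i)%:R :> R by rewrite -!natrM mul_bin_left.
rewrite mulrBr [X in X - _]mulrA M subnS !exprS /= {D d1 d2 M}.
by case: (n - i)%N => [|k] /=; rewrite ?expr0 ?exprS; ring.
Qed.

Definition wmono c n s : R[i] := \sum_(i < n.+1) c i * (beta n i s)%:C.

Lemma abel_sum (y : nat -> R[i]) a n :
  \sum_(i < n.+1) (\sum_(j < i.+1) a j) * (y i.+1 - y i)
  = (\sum_(j < n.+1) a j) * y n.+1 - \sum_(i < n.+1) a i * y i.
Proof.
elim: n => [|n IH]; first by rewrite !big_ord1 /=; ring.
have S (x : nat -> R[i]) k : \sum_(i < k.+1) x i = \sum_(i < k) x i + x k by rewrite big_ord_recr.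
rewrite (S (fun i => (\sum_(j < i.+1) a j) * (y i.+1 - y i))) IH (S (fun i => a i * y i) n.+1) (S a n.+1).
ring.
Qed.

Definition cesaro_coef a k : R[i] := k.+1%:R^-1 * \sum_(j < k.+1) a j.

Lemma realc_nat n : (n%:R%:C : R[i]) = n%:R.
Proof. exact: rmorph_nat. Qed.

(** Abel summation moves the difference onto the partial sums of [a]. The boundary term vanishes
    because [beta n n.+1] contains the binomial coefficient of [n + 1] out of [n]. *)
Lemma wmono_derive a n s :
  \sum_(i < n.+1) cesaro_coef a i * (i.+1%:R * (beta n i.+1 s - beta n i s))%:C = - wmono a n s.
Proof.
transitivity (\sum_(i < n.+1) (\sum_(j < i.+1) a j) * ((beta n i.+1 s)%:C - (beta n i s)%:C)).
  apply: eq_bigr => i _; rewrite /cesaro_coef realcM realc_nat rmorphB.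
  have i0 : i.+1%:R != 0 :> R[i] by rewrite pnatr_eq0.
  by field.
rewrite (abel_sum (fun i => (beta n i s)%:C)) /beta bin_small// mul0r mulr0 add0r.
by [].
Qed.

Lemma rder_csum c n s (v : nat -> R -> R) (dv : nat -> R) :
  (forall i, (i < n)%N -> is_derive s 1 (v i) (dv i)) ->
  is_derive s 1 (fun t => complex.Re (\sum_(i < n) c i * (v i t)%:C))
    (complex.Re (\sum_(i < n) c i * (dv i)%:C)) /\
  is_derive s 1 (fun t => complex.Im (\sum_(i < n) c i * (v i t)%:C))
    (complex.Im (\sum_(i < n) c i * (dv i)%:C)).
Proof.
have RC z x : complex.Re (z * x%:C) = complex.Re z * x by rewrite mulrC Re_realM mulrC.
have IC z x : complex.Im (z * x%:C) = complex.Im z * x by rewrite mulrC Im_realM mulrC.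
elim: n => [|n IH] H.
  split; (rewrite [X in is_derive _ _ X _](_ : _ = (fun=> 0 : R));
    [|by apply/funext => t; rewrite big_ord0]; rewrite big_ord0; exact: is_derive_cst).
have [I1 I2] : _ /\ _ := IH (fun i hi => H i (ltnW hi)).
have Hn := H n (ltnSn n); split.
  rewrite [X in is_derive _ _ X _](_ : _ = (fun t => complex.Re (\sum_(i < n) c i * (v i t)%:C) + complex.Re (c n) * v n t)); last first.
    by apply/funext => t; rewrite big_ord_recr /= ReD RC.
  by rewrite big_ord_recr /= ReD RC; exact: rder_add I1 (is_derive_lmul _ Hn).
rewrite [X in is_derive _ _ X _](_ : _ = (fun t => complex.Im (\sum_(i < n) c i * (v i t)%:C) + complex.Im (c n) * v n t)); last first.
  by apply/funext => t; rewrite big_ord_recr /= ImD IC.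
by rewrite big_ord_recr /= ImD IC; exact: rder_add I2 (is_derive_lmul _ Hn).
Qed.

Lemma continuous_expN : continuous (fun t : R => expR (- t)).
Proof.
move=> t; apply: (@continuous_comp _ _ _ (fun t : R => - t)); last exact: continuous_expR.
exact: continuousN.
Qed.

Lemma continuous_rpow (v : R -> R) n : continuous v -> continuous (fun t => v t ^+ n).
Proof.
move=> V; elim: n => [|n IH]; first exact: (@continuous_rcst _ 1).
rewrite (_ : (fun t => v t ^+ n.+1) = (fun t => v t * v t ^+ n)); first exact: continuous_rmul.
by apply/funext => t; rewrite exprS.
Qed.

Lemma continuous_beta n i : continuous (beta n i).
Proof.
apply: (continuous_rmul (@continuous_rcst _ _)); apply: continuous_rmul.
  by apply: continuous_rpow; exact: continuous_expN.
apply: continuous_rpow; apply: (continuous_radd (@continuous_rcst _ 1)).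
rewrite (_ : (fun t : R => - expR (- t)) = (fun t => -1 * expR (- t))).
  exact: (continuous_rmul (@continuous_rcst _ (-1)) continuous_expN).
by apply/funext => t; rewrite mulN1r.
Qed.

Lemma ccont_wmono c n : ccont (wmono c n).
Proof. by apply: ccont_sum => i; apply: ccontZ; apply: ccont_real; exact: continuous_beta. Qed.

Lemma wmono_int a n s t : s <= t ->
  wmono (cesaro_coef a) n t - wmono (cesaro_coef a) n s = - cint s t (wmono a n).
Proof.
move=> st; rewrite -cintN; last exact: ccont_wmono.
have B x i : (i < n.+1)%N -> is_derive x 1 (beta n i) (i.+1%:R * (beta n i.+1 x - beta n i x)).
  by rewrite ltnS; exact: beta_derive.
have H x := @rder_csum (cesaro_coef a) n.+1 x _ _ (B x).
apply/esym/cint_FTC2 => //; first by apply: ccontN; exact: ccont_wmono.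
- by move=> x; rewrite -wmono_derive; exact: (H x).1.
- by move=> x; rewrite -wmono_derive; exact: (H x).2.
Qed.

Lemma phi_exp s n z : (expR (- s))%:C * phi s z ^+ n = psum (fun i => (beta n i s)%:C) n.+1 z.
Proof.
rewrite /phi addrC exprDn mulr_sumr /psum; apply: eq_bigr => i _; rewrite /beta.
rewrite exprMn -!realcX -mulr_natl -realc_nat !realcM exprS realcM; ring.
Qed.

Definition wpoly c b n s : R[i] := \sum_(k < n) Num.conj (b k) * wmono c k s.

Lemma ccont_wpoly c b n : ccont (wpoly c b n).
Proof. by apply: ccont_sum => k; apply: ccontZ; exact: ccont_wmono. Qed.

Lemma realcJ x : Num.conj x%:C = x%:C :> R[i].
Proof. by apply: complex_ext; rewrite ?ReJ ?ImJ ?oppr0. Qed.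

(** The binomial expansion of powers of [phi s] makes the shifted polynomial a polynomial again,
    which replaces a pairing defined as a limit by an explicit smooth function of [s]. *)
Lemma wpair_poly p q a f b n s : 1 < p -> p^-1 + q^-1 = 1 -> 0 <= s -> has_ps a f -> Hp p f ->
  wpair f (psum b n) s = wpoly a b n s.
Proof.
move=> p1 pq s0 P HF; have q1 := conj_exponent p1 pq; have F := HF.1.
suff L : paired f (shift s (psum b n)) (((expR (- s))%:C)^-1 * wpoly a b n s).
  rewrite /wpair (pairingE L) mulrA mulfV ?mul1r//.
  by rewrite eq_complex /= eqxx andbT gt_eqF// expR_gt0.
have E0 : ((expR (- s))%:C : R[i]) != 0.
  by rewrite eq_complex /= eqxx andbT gt_eqF// expR_gt0.
have Hs k : holo (shift s (psum b k)) by apply: holo_shift => //; exact: holo_psum.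
elim: n => [|n IH].
  rewrite /wpoly big_ord0 mulr0.
  have := @paired_poly _ a f b 0 P; rewrite big_ord0.
  by apply: eq_pairedr => z _; rewrite /shift /psum !big_ord0.
have P2 : paired f (psum (fun i => (beta n i s)%:C) n.+1) (wmono a n s).
  have := @paired_poly _ a f (fun i => (beta n i s)%:C) n.+1 P.
  by rewrite (eq_bigr (fun i : 'I_n.+1 => a i * (beta n i s)%:C)) => [|i _]; rewrite ?realcJ.
have P3 := pairedZr (((expR (- s))%:C)^-1 * b n) F (@holo_psum R _ _) P2.
have P4 := pairedDr F (Hs n) (holoZ _ (@holo_psum R _ _)) IH P3.
have -> : ((expR (- s))%:C)^-1 * wpoly a b n.+1 s = ((expR (- s))%:C)^-1 * wpoly a b n s
   + Num.conj (((expR (- s))%:C)^-1 * b n) * wmono a n s.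
  rewrite /wpoly big_ord_recr /= conjM.
  have -> : Num.conj ((expR (- s))%:C)^-1 = ((expR (- s))%:C)^-1 :> R[i] by rewrite fmorphV; congr (_^-1); exact: realcJ.
  by ring.
apply: eq_pairedr P4 => z z1; rewrite /shift (psumS b) -phi_exp; congr (_ + _).
by rewrite -[RHS]mul1r -(mulVf E0); ring.
Qed.

Lemma wpoly_int a b n s t : s <= t ->
  wpoly (cesaro_coef a) b n t - wpoly (cesaro_coef a) b n s = - cint s t (wpoly a b n).
Proof.
move=> st; have cw k : ccont (fun x => Num.conj (b k) * wmono a k x).
  by apply: ccontZ; exact: ccont_wmono.
rewrite /wpoly cint_sum// -sumrB -sumrN; apply: eq_bigr => k _.
by rewrite cintZ; [rewrite -mulrBr wmono_int// mulrN|exact: ccont_wmono].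
Qed.

End Semigroup.

(** * The resolvent identity and boundedness of the Cesaro operator *)

Section CesaroPairing.
Variable R : realType.
Implicit Types (p q r s t x y e A B D K : R) (u : R -> R[i]) (z l m : R[i])
  (a b c : nat -> R[i]) (f g h : R[i] -> R[i]).

Lemma uniform_ccont u : (forall e, 0 < e -> exists2 v, ccont v & forall x, normc (u x - v x) <= e) ->
  ccont u.
Proof.
move=> H x e e0; have e4 : 0 < e / 4 by rewrite divr_gt0.
have [v V uv] := H _ e4; have [d d0 D] := V x _ e4; exists d => // y /D h.
rewrite (le_lt_trans (normc_triangle (v y) _ _))//.
have h1 := uv y; have h2 := normc_triangle (v x) (v y) (u x).
have h3 := uv x; rewrite normc_dist in h3; lra.
Qed.

Lemma wpair_addr p q f g h s : 1 < p -> p^-1 + q^-1 = 1 -> 0 <= s -> Hp p f -> Hp q g -> Hp q h ->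
  wpair f (fun z => g z + h z) s = wpair f g s + wpair f h s.
Proof.
move=> p1 pq s0 F G H; have q1 := conj_exponent p1 pq.
have Gs := Hp_shift q1 s0 G; have Hs := Hp_shift q1 s0 H.
have L := pairedDr F.1 Gs.1 Hs.1 (pairingP p1 pq F Gs) (pairingP p1 pq F Hs).
by rewrite /wpair -mulrDr -(pairingE L).
Qed.

Lemma eq_pairing f g h : (forall z, normc z < 1 -> g z = h z) ->
  pairing f g = pairing f h.
Proof.
move=> gh; rewrite /pairing; congr (xget _ _); apply/seteqP; split => l /=; apply: eq_pairedr => //.
by move=> z /gh.
Qed.

Lemma wpair_approx p q A e f g b n s : 1 < p -> p^-1 + q^-1 = 1 -> 0 <= s -> 0 < A -> 0 < e ->
  holo f -> bounded_means p f (A `^ p) -> Hp q g ->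
  bounded_means q (fun z => g z - psum b n z) (e `^ q) ->
  normc (wpair f g s - wpair f (psum b n) s) <= 4 * (A * e).
Proof.
move=> p1 pq s0 A0 e0 F FA G E; have q1 := conj_exponent p1 pq.
have p0 : 0 < p by rewrite (lt_trans _ p1).
have Hb := Hp_psum b n q1.
have HE := HpI e0 (holoB G.1 Hb.1) E.
have -> : wpair f g s - wpair f (psum b n) s = wpair f (fun z => g z - psum b n z) s.
  have -> : wpair f g s = wpair f (fun z => psum b n z + (g z - psum b n z)) s.
    rewrite /wpair; congr (_ * _); apply: eq_pairing => z _.
    by rewrite /shift addrC subrK.
  by rewrite (wpair_addr p1 pq s0 (HpI A0 F FA) Hb HE) addrAC subrr add0r.
have := wpair_bound p1 pq A0 e0 F HE.1 FA E s0; move=> h; apply: (le_trans h).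
rewrite -[leRHS]mulr1; apply: ler_wpM2l; first exact: mulr_ge0 _ (ltW (mulr_gt0 A0 e0)).
rewrite -[leRHS]expR0 ler_expR mulNr oppr_le0; apply: mulr_ge0 s0.
by rewrite invr_ge0 ltW.
Qed.

(** A uniform limit of the polynomial case. The even extension through [|x|] is there because the
    semigroup lives on [s >= 0], whereas the integration lemmas ask for continuity on the whole
    line. *)
Lemma ccont_wpair p q f g : 1 < p -> p^-1 + q^-1 = 1 -> Hp p f -> Hp q g ->
  ccont (fun x => wpair f g `|x|).
Proof.
move=> p1 pq HF HG; have q1 := conj_exponent p1 pq.
have [F [A A0 FA]] := HF; have [G [B B0 GB]] := HG.
apply: uniform_ccont => e e0.
have e1 : 0 < e / (4 * A) by rewrite divr_gt0// mulr_gt0.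
have [b [n E]] := poly_approx q1 G GB e1.
exists (fun x => wpoly (fcoef f) b n `|x|).
  by apply: ccont_comp_real; [exact: norm_continuous|exact: ccont_wpoly].
move=> x; rewrite -(wpair_poly _ _ p1 pq (normr_ge0 x) (holo_has_ps F) HF).
rewrite (le_trans (wpair_approx p1 pq (normr_ge0 x) A0 e1 F FA HG E))//.
by rewrite le_eqVlt; apply/orP; left; apply/eqP; field; rewrite gt_eqF.
Qed.

(** The differential equation in integrated form: for polynomial [g] it is [wpoly_int], and both
    sides depend continuously on [g], so no derivative of a general [wpair] is needed. *)
Lemma wpair_int p q a f h g s t : 1 < p -> p^-1 + q^-1 = 1 -> has_ps a f ->
  has_ps (cesaro_coef a) h -> Hp p f -> Hp p h -> Hp q g -> 0 <= s -> s <= t ->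
  wpair h g t - wpair h g s = - cint s t (fun x => wpair f g `|x|).
Proof.
move=> p1 pq PF PH HF HH HG s0 st; have q1 := conj_exponent p1 pq.
have [F [A A0 FA]] := HF; have [G [B B0 GB]] := HG; have [H [D D0 HD]] := HH.
have t0 := le_trans s0 st.
apply/eqP; rewrite -subr_eq0 -normc_eq0 eq_le normc_ge0 andbT.
apply/ler_addgt0Pl => e e0; rewrite addr0.
(* Total weight of the errors when [g] is replaced by a polynomial: [4 D] at each endpoint and [4 A]
   per unit length of the integral. *)
pose k := 8 * D + 4 * A * (t - s).
have k0 : 0 < k.
  have h1 : 0 < 8 * D by rewrite mulr_gt0.
  have h2 : 0 <= 4 * A * (t - s) by apply: mulr_ge0; rewrite ?subr_ge0// mulr_ge0// ltW.
  by rewrite /k ltr_pwDl.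
have kn : k != 0 by rewrite gt_eqF.
have kE : 8 * D + 4 * A * (t - s) = k by [].
clearbody k.
have e1 : 0 < e / k by rewrite divr_gt0.
have [b [n E]] := poly_approx q1 G GB e1.
have Xt := wpair_approx p1 pq t0 D0 e1 H HD HG E.
have Xs := wpair_approx p1 pq s0 D0 e1 H HD HG E.
rewrite !(wpair_poly _ _ p1 pq _ PH HH)// in Xt Xs.
have Wi := wpoly_int a b n st.
have cW := ccont_wpair p1 pq HF HG.
have X : normc (cint s t (fun x => wpair f g `|x|) - cint s t (wpoly a b n)) <= 4 * (A * (e / k)) * (t - s).
  rewrite -cintB//; last exact: ccont_wpoly.
  apply: cint_bound => //; first by apply: ccontB => //; exact: ccont_wpoly.
  move=> x /andP[sx _]; have x0 := le_trans s0 sx; rewrite ger0_norm//.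
  rewrite -(wpair_poly _ _ p1 pq x0 PF HF).
  exact: (wpair_approx p1 pq x0 A0 e1 F FA HG E).
have -> : wpair h g t - wpair h g s - - cint s t (fun x => wpair f g `|x|) =
  (wpair h g t - wpoly (cesaro_coef a) b n t) - (wpair h g s - wpoly (cesaro_coef a) b n s)
  + (cint s t (fun x => wpair f g `|x|) - cint s t (wpoly a b n)).
  have -> : cint s t (wpoly a b n) = - (wpoly (cesaro_coef a) b n t - wpoly (cesaro_coef a) b n s).
    by rewrite Wi opprK.
  move: (wpair h g t) (wpair h g s) (cint s t _) (wpoly _ b n t) (wpoly _ b n s) => x1 x2 x3 x4 x5.
  by ring.
rewrite (le_trans (ler_normcD _ _))// .
apply: (le_trans (lerD (ler_normcB _ _) X)); apply: (le_trans (lerD (lerD Xt Xs) (lexx _))).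
rewrite le_eqVlt; apply/orP; left; apply/eqP.
have -> : 4 * (D * (e / k)) + 4 * (D * (e / k)) + 4 * (A * (e / k)) * (t - s) = e / k * (8 * D + 4 * A * (t - s)) by ring.
by rewrite kE divfK.
Qed.

Lemma rint_exp_le (k K t : R) : 0 < k -> 0 <= K -> 0 <= t ->
  rint 0 t (fun x => K * expR (- k * x)) <= K / k.
Proof.
move=> k0 K0 t0.
have ce : continuous (fun x : R => expR (- k * x)).
  move=> x; apply: (@continuous_comp _ _ _ (fun x : R => - k * x)); last exact: continuous_expR.
  exact: (continuous_rmul (@continuous_rcst _ (- k)) (fun x => @cvg_id _ _)).
have cu : continuous (fun x : R => K * expR (- k * x)).
  exact: (continuous_rmul (@continuous_rcst _ K) ce).
have D x : is_derive x 1 (fun x => - (K / k) * expR (- k * x)) (K * expR (- k * x)).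
  have D := is_derive_lmul (- (K / k)) (rder_expN (- k) x); apply: (is_derive_eq D).
  by field; rewrite gt_eqF.
rewrite (rint_FTC2 t0 cu D) mulr0 expR0 mulr1.
have : 0 <= K / k * expR (- k * t) by rewrite mulr_ge0 ?expR_ge0// divr_ge0// ltW.
lra.
Qed.

Lemma beta_bound n i t : 0 <= t -> `|beta n i t| <= 'C(n, i)%:R * expR (- t).
Proof.
move=> /expRN_01; rewrite /beta; set e := expR (- t) => /andP[e0 e1].
rewrite normrM ger0_norm//; apply: ler_wpM2l => //.
rewrite normrM !normrX (gtr0_norm e0) ger0_norm ?subr_ge0// exprS -[leRHS]mulr1 -mulrA.
have h1 : 0 <= e ^+ i by rewrite exprn_ge0// ltW.
have h2 : e ^+ i <= 1 by rewrite exprn_ile1// ltW.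
have d1 : 0 <= 1 - e by rewrite subr_ge0.
have h3 : 0 <= (1 - e) ^+ (n - i) by exact: exprn_ge0.
have h4 : (1 - e) ^+ (n - i) <= 1 by rewrite exprn_ile1// lerBlDr lerDl ltW.
by apply: ler_wpM2l; [exact: ltW|exact: mulr_ile1].
Qed.

Lemma wpoly_decay c b n : exists2 M, 0 <= M & forall t, 0 <= t ->
  normc (wpoly c b n t) <= M * expR (- t).
Proof.
exists (\sum_(k < n) normc (b k) * \sum_(i < k.+1) normc (c i) * 'C(k, i)%:R).
  apply: sumr_ge0 => k _; apply: mulr_ge0; first exact: normc_ge0.
  by apply: sumr_ge0 => i _; apply: mulr_ge0 => //; exact: normc_ge0.
move=> t t0; rewrite /wpoly (le_trans (ler_normc_sum _ _ _))// mulr_suml.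
apply: ler_sum => k _; rewrite normcM normcJ -mulrA; apply: ler_wpM2l; first exact: normc_ge0.
rewrite (le_trans (ler_normc_sum _ _ _))// mulr_suml.
apply: ler_sum => i _; rewrite normcM normcR -mulrA; apply: ler_wpM2l; first exact: normc_ge0.
exact: beta_bound.
Qed.

Lemma beta0 n i : (i <= n)%N -> beta n i (0 : R) = (i == n)%:R.
Proof.
move=> ni; rewrite /beta oppr0 expR0 expr1n mul1r subrr expr0n subn_eq0.
have [->|h] := eqVneq i n; first by rewrite leqnn binn mulr1.
by rewrite leqNgt ltn_neqAle h ni mulr0.
Qed.

Lemma wpoly0 c b n : wpoly c b n 0 = \sum_(k < n) Num.conj (b k) * c k.
Proof.
apply: eq_bigr => k _; congr (_ * _); rewrite /wmono big_ord_recr /= beta0// eqxx mulr1.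
rewrite big1 ?add0r// => i _; rewrite beta0 ?(ltnW (ltn_ord i))//.
by rewrite (ltn_eqF (ltn_ord i)) mulr0.
Qed.

Lemma normc_cint_wpair p q A B f g t : 1 < p -> p^-1 + q^-1 = 1 -> 0 < A -> 0 < B ->
  holo f -> holo g -> bounded_means p f (A `^ p) -> bounded_means q g (B `^ q) -> 0 <= t ->
  normc (cint 0 t (fun x => wpair f g `|x|)) <= 4 * p * A * B.
Proof.
move=> p1 pq A0 B0 F G FA GB t0; have p0 : 0 < p by rewrite (lt_trans _ p1).
have cW := ccont_wpair p1 pq (HpI A0 F FA) (HpI B0 G GB).
rewrite (le_trans (normc_cint _ _ cW))//.
have K0 : 0 <= 4 * (A * B) by exact: mulr_ge0 _ (ltW (mulr_gt0 A0 B0)).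
have ip : 0 < p^-1 by rewrite invr_gt0.
have := rint_exp_le ip K0 t0; rewrite invrK.
have -> : 4 * (A * B) * p = 4 * p * A * B by ring.
apply: le_trans; apply: le_rint; first exact: ccont_norm.
  apply: (continuous_rmul (@continuous_rcst _ _)) => x.
  apply: (@continuous_comp _ _ _ (fun x : R => - p^-1 * x)); last exact: continuous_expR.
  exact: (continuous_rmul (@continuous_rcst _ (- p^-1)) (fun x => @cvg_id _ _)).
move=> x /andP[x0 _]; rewrite ger0_norm//.
exact: (wpair_bound p1 pq A0 B0 F G FA GB x0).
Qed.

(* By duality it suffices to test against polynomials. *)
Lemma cesaro_Hp p a f : 1 < p -> has_ps a f -> Hp p f ->
  exists2 h, has_ps (cesaro_coef a) h & Hp p h.
Proof.
move=> p1 PF HF; have [F [A A0 FA]] := HF.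
have p0 : 0 < p by rewrite (lt_trans _ p1).
pose q : R := (1 - p^-1)^-1.
have pq : p^-1 + q^-1 = 1 by rewrite invrK addrC subrK.
have q1 := conj_exponent p1 pq; clearbody q.
have [A1 A10 DL] := duality p1 pq (riesz q1).
have K0 : 0 < 4 * p * A by rewrite !mulr_gt0.
have [|h Ph Bh] := DL (cesaro_coef a) _ K0; last first.
  by exists h; [exact: Ph|exact: (HpI (mulr_gt0 A10 K0) (has_ps_holo Ph) Bh)].
move=> b n r B r01 B0 GB.
pose b' k := (r ^+ k)%:C * b k.
have GB' : bounded_means q (psum b' n) (B `^ q).
  move=> x /andP[x0 x1]; have /andP[r0 r1] := r01.
  have -> : mean q (psum b' n) x = mean q (psum b n) (r * x).
    by apply: eq_avg => t; rewrite psum_dilate mulrA -realcM.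
  apply: GB; apply/andP; split; first exact: mulr_ge0.
  exact: (le_lt_trans (ler_piMl x0 (ltW r1)) x1).
have -> : \sum_(k < n) cesaro_coef a k * (r ^+ k)%:C * Num.conj (b k) = wpoly (cesaro_coef a) b' n 0.
  by rewrite wpoly0; apply: eq_bigr => k _; rewrite /b' conjM realcJ; ring.
have [M M0 HM] := wpoly_decay (cesaro_coef a) b' n.
have Hb := holo_psum b' n.
(* Integration over [[0, t]] bounds the value at 0 by [4 p A B] plus a remainder at [t]. The
   constant [M] depends on the polynomial, but the remainder decays, so letting [t] grow leaves a
   bound uniform in [b]. *)
have bnd t : 0 <= t -> normc (wpoly (cesaro_coef a) b' n 0) <= 4 * p * A * B + M * expR (- t).
  move=> t0; have := wpoly_int a b' n t0.
  have -> : cint 0 t (wpoly a b' n) = cint 0 t (fun x => wpair f (psum b' n) `|x|).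
    apply: eq_cint => x /andP[x0 _]; rewrite ger0_norm//.
    by rewrite (wpair_poly _ _ p1 pq x0 PF HF).
  have I := normc_cint_wpair p1 pq A0 B0 F Hb FA GB' t0.
  set X := cint _ _ _ in I *; move=> E.
  have -> : wpoly (cesaro_coef a) b' n 0 = X + wpoly (cesaro_coef a) b' n t.
    by rewrite -[X]opprK -E; move: (wpoly _ b' n 0) (wpoly _ b' n t) => x y; ring.
  by rewrite (le_trans (ler_normcD _ _))//; apply: (lerD I); exact: HM.
apply/ler_addgt0Pl => e e0.
have M1 : 0 < M + 1 by rewrite ltr_wpDl.
have d0 : 0 < Num.min 1 (e / (M + 1)) by rewrite lt_min ltr01 divr_gt0.
have t0 : 0 <= - ln (Num.min 1 (e / (M + 1))) by rewrite oppr_ge0 ln_le0// ge_min lexx.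
have := bnd _ t0; rewrite opprK lnK ?posrE// => h; rewrite (le_trans h)// addrC; apply: lerD => //.
have h1 : Num.min 1 (e / (M + 1)) <= e / (M + 1) by rewrite ge_min lexx orbT.
rewrite (le_trans (ler_wpM2l M0 h1))// mulrCA ler_piMr ?ltW//.
by rewrite ltr_pdivrMr// mul1r ltrDl.
Qed.

End CesaroPairing.

(** * Fatou's theorem *)

Transparent rint.
Section RadialLimits.
Variable R : realType.
Implicit Types (r s t x y e c K M : R) (u : R -> R) (w : R[i]).

Opaque rint.

(** [rint] is not oriented, so a base point left of both 0 and [x] is used; near a given [t] it may
    be replaced by the fixed point [- N]. *)
Lemma primitive_exists u : continuous u -> exists V : R -> R, forall t : R, is_derive t 1 V (u t).
Proof.
move=> U; pose V x := rint (- (`|x| + 1)) x u - rint (- (`|x| + 1)) 0 u.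
exists V => t; apply: eps_derive => e e0.
pose N := `|t| + 3.
have tN : - N < t by have := ler_norm (- t); rewrite normrN /N; lra.
have [d d0 H] := derive_eps (rint_FTC1 U tN) e0.
exists (Num.min d 1); first by rewrite lt_min d0 ltr01.
have VE x : `|x - t| < 2 -> V x = rint (- N) x u - rint (- N) 0 u.
  move=> xt; have n0 := normr_ge0 x.
  have xN : `|x| + 1 <= N.
    have := ler_normD t (x - t); rewrite addrCA subrr addr0 /N; lra.
  have h1 : - N <= - (`|x| + 1) by lra.
  have h2 : - (`|x| + 1) <= x by have := ler_norm (- x); rewrite normrN; lra.
  have h3 : - (`|x| + 1) <= 0 by lra.
  by rewrite (rint_cat U h1 h2) (rint_cat U h1 h3) /V; ring.
move=> k; rewrite lt_min => /andP[kd k1].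
rewrite !VE ?subrr ?normr0//; last by rewrite addrAC subrr add0r; lra.
have -> : rint (- N) (t + k) u - rint (- N) 0 u - (rint (- N) t u - rint (- N) 0 u) - u t * k
  = rint (- N) (t + k) u - rint (- N) t u - u t * k by ring.
exact: H.
Qed.

Lemma deriv_continuous (v dv : R -> R) : (forall t : R, is_derive t 1 v (dv t)) -> continuous v.
Proof. by move=> H t; have [h _] := H t; apply/differentiable_continuous/derivable1_diffP. Qed.

Lemma cont_bounded a b u : a <= b -> continuous u -> exists2 K, 0 <= K &
  forall x, a <= x <= b -> `|u x| <= K.
Proof.
move=> ab U; have [|c _ H] := @EVT_max R (fun x => `|u x|) a b ab.
  by apply: continuous_subspaceT; exact: continuous_normr_comp.
by exists `|u c| => // x xab; apply: H; rewrite in_itv.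
Qed.

Lemma sin_le_norm x : `|sin x| <= `|x|.
Proof.
wlog x0 : x / 0 <= x => [H|].
  have [/H//|x0] := leP 0 x.
  by rewrite -(normrN (sin x)) -sinN -(normrN x); apply: H; lra.
rewrite (ger0_norm x0).
have E : rint 0 x cos = sin x.
  have D t : is_derive (t : R) 1 (@sin R) (cos t) by exact: is_derive_sin.
  by rewrite (rint_FTC2 x0 (@continuous_cos R) D) sin0 subr0.
have cN : continuous (fun t : R => - cos t) by move=> t; apply: cvgN; exact: continuous_cos.
have h1 : forall t : R, 0 <= t <= x -> cos t <= 1 by move=> t _; exact: cos_le1.
have h2 : forall t : R, 0 <= t <= x -> - cos t <= 1 by move=> t _; rewrite lerNl cos_geN1.
have := rint_bound x0 (@continuous_cos R) h1; have := rint_bound x0 cN h2.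
rewrite rintN; last exact: continuous_cos.
by rewrite E subr0 mul1r ler_norml lerNl => -> ->.
Qed.

Lemma one_sub_cos s : 1 - cos s = 2 * sin (s / 2) ^+ 2.
Proof.
have -> : cos s = cos ((s / 2) *+ 2) by congr cos; rewrite -mulr_natr; field.
by rewrite cos_mulr2n -mulr_natr; have := cos2Dsin2 (s / 2); lra.
Qed.

(** Bounds the denominator of the Poisson kernel below. Half angles near zero are handled by the
    derivative of the sine; on the remaining range the cosine is monotone, so [|cos (s / 2)|] is at
    most its larger end value [k < 1], as [m] stays below [2 pi]. *)
Lemma chord_lower m : 0 < m < 2 * pi -> exists2 c, 0 < c & forall s, `|s| <= m ->
  c * s ^+ 2 <= 1 - cos s.
Proof.
move=> /andP[m0 m2].
have h2 : 0 < 2^-1 :> R by rewrite invr_gt0.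
have [d d0 H] := derive_eps (is_derive_sin (0 : R)) h2.
rewrite sin0 cos0 in H.
pose y0 := Num.min (d / 2) (m / 2 / 2).
have y00 : 0 < y0 by rewrite lt_min !divr_gt0.
have y0d : y0 < d by rewrite (@le_lt_trans _ _ (d / 2))// ?ge_min ?lexx//; lra.
have y0m : y0 < m / 2 by rewrite (@le_lt_trans _ _ (m / 2 / 2))// ?ge_min ?lexx ?orbT//; lra.
clearbody y0.
pose k := Num.max `|cos y0| `|cos (m / 2)|.
have cosk y : 0 < y < pi -> `|cos y| < 1.
  move=> /sin_gt0_pi s0; rewrite -(@ltr_pXn2r _ 2)// ?nnegrE// expr1n real_normK ?num_real//.
  by have := cos2Dsin2 y; have := exprn_gt0 2 s0; lra.
have k1 : k < 1 by rewrite gt_max !cosk//; apply/andP; split; lra.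
have k0 : 0 <= k by rewrite le_max normr_ge0.
have kk : k ^+ 2 < 1 by rewrite exprn_ilt1.
pose c := Num.min (1 / 8) (2 * (1 - k ^+ 2) / m ^+ 2).
exists c; first by rewrite lt_min; apply/andP; split; rewrite ?divr_gt0 ?mulr_gt0 ?exprn_gt0 ?subr_gt0.
suff P s : 0 <= s <= m -> c * s ^+ 2 <= 1 - cos s.
  move=> s sm; have [s0|s0] := leP 0 s; first by apply: P; rewrite s0 -(ger0_norm s0).
  by rewrite -sqrrN -cosN; apply: P; rewrite -(ltr0_norm s0) sm normr_ge0.
move=> /andP[s0 sm]; rewrite one_sub_cos.
have [sy|sy] := ltP (s / 2) y0.
  apply: (@le_trans _ _ (1 / 8 * s ^+ 2)).
    by apply: ler_wpM2r; [exact: sqr_ge0|rewrite /c ge_min lexx].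
  have s20 : 0 <= s / 2 by lra.
  have := H (s / 2); rewrite add0r subr0 mul1r (ger0_norm s20) => /(_ (lt_trans sy y0d)).
  rewrite ler_norml => /andP[h _].
  have h3 : s / 4 <= sin (s / 2) by lra.
  have h4 : (s / 4) ^+ 2 <= sin (s / 2) ^+ 2 by apply: lerXn2r; rewrite ?nnegrE//; lra.
  by rewrite exprMn in h4; have := sqr_ge0 s; lra.
apply: (@le_trans _ _ (2 * (1 - k ^+ 2) / m ^+ 2 * s ^+ 2)).
  by apply: ler_wpM2r; [exact: sqr_ge0|rewrite /c ge_min lexx orbT].
rewrite mulrAC ler_pdivrMr ?exprn_gt0//.
have kz : 0 <= 1 - k ^+ 2 by rewrite subr_ge0 ltW.
have ck : cos (s / 2) ^+ 2 <= k ^+ 2.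
  rewrite -real_normK ?num_real//; apply: lerXn2r; rewrite ?nnegrE//.
  have itv y : y0 <= y <= m / 2 -> y \in `[0, pi] by move=> /andP[? ?]; rewrite in_itv/=; apply/andP; split; lra.
  have i0 : y0 \in `[0, pi] by apply: itv; rewrite lexx ltW.
  have i1 : m / 2 \in `[0, pi] by apply: itv; rewrite lexx ltW.
  have i2 : s / 2 \in `[0, pi] by apply: itv; rewrite sy; lra.
  have c1 : cos (s / 2) <= cos y0 by rewrite leNgt ltr_cos// -leNgt.
  have c2 : cos (m / 2) <= cos (s / 2) by rewrite leNgt ltr_cos// -leNgt; lra.
  rewrite ler_norml /k le_max lerNl le_max; apply/andP; split; apply/orP.
    right; apply: (@le_trans _ _ (- cos (m / 2))); first by rewrite lerN2.
    by rewrite -normrN ler_norm.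
  by left; rewrite (le_trans c1)// ler_norm.
have h1 : 1 - k ^+ 2 <= sin (s / 2) ^+ 2 by have := cos2Dsin2 (s / 2); lra.
have h2' : s ^+ 2 <= m ^+ 2 by apply: lerXn2r; rewrite ?nnegrE// ltW.
have := ler_pM kz (sqr_ge0 s) h1 h2'; lra.
Qed.

Lemma pkernel_polar r th t : 0 <= r < 1 ->
  pkernel (r%:C * expi th) t = (1 - r ^+ 2) / ((1 - r) ^+ 2 + 2 * r * (1 - cos (t - th))).
Proof.
move=> /andP[r0 r1]; rewrite pkernelE normc_circle//; congr (_ / _).
rewrite -mulrA -expiN -expiD normc_sq !(ReD, ImD, ReN, ImN) Re_realM Im_realM Re_expi Im_expi.
have -> : th - t = - (t - th) by rewrite opprB.
rewrite cosN sinN [complex.Re 1]/= [complex.Im 1]/=.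
by have := cos2Dsin2 (t - th); move: (cos _) (sin _) => C S h; nra.
Qed.

End RadialLimits.

Transparent avg.
Section RadialLimitPoint.
Variable R : realType.
Implicit Types (r s t x y e c K M : R) (u : R -> R) (w : R[i]).

Lemma avgE u : avg u = (2 * pi)^-1 * rint 0 (2 * pi) u.
Proof. by []. Qed.
Opaque avg.

Lemma rint_abs_le a b u (v : R -> R) : continuous u -> continuous v ->
  (forall t, a <= t <= b -> `|u t| <= v t) -> `|rint a b u| <= rint a b v.
Proof.
move=> U V H; have cN : continuous (fun t : R => - u t) by move=> t; apply: cvgN; exact: U.
have h1 : forall t : R, a <= t <= b -> u t <= v t.
  by move=> t /H; apply: le_trans; exact: ler_norm.
have h2 : forall t : R, a <= t <= b -> - u t <= v t.
  by move=> t /H; rewrite -normrN; apply: le_trans; exact: ler_norm.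
have := le_rint U V h1; have := le_rint cN V h2.
by rewrite rintN// ler_norml lerNl => -> ->.
Qed.

(* The kernel is [(1 - r^2) / D t] with [D t >= c (t - th)^2]. *)
Lemma poisson_derivative_bounds r th : 2^-1 <= r < 1 -> 0 < th < 2 * pi ->
  forall c, 0 < c -> (forall s, `|s| <= Num.max th (2 * pi - th) -> c * s ^+ 2 <= 1 - cos s) ->
  exists P' : R -> R, [/\ continuous P',
    forall t : R, is_derive t 1 (pkernel (r%:C * expi th)) (P' t),
    pkernel (r%:C * expi th) 0 <= (1 - r ^+ 2) / (c * th ^+ 2),
    forall t, 0 <= t <= 2 * pi -> `|P' t| * `|t - th| <= 2 / c * pkernel (r%:C * expi th) t &
    forall t, 0 <= t <= 2 * pi -> pkernel (r%:C * expi th) t * `|t - th| ^+ 2 <= (1 - r ^+ 2) / c].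
Proof.
move=> /andP[r2 r1] /andP[th0 th1] c c0 Hc.
have r0 : 0 < r by lra.
have r01 : 0 <= r < 1 by rewrite ltW.
pose D t := (1 - r) ^+ 2 + 2 * r * (1 - cos (t - th)).
have D0 t : 0 < D t.
  rewrite /D ltr_pwDl ?exprn_gt0 ?subr_gt0// mulr_ge0 ?subr_ge0 ?cos_le1//; lra.
have PE : pkernel (r%:C * expi th) = fun t => (1 - r ^+ 2) * (D t)^-1.
  by apply/funext => t; rewrite pkernel_polar.
have k0 : 0 <= 1 - r ^+ 2 by rewrite subr_ge0 exprn_ile1// ltW.
have DX t : 0 <= t <= 2 * pi -> c * `|t - th| ^+ 2 <= D t.
  move=> /andP[t0 t2].
  have h : `|t - th| <= Num.max th (2 * pi - th).
    rewrite le_max !ler_norml; have [|] := leP t th => h; apply/orP; [left|right]; lra.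
  have := Hc _ h; rewrite real_normK ?num_real// => h2.
  have h3 : 0 <= 1 - cos (t - th) by rewrite subr_ge0 cos_le1.
  (* Here [r >= 1/2] makes [2 r] at least 1, which keeps the constant [c] independent of [r]. *)
  have h4 : 1 * (1 - cos (t - th)) <= 2 * r * (1 - cos (t - th)) by rewrite ler_wpM2r//; lra.
  have := sqr_ge0 (1 - r); rewrite /D; lra.
pose P' t := (1 - r ^+ 2) * (- (D t) ^- 2 * (2 * r * sin (t - th))).
have dsh (t : R) : is_derive t 1 (fun x => x - th) 1.
  by have D1 := rder_add (is_derive_id t (1 : R)) (is_derive_cst (- th) t 1); apply: (is_derive_eq D1); rewrite addr0.
have dcos (t : R) : is_derive t 1 (fun x => cos (x - th)) (- sin (t - th)).
  have D1 := @is_derive1_comp R (@cos R) (fun x => x - th) t _ _ (is_derive_cos (t - th)) (dsh t).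
  by apply: (is_derive_eq D1); rewrite mulr1.
have dD (t : R) : is_derive t 1 D (2 * r * sin (t - th)).
  have D1 := is_derive_lmul (- (2 * r)) (dcos t).
  have D2 := rder_add (is_derive_cst ((1 - r) ^+ 2 + 2 * r) t 1) D1.
  have DE : D = fun x => (1 - r) ^+ 2 + 2 * r + - (2 * r) * cos (x - th).
    by apply/funext => x; rewrite /D; ring.
  by rewrite DE; apply: (is_derive_eq D2); rewrite add0r; ring.
have cD : continuous D by exact: deriv_continuous dD.
have cDV : continuous (fun t => (D t)^-1).
  by move=> t; apply: cvgV; [rewrite gt_eqF|exact: cD].
have csin : continuous (fun t => sin (t - th)).
  move=> t; apply: (@continuous_comp _ _ _ (fun x : R => x - th) (@sin R)); last exact: continuous_sin.
  exact: (deriv_continuous dsh).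
exists P'; split.
- apply: (continuous_rmul (@continuous_rcst _ _)).
  have -> : (fun t => - D t ^- 2 * (2 * r * sin (t - th)))
     = fun t => (D t)^-1 * ((D t)^-1 * (- (2 * r) * sin (t - th))).
    by apply/funext => t; rewrite -exprVn expr2; move: (D t)^-1 => x; ring.
  apply: (continuous_rmul cDV); apply: (continuous_rmul cDV).
  exact: (continuous_rmul (@continuous_rcst _ _) csin).
- move=> t; rewrite PE; apply: is_derive_lmul.
  by have D1 := is_deriveV (lt0r_neq0 (D0 t)) (dD t); apply: (is_derive_eq D1).
- rewrite PE; have := DX 0; rewrite lexx sub0r normrN (gtr0_norm th0) => h.
  apply: (ler_wpM2l k0); rewrite lef_pV2 ?posrE ?mulr_gt0 ?exprn_gt0//.
  by apply: h; lra.
- move=> t t02; rewrite PE.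
  have -> : `|P' t| * `|t - th| = (1 - r ^+ 2) * (`|- (D t) ^- 2 * (2 * r * sin (t - th))| * `|t - th|).
    by rewrite /P' (normrM (1 - r ^+ 2)) (ger0_norm k0) -[LHS]mulrA.
  have -> : 2 / c * ((1 - r ^+ 2) / D t) = (1 - r ^+ 2) * (2 / c / D t) by ring.
  apply: (ler_wpM2l k0); rewrite normrM normrN normrV ?unitfE ?gt_eqF ?exprn_gt0// (gtr0_norm (exprn_gt0 _ (D0 t))).
  rewrite normrM (gtr0_norm (mulr_gt0 _ r0))//.
  have h1 := sin_le_norm (t - th); have h2 := DX t t02.
  set X := `|t - th| in h1 h2 *; set S := `|sin _| in h1 *.
  have X0 : 0 <= X by exact: normr_ge0.
  have S0 : 0 <= S by exact: normr_ge0.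
  have d0 := D0 t; set d := D t in h2 d0 *.
  have -> : d ^- 2 * (2 * r * S) * X = (2 * (r * (S * X))) / d / d by field; rewrite gt_eqF.
  rewrite ler_pM2r ?invr_gt0// ler_pdivrMr//.
  have a1 : S * X <= X ^+ 2 by rewrite expr2 ler_wpM2r.
  have a2 : r * (S * X) <= 1 * X ^+ 2 by apply: ler_pM => //; [exact: ltW|exact: mulr_ge0|exact: ltW].
  have a3 : X ^+ 2 <= d / c by rewrite ler_pdivlMr// mulrC.
  have -> : 2 / c * d = 2 * (d / c) by ring.
  rewrite ler_pM2l//; lra.
- move=> t t02; rewrite PE -mulrA; apply: (ler_wpM2l k0).
  by rewrite mulrC ler_pdivrMr// mulrC ler_pdivlMr// mulrC; exact: DX.
Qed.

(** Integration by parts moves the derivative onto the kernel [P], so only the primitive [Psi] of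
    the boundary function matters. Where [Psi] has derivative [beta], the remainder [U] is at most
    [eps |x - th|] plus a multiple of [|x - th|^2]. Since [|P'| |x - th|] is at most a multiple of
    [P], the first part costs a multiple of [eps]; the second costs a small multiple of [eta] plus a
    term of order [1 - r^2]. The approximants [v n] keep every integrand continuous. *)
Lemma radial_limit (v V : nat -> R -> R) (h : R[i] -> R) (Psi : R -> R) th beta :
  0 < th < 2 * pi -> (forall n, continuous (v n)) ->
  (forall n (t : R), is_derive t 1 (V n) (v n t)) ->
  (forall w, normc w < 1 -> forall e, 0 < e -> exists N, forall n, (N <= n)%N ->
     `|avg (fun t => pkernel w t * v n t) - h w| <= e) ->
  (forall e, 0 < e -> exists N, forall n, (N <= n)%N -> forall x, 0 <= x <= 2 * pi ->
     `|V n x - V n 0 - Psi x| <= e) ->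
  (forall e, 0 < e -> exists2 d, 0 < d & forall x, `|x - th| < d ->
     `|Psi x - Psi th - beta * (x - th)| <= e * `|x - th|) ->
  forall e, 0 < e -> exists2 d, 0 <= d < 1 & forall r, d < r < 1 ->
    `|h (r%:C * expi th) - beta| <= e.
Proof.
move=> th02 cv dV Hh HV HP e e0; have /andP[th0 th2] := th02.
have pi0 := twopi_gt0 R.
have m02 : 0 < Num.max th (2 * pi - th) < 2 * pi by rewrite lt_max th0 gt_max; lra.
have [c c0 Hc] := chord_lower m02.
have [N1 HN1] := HV 1 ltr01.
have cV n : continuous (V n) by exact: (deriv_continuous (dV n)).
have [K0 K00 HK0] := cont_bounded (ltW pi0) (cV N1 : continuous (V N1)).
pose M := 2 * K0 + 1.
have PM x : 0 <= x <= 2 * pi -> `|Psi x| <= M.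
  move=> x02; have a1 := HN1 N1 (leqnn _) x x02; have a2 := HK0 x x02.
  have a3 : `|V N1 0| <= K0 by apply: HK0; rewrite lexx ltW.
  have -> : Psi x = V N1 x - V N1 0 - (V N1 x - V N1 0 - Psi x) by ring.
  have := ler_normB (V N1 x - V N1 0) (V N1 x - V N1 0 - Psi x).
  have := ler_normB (V N1 x) (V N1 0); rewrite /M; lra.
pose U x := Psi x - Psi th - beta * (x - th).
pose B := 2 * M + `|beta| * (2 * pi).
have M0 : 0 <= M by rewrite /M; lra.
have pi0' := ltW pi0.
have B0 : 0 <= B by exact: addr_ge0 (mulr_ge0 (ler0n _ 2) M0) (mulr_ge0 (normr_ge0 _) pi0').
have th_in : 0 <= th <= 2 * pi by rewrite !ltW.
have UB x : 0 <= x <= 2 * pi -> `|U x| <= B.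
  move=> /[dup] x02 /andP[x0 x2]; have a1 := PM x x02; have a2 := PM th th_in.
  have := ler_normB (Psi x - Psi th) (beta * (x - th)).
  have := ler_normB (Psi x) (Psi th); rewrite normrM /U /B.
  have : `|beta| * `|x - th| <= `|beta| * (2 * pi).
    by apply: ler_wpM2l => //; rewrite ler_norml; lra.
  lra.
pose C : R := 2 / c; have C0 : 0 < C by exact: divr_gt0 (ltr0Sn R 1) c0.
pose eps := e / (4 * C); have eps0 : 0 < eps by exact: divr_gt0 e0 (mulr_gt0 (ltr0Sn R 3) C0).
have [d d0 Hd] := HP _ eps0.
(* At distance at least [d] from [th] the bounded function [U] is dominated by [M' |x - th|^2], so a
   single inequality covers the whole interval. *)
pose M' := B / d ^+ 2.
have M'0 : 0 <= M' by exact: divr_ge0 B0 (sqr_ge0 d).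
have UX x : 0 <= x <= 2 * pi -> `|U x| <= eps * `|x - th| + M' * `|x - th| ^+ 2.
  move=> x02; have [xd|xd] := ltP `|x - th| d.
    rewrite (le_trans (Hd _ xd))// lerDl; exact: mulr_ge0 M'0 (exprn_ge0 2 (normr_ge0 _)).
  apply: ler_wpDl; first exact: mulr_ge0 (ltW eps0) (normr_ge0 _).
  rewrite (le_trans (UB x x02))// /M' mulrAC ler_pdivlMr ?exprn_gt0//.
  by apply: ler_wpM2l => //; apply: lerXn2r; rewrite ?nnegrE// ltW.
pose eta := e / (8 * C * (M' + 1)).
have M1 : 0 < M' + 1 by rewrite ltr_wpDl.
have eta0 : 0 < eta by exact: divr_gt0 e0 (mulr_gt0 (mulr_gt0 (ltr0Sn R 7) C0) M1).
pose L := (2 * pi)^-1 * (2 * B / (c * th ^+ 2)) + M' * C / (c * eta).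
have L0 : 0 <= L.
  have i1 : 0 <= (2 * pi)^-1 :> R by rewrite invr_ge0.
  have i2 : 0 <= 2 * B / (c * th ^+ 2).
    exact: divr_ge0 (mulr_ge0 (ler0n _ 2) B0) (mulr_ge0 (ltW c0) (sqr_ge0 th)).
  have i3 : 0 <= M' * C / (c * eta).
    exact: divr_ge0 (mulr_ge0 M'0 (ltW C0)) (mulr_ge0 (ltW c0) (ltW eta0)).
  exact: addr_ge0 (mulr_ge0 i1 i2) i3.
have bnd r : 2^-1 <= r < 1 -> `|h (r%:C * expi th) - beta| <= eps * C + M' * C * eta + (1 - r ^+ 2) * L.
  move=> /[dup] r21 /andP[r2 r1]; have r01 : 0 <= r < 1 by lra.
  have [P' [cP' dP P0 PX PXX]] := poisson_derivative_bounds r21 th02 c0 Hc.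
  set w := r%:C * expi th in dP P0 PX PXX *.
  have w1 : normc w < 1 by rewrite normc_circle; case/andP: r01.
  have cP := continuous_pkernel w1.
  have k0 : 0 <= 1 - r ^+ 2.
    by rewrite subr_ge0; apply: exprn_ile1; [case/andP: r01|exact: ltW].
  clearbody w.
  pose S := eps * C + M' * C * eta + (1 - r ^+ 2) * (M' * C / (c * eta)).
  pose Kw := rint 0 (2 * pi) (fun t => `|P' t|).
  have Kw0 : 0 <= Kw by apply: rint_ge0 => t _; exact: normr_ge0.
  (* [e1] measures the distance between the approximants and their limits. The total variation [Kw]
     of the kernel may be large, but it multiplies only [e1], which is then sent to 0 at fixed
     [r]. *)
  have key e1 : 0 < e1 -> `|h w - beta| <= e1 + ((2 * pi)^-1 *
     (2 * (pkernel w 0 * (B + 2 * e1)) + 2 * e1 * Kw) + S).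
    move=> e10; have [Na Ha] := Hh w w1 e1 e10; have [Nb Hb] := HV e1 e10.
    pose n := maxn Na Nb; have A := Ha n (leq_maxl _ _); have A' := Hb n (leq_maxr _ _).
    clearbody n; clear Ha Hb HV HN1 Hh.
    pose u x := V n x - V n th - beta * (x - th).
    have uU x : 0 <= x <= 2 * pi -> `|u x| <= `|U x| + 2 * e1.
      move=> x02; have a1 := A' x x02; have a2 := A' th th_in.
      have -> : u x = U x + ((V n x - V n 0 - Psi x) - (V n th - V n 0 - Psi th)) by rewrite /u /U; clear; ring.
      have b1 := ler_normD (U x) ((V n x - V n 0 - Psi x) - (V n th - V n 0 - Psi th)).
      have b2 := ler_normB (V n x - V n 0 - Psi x) (V n th - V n 0 - Psi th).
      clear -a1 a2 b1 b2; lra.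
    have du (t : R) : is_derive t 1 u (v n t - beta).
      have D1 := rder_add (dV n t) (is_derive_lmul (- beta) (is_derive_id t (1 : R))).
      have D2 := rder_add D1 (is_derive_cst (beta * th - V n th) t 1).
      have -> : u = (fun x => (V n x + - beta * x) + (beta * th - V n th)) by apply/funext => x; rewrite /u; ring.
      by apply: (is_derive_eq D2); rewrite addr0 mulr1.
    have cu : continuous u by exact: (deriv_continuous du).
    have dPu (t : R) : is_derive t 1 (fun x => pkernel w x * u x) (pkernel w t * (v n t - beta) + P' t * u t).
      by have D1 := rder_mul (dP t) (du t); apply: (is_derive_eq D1); rewrite (mulrC (u t)).
    have cvb : continuous (fun t => v n t - beta) by exact: (continuous_radd (cv n) (@continuous_rcst _ (- beta))).
    have cPv := continuous_rmul cP cvb; have cPu := continuous_rmul cP' cu.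
    have I := rint_FTC2 (ltW pi0) (continuous_radd cPv cPu) dPu.
    rewrite rintD// in I.
    have P2 : pkernel w (2 * pi) = pkernel w 0.
      by rewrite /pkernel /ckernel expi2pi expi0.
    have av : avg (fun t => pkernel w t * v n t) - beta = (2 * pi)^-1 * rint 0 (2 * pi) (fun t => pkernel w t * (v n t - beta)).
      have -> : beta = avg (fun t => beta * pkernel w t) by rewrite avgZ ?avg_pkernel ?mulr1.
      rewrite -avgB//; [|exact: (continuous_rmul cP (cv n))|exact: (continuous_rmul (@continuous_rcst _ beta) cP)].
      have -> : avg (fun t => beta * pkernel w t) = beta by rewrite avgZ ?avg_pkernel ?mulr1.
      by rewrite -avgE; apply: eq_avg => t; ring.
    have Ii : rint 0 (2 * pi) (fun t => pkernel w t * (v n t - beta)) =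
       pkernel w 0 * (u (2 * pi) - u 0) - rint 0 (2 * pi) (fun t => P' t * u t).
      by rewrite P2 in I; clear -I; lra.
    have bu x : 0 <= x <= 2 * pi -> `|u x| <= B + 2 * e1.
      by move=> x02; rewrite (le_trans (uU x x02))// lerD2r; exact: UB.
    have pk0 : 0 <= pkernel w 0 by exact: pkernel_ge0.
    have b1 : `|pkernel w 0 * (u (2 * pi) - u 0)| <= 2 * (pkernel w 0 * (B + 2 * e1)).
      rewrite normrM (ger0_norm pk0) mulrCA; apply: ler_wpM2l => //.
      have c1 := bu (2 * pi); have c2 := bu 0; rewrite !lexx pi0' in c1 c2.
      have := ler_normB (u (2 * pi)) (u 0); have := c1 isT; have := c2 isT; clear; lra.
    have b2 : `|rint 0 (2 * pi) (fun t => P' t * u t)| <= 2 * e1 * Kw + 2 * pi * S.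
      pose Q t := 2 * e1 * `|P' t| + ((eps * C + M' * C * eta) * pkernel w t + (1 - r ^+ 2) * (M' * C / (c * eta))).
      have cabs : continuous (fun t => 2 * e1 * `|P' t|).
        exact: (continuous_rmul (@continuous_rcst _ _) (continuous_normr_comp cP')).
      have cpk : continuous (fun t => (eps * C + M' * C * eta) * pkernel w t) by exact: (continuous_rmul (@continuous_rcst _ _) cP).
      have ck : continuous (fun _ : R => (1 - r ^+ 2) * (M' * C / (c * eta))) by exact: continuous_rcst.
      have cQ : continuous Q by exact: (continuous_radd cabs (continuous_radd cpk ck)).
      have -> : 2 * e1 * Kw + 2 * pi * S = rint 0 (2 * pi) Q.
        rewrite rintD//; last exact: continuous_radd.
        rewrite rintD// rintZ; last exact: continuous_normr_comp.
        rewrite rintZ// rint_cst ?(ltW pi0)// -/Kw.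
        have -> : rint 0 (2 * pi) (pkernel w) = 2 * pi.
          by have := avg_pkernel w1; rewrite avgE => a1; rewrite -[LHS](mulVKf (lt0r_neq0 pi0)) a1 mulr1.
        rewrite /S subr0; clear; by ring.
      apply: rint_abs_le => // t t02; rewrite normrM.
      have q0 : 0 <= pkernel w t by exact: pkernel_ge0.
      have d1 := uU t t02; have d2 := UX t t02; have d3 := PX t t02; have d4 := PXX t t02.
      rewrite -/C in d3.
      have X0 : 0 <= `|t - th| by exact: normr_ge0.
      have P0' : 0 <= `|P' t| by exact: normr_ge0.
      rewrite /Q; move: d1 d2 d3 d4 X0 P0' q0.
      move: `|u t| `|U t| `|P' t| `|t - th| (pkernel w t) => a1 a2 a3 a4 a5 d1 d2 d3 d4 X0 P0' q0.
      have f1 : a3 * a1 <= a3 * (eps * a4 + M' * a4 ^+ 2 + 2 * e1) by apply: (ler_wpM2l P0'); clear -d1 d2; lra.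
      have f2 : eps * (a3 * a4) <= eps * (C * a5) by apply: ler_wpM2l => //; exact: ltW.
      (* AM-GM: [P X <= eta P + P X^2 / eta] *)
      have f3 : a5 * a4 <= eta * a5 + (1 - r ^+ 2) / (c * eta).
        have g1 : a5 * a4 * eta <= (eta * a5 + (1 - r ^+ 2) / (c * eta)) * eta.
          have -> : (eta * a5 + (1 - r ^+ 2) / (c * eta)) * eta = eta ^+ 2 * a5 + (1 - r ^+ 2) / c.
            by field; rewrite !gt_eqF.
          have z1 := mulr_ge0 q0 (sqr_ge0 (a4 - eta)).
          have z2 := mulr_ge0 q0 (sqr_ge0 a4); have z3 := mulr_ge0 q0 (sqr_ge0 eta).
          clear -d4 z1 z2 z3; lra.
        by rewrite ler_pM2r in g1.
      have f4 : M' * (a3 * a4 * a4) <= M' * (C * (eta * a5 + (1 - r ^+ 2) / (c * eta))).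
        apply: ler_wpM2l => //; apply: (@le_trans _ _ (C * a5 * a4)); first exact: ler_wpM2r.
        by rewrite -mulrA; apply: ler_wpM2l => //; exact: ltW.
      have -> : a3 * a1 = a3 * a1 by [].
      rewrite (le_trans f1)//.
      have -> : a3 * (eps * a4 + M' * a4 ^+ 2 + 2 * e1) = eps * (a3 * a4) + M' * (a3 * a4 * a4) + 2 * e1 * a3 by ring.
      apply: (le_trans (lerD (lerD f2 f4) (lexx _))).
      by rewrite le_eqVlt; apply/orP; left; apply/eqP; ring.
    have -> : h w - beta = - (avg (fun t => pkernel w t * v n t) - h w) + (avg (fun t => pkernel w t * v n t) - beta) by ring.
    rewrite (le_trans (ler_normD _ _))// normrN; apply: (lerD A).
    rewrite av Ii normrM gtr0_norm ?invr_gt0//.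
    have ip : 0 <= (2 * pi)^-1 :> R by rewrite invr_ge0 ltW.
    have b3 := le_trans (ler_normB _ _) (lerD b1 b2).
    rewrite -[S in leRHS](mulKf (lt0r_neq0 pi0)) -mulrDr; apply: (ler_wpM2l ip).
    by apply: (le_trans b3); rewrite addrA; exact: lexx.
  have lim : `|h w - beta| <= (2 * pi)^-1 * (2 * (pkernel w 0 * B)) + S.
    apply/ler_addgt0Pl => e1 e10.
    have pk0 : 0 <= pkernel w 0 by exact: pkernel_ge0.
    have ip : 0 <= (2 * pi)^-1 :> R by rewrite invr_ge0 ltW.
    pose Z := 1 + (2 * pi)^-1 * (4 * pkernel w 0 + 2 * Kw).
    have Z0 : 0 < Z by rewrite ltr_pwDl// mulr_ge0// addr_ge0// mulr_ge0.
    have [y y0 yE] : exists2 y, 0 < y & e1 = y * Z.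
      by exists (e1 / Z); [exact: divr_gt0|rewrite divfK// gt_eqF].
    rewrite (le_trans (key _ y0))// le_eqVlt; apply/orP; left; apply/eqP.
    by rewrite yE /Z; clear; ring.
  rewrite /L.
  have g : (2 * pi)^-1 * (2 * (pkernel w 0 * B)) <= (1 - r ^+ 2) * ((2 * pi)^-1 * (2 * B / (c * th ^+ 2))).
    have ip : 0 <= (2 * pi)^-1 :> R by rewrite invr_ge0 ltW.
    rewrite [leRHS]mulrCA; apply: (ler_wpM2l ip).
    have -> : (1 - r ^+ 2) * (2 * B / (c * th ^+ 2)) = (2 * B) * ((1 - r ^+ 2) / (c * th ^+ 2)) by ring.
    have -> : 2 * (pkernel w 0 * B) = 2 * B * pkernel w 0 by ring.
    by apply: (ler_wpM2l _ P0); rewrite mulr_ge0.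
  by move: lim g; rewrite /S; clear; lra.
have t1 : eps * C = e / 4 by rewrite /eps; field; rewrite gt_eqF.
have t2 : M' * C * eta <= e / 8.
  have -> : M' * C * eta = M' / (M' + 1) * (e / 8) by rewrite /eta; field; rewrite !gt_eqF.
  have q1 : M' / (M' + 1) <= 1 by rewrite ler_pdivrMr// mul1r lerDl.
  exact: ler_piMl (divr_ge0 (ltW e0) (ler0n _ 8)) q1.
clear Hd UX HP.
pose d1 := Num.min 2^-1 (e / (4 * (L + 1))).
have L1 : 0 < L + 1 by rewrite ltr_wpDl.
have d10 : 0 < d1 by rewrite lt_min invr_gt0 ltr0n divr_gt0// mulr_gt0.
have d12 : d1 <= 2^-1 by rewrite ge_min lexx.
have d13 : d1 <= e / (4 * (L + 1)) by rewrite ge_min lexx orbT.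
clearbody d1; exists (1 - d1); first by lra.
move=> r /andP[r1 r2]; have r21 : 2^-1 <= r < 1 by lra.
rewrite (le_trans (bnd r r21))//.
have g1 : 1 - r ^+ 2 <= 2 * d1 by move: r1 r2 d12; clear; nra.
have g2 : (1 - r ^+ 2) * L <= e / 2.
  apply: (@le_trans _ _ (2 * d1 * L)); first exact: ler_wpM2r.
  apply: (@le_trans _ _ (2 * (e / (4 * (L + 1))) * L)).
    by apply: ler_wpM2r => //; rewrite ler_pM2l.
  have -> : 2 * (e / (4 * (L + 1))) * L = L / (L + 1) * (e / 2) by field; rewrite gt_eqF.
  have q1 : L / (L + 1) <= 1 by rewrite ler_pdivrMr// mul1r lerDl.
  exact: ler_piMl (divr_ge0 (ltW e0) (ler0n _ 2)) q1.
move: e0 t1 t2 g2; clear; lra.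
Qed.

End RadialLimitPoint.

Transparent rint.

(** * Limits in mean of continuous functions, and integrals off null sets *)

Section L1Limits.
Variable R : realType.
Implicit Types (r s t x y e K : R) (u : nat -> R -> R).
Let mu := @lebesgue_measure R.
Let D : set (measurableTypeR R) := `[(0 : R), 2 * pi]%classic.

Lemma rintE a b (v : R -> R) : rint a b v = \int[mu]_(t in `[a, b]) v t.
Proof. by []. Qed.
Opaque rint.

Lemma EFin_rint a b (v : R -> R) : continuous v ->
  (\int[mu]_(t in `[a, b]) (v t)%:E)%E = (rint a b v)%:E.
Proof.
move=> V; rewrite rintE /Rintegral fineK//.
have m : measurable (`[a, b]%classic : set (measurableTypeR R)) by exact: measurable_itv.
exact: (@integrable_fin_num _ _ _ mu _ m (EFin \o v) (cont_integrable a b V)).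
Qed.

(** The increments are summable in mean, so [G], the sum of their moduli, is an integrable majorant:
    the sequence converges almost everywhere and its primitives converge uniformly. The null set
    also collects the points where Lebesgue differentiation fails. *)
Lemma l1_limit u : (forall n, continuous (u n)) ->
  (forall n, rint 0 (2 * pi) (fun t => `|u n.+1 t - u n t|) <= 2^-1 ^+ n) ->
  exists psi : R -> R, exists N : set (measurableTypeR R), [/\ measurable N /\ mu N = 0,
    measurable_fun setT (psi : measurableTypeR R -> R) /\ mu.-integrable D (EFin \o psi),
    forall t, 0 <= t <= 2 * pi -> ~ N t -> u n t @[n --> \oo] --> psi t,
    forall n x, 0 <= x <= 2 * pi -> `|rint 0 x (u n) - rint 0 x psi| <= 2 * 2^-1 ^+ n &
    forall t, 0 < t < 2 * pi -> ~ N t -> is_derive t 1 (fun x => rint 0 x psi) (psi t)].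
Proof.
move=> cu du.
have mD : measurable D by exact: measurable_itv.
have pi0 := ltW (@twopi_gt0 R).
pose w n t := `|u n.+1 t - u n t|.
have cw n : continuous (w n).
  apply: continuous_normr_comp; apply: continuous_radd; first exact: cu.
  by move=> t; apply: cvgN; exact: cu.
have mc (v : R -> R) : continuous v -> measurable_fun setT (v : measurableTypeR R -> R).
  by move=> V; exact: continuous_measurable_fun.
pose G (t : measurableTypeR R) : \bar R := (`|u 0%N t|%:E + \sum_(0 <= n <oo) (w n t)%:E)%E.
have w0 n t : (0 <= (w n t)%:E)%E by rewrite lee_fin normr_ge0.
have mw n : measurable_fun D (fun t => (w n t)%:E).
  by apply/measurable_EFinP; apply: measurable_funTS; exact: mc.
have mG : measurable_fun D G.
  apply: emeasurable_funD.
    apply/measurable_EFinP; apply: measurable_funTS; apply: mc.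
    exact: continuous_normr_comp (cu 0%N).
  by apply: ge0_emeasurable_sum => // n t _ _; exact: w0.
have S0 t : (0 <= \sum_(0 <= n <oo) (w n t)%:E)%E by apply: nneseries_ge0.
have G0 t : (0 <= G t)%E by rewrite adde_ge0// lee_fin normr_ge0.
have IG : (\int[mu]_(t in D) G t < +oo)%E.
  rewrite ge0_integralD//; first last.
  - by apply: ge0_emeasurable_sum => // n t _ _; exact: w0.
  - apply/measurable_EFinP; apply: measurable_funTS; apply: mc.
    exact: continuous_normr_comp (cu 0%N).
  rewrite (EFin_rint 0 (2 * pi) (continuous_normr_comp (cu 0%N))).
  rewrite lte_add_pinfty ?ltry// integral_nneseries//.
  apply: (@le_lt_trans _ _ (\sum_(0 <= n <oo) (2^-1 ^+ n)%:E)%E).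
    apply: lee_nneseries; first by move=> n _ _; apply: integral_ge0 => t _; exact: w0.
    by move=> n _; rewrite (EFin_rint 0 (2 * pi) (cw n)) lee_fin; exact: du.
  have h : (2^-1 : R) < 1 by rewrite invf_lt1// ltr1n.
  have C := @cvg_geometric_series R 1 2^-1; rewrite ger0_norm ?invr_ge0// in C.
  have {}C := C h.
  rewrite (_ : (fun n => _) = fun n => (series (geometric 1 2^-1) n)%:E); last first.
    apply/funext => n; rewrite /series /= -sumEFin; apply: eq_bigr => k _.
    by rewrite /geometric /= mul1r.
  have -> : limn (fun n => (series (geometric 1 2^-1) n : R)%:E) = (1 / (1 - 2^-1))%:E.
    by apply/cvg_lim => //; apply: cvg_EFin; [exact: nearW|exact: C].
  exact: ltry.
have iG : mu.-integrable D G.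
  by apply/integrableP; split=> //; under eq_integral do rewrite gee0_abs//.
have uG n t : `|u n t| <= `|u 0%N t| + \sum_(0 <= k < n) w k t.
  elim: n => [|n IH]; first by rewrite big_geq// addr0.
  rewrite big_nat_recr//= addrA; apply: (@le_trans _ _ (`|u n t| + w n t)); last exact: lerD.
  have -> : u n.+1 t = u n t + (u n.+1 t - u n t) by ring.
  exact: ler_normD.
have uG' n t : (`|(u n t)%:E| <= G t)%E.
  rewrite /= (@le_trans _ _ (`|u 0%N t|%:E + (\sum_(0 <= k < n) w k t)%:E)%E)//.
    by rewrite -EFinD lee_fin.
  rewrite leeD2l// -sumEFin; exact: nneseries_lim_ge.
have [N1 [mN1 N10 sN1]] := integrable_ae mD iG.
have fG t : D t -> ~ N1 t -> G t \is a fin_num.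
  by move=> Dt nN; apply: contrapT => h; apply: nN; apply: sN1 => /= /(_ Dt).
have cvu t : D t -> ~ N1 t -> cvgn (fun n => u n t).
  move=> Dt nN; have F := fG t Dt nN.
  have FS : (\sum_(0 <= n <oo) (w n t)%:E)%E \is a fin_num.
    by move: F; rewrite /G fin_numD => /andP[].
  have cs : cvgn (series (fun n => w n t)).
    apply: nondecreasing_is_cvgn.
      by apply/nondecreasing_seqP => n; rewrite /series /= big_nat_recr//= lerDl normr_ge0.
    exists (fine (\sum_(0 <= n <oo) (w n t)%:E)%E) => _ [n _ <-].
    rewrite -lee_fin fineK// /series /= -sumEFin; exact: nneseries_lim_ge.
  have cs2 : cvgn (series (fun n => u n.+1 t - u n t)) by apply: normed_cvg.
  rewrite (_ : (fun n => u n t) = (fun n => u 0%N t + series (fun n => u n.+1 t - u n t) n)).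
    by apply: is_cvgD => //; exact: is_cvg_cst.
  by apply/funext => n; rewrite /series /= telescope_sumr// addrC subrK.
(* The upper limit is measurable everywhere and agrees with the limit wherever the latter exists. *)
pose psi0 t := fine (limn_esup (fun n => (u n t)%:E)).
have mpsi0 : measurable_fun setT (psi0 : measurableTypeR R -> R).
  apply: measurableT_comp; first exact: fine_measurable.
  by apply: measurable_fun_limn_esup => n; apply/measurable_EFinP; exact: mc.
(* Cut off outside the interval, the limit is integrable on the whole line, which gives the local
   integrability required for differentiation. *)
pose psi : measurableTypeR R -> R := psi0 \_ D.
have mpsi : measurable_fun setT psi.
  by apply/(measurable_restrictT _ mD); exact: measurable_funTS.
have cvpsi t : D t -> ~ N1 t -> u n t @[n --> \oo] --> psi t.
  move=> Dt nN; have C := cvu t Dt nN.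
  have CE : (u n t)%:E @[n --> \oo] --> (limn (fun n => u n t))%:E.
    by apply: cvg_EFin; [exact: nearW|exact: C].
  rewrite /psi patchE mem_set// /psi0 is_cvg_limn_esupE; last by apply/cvg_ex; eexists; exact: CE.
  by have -> := cvg_lim (@ereal_hausdorff R) CE.
have DC x : 0 <= x <= 2 * pi -> mu.-integrable `[0, x] (EFin \o psi) /\
    (rint 0 x (u n) @[n --> \oo] --> rint 0 x psi).
  move=> /andP[x0 x2].
  have sD : `[0, x]%classic `<=` D by apply: subset_itvl; rewrite bnd_simp.
  set X : set (measurableTypeR R) := `[0, x]%classic in sD *.
  have mx : measurable X by exact: measurable_itv.
  have h1 n : measurable_fun X (fun t => (u n t)%:E).
    by apply/measurable_EFinP; apply: measurable_funTS; exact: mc.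
  have h2 : measurable_fun X (EFin \o psi).
    by apply/measurable_EFinP; exact: measurable_funTS.
  have h3 : {ae mu, forall t, X t -> (fun n => (u n t)%:E) @ \oo --> (EFin \o psi) t}.
    exists N1; split => // t /= /not_implyP[xt]; apply: contra_notP => nN.
    by apply: cvg_EFin; [exact: nearW|apply: cvpsi => //; exact: sD].
  have h4 : mu.-integrable X G by exact: integrableS iG.
  have h5 : {ae mu, forall t n, X t -> (`|(u n t)%:E| <= G t)%E}.
    by apply: aeW => t n _; exact: uG'.
  have [I1 _ I3] := dominated_convergence mx h1 h2 h3 h4 h5.
  split => //; rewrite [Y in _ --> Y]rintE /Rintegral.
  have F := integrable_fin_num mx I1.
  rewrite -(fineK F) in I3; have C := fine_cvg I3.
  have -> : (fun n => rint 0 x (u n)) = fine \o (fun n => \int[mu]_(t in X) (u n t)%:E)%E.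
    by apply/funext => n /=; rewrite (EFin_rint 0 x (cu n)).
  exact: C.
have ipsi : mu.-integrable D (EFin \o psi) by apply: (DC (2 * pi) _).1; rewrite pi0 lexx.
have iT : mu.-integrable setT (EFin \o psi).
  have := (integrable_mkcond (EFin \o psi) mD).1 ipsi.
  apply: eq_integrable => // t _; rewrite patchE /=; case: ifPn => // h.
  by rewrite /psi patchE (negbTE h).
have LI : locally_integrable [set: R] psi.
  by apply: open_integrable_locally => //; exact: openT.
have iy y : mu.-integrable [set` Interval (BLeft (0 : R)) (BRight y)] (EFin \o psi).
  by apply: integrableS iT => //; exact: measurable_itv.
have [N2 [mN2 N20 sN2]] := FTC1 iy LI.
exists psi, (N1 `|` N2); split.
- by split; [exact: measurableU|apply: null_set_setU].
- by [].
- by move=> t t02 /not_orP[h1 _]; apply: cvpsi => //; rewrite /D /= in_itv.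
- move=> n x x02; have [_ L] := DC x x02.
  have stp m : (n <= m)%N -> `|rint 0 x (u n) - rint 0 x (u m)| <= \sum_(n <= k < m) 2^-1 ^+ k.
    elim: m => [|m IH]; first by rewrite leqn0 => /eqP ->; rewrite subrr normr0 big_geq.
    rewrite leq_eqVlt => /orP[/eqP ->|]; first by rewrite subrr normr0 big_geq.
    rewrite ltnS => nm; rewrite big_nat_recr//=.
    have -> : rint 0 x (u n) - rint 0 x (u m.+1) = (rint 0 x (u n) - rint 0 x (u m)) - (rint 0 x (u m.+1) - rint 0 x (u m)) by ring.
    rewrite (le_trans (ler_normB _ _))//; apply: (lerD (IH nm)).
    rewrite -rintB//; apply: le_trans (du m).
    have cd : continuous (fun t => u m.+1 t - u m t).
      by apply: (continuous_radd (cu _)) => t; apply: cvgN; exact: cu.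
    have /andP[x0 x2] := x02.
    rewrite (rint_cat (cw m) x0 x2).
    apply: (@le_trans _ _ (rint 0 x (w m))); first exact: rint_abs_le.
    by rewrite lerDl; apply: rint_ge0 => t _; exact: normr_ge0.
  have stp2 m : (n <= m)%N -> `|rint 0 x (u n) - rint 0 x (u m)| <= 2 * 2^-1 ^+ n.
    move=> nm; rewrite (le_trans (stp m nm))//.
    have q01 : 0 <= (2^-1 : R) < 1 by rewrite invr_ge0 ler0n invf_lt1// ltr1n.
    have e2 : (1 - 2^-1 : R)^-1 = 2 by field.
    by have := geo_sum_le q01 nm; rewrite e2.
  have L2 : `|rint 0 x (u n) - rint 0 x (u m)| @[m --> \oo] --> `|rint 0 x (u n) - rint 0 x psi|.
    by apply: cvg_norm; apply: cvgB => //; exact: cvg_cst.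
  rewrite -(cvg_lim _ L2)//; apply: limr_le; first by apply/cvg_ex; eexists; exact: L2.
  by exists n => // m /= nm; exact: stp2.
- move=> t /andP[t0 t2] /not_orP[_ h2].
  have K := contrapT (fun h => h2 (sN2 t h)).
  have [|d1 d2] := K _; first by first [exact: (ltW t0)|rewrite bnd_simp; exact: (ltW t0)|rewrite bnd_simp; exact: t0|exact: t0].
  rewrite derive1E in d2.
  by have H := DeriveDef d1 d2.
Qed.

Import HBNNSimple.

(* Radial limits need not be measurable, so integrals are compared off a Borel null set. *)
Lemma nnintegral_off_null (f g : measurableTypeR R -> \bar R) (N : set (measurableTypeR R)) :
  measurable N -> mu N = 0%E -> measurable_fun setT g -> (forall t, (0 <= f t)%E) ->
  (forall t, (0 <= g t)%E) -> (forall t, ~ N t -> f t = g t) ->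
  (\int[mu]_t f t = \int[mu]_t g t)%E.
Proof.
move=> mN N0 mg f0 g0 fg.
have mNC : measurable (~` N) by exact: measurableC.
have gN : (\int[mu]_t g t = \int[mu]_(t in ~` N) g t)%E.
  by rewrite (ge0_negligible_integral mN)// setTD.
apply/eqP; rewrite eq_le; apply/andP; split.
  rewrite [leLHS]ge0_integralE// patch_setT; apply: ge_ereal_sup => _ [h hf <-].
  rewrite -integralT_nnsfun (ge0_negligible_integral mN)//; last 2 first.
  - apply/measurable_EFinP; first [exact: measurable_funPT|exact: measurable_funP|exact: (@measurable_funPT _ _ _ _ h)].
  - by move=> t _; rewrite lee_fin.
  rewrite setTD gN; apply: ge0_le_integral => //.
  - by move=> t _; rewrite lee_fin.
  - by apply/measurable_EFinP; apply: measurable_funTS; first [exact: measurable_funPT|exact: measurable_funP].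
  - exact: measurable_funTS.
  - by move=> t nN; rewrite -fg//; exact: hf.
rewrite gN integral_mkcond [leLHS]ge0_integralE; last by move=> t _; rewrite patchE; case: ifP.
rewrite [leRHS]ge0_integralE// !patch_setT; apply: ge_ereal_sup => _ [h hf <-].
apply: ereal_sup_ubound; exists h => // t; apply: (le_trans (hf t)).
by rewrite patchE; case: ifPn => // /set_mem nN; rewrite fg.
Qed.

Lemma Rintegral_off_null (f g : R -> R) (N : set (measurableTypeR R)) :
  measurable N -> mu N = 0%E -> measurable_fun D (g : measurableTypeR R -> R) ->
  (forall t, D t -> ~ N t -> f t = g t) -> rint 0 (2 * pi) f = rint 0 (2 * pi) g.
Proof.
move=> mN N0 mg fg; rewrite !rintE /Rintegral; congr fine.
have mD : measurable D by exact: measurable_itv.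
rewrite integralE [RHS]integralE; congr (_ - _)%E.
  rewrite integral_mkcond [RHS]integral_mkcond; apply: (nnintegral_off_null mN N0).
  - apply/(measurable_restrictT _ mD); apply: measurable_funepos; exact/measurable_EFinP.
  - by move=> t; rewrite patchE; case: ifP => // _; exact: funepos_ge0.
  - by move=> t; rewrite patchE; case: ifP => // _; exact: funepos_ge0.
  - by move=> t nN; rewrite !patchE; case: ifPn => // /set_mem Dt; rewrite unlock /= fg.
rewrite integral_mkcond [RHS]integral_mkcond; apply: (nnintegral_off_null mN N0).
- apply/(measurable_restrictT _ mD); apply: measurable_funeneg; exact/measurable_EFinP.
- by move=> t; rewrite patchE; case: ifP => // _; exact: funeneg_ge0.
- by move=> t; rewrite patchE; case: ifP => // _; exact: funeneg_ge0.
- by move=> t nN; rewrite !patchE; case: ifPn => // /set_mem Dt; rewrite unlock /= fg.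
Qed.

End L1Limits.

(** * Radial limits and the boundary form of the pairing *)

Section BoundaryValues.
Variable R : realType.
Implicit Types (p q r s t x y e K A B : R) (w z : R[i]) (f g : R[i] -> R[i]).
Let mu := @lebesgue_measure R.

(** Radii approaching 1 so fast that the increments are summable, as [l1_limit] demands. [P] may
    combine several Cauchy conditions, so that one sequence serves [f], [g] and their product. *)
Lemma left_subsequence (P : R -> R -> R -> Prop) :
  (forall e, 0 < e -> exists2 d, 0 <= d < 1 & forall r s, d < r < 1 -> d < s < 1 -> P r s e) ->
  exists rho : nat -> R, forall n,
    [/\ 0 <= rho n < 1, 1 - rho n <= 2^-1 ^+ n & P (rho n.+1) (rho n) (2^-1 ^+ n)].
Proof.
move=> C.
have C' n : exists d, 0 <= d < 1 /\ forall r s, d < r < 1 -> d < s < 1 -> P r s (2^-1 ^+ n).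
  have [|d d01 H] := C (2^-1 ^+ n); first by rewrite exprn_gt0.
  by exists d.
have [d Hd] := choice C'.
pose D := fix D n := if n is k.+1 then Num.max (D k) (d n) else d 0%N.
have D1 n : 0 <= D n < 1.
  elim: n => [|n /andP[i1 i2]]; first exact: (Hd 0%N).1.
  have [/andP[j1 j2] _] := Hd n.+1.
  by rewrite /= le_max i1 gt_max i2 j2.
have dD n : d n <= D n by case: n => [|n] //=; rewrite le_max lexx orbT.
have DS n : D n <= D n.+1 by rewrite /= le_max lexx.
pose x n := Num.max ((1 + D n) / 2) (1 - 2^-1 ^+ n).
have h0 n : 0 < (2^-1 : R) ^+ n by rewrite exprn_gt0.
have x1 n : (1 + D n) / 2 <= x n /\ x n < 1.
  have /andP[a1 a2] := D1 n; have h := h0 n.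
  by rewrite /x le_max lexx gt_max; split=> //; apply/andP; split; lra.
exists x => n; have [a1 a2] := x1 n; have [b1 b2] := x1 n.+1.
have /andP[c1 c2] := D1 n; have /andP[c3 c4] := D1 n.+1; have c5 := DS n; have c6 := dD n.
split; first by rewrite a2 andbT; lra.
  by rewrite lerBlDr -lerBlDl /x le_max lexx orbT.
by apply: (Hd n).2; apply/andP; split=> //; lra.
Qed.

Lemma avg_norm_le p q e (u : R -> R[i]) : 1 < p -> p^-1 + q^-1 = 1 -> 0 < e -> ccont u ->
  avg (fun t => normc (u t) `^ p) <= e `^ p -> avg (fun t => normc (u t)) <= e.
Proof.
move=> p1 pq e0 cu ue; have q1 := conj_exponent p1 pq.
have h1 : avg (fun _ : R => 1 `^ q) <= (1 : R) `^ q by rewrite avg_cst.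
have := avg_hoelder p1 q1 pq e0 ltr01 (ccont_norm cu) (@continuous_rcst R 1)
  (fun t => normc_ge0 _) (fun t => ler01) ue h1.
by rewrite mulr1; under eq_avg do rewrite mulr1.
Qed.

Lemma rint_Re_le (u : R -> R[i]) : ccont u ->
  rint 0 (2 * pi) (fun t => `|complex.Re (u t)|) <= 2 * pi * avg (fun t => normc (u t)).
Proof.
move=> cu; rewrite avgE mulVKf ?gt_eqF ?twopi_gt0//; apply: le_rint.
- exact: continuous_normr_comp (ccont_Re cu).
- exact: ccont_norm.
- by move=> t _; exact: normc_Re.
Qed.

Lemma l1_cauchy p q f K : 1 < p -> p^-1 + q^-1 = 1 -> holo f -> bounded_means p f K ->
  forall e, 0 < e -> exists2 d, 0 <= d < 1 & forall r s, d < r < 1 -> d < s < 1 ->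
    2 * pi * avg (fun t => normc (f (r%:C * expi t) - f (s%:C * expi t))) <= e.
Proof.
move=> p1 pq F FK e e0; have pi0 := twopi_gt0 R.
have e1 : 0 < e / (2 * pi) by rewrite divr_gt0.
have [d d01 H] := radial_cauchy p1 F FK (powR_gt0 p e1).
exists d => // r s rd sd; rewrite mulrC -ler_pdivlMr//.
have r01 : 0 <= r < 1 by case/andP: rd => h1 ->; case/andP: d01 => h2 _; rewrite andbT; lra.
have s01 : 0 <= s < 1 by case/andP: sd => h1 ->; case/andP: d01 => h2 _; rewrite andbT; lra.
apply: (avg_norm_le p1 pq e1); last exact: H.
by apply: ccontB; exact: ccont_circle.
Qed.

(** Along [rho] the circle functions converge in mean to [psi], whose primitive is differentiable
    almost everywhere; at such points [radial_limit] upgrades the limit along [rho] to a full radial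
    limit. *)
Lemma fatou_Re f (rho : nat -> R) : holo f ->
  (forall n, [/\ 0 <= rho n < 1, 1 - rho n <= 2^-1 ^+ n &
    2 * pi * avg (fun t => normc (f ((rho n.+1)%:C * expi t) - f ((rho n)%:C * expi t))) <= 2^-1 ^+ n]) ->
  exists psi : R -> R, exists2 N : set (measurableTypeR R), measurable N /\ mu N = 0%E &
    forall t, 0 < t < 2 * pi -> ~ N t ->
      (complex.Re (f ((rho n)%:C * expi t)) @[n --> \oo] --> psi t) /\
      forall e, 0 < e -> exists2 d, 0 <= d < 1 & forall r, d < r < 1 ->
        `|complex.Re (f (r%:C * expi t)) - psi t| <= e.
Proof.
move=> F H; pose v n t := complex.Re (f ((rho n)%:C * expi t)).
have r01 n : 0 <= rho n < 1 by have [] := H n.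
have cc n := ccont_circle F (r01 n).
have cv n : continuous (v n) := ccont_Re (cc n).
have dv n : rint 0 (2 * pi) (fun t => `|v n.+1 t - v n t|) <= 2^-1 ^+ n.
  have [_ _ h] := H n; apply: le_trans h.
  have := rint_Re_le (ccontB (cc n.+1) (cc n)).
  apply: le_trans; rewrite le_eqVlt; apply/orP; left; apply/eqP/eq_rint => t _.
  by rewrite ReD ReN.
have [psi [N [[mN N0] [_ _] cvpsi bpsi dpsi]]] := l1_limit cv dv.
have [V dV] := choice (fun n => primitive_exists (cv n)).
exists psi, N => // t /[dup] t02 /andP[t0 t2] nN.
split; first by apply: cvpsi => //; rewrite !ltW.
have q01 : 0 <= (2^-1 : R) < 1 by rewrite invr_ge0 ler0n invf_lt1// ltr1n.
apply: (@radial_limit R v V (fun w => complex.Re (f w)) (fun x => rint 0 x psi) t (psi t)) => //.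
- move=> w w1 e e0; have w01 : 0 <= normc w < 1 by rewrite normc_ge0.
  have [L L0 HL] := holo_lipschitz F w01.
  have [n0 Hn] := @geo_small R L 2^-1 e q01 e0; exists n0 => n nn.
  have -> : avg (fun t => pkernel w t * v n t) = complex.Re (f ((rho n)%:C * w)).
    rewrite (poisson_formula F (r01 n) w1) Re_cavg; apply: eq_avg => s.
    by rewrite Re_realM.
  rewrite -ReN -ReD (le_trans (normc_Re _))// (le_trans (HL _ _ _ _))//.
    rewrite normcM normcR ger0_norm; last by case/andP: (r01 n).
    by apply: ler_piMl; [exact: normc_ge0|case/andP: (r01 n) => _ /ltW].
  have -> : (rho n)%:C * w - w = (rho n - 1)%:C * w by rewrite rmorphB; ring.
  rewrite normcM normcR -normrN opprB ger0_norm; last by case/andP: (r01 n) => _ h; rewrite subr_ge0 ltW.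
  have [_ h _] := H n; apply: (le_trans _ (ltW (Hn n nn))).
  apply: (ler_wpM2l L0); rewrite -[leRHS]mulr1; apply: ler_pM => //; last exact: ltW.
    by case/andP: (r01 n) => _ h'; rewrite subr_ge0 ltW.
  exact: normc_ge0.
- move=> e e0; have [n0 Hn] := @geo_small R 2 2^-1 e q01 e0; exists n0 => n nn x x02.
  have -> : V n x - V n 0 = rint 0 x (v n).
    by rewrite (rint_FTC2 _ (cv n) (dV n))//; case/andP: x02.
  exact: (le_trans (bpsi n x x02) (ltW (Hn n nn))).
- move=> e e0; have [d d0 Hd] := derive_eps (dpsi t t02 nN) e0.
  exists d => // x /Hd; have -> : t + (x - t) = x by ring.
  by [].
Qed.

Lemma fatou f (rho : nat -> R) : holo f ->
  (forall n, [/\ 0 <= rho n < 1, 1 - rho n <= 2^-1 ^+ n &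
    2 * pi * avg (fun t => normc (f ((rho n.+1)%:C * expi t) - f ((rho n)%:C * expi t))) <= 2^-1 ^+ n]) ->
  exists2 N : set (measurableTypeR R), measurable N /\ mu N = 0%E &
    forall t, 0 < t < 2 * pi -> ~ N t ->
     (complex.Re (f ((rho n)%:C * expi t)) @[n --> \oo] --> complex.Re (boundary_value f t)) /\
     (complex.Im (f ((rho n)%:C * expi t)) @[n --> \oo] --> complex.Im (boundary_value f t)).
Proof.
move=> F H; have [psi1 [N1 [mN1 N10] H1]] := fatou_Re F H.
(* Multiplication by [- i] turns imaginary parts into real parts, so the imaginary part of [f] is
   covered by the previous lemma. *)
pose j : R[i] := 0 +i* -1.
have Rej z : complex.Re (j * z) = complex.Im z by rewrite ReM /=; ring.
have nj : normc j = 1.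
  by apply/eqP; rewrite -(@eqrXn2 _ 2) ?normc_ge0// normc_sq /= expr0n sqrrN expr1n add0r.
have Hj : forall n, [/\ 0 <= rho n < 1, 1 - rho n <= 2^-1 ^+ n &
    2 * pi * avg (fun t => normc (j * f ((rho n.+1)%:C * expi t) - j * f ((rho n)%:C * expi t))) <= 2^-1 ^+ n].
  move=> n; have [a b c] := H n; split => //.
  by under eq_avg do rewrite -mulrBr normcM nj mul1r.
have [psi2 [N2 [mN2 N20] H2]] := fatou_Re (holoZ j F) Hj.
exists (N1 `|` N2); first by split; [exact: measurableU|apply: null_set_setU].
move=> t t02 /not_orP[n1 n2].
have [c1 l1] := H1 t t02 n1; have [c2 l2] := H2 t t02 n2.
rewrite (_ : (fun n => complex.Re (j * f ((rho n)%:C * expi t))) = (fun n => complex.Im (f ((rho n)%:C * expi t)))) in c2; last first.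
  by apply/funext => n.
suff -> : boundary_value f t = psi1 t +i* psi2 t by [].
rewrite /boundary_value; apply: (@cvg_lim (Cplx R)); first exact: norm_hausdorff.
apply/cvgrPdist_le => e e0; have [e' e'0 ->] := cplx_gt0 e0.
have e2 : 0 < e' / 2 by rewrite divr_gt0.
have [d1 /andP[d10 d11] h1] := l1 _ e2; have [d2 /andP[d20 d21] h2] := l2 _ e2.
near=> r.
have r1 : d1 < r < 1.
  by apply/andP; split; near: r; [exact: nbhs_left_gt|exact: nbhs_left_lt].
have r2 : d2 < r < 1.
  by apply/andP; split; near: r; [exact: nbhs_left_gt|exact: nbhs_left_lt].
rewrite normr_normc lecR circle_ptE normc_dist (le_trans (normc_ReIm _))// (splitr e').
have := h1 r r1; have := h2 r r2; rewrite Rej ReD ImD ReN ImN /= => a b.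
exact: lerD.
Unshelve. all: by end_near. Qed.

Lemma left_lim_seq (u : R -> R[i]) l (rho : nat -> R) : left_lim u l ->
  (forall n, 0 <= rho n < 1 /\ 1 - rho n <= 2^-1 ^+ n) ->
  (complex.Re (u (rho n)) @[n --> \oo] --> complex.Re l) /\
  (complex.Im (u (rho n)) @[n --> \oo] --> complex.Im l).
Proof.
move=> L H; have q01 : 0 <= (2^-1 : R) < 1 by rewrite invr_ge0 ler0n invf_lt1// ltr1n.
suff S : forall e, 0 < e -> \forall n \near \oo, normc (l - u (rho n)) <= e.
  split; apply/cvgrPdist_le => e /S; apply: filterS => n; apply: le_trans.
    by rewrite -ReN -ReD normc_Re.
  by rewrite -ImN -ImD normc_Im.
move=> e e0; have [d /andP[d0 d1] Hd] := L e e0.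
have d10 : 0 < 1 - d by rewrite subr_gt0.
have [n0 Hn] := @geo_small R 1 2^-1 _ q01 d10; exists n0 => // n /= nn.
have [/andP[a b] c] := H n; have := Hn n nn; rewrite mul1r => h.
by rewrite normc_dist; apply: Hd; rewrite b andbT; lra.
Qed.

(** Circle products are Cauchy in mean by Hoelder's inequality, and along suitable radii they
    converge almost everywhere to the product of boundary values, by Fatou. The integrals over these
    circles tend to [pairing], and the mean limit agrees with the boundary integrand off a null
    set. *)
Theorem hardy_pairing_lim p q f g : 1 < p -> p^-1 + q^-1 = 1 -> Hp p f -> Hp q g ->
  hardy_pairing f g = pairing f g.
Proof.
move=> p1 pq HF HG; have q1 := conj_exponent p1 pq.
have qp : q^-1 + p^-1 = 1 by rewrite addrC.
have L := pairingP p1 pq HF HG.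
have [F [A A0 FA]] := HF; have [G [B B0 GB]] := HG.
have pi0 := twopi_gt0 R.
pose k : R[i] := ((2 * pi)^-1)%:C.
pose H3 r t := k * (f (r%:C * expi t) * Num.conj (g (r%:C * expi t))).
have cH3 r : 0 <= r < 1 -> ccont (H3 r).
  by move=> r01; apply: ccontZ; apply: ccontM; [|apply: ccontJ]; exact: ccont_circle.
have C3 e : 0 < e -> exists2 d, 0 <= d < 1 & forall r s, d < r < 1 -> d < s < 1 ->
    2 * pi * avg (fun t => normc (H3 r t - H3 s t)) <= e.
  move=> e0; have e1 : 0 < e / (2 * B) by rewrite divr_gt0// mulr_gt0.
  have e2 : 0 < e / (2 * A) by rewrite divr_gt0// mulr_gt0.
  have [d1 /andP[d10 d11] H1] := radial_cauchy p1 F FA (powR_gt0 p e1).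
  have [d2 /andP[d20 d21] H2] := radial_cauchy q1 G GB (powR_gt0 q e2).
  exists (Num.max d1 d2); first by rewrite le_max d10 gt_max d11.
  move=> r s; rewrite !gt_max => /andP[/andP[r1 r2] r3] /andP[/andP[s1 s2] s3].
  have r01 : 0 <= r < 1 by rewrite r3 ltW// (le_lt_trans d10).
  have s01 : 0 <= s < 1 by rewrite s3 ltW// (le_lt_trans d10).
  have cfr := ccont_circle F r01; have cfs := ccont_circle F s01.
  have cgr := ccont_circle G r01; have cgs := ccont_circle G s01.
  pose a t := normc (f (r%:C * expi t) - f (s%:C * expi t)).
  pose b t := normc (g (r%:C * expi t)).
  pose c t := normc (f (s%:C * expi t)).
  pose d t := normc (g (r%:C * expi t) - g (s%:C * expi t)).
  have ca : continuous a by exact/ccont_norm/ccontB.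
  have cb : continuous b by exact: ccont_norm.
  have cc : continuous c by exact: ccont_norm.
  have cd : continuous d by exact/ccont_norm/ccontB.
  have ab : avg (fun t => a t * b t) <= e / (2 * B) * B.
    apply: (avg_hoelder p1 q1 pq e1 B0 ca cb) => //; try by move=> t; exact: normc_ge0.
      by apply: H1; exact/andP.
    exact: GB.
  have cde : avg (fun t => c t * d t) <= A * (e / (2 * A)).
    apply: (avg_hoelder p1 q1 pq A0 e2 cc cd) => //; try by move=> t; exact: normc_ge0.
      exact: FA.
    by apply: H2; exact/andP.
  have cab := continuous_rmul ca cb; have ccd := continuous_rmul cc cd.
  have key : avg (fun t => normc (H3 r t - H3 s t)) <= (2 * pi)^-1 * (avg (fun t => a t * b t) + avg (fun t => c t * d t)).
    rewrite -avgD// -avgZ; last exact: continuous_radd.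
    apply: le_avg.
    - by apply: ccont_norm; apply: ccontB; exact: cH3.
    - exact: (continuous_rmul (@continuous_rcst _ _) (continuous_radd cab ccd)).
    move=> t; rewrite /H3 -mulrBr normcM normcR ger0_norm ?invr_ge0 ?(ltW pi0)//.
    apply: ler_wpM2l; first by rewrite invr_ge0 ltW.
    rewrite /a /b /c /d.
    move: (f (r%:C * expi t)) (f (s%:C * expi t)) (g (r%:C * expi t)) (g (s%:C * expi t)) => x y z w.
    have -> : x * Num.conj z - y * Num.conj w = (x - y) * Num.conj z + y * Num.conj (z - w).
      by rewrite [in RHS]rmorphB; ring.
    by rewrite (le_trans (ler_normcD _ _))// !normcM !normcJ.
  rewrite (le_trans (ler_wpM2l (ltW pi0) key))// mulVKf ?gt_eqF//.
  rewrite (le_trans (lerD ab cde))// le_eqVlt; apply/orP; left; apply/eqP.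
  by field; rewrite !gt_eqF.
have C1 := l1_cauchy p1 pq F FA; have C2 := l1_cauchy q1 qp G GB.
have [|rho Hr] := @left_subsequence (fun r s e => [/\
    2 * pi * avg (fun t => normc (f (r%:C * expi t) - f (s%:C * expi t))) <= e,
    2 * pi * avg (fun t => normc (g (r%:C * expi t) - g (s%:C * expi t))) <= e &
    2 * pi * avg (fun t => normc (H3 r t - H3 s t)) <= e]).
  move=> e e0; have [d1 /andP[d10 d11] X1] := C1 e e0; have [d2 /andP[d20 d21] X2] := C2 e e0.
  have [d3 /andP[d30 d31] X3] := C3 e e0.
  exists (Num.max (Num.max d1 d2) d3); first by rewrite !le_max d10 !gt_max d11 d21 d31.
  move=> r s; rewrite !gt_max => /andP[/andP[/andP[r1 r2] r3] r4] /andP[/andP[/andP[s1 s2] s3] s4].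
  by split; [apply: X1|apply: X2|apply: X3]; exact/andP.
have [N1 [mN1 N10] T1] := @fatou f rho F (fun n => let: And3 a b (And3 c _ _) := Hr n in And3 a b c).
have [N2 [mN2 N20] T2] := @fatou g rho G (fun n => let: And3 a b (And3 _ c _) := Hr n in And3 a b c).
have r01 n : 0 <= rho n < 1 by have [] := Hr n.
have r2n n : 0 <= rho n < 1 /\ 1 - rho n <= 2^-1 ^+ n by have [a b _] := Hr n.
pose hh t : R[i] := boundary_value f t * Num.conj (boundary_value g t) / (2 * pi)%:C.
have kE : ((2 * pi)%:C : R[i])^-1 = k by rewrite /k fmorphV.
have main (pr : R[i] -> R) : (forall u, ccont u -> continuous (fun t => pr (u t))) ->
    (forall z w, pr (z - w) = pr z - pr w) -> (forall z, `|pr z| <= normc z) ->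
    (forall t, 0 < t < 2 * pi -> ~ N1 t -> ~ N2 t -> pr (H3 (rho n) t) @[n --> \oo] --> pr (hh t)) ->
    rint 0 (2 * pi) (fun t => pr (H3 (rho n) t)) @[n --> \oo] --> rint 0 (2 * pi) (fun t => pr (hh t)).
  move=> cpr prB prn prl; pose v n t := pr (H3 (rho n) t).
  have cv n : continuous (v n) by apply: cpr; exact: cH3.
  have dv n : rint 0 (2 * pi) (fun t => `|v n.+1 t - v n t|) <= 2^-1 ^+ n.
    have [_ _ [_ _ h]] := Hr n; apply: le_trans h.
    have cB := ccontB (cH3 _ (r01 n.+1)) (cH3 _ (r01 n)).
    rewrite avgE mulVKf ?gt_eqF//; apply: le_rint.
    - apply: continuous_normr_comp; apply: (continuous_radd (cv _)) => t; apply: cvgN; exact: cv.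
    - exact: ccont_norm.
    - by move=> t _; rewrite /v -prB.
  have [psi [N [[mN N0] [mpsi _] cvpsi bpsi _]]] := l1_limit cv dv.
  have -> : rint 0 (2 * pi) (fun t => pr (hh t)) = rint 0 (2 * pi) psi.
    (* The endpoints are added to the exceptional set because radial limits were obtained only for
       [0 < t < 2 pi]. *)
    pose E : set (measurableTypeR R) := [set 0] `|` [set 2 * pi].
    have mE : measurable E by apply: measurableU; exact: measurable_set1.
    have E0 : mu E = 0%E by apply: null_set_setU => //; exact: lebesgue_measure_set1.
    have mN12 : measurable (N1 `|` N2) by exact: measurableU.
    have N120 : mu (N1 `|` N2) = 0%E by exact: null_set_setU.
    have mNE : measurable (N `|` E) by exact: measurableU.
    have NE0 : mu (N `|` E) = 0%E by exact: null_set_setU.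
    apply: (@Rintegral_off_null R _ _ ((N1 `|` N2) `|` (N `|` E))).
    - exact: measurableU.
    - exact: null_set_setU.
    - exact: measurable_funTS.
    - move=> t; rewrite /= in_itv/= => /andP[t0 t2] /not_orP[/not_orP[n1 n2] /not_orP[n3 /not_orP[e1 e2]]].
      have t02 : 0 < t < 2 * pi.
        by rewrite !lt_neqAle t0 t2 !andbT eq_sym; apply/andP; split; apply/eqP.
      have a1 := prl t t02 n1 n2; have a2 := cvpsi t _ n3.
      by rewrite -(cvg_lim (@Rhausdorff R) a1); apply: cvg_lim => //; apply: a2; rewrite t0.
  have q01 : 0 <= (2^-1 : R) < 1 by rewrite invr_ge0 ler0n invf_lt1// ltr1n.
  apply/cvgrPdist_le => e e0; have [n0 Hn] := @geo_small R 2 2^-1 e q01 e0.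
  exists n0 => // n /= nn; rewrite distrC; apply: le_trans (ltW (Hn n nn)).
  by apply: bpsi; rewrite lexx ltW.
have ReH3 z w : complex.Re (k * (z * Num.conj w)) = (2 * pi)^-1 * (complex.Re z * complex.Re w + complex.Im z * complex.Im w).
  by rewrite Re_realM ReM ReJ ImJ mulrN opprK.
have ImH3 z w : complex.Im (k * (z * Num.conj w)) = (2 * pi)^-1 * (complex.Im z * complex.Re w - complex.Re z * complex.Im w).
  by rewrite Im_realM ImM ReJ ImJ mulrN [in LHS]addrC.
have hhE t : hh t = k * (boundary_value f t * Num.conj (boundary_value g t)) by rewrite /hh kE mulrC.
have L1 : rint 0 (2 * pi) (fun t => complex.Re (H3 (rho n) t)) @[n --> \oo] --> rint 0 (2 * pi) (fun t => complex.Re (hh t)).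
  apply: main; [exact: ccont_Re|by move=> z w; rewrite ReD ReN|exact: normc_Re|].
  move=> t t02 n1 n2; have [a1 a2] := T1 t t02 n1; have [b1 b2] := T2 t t02 n2.
  rewrite hhE ReH3; under eq_fun do rewrite /H3 ReH3.
  apply: cvgM; first exact: cvg_cst.
  by apply: cvgD; apply: cvgM.
have L2 : rint 0 (2 * pi) (fun t => complex.Im (H3 (rho n) t)) @[n --> \oo] --> rint 0 (2 * pi) (fun t => complex.Im (hh t)).
  apply: main; [exact: ccont_Im|by move=> z w; rewrite ImD ImN|exact: normc_Im|].
  move=> t t02 n1 n2; have [a1 a2] := T1 t t02 n1; have [b1 b2] := T2 t t02 n2.
  rewrite hhE ImH3; under eq_fun do rewrite /H3 ImH3.
  apply: cvgM; first exact: cvg_cst.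
  by apply: cvgB; apply: cvgM.
have [M1 M2] := left_lim_seq L r2n.
have ccn n : ccont (fun t => f ((rho n)%:C * expi t) * Num.conj (g ((rho n)%:C * expi t))).
  by apply: ccontM; [|apply: ccontJ]; apply: ccont_circle.
have E1 n : rint 0 (2 * pi) (fun t => complex.Re (H3 (rho n) t)) = complex.Re (hpair f g (rho n)).
  rewrite /hpair Re_cavg avgE -rintZ; last exact: ccont_Re (ccn n).
  by apply: eq_rint => t _; rewrite /H3 Re_realM.
have E2 n : rint 0 (2 * pi) (fun t => complex.Im (H3 (rho n) t)) = complex.Im (hpair f g (rho n)).
  rewrite /hpair Im_cavg avgE -rintZ; last exact: ccont_Im (ccn n).
  by apply: eq_rint => t _; rewrite /H3 Im_realM.
rewrite (_ : (fun n => _) = (fun n => complex.Re (hpair f g (rho n)))) in L1; last exact/funext.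
rewrite (_ : (fun n => _) = (fun n => complex.Im (hpair f g (rho n)))) in L2; last exact/funext.
apply: complex_ext.
  transitivity (rint 0 (2 * pi) (fun t => complex.Re (hh t))); first by rewrite rintE.
  by rewrite -(cvg_lim (@Rhausdorff R) L1); exact: cvg_lim M1.
transitivity (rint 0 (2 * pi) (fun t => complex.Im (hh t))); first by rewrite rintE.
by rewrite -(cvg_lim (@Rhausdorff R) L2); exact: cvg_lim M2.
Qed.

End BoundaryValues.

(** * Separation of points from closed subspaces *)

Section HahnBanach.
Variable R : realType.
Variable T : (nat -> R) -> nat -> R.
Hypothesis T_ext : forall n c c', (forall i, (i < n)%N -> c i = c' i) -> T c n = T c' n.
Hypothesis T_step : forall n c, c n = 0 -> T c n.+1 = T c n.
Hypothesis T_add : forall n c c', T (fun i => c i + c' i) n <= T c n + T c' n.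
Hypothesis T_scale : forall n t c, 0 < t -> T (fun i => t * c i) n <= t * T c n.

Let good n (phi : nat -> R) := forall c : nat -> R, \sum_(i < n) c i * phi i <= T c n.
Let upd (phi : nat -> R) n x i := if i == n then x else phi i.

Let lin n (phi c : nat -> R) : R := \sum_(i < n) c i * phi i.

(** [T c n] stands for a sublinear functional at the combination of the first [n] vectors with
    coefficients [c]; working with coefficients allows dependent vectors. The admissible values at
    the new vector lie between the lower bounds collected in [S] and upper bounds that [sep] shows
    to dominate them, so [sup S] is admissible. *)
Lemma one_step_extension n phi : good n phi -> exists x, good n.+1 (upd phi n x).
Proof.
move=> G.
have linU c t : lin n phi (upd c n t) = lin n phi c.
  by apply: eq_bigr => i _; rewrite /upd (ltn_eqF (ltn_ord i)).
have sep c c' : lin n phi c - T (upd c n (-1)) n.+1 <= T (upd c' n 1) n.+1 - lin n phi c'.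
  have h1 := G (fun i => c i + c' i); have h2 := T_add n.+1 (upd c n (-1)) (upd c' n 1).
  have h3 : T (fun i => upd c n (-1) i + upd c' n 1 i) n.+1 = T (fun i => c i + c' i) n.
    rewrite T_step; last by rewrite /upd eqxx addNr.
    by apply: T_ext => i iN; rewrite /upd (ltn_eqF iN).
  have h4 : \sum_(i < n) (c i + c' i) * phi i = lin n phi c + lin n phi c'.
    by rewrite /lin -big_split; apply: eq_bigr => i _; rewrite /= mulrDl.
  by rewrite h4 in h1; rewrite h3 in h2; lra.
pose S := [set y | exists c, y = lin n phi c - T (upd c n (-1)) n.+1].
have S0 : S !=set0 by exists (lin n phi (fun=> 0) - T (upd (fun=> 0) n (-1)) n.+1), (fun=> 0).
have Sub c' : ubound S (T (upd c' n 1) n.+1 - lin n phi c') by move=> y [c ->]; exact: sep.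
have hS : has_sup S by split=> //; exists (T (upd (fun=> 0) n 1) n.+1 - lin n phi (fun=> 0)); exact: Sub.
exists (sup S) => c; rewrite big_ord_recr /= /upd eqxx.
have -> : \sum_(i < n) c i * (if i == n :> nat then sup S else phi i) = lin n phi c.
  by apply: eq_bigr => i _; rewrite (ltn_eqF (ltn_ord i)).
have linS t : lin n phi (fun i => t * c i) = t * lin n phi c.
  by rewrite /lin mulr_sumr; apply: eq_bigr => i _; rewrite mulrA.
have [cn|cn|cn] := ltgtP (c n) 0.
- have t0 : 0 < (- c n)^-1 by rewrite invr_gt0 oppr_gt0.
  have h1 : lin n phi (fun i => (- c n)^-1 * c i) - T (upd (fun i => (- c n)^-1 * c i) n (-1)) n.+1 <= sup S.
    by apply: ub_le_sup; [exact: hS.2|exists (fun i => (- c n)^-1 * c i)].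
  have h2 : T (upd (fun i => (- c n)^-1 * c i) n (-1)) n.+1 <= (- c n)^-1 * T c n.+1.
    have -> : T (upd (fun i => (- c n)^-1 * c i) n (-1)) n.+1 = T (fun i => (- c n)^-1 * c i) n.+1; last exact: T_scale.
    apply: T_ext => i iN; rewrite /upd; case: eqP => // ->.
    by rewrite invrN mulNr mulVf// lt_eqF.
  rewrite linS in h1.
  have h3 : (- c n)^-1 * (lin n phi c - T c n.+1) <= sup S by rewrite mulrBr; lra.
  rewrite mulrC ler_pdivrMr ?oppr_gt0// in h3; lra.
- have t0 : 0 < (c n)^-1 by rewrite invr_gt0.
  have h1 : sup S <= T (upd (fun i => (c n)^-1 * c i) n 1) n.+1 - lin n phi (fun i => (c n)^-1 * c i).
    by apply: ge_sup => //; exact: Sub.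
  have h2 : T (upd (fun i => (c n)^-1 * c i) n 1) n.+1 <= (c n)^-1 * T c n.+1.
    have -> : T (upd (fun i => (c n)^-1 * c i) n 1) n.+1 = T (fun i => (c n)^-1 * c i) n.+1; last exact: T_scale.
    apply: T_ext => i iN; rewrite /upd; case: eqP => // ->.
    by rewrite mulVf// gt_eqF.
  rewrite linS in h1.
  have h3 : sup S <= (c n)^-1 * (T c n.+1 - lin n phi c) by rewrite mulrBr; lra.
  rewrite mulrC ler_pdivlMr// in h3; lra.
- by rewrite cn mul0r addr0 T_step//; exact: G.
Qed.

Lemma hahn_banach_countable d : (forall c, c 0%N * d <= T c 1) ->
  exists2 phi : nat -> R, phi 0%N = d & forall n (c : nat -> R), \sum_(i < n.+1) c i * phi i <= T c n.+1.
Proof.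
move=> H0.
pose F := fix F n := if n is k.+1 then upd (F k) k.+1 (xget 0 [set x | good k.+2 (upd (F k) k.+1 x)])
  else fun=> d.
have GF n : good n.+1 (F n).
  elim: n => [|n IH]; first by move=> c; rewrite big_ord1; exact: H0.
  have [x Gx] := one_step_extension IH.
  by apply: (@xgetPex R 0 [set x | good n.+2 (upd (F n) n.+1 x)]); exists x.
have FE m i : (i <= m)%N -> F m i = F i i.
  elim: m => [|m IH]; first by rewrite leqn0 => /eqP ->.
  rewrite leq_eqVlt => /orP[/eqP -> //|]; rewrite ltnS => im.
  by rewrite /= /upd (ltn_eqF (_ : (i < m.+1)%N))//; exact: IH.
exists (fun i => F i i) => // n c.
have := GF n c; rewrite (eq_bigr (fun i : 'I_n.+1 => c i * F i i))// => i _.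
by rewrite FE// -ltnS.
Qed.

End HahnBanach.

(** * Separation from a closed subspace by a function of the dual Hardy space *)

Section Separation.
Variable R : realType.
Implicit Types (p q r s t x y e K A B d : R) (w z k : R[i]) (f g m : R[i] -> R[i]) (b c : nat -> R[i]).

(** The norm of the quotient by [M]: a functional dominated by it annihilates [M]. *)
Definition dist_sub p (M : set (R[i] -> R[i])) f : R := inf [set B : R | 0 < B /\
  exists2 m, M m & bounded_means p (fun z => f z - m z) (B `^ p)].

Lemma dist_sub_le p M f m B : 0 < B -> M m -> bounded_means p (fun z => f z - m z) (B `^ p) ->
  dist_sub p M f <= B.
Proof.
move=> B0 Mm H; apply: ge_inf; last by split => //; exists m.
by exists 0 => x [x0 _]; exact: ltW.
Qed.

Lemma dist_sub_adherent p M f e : M (fun=> 0) -> Hp p f -> 0 < e -> exists B,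
  [/\ 0 < B, B < dist_sub p M f + e & exists2 m, M m & bounded_means p (fun z => f z - m z) (B `^ p)].
Proof.
move=> M0 [F [A A0 FA]] e0.
have HI : has_inf [set B : R | 0 < B /\ exists2 m, M m & bounded_means p (fun z => f z - m z) (B `^ p)].
  split; last by exists 0 => x [x0 _]; exact: ltW.
  exists A; split => //; exists (fun=> 0); first exact: M0.
  by apply: eq_bounded_means FA => z _; rewrite subr0.
by have [B [B0 H] BE] := inf_adherent e0 HI; exists B.
Qed.

Lemma le_dist_sub p M f x : M (fun=> 0) -> Hp p f ->
  (forall m B, M m -> 0 < B -> bounded_means p (fun z => f z - m z) (B `^ p) -> x <= B) ->
  x <= dist_sub p M f.
Proof.
move=> M0 [F [A A0 FA]] H; apply: lb_le_inf.
  exists A; split => //; exists (fun=> 0); first exact: M0.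
  by apply: eq_bounded_means FA => z _; rewrite subr0.
by move=> B [B0 [m Mm Hm]]; exact: (H m B Mm B0 Hm).
Qed.

(** Hahn-Banach gives a functional below the distance to [M] and equal to it at [f0]. Its
    coefficients on monomials satisfy the dual bound, so [duality] represents it by some [g];
    density of polynomials carries domination over to elements of [M] and to [f0]. *)
Lemma separation p q (M : set (R[i] -> R[i])) f0 d : 1 < p -> p^-1 + q^-1 = 1 ->
  (forall m, M m -> Hp p m) -> M (fun=> 0) ->
  (forall m m', M m -> M m' -> M (fun z => m z + m' z)) ->
  (forall k m, M m -> M (fun z => k * m z)) -> Hp p f0 -> 0 < d ->
  (forall m B, M m -> 0 < B -> bounded_means p (fun z => f0 z - m z) (B `^ p) -> d <= B) ->
  exists g, [/\ Hp q g, forall m, M m -> pairing m g = 0 & pairing f0 g != 0].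
Proof.
move=> p1 pq HM M0 MD MZ H0 d0 far; have q1 := conj_exponent p1 pq.
have qp : q^-1 + p^-1 = 1 by rewrite addrC.
pose N := dist_sub p M.
have NA f e : Hp p f -> 0 < e -> exists B, [/\ 0 < B, B < N f + e &
    exists2 m, M m & bounded_means p (fun z => f z - m z) (B `^ p)].
  by move=> HF e0; exact: (dist_sub_adherent M0 HF e0).
have NL f m B : 0 < B -> M m -> bounded_means p (fun z => f z - m z) (B `^ p) -> N f <= B.
  by move=> B0 Mm H; exact: (dist_sub_le B0 Mm H).
have N0 f : Hp p f -> 0 <= N f.
  by move=> HF; apply: (le_dist_sub M0 HF) => m B _ /ltW.
have Nd : d <= N f0 by exact: (le_dist_sub M0 H0 far).
clearbody N.
have ND f g : Hp p f -> Hp p g -> N (fun z => f z + g z) <= N f + N g.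
  move=> HF HG; apply/ler_addgt0Pl => e e0; have e2 : 0 < e / 2 by rewrite divr_gt0.
  have [B [B0 BE [m Mm Hm]]] := NA _ _ HF e2.
  have [B' [B0' BE' [m' Mm' Hm']]] := NA _ _ HG e2.
  apply: (@le_trans _ _ (B + B')); last by move: BE BE'; clear; lra.
  apply: (NL _ _ _ (addr_gt0 B0 B0') (MD _ _ Mm Mm')).
  have := bounded_meansD p1 (holoB HF.1 (HM _ Mm).1) (holoB HG.1 (HM _ Mm').1) B0 B0' Hm Hm'.
  by apply: eq_bounded_means => z _; ring.
have NZ t f : 0 < t -> Hp p f -> N (fun z => t%:C * f z) <= t * N f.
  move=> t0 HF; apply/ler_addgt0Pl => e e0; have et : 0 < e / t by rewrite divr_gt0.
  have [B [B0 BE [m Mm Hm]]] := NA _ _ HF et.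
  apply: (@le_trans _ _ (t * B)).
    apply: (NL _ _ _ (mulr_gt0 t0 B0) (MZ t%:C _ Mm)).
    have := bounded_meansZ t%:C p1 (holoB HF.1 (HM _ Mm).1) B0 Hm.
    rewrite normcR (gtr0_norm t0); apply: eq_bounded_means => z _; ring.
  have := ltW BE; rewrite -(ler_pM2l t0) mulrDr mulrCA mulfV ?gt_eqF// mulr1; clear; lra.
have NB f B : 0 < B -> holo f -> bounded_means p f (B `^ p) -> N f <= B.
  move=> B0 _ FB; apply: (NL _ _ _ B0 M0).
  by apply: eq_bounded_means FB => z _; rewrite subr0.
pose ii : R[i] := 0 +i* 1.
(* [f0] followed by [z^k] and [i z^k] in turn, because the extension is real-linear; [f0] may itself
   be a polynomial, which does no harm since only coefficients are extended. *)
pose E i : R[i] -> R[i] := if i is j.+1 then (fun z => (if odd j then ii else 1) * z ^+ j./2) else f0.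
have HE i : Hp p (E i).
  case: i => [|j]; first exact: H0.
  rewrite /E.
  have := Hp_scale (if odd j then ii else 1) p1 (Hp_psum (fun k : nat => (k == j./2)%:R) j./2.+1 p1).
  apply: Hp_eq => [z _|]; last first.
    by apply: holoZ => z _; exists (j./2%:R * z ^+ j./2.-1 * 1); exact: (cderivX j./2 (cderiv_id z)).
  rewrite psumS eqxx mul1r /psum big1 ?add0r// => i _.
  by rewrite (ltn_eqF (ltn_ord i)) mul0r.
have E0 : E 0%N = f0 by [].
have ES j z : E j.+1 z = (if odd j then ii else 1) * z ^+ j./2 by [].
clearbody E.
pose comb (a : nat -> R) n z := \sum_(i < n) (a i)%:C * E i z.
have combS a n : comb a n.+1 = fun z => comb a n z + (a n)%:C * E n z.
  by apply/funext => z; rewrite /comb big_ord_recr.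
have Hc a n : Hp p (comb a n).
  elim: n => [|n IH]; last by rewrite combS; exact: (Hp_add p1 IH (Hp_scale _ p1 (HE n))).
  have := Hp_psum (fun=> 0) 0 p1; congr (Hp p _); apply/funext => z.
  by rewrite /psum /comb !big_ord0.
have [||||| phi phi0 Hphi] := @hahn_banach_countable R (fun a n => N (comb a n)) _ _ _ _ (N f0).
- move=> n a a' aa; congr N; apply/funext => z; apply: eq_bigr => i _; by rewrite aa.
- by move=> n a an; rewrite combS an; congr N; apply/funext => z; rewrite mul0r addr0.
- move=> n a a'; apply: le_trans (ND _ _ (Hc a n) (Hc a' n)).
  rewrite le_eqVlt; apply/orP; left; apply/eqP; congr N; apply/funext => z.
  by rewrite /comb -big_split; apply: eq_bigr => i _; rewrite /= rmorphD mulrDl.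
- move=> n t a t0; apply: le_trans (NZ t _ t0 (Hc a n)).
  rewrite le_eqVlt; apply/orP; left; apply/eqP; congr N; apply/funext => z.
  by rewrite /comb mulr_sumr; apply: eq_bigr => i _; rewrite realcM mulrA.
- move=> a; have e1 : comb a 1 = fun z => (a 0%N)%:C * f0 z.
    by apply/funext => z; rewrite /comb big_ord1 E0.
  have [a0|a0] := ltP 0 (a 0%N); last first.
    by apply: le_trans (N0 _ (Hc a 1%N)); rewrite mulr_le0_ge0//; exact: N0.
  rewrite -ler_pdivlMl//.
  have -> : f0 = fun z => ((a 0%N)^-1)%:C * comb a 1 z.
    by apply/funext => z; rewrite e1 mulrA -realcM mulVf ?gt_eqF// mul1r.
  by apply: (fun h => NZ _ _ h (Hc a 1%N)); rewrite invr_gt0.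
(* The complex-linear functional with real part [phi] sends [v] to [phi v - i phi (i v)]; the
   vectors [z^k] and [i z^k] have indices [2k+1] and [2k+2]. *)
pose beta (k : nat) : R[i] := phi k.*2.+1 +i* - phi k.*2.+2.
(* [a] lists the real coordinates of the vector [x f0 + psum b n]. *)
have dom x b n : x * N f0 + complex.Re (\sum_(k < n) b k * beta k) <= N (fun z => x%:C * f0 z + psum b n z).
  pose a i : R := if i is j.+1 then (if odd j then complex.Im (b j./2) else complex.Re (b j./2)) else x.
  have := Hphi n.*2 a; rewrite big_ord_recl /= phi0.
  have S1 (v : nat -> R) l : \sum_(i < l.*2) v i = \sum_(k < l) (v k.*2 + v k.*2.+1).
    elim: l => [|l IH]; first by rewrite !big_ord0.
    by rewrite doubleS !big_ord_recr /= IH addrA.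
  have S2 (v : nat -> R[i]) l : \sum_(i < l.*2) v i = \sum_(k < l) (v k.*2 + v k.*2.+1).
    elim: l => [|l IH]; first by rewrite !big_ord0.
    by rewrite doubleS !big_ord_recr /= IH addrA.
  have -> : comb a n.*2.+1 = fun z => x%:C * f0 z + psum b n z.
    apply/funext => z; rewrite /comb big_ord_recl E0 [a _]/=; congr (_ + _).
    under eq_bigr do rewrite lift0 ES [a _]/=.
    rewrite (S2 (fun i => (if odd i then complex.Im (b i./2) else complex.Re (b i./2))%:C * ((if odd i then ii else 1) * z ^+ i./2))).
    apply: eq_bigr => k _; rewrite /= odd_double /= uphalf_double half_double.
    rewrite mul1r mulrA -mulrDl; congr (_ * _).
    by apply: complex_ext; rewrite !ReImE /=; ring.
  rewrite (S1 (fun i => (if odd i then complex.Im (b i./2) else complex.Re (b i./2)) * phi i.+1)).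
  have ReS (v : nat -> R[i]) l : complex.Re (\sum_(k < l) v k) = \sum_(k < l) complex.Re (v k).
    by elim: l => [|l IH]; rewrite ?big_ord0// !big_ord_recr /= ReD IH.
  rewrite (ReS (fun k : nat => b k * beta k)).
  rewrite (eq_bigr (fun k : 'I_n => complex.Re (b k * beta k)))// => k _.
  by rewrite /= odd_double /= uphalf_double half_double ReM /beta /=; ring.
have domC b n B m : M m -> 0 < B -> bounded_means p (fun z => psum b n z - m z) (B `^ p) ->
    normc (\sum_(k < n) b k * beta k) <= B.
  move=> Mm B0 H; have [u u1 uE] := exists_rotation (\sum_(k < n) b k * beta k).
  have := dom 0 (fun k : nat => u * b k) n; rewrite mul0r add0r.
  have -> : \sum_(k < n) u * b k * beta k = u * \sum_(k < n) b k * beta k.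
    by rewrite mulr_sumr; apply: eq_bigr => k _; rewrite mulrA.
  rewrite uE /= => h; apply: (le_trans h).
  apply: (NL _ _ _ B0 (MZ u _ Mm)).
  have := bounded_meansZ u p1 (holoB (holo_psum b n) (HM _ Mm).1) B0 H; rewrite u1 mul1r.
  apply: eq_bounded_means => z _; rewrite mul0r add0r /psum mulrBr mulr_sumr.
  by congr (_ - _); apply: eq_bigr => k _; rewrite mulrA.
pose c (k : nat) := Num.conj (beta k).
have [A A0 DL] := duality q1 qp (riesz p1).
have [|g Pg Bg] := DL c 1 ltr01.
  move=> b n r B r01 B0 GB; rewrite mul1r.
  pose b' (k : nat) := (r ^+ k)%:C * b k.
  have -> : \sum_(k < n) c k * (r ^+ k)%:C * Num.conj (b k) = Num.conj (\sum_(k < n) b' k * beta k).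
    by rewrite conj_sum; apply: eq_bigr => k _; rewrite /b' !conjM realcJ /c; ring.
  rewrite normcJ; apply: (domC _ _ _ _ M0 B0) => x /andP[x0 x1]; have /andP[r0 r1] := r01.
  have -> : mean p (fun z => psum b' n z - 0) x = mean p (psum b n) (r * x).
    by apply: eq_avg => t; rewrite subr0 psum_dilate mulrA -realcM.
  apply: GB; apply/andP; split; first exact: mulr_ge0.
  exact: (le_lt_trans (ler_piMl x0 (ltW r1)) x1).
rewrite mulr1 in Bg; have HG := has_ps_holo Pg; have HG' := HpI A0 HG Bg.
have pp b n : paired (psum b n) g (\sum_(k < n) b k * beta k).
  have := paired_sym HG (holo_psum b n) (paired_poly b n Pg).
  rewrite conj_sum (eq_bigr (fun k : 'I_n => b k * beta k))// => k _.
  by rewrite conjM !conjK mulrC.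
have close f b n e : Hp p f -> 0 < e -> bounded_means p (fun z => f z - psum b n z) (e `^ p) ->
    normc (pairing f g - \sum_(k < n) b k * beta k) <= e * A.
  move=> HF e0 H; have P := pairingP p1 pq HF HG'.
  have Hb := holo_psum b n.
  have P2 := pairedDl HF.1 (holoZ (-1) Hb) HG P (pairedZl (-1) Hb HG (pp b n)).
  have := paired_bound p1 pq e0 A0 (holoD HF.1 (holoZ (-1) Hb)) HG _ Bg P2.
  rewrite mulN1r; apply; apply: eq_bounded_means H => z _; by rewrite mulN1r.
exists g; split => //.
  move=> m Mm; have [Hm [K K0 mK]] := HM m Mm.
  apply/eqP; rewrite -normc_eq0 eq_le normc_ge0 andbT; apply/ler_addgt0Pl => e e0; rewrite addr0.
  have A1 : 0 < A + 1 by rewrite addr_gt0.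
  have e1 : 0 < e / (A + 1) by rewrite divr_gt0.
  have [b [n H]] := poly_approx p1 Hm mK e1.
  have h1 := close m b n _ (HM m Mm) e1 H.
  have h2 : normc (\sum_(k < n) b k * beta k) <= e / (A + 1).
    apply: (domC _ _ _ _ Mm e1) => x x01; have := H x x01.
    have -> : mean p (fun z => psum b n z - m z) x = mean p (fun z => m z - psum b n z) x.
      by apply: eq_avg => t; rewrite normc_dist.
    by [].
  have := normc_triangle (\sum_(k < n) b k * beta k) (pairing m g) 0; rewrite !subr0 => h3.
  have -> : e = e / (A + 1) * A + e / (A + 1) by field; rewrite gt_eqF.
  by apply: (le_trans h3); exact: lerD.
have [F0 [K K0 fK]] := H0.
(* If [g] annihilated [f0], a polynomial within [e1 = d / (2 (A + 1))] of [f0] would have functional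
   value at most [A e1], and [dom] with [x = 1] would give [d <= (A + 1) e1 = d / 2]. *)
apply/eqP => P0.
have A2 : 0 < 2 * (A + 1) by rewrite mulr_gt0// addr_gt0.
have e1 : 0 < d / (2 * (A + 1)) by rewrite divr_gt0.
have [b [n H]] := poly_approx p1 F0 fK e1.
have h1 := close f0 b n _ H0 e1 H; rewrite P0 sub0r normc_opp in h1.
have h2 := dom 1 (fun k : nat => - b k) n.
have h3 : N (fun z => 1%:C * f0 z + psum (fun k : nat => - b k) n z) <= d / (2 * (A + 1)).
  apply: (NB _ _ e1 (holoD (holoZ 1 F0) (holo_psum _ _))).
  apply: eq_bounded_means H => z _; rewrite mul1r /psum -sumrN; congr (_ + _).
  by apply: eq_bigr => k _; rewrite mulNr.
have h4 : complex.Re (\sum_(k < n) - b k * beta k) = - complex.Re (\sum_(k < n) b k * beta k).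
  by rewrite -ReN -sumrN; congr complex.Re; apply: eq_bigr => k _; rewrite mulNr.
rewrite h4 mul1r in h2.
have h5 := le_trans (le_trans (ler_norm _) (normc_Re _)) h1.
have h6 : d = d / (2 * (A + 1)) * A + d / (2 * (A + 1)) + d / 2 by field; rewrite gt_eqF// addr_gt0.
by move: Nd h2 h3 h5 h6 d0; clear; lra.
Qed.

End Separation.

(** * Uniqueness for the Laplace transform *)

Transparent rint.
Section LaplaceUniqueness.
Variable R : realType.
Implicit Types (s t x y e a C d : R) (u : R -> R).
Let mu := @lebesgue_measure R.
Let D : set (measurableTypeR R) := `[(0 : R), +oo[%classic.

Definition exp_decay u := exists C a, [/\ 0 <= C, 0 < a & forall s, 0 <= s -> `|u s| <= C * expR (- a * s)].

Lemma pow_le_exp k e : 0 < e -> exists2 C, 0 <= C & forall s, 0 <= s -> s ^+ k <= C * expR (e * s).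
Proof.
move=> e0; pose e' := e / k.+1%:R; have e'0 : 0 < e' by rewrite divr_gt0.
exists ((e'^-1) ^+ k) => [|s s0]; first by rewrite exprn_ge0// invr_ge0 ltW.
have h1 : s <= e'^-1 * expR (e' * s).
  rewrite mulrC ler_pdivlMr// mulrC (le_trans _ (expR_ge1Dx _))// lerDr ler01//.
rewrite (@le_trans _ _ ((e'^-1 * expR (e' * s)) ^+ k))//.
  by apply: lerXn2r; rewrite ?nnegrE// (le_trans s0).
rewrite exprMn; apply: ler_wpM2l; first by rewrite exprn_ge0// invr_ge0 ltW.
rewrite -expRM_natl ler_expR /e' mulrA; apply: (ler_wpM2r s0).
rewrite mulrA ler_pdivrMr// mulrC; apply: ler_wpM2l; [exact: ltW|by rewrite ler_nat].
Qed.

Lemma exp_decay_pow u k : exp_decay u -> exp_decay (fun s => s ^+ k * u s).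
Proof.
move=> [C [a [C0 a0 H]]]; have a20 : 0 < a / 2 by rewrite divr_gt0.
have [K K0 HK] := pow_le_exp k a20; exists (K * C), (a / 2); split => // [|s s0]; first exact: mulr_ge0.
have sk : 0 <= s ^+ k by rewrite exprn_ge0.
rewrite normrM (ger0_norm sk); apply: (le_trans (ler_pM sk (normr_ge0 _) (HK s s0) (H s s0))).
by rewrite mulrACA -expRD le_eqVlt; apply/orP; left; apply/eqP; congr (_ * expR _); field.
Qed.

Lemma exp_decay_exp u l : 0 <= l -> exp_decay u -> exp_decay (fun s => expR (- l * s) * u s).
Proof.
move=> l0 [C [a [C0 a0 H]]]; exists C, a; split => // s s0.
rewrite normrM ger0_norm ?expR_ge0//; apply: le_trans (H s s0).
by rewrite ler_piMl// -[leRHS]expR0 ler_expR mulNr oppr_le0 mulr_ge0.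
Qed.

Lemma continuous_expRM l : continuous (fun s : R => expR (l * s)).
Proof.
move=> x; apply: (@continuous_comp _ _ _ (fun x : R => l * x)); last exact: continuous_expR.
exact: (continuous_rmul (@continuous_rcst _ l) (fun x => @cvg_id _ _)).
Qed.

Lemma continuous_idpow k : continuous (fun s : R => s ^+ k).
Proof. by apply: continuous_rpow => x; exact: cvg_id. Qed.

Lemma measurable_half : measurable D.
Proof. exact: measurable_itv. Qed.

Lemma measurable_cont u (A : set (measurableTypeR R)) : continuous u -> measurable_fun A (u : measurableTypeR R -> R).
Proof. by move=> U; apply: measurable_funTS; exact: continuous_measurable_fun. Qed.

(** Dominated by a multiple of the exponential density, whose integral is known. *)
Lemma exp_decay_integrable u : continuous u -> exp_decay u -> mu.-integrable D (EFin \o u).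
Proof.
move=> U [C [a [C0 a0 H]]]; have mD := measurable_half.
have ip : mu.-integrable setT (EFin \o exponential_pdf a).
  apply/integrableP; split; first by apply/measurable_EFinP; exact: measurable_exponential_pdf.
  under eq_integral do rewrite /= ger0_norm ?exponential_pdf_ge0 ?(ltW a0)//.
  by rewrite integral_exponential_pdf// ltry.
have iD : mu.-integrable D (EFin \o exponential_pdf a) by exact: integrableS ip.
apply: le_integrable (integrable_realZ (C / a) mD iD) => //.
  by apply/measurable_EFinP; exact: measurable_cont.
move=> s; rewrite /D /= in_itv/= andbT => s0; rewrite lee_fin exponential_pdfE//.
have -> : C / a * (a * expR (- a * s)) = C * expR (- a * s) by field; rewrite gt_eqF.
by rewrite (le_trans (H s s0))// ler_norm.
Qed.

Lemma tail_limit u : continuous u -> exp_decay u ->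
  rint 0 n%:R u @[n --> \oo] --> \int[mu]_(t in D) u t.
Proof.
move=> U E; have I := exp_decay_integrable U E; have mD := measurable_half.
pose A n : set (measurableTypeR R) := `[(0 : R), n%:R]%classic.
have mA n : measurable (A n) by exact: measurable_itv.
have h1 n : measurable_fun D ((EFin \o u) \_ (A n)).
  apply: measurable_funTS; apply/(measurable_restrictT _ (mA n)).
  by apply/measurable_EFinP; exact: measurable_cont.
have h2 : measurable_fun D (EFin \o u) by apply/measurable_EFinP; exact: measurable_cont.
have h3 : {ae mu, forall t, D t -> (fun n => ((EFin \o u) \_ (A n)) t) @ \oo --> (EFin \o u) t}.
  apply: aeW => t Dt; apply: cvg_near_cst; near=> n.
  rewrite patchE mem_set// /A /= in_itv/=; move: Dt; rewrite /D /= in_itv/= andbT => -> /=.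
  by near: n; exact: nbhs_infty_ger.
have h4 : mu.-integrable D (abse \o (EFin \o u)) by exact: integrable_abse.
have h5 : {ae mu, forall t n, D t -> (`|((EFin \o u) \_ (A n)) t| <= (abse \o (EFin \o u)) t)%E}.
  by apply: aeW => t n _; rewrite patchE; case: ifP => _; [exact: lexx|rewrite abse0; exact: abse_ge0].
have [_ _ L] := dominated_convergence mD h1 h2 h3 h4 h5.
have F := integrable_fin_num mD I; rewrite -(fineK F) in L.
have C := fine_cvg L; move: C; rewrite /Rintegral.
have -> : fine \o (fun n => \int[mu]_(t in D) ((EFin \o u) \_ (A n)) t)%E = (fun n => rint 0 n%:R u).
  apply/funext => n /=; rewrite -integral_mkcondr setIidr//.
  by move=> t; rewrite /A /D /= !in_itv/= => /andP[->].
by apply.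
Unshelve. all: by end_near. Qed.
Opaque rint.

Lemma exp_decay_lim0 u : exp_decay u -> u n%:R @[n --> \oo] --> 0.
Proof.
move=> [C [a [C0 a0 H]]]; apply/cvgrPdist_le => e e0.
have q01 : 0 <= expR (- a) < 1 by rewrite expR_ge0 expR_lt1 oppr_lt0.
have [n0 Hn] := geo_small C q01 e0; exists n0 => // n /= nn.
rewrite sub0r normrN (le_trans (H n%:R (ler0n _ n)))//.
have -> : expR (- a * n%:R) = expR (- a) ^+ n by rewrite mulrC -expRM_natl.
exact/ltW/Hn.
Qed.

(** Integration by parts trades a power of [t] for one more index: the moment of order [k + 1] of
    [v n] is [k + 1] times that of order [k] of [v n.+1]. The boundary terms vanish by decay and,
    for order zero, because [v n.+1] tends to 0. *)
Lemma moments_eq0 (v : nat -> R -> R) : (forall n, continuous (v n)) -> (forall n, exp_decay (v n)) ->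
  (forall n t, 0 <= t -> v n.+1 t = - rint 0 t (v n)) ->
  forall k n, \int[mu]_(t in D) (t ^+ k * v n t) = 0.
Proof.
move=> cv dv vS k; elim: k => [|k IH] n.
  have L := tail_limit (cv n) (dv n).
  have L0 := exp_decay_lim0 (dv n.+1).
  have -> : \int[mu]_(t in D) (t ^+ 0 * v n t) = \int[mu]_(t in D) v n t.
    by apply: eq_Rintegral => t _; rewrite expr0 mul1r.
  rewrite -(cvg_lim (@Rhausdorff R) L); apply: cvg_lim => //.
  have -> : (fun m => rint 0 m%:R (v n)) = (fun m => - v n.+1 m%:R).
    by apply/funext => m; rewrite vS// opprK.
  rewrite -oppr0; exact: (cvgN L0).
have [V dV] := primitive_exists (cv n).
have VE t : 0 <= t -> v n.+1 t = V 0 - V t.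
  by move=> t0; rewrite vS// (rint_FTC2 t0 (cv n) dV) opprB.
have cV := deriv_continuous dV.
have dW (t : R) : is_derive t 1 (fun x => x ^+ k.+1 * (V 0 - V x))
   (t ^+ k.+1 * - v n t + (V 0 - V t) * (k.+1%:R * t ^+ k)).
  have D1 := rder_add (is_derive_cst (V 0) t 1) (is_deriveN (dV t)); rewrite add0r in D1.
  have D2 := rder_pow k.+1 (is_derive_id t (1 : R)).
  have D3 := rder_mul D2 D1; apply: (is_derive_eq D3); rewrite mulr1; exact: erefl.
have c0 : continuous (fun t => V 0 - V t).
  have cN : continuous (fun t => - V t) by move=> t; apply: cvgN; exact: cV.
  exact: (continuous_radd (@continuous_rcst _ (V 0)) cN).
have c1 : continuous (fun t => t ^+ k.+1 * - v n t).
  have cN : continuous (fun t => - v n t) by move=> t; apply: cvgN; exact: cv.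
  exact: (continuous_rmul (@continuous_idpow k.+1) cN).
have c2 : continuous (fun t : R => (V 0 - V t) * (k.+1%:R * t ^+ k)).
  exact: (continuous_rmul c0 (continuous_rmul (@continuous_rcst _ _) (@continuous_idpow k))).
have ck j m : continuous (fun t => t ^+ j * v m t) by exact: (continuous_rmul (@continuous_idpow j) (cv m)).
have E m : m%:R ^+ k.+1 * v n.+1 m%:R = k.+1%:R * rint 0 m%:R (fun t => t ^+ k * v n.+1 t) - rint 0 m%:R (fun t => t ^+ k.+1 * v n t).
  have m0 : 0 <= m%:R :> R by exact: ler0n.
  have := rint_FTC2 m0 (continuous_radd c1 c2) dW; rewrite subrr mulr0 subr0 -VE// => <-.
  rewrite rintD// -rintZ; last exact: ck.
  have -> : rint 0 m%:R (fun t => t ^+ k.+1 * - v n t) = - rint 0 m%:R (fun t => t ^+ k.+1 * v n t).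
    by rewrite -rintN; [apply: eq_rint => t _; rewrite mulrN|exact: ck].
  rewrite addrC; congr (_ + _); apply: eq_rint => t /andP[t0 _].
  by rewrite VE//; ring.
have L1 := tail_limit (ck k n.+1) (exp_decay_pow k (dv n.+1)).
have L2 := tail_limit (ck k.+1 n) (exp_decay_pow k.+1 (dv n)).
have L3 := exp_decay_lim0 (exp_decay_pow k.+1 (dv n.+1)).
rewrite IH in L1.
have L4 : - (m%:R ^+ k.+1 * v n.+1 m%:R) + k.+1%:R * rint 0 m%:R (fun t => t ^+ k * v n.+1 t) @[m --> \oo] --> (- 0 + k.+1%:R * 0 : R).
  by apply: cvgD; [exact: cvgN|apply: cvgM => //; exact: cvg_cst].
rewrite oppr0 mulr0 addr0 in L4.
rewrite -(cvg_lim (@Rhausdorff R) L2); apply: cvg_lim => //.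
rewrite (_ : (fun m => rint 0 m%:R (fun t => t ^+ k.+1 * v n t)) =
  (fun m => - (m%:R ^+ k.+1 * v n.+1 m%:R) + k.+1%:R * rint 0 m%:R (fun t => t ^+ k * v n.+1 t)))//.
apply/funext => m; rewrite E opprB subrK//.
Qed.

(** The series of [e^(-d t)] is integrated term by term. Its partial sums are dominated by
    [e^(d t)], and [2 d <= a] keeps the product with [u] integrable; this limits the size of a
    step. *)
Lemma exp_step u l d : continuous u -> (exists C a, [/\ 0 <= C, 2 * d <= a, 0 < a & forall s, 0 <= s -> `|u s| <= C * expR (- a * s)]) ->
  0 <= l -> 0 <= d -> (forall k, \int[mu]_(t in D) (t ^+ k * (expR (- l * t) * u t)) = 0) ->
  forall k, \int[mu]_(t in D) (t ^+ k * (expR (- (l + d) * t) * u t)) = 0.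
Proof.
move=> U [C [a [C0 da a0 H]]] l0 d0 M k; have mD := measurable_half.
have Eu : exp_decay u by exists C, a.
pose w t := t ^+ k * (expR (- l * t) * u t).
have cw : continuous w.
  exact: (continuous_rmul (@continuous_idpow k) (continuous_rmul (@continuous_expRM (- l)) U)).
pose S (J : nat) t : R := series (exp_coeff (- d * t)) J * w t.
pose g t := `|t ^+ k * (expR (d * t) * u t)|.
have cg : continuous g.
  apply: continuous_normr_comp.
  exact: (continuous_rmul (@continuous_idpow k) (continuous_rmul (@continuous_expRM d) U)).
have Eg : exp_decay g.
  have : exp_decay (fun t => t ^+ k * (expR (d * t) * u t)).
    apply: exp_decay_pow; exists C, (a / 2); split => //; first by rewrite divr_gt0.
    move=> s s0; rewrite normrM ger0_norm ?expR_ge0//.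
    apply: (le_trans (ler_wpM2l (expR_ge0 _) (H s s0))); rewrite mulrCA; apply: ler_wpM2l => //.
    rewrite -expRD ler_expR -mulrDl; apply: (ler_wpM2r s0); lra.
  by move=> [C' [a' [? ? h]]]; exists C', a'; split=> // s /h; rewrite normr_id.
have cS J : continuous (S J).
  apply: continuous_rmul => //; rewrite /series /=.
  elim: J => [|J IH]; first by under eq_fun do rewrite big_geq//; exact: (@continuous_rcst _ 0).
  under eq_fun do rewrite big_nat_recr//=.
  apply: (continuous_radd IH); rewrite /exp_coeff /=.
  apply: (continuous_rmul _ (@continuous_rcst _ _)); apply: continuous_rpow.
  exact: (continuous_rmul (@continuous_rcst _ _) (fun x => @cvg_id _ _)).
have int0 J : mu.-integrable D (EFin \o S J) /\ \int[mu]_(t in D) S J t = 0.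
  have IJ j : mu.-integrable D (EFin \o (fun t => t ^+ (j + k) * (expR (- l * t) * u t))).
    apply: exp_decay_integrable; last exact: (exp_decay_pow _ (exp_decay_exp l0 Eu)).
    exact: (continuous_rmul (@continuous_idpow _) (continuous_rmul (@continuous_expRM (- l)) U)).
  have SE j : (fun t => exp_coeff (- d * t) j * w t) = (fun t => ((- d) ^+ j / j`!%:R) * (t ^+ (j + k) * (expR (- l * t) * u t))).
    by apply/funext => t; rewrite /exp_coeff /= /w exprMn exprD; ring.
  have IS j : mu.-integrable D (EFin \o (fun t => exp_coeff (- d * t) j * w t)).
    by rewrite SE; exact: integrable_realZ.
  elim: J => [|J [IH1 IH2]].
    have S0 : S 0%N = fun=> 0 by apply/funext => t; rewrite /S /series /= big_geq// mul0r.
    rewrite S0; split; first exact: integrable0.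
    by rewrite Rintegral_cst// mul0r.
  have SS : S J.+1 = fun t => S J t + exp_coeff (- d * t) J * w t.
    by apply/funext => t; rewrite /S /series /= big_nat_recr//= mulrDl.
  rewrite SS; split; first exact: (integrableD mD IH1 (IS J)).
  rewrite RintegralD; try first [exact: mD|exact: IH1|exact: (IS J)].
  rewrite IH2 add0r SE RintegralZl; try first [exact: mD|exact: IJ].
  by rewrite M mulr0.
have h1 J : measurable_fun D (EFin \o S J) by apply/measurable_EFinP; exact: measurable_cont.
pose lim_ t := t ^+ k * (expR (- (l + d) * t) * u t).
have cl : continuous lim_.
  exact: (continuous_rmul (@continuous_idpow k) (continuous_rmul (@continuous_expRM (- (l + d))) U)).
have h2 : measurable_fun D (EFin \o lim_) by apply/measurable_EFinP; exact: measurable_cont.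
have h3 : {ae mu, forall t, D t -> (fun J => (EFin \o S J) t) @ \oo --> (EFin \o lim_) t}.
  apply: aeW => t _; apply: cvg_EFin; first exact: nearW.
  have -> : lim_ t = expR (- d * t) * w t.
    by rewrite /lim_ /w opprD mulrDl expRD; ring.
  by apply: cvgM; [exact: is_cvg_series_exp_coeff|exact: cvg_cst].
have h4 : mu.-integrable D (EFin \o g) by exact: exp_decay_integrable.
have h5 : {ae mu, forall t J, D t -> (`|(EFin \o S J) t| <= (EFin \o g) t)%E}.
  apply: aeW => t J; rewrite /D /= in_itv/= andbT => t0; rewrite lee_fin /S /g /w !normrM.
  rewrite (ger0_norm (expR_ge0 (- l * t))) (ger0_norm (expR_ge0 (d * t))).
  have e1 : expR (- l * t) <= 1 by rewrite -[leRHS]expR0 ler_expR mulNr oppr_le0 mulr_ge0.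
  have b1 : `|series (exp_coeff (- d * t)) J| <= expR (d * t).
    rewrite /series /= (le_trans (ler_norm_sum _ _ _))//.
    have -> : \sum_(0 <= i < J) `|exp_coeff (- d * t) i| = series (exp_coeff (d * t)) J.
      apply: eq_bigr => i _; rewrite /exp_coeff /= normrM normrX mulNr normrN ger0_norm ?mulr_ge0//.
      by rewrite (ger0_norm (mulr_ge0 d0 t0)).
    apply: nondecreasing_cvgn_le; last exact: is_cvg_series_exp_coeff.
    by apply/nondecreasing_seqP => n; rewrite /series /= big_nat_recr//= lerDl exp_coeff_ge0// mulr_ge0.
  have z1 : 0 <= `|t ^+ k| * `|u t| by rewrite mulr_ge0.
  have z2 : `|series (exp_coeff (- d * t)) J| * expR (- l * t) <= expR (d * t) * 1.
    by apply: ler_pM => //; exact: expR_ge0.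
  have := ler_wpM2r z1 z2; rewrite mulr1.
  move: `|series _ _| `|t ^+ k| `|u t| (expR _) (expR _) => x1 x2 x3 x4 x5 h.
  have -> : x1 * (x2 * (x5 * x3)) = x1 * x5 * (x2 * x3) by ring.
  by have -> : x2 * (x4 * x3) = x4 * (x2 * x3) by ring.
have [_ _ L] := dominated_convergence mD h1 h2 h3 h4 h5.
rewrite (_ : [sequence _]_n = fun=> 0%E) in L.
  by rewrite /Rintegral -(cvg_lim (@ereal_hausdorff R) L) lim_cst.
apply/funext => J /=; have [IJ] := int0 J; rewrite /Rintegral => E.
by rewrite -(fineK (integrable_fin_num mD IJ)) E.
Qed.

(** The decay rate of [u] itself does not change from step to step, so any [l] is reached by
    finitely many equal steps of length at most [a / 2]. *)
Lemma laplace_moments u : continuous u -> exp_decay u ->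
  (forall k, \int[mu]_(t in D) (t ^+ k * u t) = 0) ->
  forall l, 0 <= l -> forall k, \int[mu]_(t in D) (t ^+ k * (expR (- l * t) * u t)) = 0.
Proof.
move=> U [C [a [C0 a0 H]]] M l l0.
have [m Hm] : exists m : nat, 2 * l / a < m.+1%:R.
  have := archi_boundP (divr_ge0 (mulr_ge0 (ler0n R 2) l0) (ltW a0)).
  by set m := Num.bound _ => h; exists m; rewrite (lt_le_trans h)// ler_nat.
pose d := l / m.+1%:R; have d0 : 0 <= d by rewrite divr_ge0.
have da : 2 * d <= a.
  by rewrite /d mulrA ler_pdivrMr// -ler_pdivrMl// mulrC ltW.
suff S j k : \int[mu]_(t in D) (t ^+ k * (expR (- (j%:R * d) * t) * u t)) = 0.
  move=> k; have := S m.+1 k; rewrite (_ : m.+1%:R * d = l)//.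
  by rewrite /d mulrC divfK// pnatr_eq0.
elim: j k => [|j IH] k.
  rewrite -(M k); apply: eq_Rintegral => t _.
  by rewrite mul0r oppr0 mul0r expR0 mul1r.
have -> : j.+1%:R * d = j%:R * d + d by rewrite -natr1 mulrDl mul1r.
by apply: exp_step => //; [exists C, a|exact: mulr_ge0].
Qed.

(** Follows from [e^(x-1) >= (1 + (x - 1) / 2)^2 = x + (x - 1)^2 / 4], once [x e^2] is bounded by
    [2 (x - 1)^2]; for large [x] the restriction [e <= 1] is what gives this. *)
Lemma peak_bound x e : 0 <= x -> 0 < e <= 1 -> e <= `|x - 1| ->
  x * expR (1 - x) <= (1 + e ^+ 2 / 8)^-1.
Proof.
move=> x0 /andP[e0 e1] xe.
have q0 : 0 < 1 + e ^+ 2 / 8 by rewrite ltr_pwDl// divr_ge0// sqr_ge0.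
have E : (1 + (x - 1) / 2) ^+ 2 <= expR (x - 1).
  have h := expR_ge1Dx ((x - 1) / 2).
  have -> : expR (x - 1) = expR ((x - 1) / 2) ^+ 2 by rewrite expr2 -expRD; congr expR; field.
  by apply: lerXn2r; rewrite ?nnegrE ?expR_ge0//; lra.
have -> : 1 - x = - (x - 1) by ring.
rewrite expRN ler_pdivrMr ?expR_gt0// mulrC ler_pdivlMr//; apply: le_trans E.
have key : x * e ^+ 2 <= 2 * (x - 1) ^+ 2.
  have h2 : e ^+ 2 <= (x - 1) ^+ 2.
    by rewrite -[leRHS]real_normK ?num_real//; apply: lerXn2r; rewrite ?nnegrE// ltW.
  have [x2|x2] := leP x 2.
    have := ler_wpM2l x0 h2; have := ler_wpM2r (sqr_ge0 (x - 1)) x2; lra.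
  have e2 : e ^+ 2 <= 1 by rewrite exprn_ile1// ltW.
  have := ler_wpM2l x0 e2; nra.
nra.
Qed.

(** The idea of the Post-Widder inversion: [K] is 1 at [t = s] and smaller elsewhere, and its [N]-th
    power is a multiple of [t^N e^(-N t / s)], against which [u] integrates to zero. [concentration]
    concludes. *)
Theorem laplace_unique u : continuous u -> exp_decay u ->
  (forall k, \int[mu]_(t in D) (t ^+ k * u t) = 0) -> forall s, 0 < s -> u s = 0.
Proof.
move=> U E M s s0; have mD := measurable_half.
pose K t := t / s * expR (1 - t / s).
have KN N t : K t ^+ N * u t = ((s^-1 * expR 1) ^+ N) * (t ^+ N * (expR (- (N%:R / s) * t) * u t)).
  rewrite /K !exprMn expRD exprMn -(expRM_natl _ (- (t / s))).
  have -> : N%:R * - (t / s) = - (N%:R / s) * t by ring.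
  by ring.
have cc N : continuous (fun t => t ^+ N * (expR (- (N%:R / s) * t) * u t)).
  exact: (continuous_rmul (@continuous_idpow N) (continuous_rmul (@continuous_expRM _) U)).
have ln N : 0 <= N%:R / s by rewrite divr_ge0// ltW.
have ii N : mu.-integrable D (EFin \o (fun t => t ^+ N * (expR (- (N%:R / s) * t) * u t))).
  by apply: exp_decay_integrable => //; apply: exp_decay_pow; exact: exp_decay_exp.
have cK : continuous K.
  apply: continuous_rmul; first exact: (continuous_rmul (fun x => @cvg_id _ _) (@continuous_rcst _ s^-1)).
  have -> : (fun t => expR (1 - t / s)) = fun t => expR 1 * expR (- s^-1 * t).
    by apply/funext => t; rewrite -expRD; congr expR; ring.
  exact: (continuous_rmul (@continuous_rcst _ (expR 1)) (@continuous_expRM (- s^-1))).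
apply: (@concentration R D K u s mD).
- exact: exp_decay_integrable.
- move=> N; rewrite (_ : (fun t => K t ^+ N * u t) = (fun t => ((s^-1 * expR 1) ^+ N) * (t ^+ N * (expR (- (N%:R / s) * t) * u t)))); last exact/funext.
  exact: integrable_realZ.
- move=> N; under eq_Rintegral do rewrite KN.
  by rewrite RintegralZl// laplace_moments// mulr0.
- by move=> t; rewrite /D /= in_itv/= andbT => t0; rewrite mulr_ge0 ?expR_ge0// divr_ge0// ltW.
- by rewrite /K mulfV ?gt_eqF// subrr expR0 mulr1.
- exact: cK.
- exact: U.
- exists s => // t; rewrite ltr_norml => /andP[h _]; rewrite /D /= in_itv/= andbT; lra.
- move=> d d0; pose e := Num.min 1 (d / s).
  have e01 : 0 < e <= 1 by rewrite lt_min ltr01 divr_gt0//= ge_min lexx.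
  have q0 : 0 < 1 + e ^+ 2 / 8 by rewrite ltr_pwDl// divr_ge0// sqr_ge0.
  exists ((1 + e ^+ 2 / 8)^-1); split; first by rewrite invr_ge0 ltW.
    rewrite invf_lt1// ltrDl divr_gt0// exprn_gt0//; by case/andP: e01.
  move=> t; rewrite /D /= in_itv/= andbT => t0 dt; apply: peak_bound => //.
    by rewrite divr_ge0// ltW.
  rewrite /e ge_min; apply/orP; right.
  have -> : t / s - 1 = (t - s) / s by field; rewrite gt_eqF.
  by rewrite normrM normfV (gtr0_norm s0) ler_pM2r ?invr_gt0.
Qed.

End LaplaceUniqueness.

(** * The invariant subspaces *)

Transparent cint.
Section Translation.
Variable R : realType.
Local Notation C := (Cplx R).
Implicit Types (p q r s t x e K : R) (z : C) (f g h : C -> C) (M : set (C -> C)).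

Lemma Re_cint a b (u : R -> R[i]) : complex.Re (cint a b u) = rint a b (fun t => complex.Re (u t)).
Proof. by []. Qed.

Lemma Im_cint a b (u : R -> R[i]) : complex.Im (cint a b u) = rint a b (fun t => complex.Im (u t)).
Proof. by []. Qed.
Opaque cint.

Lemma disc_normc z : disc z <-> normc z < 1.
Proof. by rewrite /disc /= normr_normc -[1]/(1%:C) ltcR. Qed.

Lemma on_discE f z : normc z < 1 -> on_disc f z = f z.
Proof. by move=> /disc_normc z1; rewrite /on_disc patchE mem_set. Qed.

Lemma on_disc_idem f : on_disc (on_disc f) = on_disc f.
Proof. apply/funext => z; rewrite {1}/on_disc patchE; case: ifPn => // h; by rewrite /on_disc patchE (negbTE h). Qed.

Lemma on_disc_eq f g : (forall z, normc z < 1 -> f z = g z) -> on_disc f = on_disc g.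
Proof.
move=> fg; apply/funext => z; rewrite /on_disc !patchE; case: ifPn => // /set_mem/disc_normc.
exact: fg.
Qed.

Lemma holomorphic_holo f : holomorphic_on_disc f <-> holo f.
Proof.
split=> H z; last first.
  by move=> /disc_normc/H[l /cderivP[]].
move=> /disc_normc/H D; exists ('D_1 f z); apply/cderivP.
by apply: DeriveDef.
Qed.

Lemma holo_on_disc f : holo f -> holo (on_disc f).
Proof.
move=> F z z1; have [l L] := F z z1; exists l.
have d0 : 0 < 1 - normc z by rewrite subr_gt0.
apply: (cderiv_local d0 _ L) => w wz; rewrite on_discE//.
by have := normc_triangle z w 0; rewrite !subr0; lra.
Qed.

Lemma integral_meanE p f r : 1 < p -> holo f -> 0 <= r < 1 ->
  integral_mean p f r = (mean p f r)%:E.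
Proof.
move=> p1 F r01; have c := continuous_circle_pow p1 F r01.
have c2 := continuous_rmul c (@continuous_rcst R (2 * pi)^-1).
have := EFin_rint 0 (2 * pi) c2; rewrite /integral_mean.
under eq_integral do rewrite -circle_ptE; move=> ->; congr (_%:E).
rewrite /mean avgE -rintZ//; by apply: eq_rint => t _; rewrite mulrC.
Qed.

Lemma hardy_norm_le p f B : 1 < p -> holo f -> 0 < B -> bounded_means p f (B `^ p) ->
  (hardy_norm p f <= B%:E)%E.
Proof.
move=> p1 F B0 FB; have p0 : 0 < p by rewrite (lt_trans _ p1).
have -> : B%:E = ((B `^ p)%:E `^ p^-1)%E.
  by rewrite poweR_EFin -powRrM mulfV ?gt_eqF// powRr1// ltW.
have S0 : (0 <= ereal_sup [set integral_mean p f r | r in `[0%R, 1%R[])%E.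
  apply: ereal_sup_ge; exists (integral_mean p f 0); last first.
    by rewrite integral_meanE// ?lexx ?ltr01// lee_fin mean_ge0.
  by exists 0 => //; rewrite /= in_itv/= lexx ltr01.
apply: gt0_ler_poweR; rewrite ?invr_ge0 ?(ltW p0)// ?in_itv/= ?leey ?andbT//.
  by rewrite lee_fin powR_ge0.
apply: ge_ereal_sup => _ [r r01 <-]; rewrite /= in_itv/= in r01.
by rewrite integral_meanE// lee_fin; exact: FB.
Qed.

Lemma hardyP p f : 1 < p -> hardy p f <-> on_disc f = f /\ Hp p f.
Proof.
move=> p1; have p0 : 0 < p by rewrite (lt_trans _ p1).
split=> [[Df /holomorphic_holo F N]|[Df [F [A A0 FA]]]]; last first.
  split => //; first exact/holomorphic_holo.
  by apply: le_lt_trans (hardy_norm_le p1 F A0 FA) _; rewrite ltry.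
split=> //.
have S : (ereal_sup [set integral_mean p f r | r in `[0%R, 1%R[] < +oo)%E.
  by apply: lty_poweRy N; rewrite invr_neq0// gt_eqF.
set X := ereal_sup _ in S.
have X0 : (0 <= X)%E.
  apply: ereal_sup_ge; exists (integral_mean p f 0); last first.
    by rewrite integral_meanE// ?lexx ?ltr01// lee_fin mean_ge0.
  by exists 0 => //; rewrite /= in_itv/= lexx ltr01.
have XF : X \is a fin_num by rewrite ge0_fin_numE.
have K0 : 0 < fine X + 1 by rewrite ltr_wpDl// fine_ge0.
apply: (@HpI R p f ((fine X + 1) `^ p^-1)) => //; first by rewrite powR_gt0.
rewrite -powRrM mulVf ?gt_eqF// powRr1 ?(ltW K0)// => r r01.
have : ((mean p f r)%:E <= X)%E.
  rewrite -integral_meanE//; apply: ereal_sup_ubound; exists r => //; by rewrite /= in_itv.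
by rewrite -(fineK XF) lee_fin => h; rewrite (le_trans h)// lerDl.
Qed.

Lemma hardy_on_disc p f : 1 < p -> Hp p f -> hardy p (on_disc f).
Proof.
move=> p1 HF; apply/(hardyP _ p1); split; first exact: on_disc_idem.
by apply: (Hp_eq _ (holo_on_disc HF.1) HF) => z z1; rewrite on_discE.
Qed.

Lemma cesaro_opE a f h z : has_ps a f -> has_ps (cesaro_coef a) h -> normc z < 1 ->
  cesaro_op f z = h z.
Proof.
move=> PF PH z1; rewrite /cesaro_op on_discE//.
apply: (@cvg_lim C); first exact: norm_hausdorff.
have z01 : 0 <= normc z < 1 by rewrite normc_ge0.
have [K [q [K0 q01 H]]] := PH _ z01.
apply/cvgrPdist_le => e e0; have [e' e'0 ->] := cplx_gt0 e0.
have [n0 Hn] := geo_small K q01 e'0; exists n0 => // n /= nn.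
rewrite normr_normc lecR (le_trans _ (ltW (Hn n nn)))//.
have -> : series (fun n : nat => (n.+1%:R^-1 * \sum_(k < n.+1) taylor_coef f k) * z ^+ n) n = psum (cesaro_coef a) n z.
  rewrite /series /= big_mkord; apply: eq_bigr => k _; congr (_ * _ * _).
  by apply: eq_bigr => j _; exact: taylor_coefE.
exact: H.
Qed.

Lemma hardy_cesaro p f : 1 < p -> hardy p f -> hardy p (cesaro_op f) /\
  exists2 a, has_ps a f & has_ps (cesaro_coef a) (cesaro_op f).
Proof.
move=> p1 /(hardyP _ p1)[Df HF]; have PF := holo_has_ps HF.1.
have [h PH HH] := cesaro_Hp p1 PF HF.
have E : cesaro_op f = on_disc h.
  have <- : on_disc (cesaro_op f) = on_disc h by apply: on_disc_eq => z; exact: cesaro_opE PF PH.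
  by rewrite /cesaro_op on_disc_idem.
rewrite E; split; first exact: hardy_on_disc.
by exists (fcoef f) => //; apply: has_ps_eq PH => z z1; rewrite on_discE.
Qed.

Lemma composition_shift t g : composition_op (phi_semigroup t) g = on_disc (shift t g).
Proof.
rewrite /composition_op; congr on_disc; apply/funext => z; rewrite /= /shift /phi /phi_semigroup.
by congr g; rewrite rmorphB addrA.
Qed.

Lemma shift0 g : shift 0 g = g.
Proof. by apply/funext => z; rewrite /shift /phi oppr0 expR0 subrr mul1r addr0. Qed.

(** From here on the pairing is a radial limit, and boundary values disappear from the argument. *)
Lemma annihilatorP p q M g : 1 < p -> p^-1 + q^-1 = 1 -> M `<=` hardy p ->
  annihilator q M g <-> hardy q g /\ forall f, M f -> pairing f g = 0.
Proof.
move=> p1 pq HM; have q1 := conj_exponent p1 pq.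
by split=> -[G H]; split=> // f Mf; have [_ HF] := (hardyP _ p1).1 (HM _ Mf);
  have [_ HG] := (hardyP _ q1).1 G; have := H f Mf; rewrite (hardy_pairing_lim p1 pq HF HG).
Qed.

End Translation.

(** * From invariance to vanishing pairings *)

Section Invariance.
Variable R : realType.
Local Notation C := (Cplx R).
Implicit Types (p q r s t x e K : R) (z : C) (f g h : C -> C) (M : set (C -> C)).

Lemma wpair0 f g : wpair f g 0 = pairing f g.
Proof. by rewrite /wpair oppr0 expR0 mul1r shift0. Qed.

Lemma wpair_decay p q f g : 1 < p -> p^-1 + q^-1 = 1 -> Hp p f -> Hp q g ->
  exists2 K, 0 <= K & forall s, 0 <= s -> normc (wpair f g s) <= K * expR (- p^-1 * s).
Proof.
move=> p1 pq [F [A A0 FA]] [G [B B0 GB]]; exists (4 * (A * B)).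
  exact: mulr_ge0 _ (ltW (mulr_gt0 A0 B0)).
by move=> s s0; exact: (wpair_bound p1 pq A0 B0 F G FA GB s0).
Qed.

Lemma cesaro_orbit_wpair p q f g : 1 < p -> p^-1 + q^-1 = 1 -> hardy p f -> Hp q g ->
  (forall n, pairing (iter n (@cesaro_op R) f) g = 0) -> forall s, 0 < s -> wpair f g s = 0.
Proof.
move=> p1 pq Hf HG P0; have p0 : 0 < p by rewrite (lt_trans _ p1).
pose F n := iter n (@cesaro_op R) f.
have HF n : hardy p (F n) by elim: n => [|n IH]; [exact: Hf|exact: (hardy_cesaro p1 IH).1].
have HpF n : Hp p (F n) by have [] := (hardyP _ p1).1 (HF n).
have cW n := ccont_wpair p1 pq (HpF n) HG.
have F0 : F 0%N = f by [].
have FS n : F n.+1 = cesaro_op (F n) by [].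
have {}P0 n : pairing (F n) g = 0 := P0 n.
clearbody F.
have step n t : 0 <= t -> wpair (F n.+1) g `|t| = - cint 0 t (fun x => wpair (F n) g `|x|).
  move=> t0; have [_ [a Pa Pc]] := hardy_cesaro p1 (HF n); rewrite -FS in Pc.
  have := wpair_int p1 pq Pa Pc (HpF n) (HpF n.+1) HG (lexx 0) t0.
  by rewrite wpair0 P0 subr0 ger0_norm.
have dec (pr : R[i] -> R) n : (forall z, `|pr z| <= normc z) -> exp_decay (fun x => pr (wpair (F n) g `|x|)).
  move=> H; have [K K0 HK] := wpair_decay p1 pq (HpF n) HG; exists K, p^-1; split => //.
    by rewrite invr_gt0.
  by move=> s s0; rewrite (le_trans (H _))// ger0_norm//; exact: HK.
have vanish (v : nat -> R -> R) : (forall n, continuous (v n)) -> (forall n, exp_decay (v n)) ->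
    (forall n t, 0 <= t -> v n.+1 t = - rint 0 t (v n)) -> forall s, 0 < s -> v 0%N s = 0.
  move=> cv dv vS; apply: laplace_unique => // k; exact: (moments_eq0 cv dv vS k 0%N).
move=> s s0; rewrite -F0; apply: complex_ext.
  have := vanish (fun n x => complex.Re (wpair (F n) g `|x|)) (fun n => ccont_Re (cW n))
    (fun n => dec _ n (@normc_Re R)).
  move=> V; suff H : forall n t, 0 <= t -> complex.Re (wpair (F n.+1) g `|t|) =
      - rint 0 t (fun x => complex.Re (wpair (F n) g `|x|)).
    by have := V H s s0; rewrite (gtr0_norm s0).
  by move=> n t t0; rewrite (step n t t0) ReN Re_cint.
have := vanish (fun n x => complex.Im (wpair (F n) g `|x|)) (fun n => ccont_Im (cW n))
  (fun n => dec _ n (@normc_Im R)).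
move=> V; suff H : forall n t, 0 <= t -> complex.Im (wpair (F n.+1) g `|t|) =
    - rint 0 t (fun x => complex.Im (wpair (F n) g `|x|)).
  by have := V H s s0; rewrite (gtr0_norm s0).
by move=> n t t0; rewrite (step n t t0) ImN Im_cint.
Qed.

(** With [wpair f g] zero, [wpair (cesaro_op f) g] is constant in [s]; it also decays, so its value
    at 0, which is the pairing, vanishes. *)
Lemma pairing_cesaro_eq0 p q f g : 1 < p -> p^-1 + q^-1 = 1 -> hardy p f -> Hp q g ->
  (forall s, 0 <= s -> wpair f g s = 0) -> pairing (cesaro_op f) g = 0.
Proof.
move=> p1 pq Hf HG W0; have p0 : 0 < p by rewrite (lt_trans _ p1).
have [HC [a Pa Pc]] := hardy_cesaro p1 Hf.
have [_ HF] := (hardyP _ p1).1 Hf; have [_ HC'] := (hardyP _ p1).1 HC.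
have E t : 0 <= t -> pairing (cesaro_op f) g = wpair (cesaro_op f) g t.
  move=> t0; have := wpair_int p1 pq Pa Pc HF HC' HG (lexx 0) t0.
  have -> : cint 0 t (fun x => wpair f g `|x|) = cint 0 t (fun=> 0).
    by apply: eq_cint => x _; exact: W0.
  by rewrite cint_cst// mulr0 oppr0 => /eqP; rewrite subr_eq0 wpair0 => /eqP.
have [K K0 HK] := wpair_decay p1 pq HC' HG.
apply/eqP; rewrite -normc_eq0 eq_le normc_ge0 andbT; apply/ler_addgt0Pl => e e0; rewrite addr0.
have q01 : 0 <= expR (- p^-1) < 1 by rewrite expR_ge0 expR_lt1 oppr_lt0 invr_gt0.
have [n Hn] := geo_small K q01 e0.
rewrite (E n%:R)// (le_trans (HK _ _))// ltW//.
by rewrite (mulrC (- p^-1)) expRM_natl; exact: Hn.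
Qed.

End Invariance.

Theorem mainTheorem2 (R : realType) (p p' : R) (hp : 1 < p)
    (hpp' : p^-1 + p'^-1 = 1) (M : set (Cplx R -> Cplx R))
    (hM : closed_subspace p M) :
  (@cesaro_op R) @` M `<=` M <->
  (forall t : R, 0 <= t ->
     composition_op (phi_semigroup t) @` (annihilator p' M)
       `<=` annihilator p' M).
Proof.
have [MH [M0 MS] MC] := hM; have q1 := conj_exponent hp hpp'.
have AP g := annihilatorP g hp hpp' MH.
split=> [CM t t0 _ [g /AP[Hg g0] <-]|SM _ [f Mf <-]].
  have [_ HG] := (hardyP _ q1).1 Hg.
  apply/AP; rewrite composition_shift; split.
    by apply: (hardy_on_disc q1); exact: Hp_shift.
  move=> f Mf.
  rewrite (eq_pairing f (g := on_disc (shift t g)) (h := shift t g)); last by move=> z; exact: on_discE.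
  (* Uniqueness for the Laplace transform speaks only of positive times; at time 0 the operator is
     the identity. *)
  have [->|tn] := eqVneq t 0; first by rewrite shift0 g0.
  have tp : 0 < t by rewrite lt_neqAle eq_sym tn.
  have orb n : M (iter n (@cesaro_op R) f).
    elim: n => [|n IH]; first exact: Mf.
    by apply: CM; exists (iter n (@cesaro_op R) f).
  have := cesaro_orbit_wpair hp hpp' (MH _ Mf) HG (fun n => g0 _ (orb n)) tp.
  rewrite /wpair => /eqP; rewrite mulf_eq0 => /orP[|/eqP//].
  by rewrite eq_complex /= eqxx andbT gt_eqF// expR_gt0.
have [HC _] := hardy_cesaro hp (MH _ Mf).
apply: contrapT => nM.
have [e e0 far] : exists2 e, 0 < e & forall m, M m -> ~ (hardy_norm p (cesaro_op f - m)%R < e%:E)%E.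
  apply: contrapT => nE; apply: nM; apply: MC => // e e0.
  apply: contrapT => nm; apply: nE; exists e => // m Mm h; apply: nm; by exists m.
have [_ HC'] := (hardyP _ hp).1 HC.
have HpM m : M m -> Hp p m by move=> /MH/(hardyP _ hp)[].
have e2 : 0 < e / 2 by rewrite divr_gt0.
have [|||| g [HG gM]] := @separation R p p' M (cesaro_op f) (e / 2) hp hpp' HpM _ _ _ HC' e2.
- exact: (set_mem M0).
- move=> m m' Mm Mm'; have := MS 1 m m' (mem_set Mm) (mem_set Mm').
  by rewrite scale1r => /set_mem.
- move=> k m Mm; have := MS k m 0 (mem_set Mm) M0.
  by rewrite addr0 => /set_mem.
- move=> m B Mm B0 H; rewrite leNgt; apply/negP => Be; apply: (far m Mm).
  have := hardy_norm_le hp (holoB HC'.1 (HpM _ Mm).1) B0 H.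
  by move=> h; apply: (le_lt_trans h); rewrite lte_fin (lt_trans Be)//; lra.
apply/negP; rewrite negbK; apply/eqP.
(* Separation says nothing about the values of [g] outside the disc; extending by zero makes it an
   element of [hardy] without changing any pairing. *)
have A : annihilator p' M (on_disc g).
  apply/AP; split; first exact: hardy_on_disc.
  move=> m Mm; rewrite (eq_pairing m (g := on_disc g) (h := g)) ?gM//.
  by move=> z; exact: on_discE.
apply: (pairing_cesaro_eq0 hp hpp' (MH _ Mf) HG) => s s0.
have /AP[_ H] : annihilator p' M (composition_op (phi_semigroup s) (on_disc g)).
  by apply: SM s0 _ _; exists (on_disc g).
have := H f Mf; rewrite composition_shift /wpair => E.
rewrite -(eq_pairing f (g := on_disc (shift s (on_disc g)))) ?E ?mulr0// => z z1.
rewrite on_discE// /shift on_discE//; exact: phi_disc.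
Qed.
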